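(* Let $u_0,v_0\in H^{1,1}(\mathbb{R})$ be complex-valued, and let $\Sigma$ be the augmented contour and $V$ the jump matrix on $\Sigma$ constructed from $(u_0,v_0)$ as in the context. Then for each fixed $x\in\mathbb{R}$ the following Riemann-Hilbert problem has a unique solution: find a $3\times3$ matrix-valued function $\mathbf{M}(x,z)$ such that (i) $\mathbf{M}(x,\cdot)$ is analytic on $\mathbb{C}\setminus\Sigma$; (ii) $\mathbf{M}(x,z)=I+O(z^{-1})$ as $z\to\infty$; (iii) $\mathbf{M}$ has continuous boundary values $\mathbf{M}_\pm(x,\lambda)$ as $z\to\lambda\in\Sigma$ from $\Omega_\pm$, and $\mathbf{M}_+(x,\lambda)=\mathbf{M}_-(x,\lambda)\,e^{i\lambda x\operatorname{ad}\sigma}V(\lambda)$ for $\lambda\in\Sigma$.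
   Context: $*$ denotes complex conjugation, $\dagger$ Hermitian adjoint, $\mathbb{C}^\pm=\{\pm\operatorname{Im}z>0\}$. $H^{1,1}(\mathbb{R})=\{f: f'\in L^2(\mathbb{R}),\ xf\in L^2(\mathbb{R})\}$. $\sigma=\mathrm{diag}(-1,1,1)$, $\operatorname{ad}\sigma(B)=\sigma B-B\sigma$, $e^{i\lambda x\operatorname{ad}\sigma}B=e^{i\lambda x\sigma}Be^{-i\lambda x\sigma}$. The focusing case $\varepsilon=1$ is considered: $$U(x)=\begin{pmatrix}0&u_0&v_0\\-u_0^*&0&0\\-v_0^*&0&0\end{pmatrix}.$$ For $\lambda\in\mathbb{R}$, $m^\pm$ solve $m^\pm(x,\lambda)=I+\int_{\pm\infty}^xe^{i\lambda(x-y)\operatorname{ad}\sigma}U(y)m^\pm(y,\lambda)\,dy$; the columns $m_1^-,m_2^+,m_3^+$ extend analytically to $\mathbb{C}^+$. $S=(s_{jk})$, $S(\lambda)=I+\int_{\mathbb{R}}e^{-i\lambda y\operatorname{ad}\sigma}U(y)m^-(y,\lambda)\,dy$; $s_{11}$ extends analytically to $\mathbb{C}^+$. Here $s_{11}$ is allowed to have (possibly infinitely many) zeros of arbitrary order in $\mathbb{C}^+\cup\mathbb{R}$. Choose $S_\infty>0$ such that $s_{11}$ has no zeros in $\{\operatorname{Im}z\ge0,\ |z|\ge S_\infty\}$. For real $|\lambda|\ge S_\infty$ let $\rho_1=s_{21}/s_{11}$, $\rho_2=s_{31}/s_{11}$. For $|z|\ge S_\infty$ let $M(x,z)=\big(m_1^-/s_{11},m_2^+,m_3^+\big)(x,z)$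 if $z\in\mathbb{C}^+$ and $M(x,z)=\big(M(x,z^* )^\dagger\big)^{-1}$ if $z\in\mathbb{C}^-$ (Beals-Coifman solution). Choose $x_0\in\mathbb{R}$ such that the cut-off potential $U_{x_0}=U\chi_{(x_0,\infty)}$ has $L^1$ norm so small that its coefficient $\mathbf{s}_{11}$ has no zeros in $\mathbb{C}^+\cup\mathbb{R}$, where $\mathbf{S}=(\mathbf{s}_{jk})$ and $M^{(0)}$ denote the scattering matrix and Beals-Coifman solution constructed in the same way from $U_{x_0}$ in place of $U$. Let $r_1=\mathbf{s}_{21}/\mathbf{s}_{11}$, $r_2=\mathbf{s}_{31}/\mathbf{s}_{11}$ on $\mathbb{R}$. Contour: $\Sigma=\mathbb{R}\cup\Sigma_\infty$, $\Sigma_\infty=\{|z|=S_\infty\}$, $\Sigma_\infty^\pm=\Sigma_\infty\cap\mathbb{C}^\pm$. $\Omega_1$ (resp. $\Omega_2$) is the part of $\mathbb{C}^+$ (resp. $\mathbb{C}^-$) outside $\Sigma_\infty$, $\Omega_3$ (resp. $\Omega_4$) the part of $\mathbb{C}^+$ (resp. $\mathbb{C}^-$) inside. $\Omega_+=\Omega_1\cup\Omega_4$, $\Omega_-=\Omega_2\cup\Omega_3$; $\Sigma$ is oriented with $\Omega_+$ on the left. Jump matrix: $$V=\begin{pmatrix}1+|\rho_1|^2+|\rho_2|^2&\rho_1^*&\rho_2^*\\\rho_1&1&0\\\rho_2&0&1\end{pmatrix}\ (\lambda\in\mathbb{R},|\lambda|>S_\infty),\qquad V=\begin{pmatrix}1&-r_1^*&-r_2^*\\-r_1&1+|r_1|^2&r_1r_2^*\\-r_2&r_1^*r_2&1+|r_2|^2\end{pmatrix}\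 (\lambda\in(-S_\infty,S_\infty)),$$ $V(\lambda)=e^{-ix_0\lambda\operatorname{ad}\sigma}\big(M^{(0)}(x_0,\lambda)^{-1}M(x_0,\lambda)\big)$ for $\lambda\in\Sigma_\infty^+$ (a lower triangular matrix differing from $I$ only in entries $(2,1),(3,1)$), and $V(\lambda)=e^{-ix_0\lambda\operatorname{ad}\sigma}\big(M(x_0,\lambda)^{-1}M^{(0)}(x_0,\lambda)\big)$ for $\lambda\in\Sigma_\infty^-$ (upper triangular, differing from $I$ only in entries $(1,2),(1,3)$).
   Formalization: Condition (ii) is read as M→I uniformly as z→∞, with O(1/z) only on |Im z|≥δ for each δ>0, since a uniform O(1/z) fails for general H^{1,1} data; at ±S∞, where V is undefined, no jump is imposed and limits are taken from each Ω_j separately. *)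

(* Defs.v *)
From HB Require Import structures.
From mathcomp Require Import all_boot all_order all_algebra.
From mathcomp Require Import complex.
From mathcomp Require Import all_classical all_reals all_analysis.

Set Implicit Arguments.
Unset Strict Implicit.
Unset Printing Implicit Defensive.

Import Order.TTheory GRing.Theory Num.Theory.
Import numFieldNormedType.Exports.

Local Open Scope classical_set_scope.
Local Open Scope ring_scope.
Local Open Scope complex_scope.

Notation j1 := (@Ordinal 3 0 isT).
Notation j2 := (@Ordinal 3 1 isT).
Notation j3 := (@Ordinal 3 2 isT).

(** $\mathbb C$ as a normed space over itself, with the topology of the modulus. *)
HB.instance Definition _ (R : realType) := NormedModule.copy R[i] R[i]^o.

Section Defs.
Context {R : realType}.
Notation C := R[i].
Notation mu := (@lebesgue_measure R).

Definition mx3 (s : seq (seq C)) : 'M[C]_3 := \matrix_(i, j) nth 0 (nth [::] s i) j.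

Definition dagger (A : 'M[C]_3) : 'M[C]_3 := map_mx (@conjc R) A^T.

Definition Cintegrable (D : set R) (f : R -> C) : Prop :=
  mu.-integrable D (EFin \o (fun y => complex.Re (f y))) /\
  mu.-integrable D (EFin \o (fun y => complex.Im (f y))).

Definition Cint (D : set R) (f : R -> C) : C :=
  (\int[mu]_(y in D) complex.Re (f y))%R +i* (\int[mu]_(y in D) complex.Im (f y))%R.

Definition mx_integrable (D : set R) (F : R -> 'M[C]_3) : Prop :=
  forall i j, Cintegrable D (fun y => F y i j).

Definition mx_int (D : set R) (F : R -> 'M[C]_3) : 'M[C]_3 :=
  \matrix_(i, j) Cint D (fun y => F y i j).

Definition L2 (f : R -> C) : Prop :=
  (fun y => complex.Re (f y)) \in Lfun mu 2%:E /\
  (fun y => complex.Im (f y)) \in Lfun mu 2%:E.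

(** [H11 f]: [f] is the (locally absolutely) continuous representative of an
    element of $H^{1,1}(\mathbb R)$; the derivative [g] in $L^2$ is characterized
    by $f(b) - f(a) = \int_a^b g$, the integral making sense because
    $L^2 \subset L^1_{loc}$. *)
Definition H11 (f : R -> C) : Prop :=
  (exists g : R -> C, L2 g /\
     forall a b : R, a <= b -> f b - f a = Cint `[a, b] g) /\
  L2 (fun y => y%:C * f y).

Definition potential (u v : R -> C) (y : R) : 'M[C]_3 :=
  mx3 [:: [:: 0;            u y; v y];
          [:: - (u y)^*;    0;   0  ];
          [:: - (v y)^*;    0;   0  ]].

Definition cutoff (x0 : R) (U : R -> 'M[C]_3) (y : R) : 'M[C]_3 :=
  if x0 < y then U y else 0.

Definition cexp (z : C) : C :=
  (expR (complex.Re z))%:C * (cos (complex.Im z) +i* sin (complex.Im z)).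

Definition sigma_diag : 'rV[C]_3 := \row_j (if j == j1 then -1 else 1).

Definition exp_sigma (w : C) : 'M[C]_3 :=
  diag_mx (\row_j cexp ('i * w * sigma_diag 0 j)).

(** $e^{iw\,\mathrm{ad}\,\sigma} B$ with $\sigma = \mathrm{diag}(-1,1,1)$. *)
Definition exp_ad (w : C) (B : 'M[C]_3) : 'M[C]_3 :=
  exp_sigma w *m B *m exp_sigma (- w).

Definition Cplus : set C := [set z | 0 < complex.Im z].
Definition Cplus_closed : set C := [set z | 0 <= complex.Im z].

(** [extends_to_Cplus f F]: [F] is the analytic extension to $\mathbb C^+$,
    continuous up to the real axis, of [f] given on the real line. *)
Definition extends_to_Cplus (V : normedModType C) (f : R -> V) (F : C -> V) : Prop :=
  [/\ forall l : R, F l%:C = f l,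
      {within Cplus_closed, continuous F} &
      forall z, Cplus z -> derivable F z 1].

(** The exponential acts on the product $U(y) m(y,\lambda)$. *)
Definition jost_integrand (U : R -> 'M[C]_3) (m : R -> R -> 'M[C]_3) (x l y : R) :=
  exp_ad (l * (x - y))%:C (U y *m m y l).

Definition jost_minus (U : R -> 'M[C]_3) (m : R -> R -> 'M[C]_3) : Prop :=
  forall x l : R,
    mx_integrable `]-oo, x] (jost_integrand U m x l) /\
    m x l = 1%:M + mx_int `]-oo, x] (jost_integrand U m x l).

(** $\int_{+\infty}^x = -\int_x^{+\infty}$. *)
Definition jost_plus (U : R -> 'M[C]_3) (m : R -> R -> 'M[C]_3) : Prop :=
  forall x l : R,
    mx_integrable `[x, +oo[ (jost_integrand U m x l) /\
    m x l = 1%:M - mx_int `[x, +oo[ (jost_integrand U m x l).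

Definition scattering_matrix (U : R -> 'M[C]_3) (mminus : R -> R -> 'M[C]_3)
    (l : R) : 'M[C]_3 :=
  1%:M + mx_int setT (jost_integrand U mminus 0 l).

(** The functions below are uniquely determined by [U]. *)
Record jost_data (U : R -> 'M[C]_3) := JostData {
  mminus : R -> R -> 'M[C]_3;
  mplus : R -> R -> 'M[C]_3;
  mminusP : jost_minus U mminus;
  mplusP : jost_plus U mplus;
  m1minus : R -> C -> 'cV[C]_3;
  m2plus : R -> C -> 'cV[C]_3;
  m3plus : R -> C -> 'cV[C]_3;
  m1minusP : forall x, extends_to_Cplus (fun l => col j1 (mminus x l)) (m1minus x);
  m2plusP : forall x, extends_to_Cplus (fun l => col j2 (mplus x l)) (m2plus x);
  m3plusP : forall x, extends_to_Cplus (fun l => col j3 (mplus x l)) (m3plus x);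
  s11 : C -> C;
  s11P : extends_to_Cplus
           (fun l => scattering_matrix U mminus l j1 j1) s11
}.

Section Scattering.
Context {U : R -> 'M[C]_3}.
Variable D : jost_data U.

Definition smx (l : R) : 'M[C]_3 := scattering_matrix U (mminus D) l.

Definition refl1 (l : R) : C := smx l j2 j1 / smx l j1 j1.
Definition refl2 (l : R) : C := smx l j3 j1 / smx l j1 j1.

(** The matrix with columns $m_1^-/s_{11}$, $m_2^+$, $m_3^+$. *)
Definition beals_coifman_plus (x : R) (z : C) : 'M[C]_3 :=
  row_mx ((s11 D z)^-1 *: m1minus D x z) (row_mx (m2plus D x z) (m3plus D x z)).

Definition beals_coifman (x : R) (z : C) : 'M[C]_3 :=
  if 0 < complex.Im z then beals_coifman_plus x z
  else invmx (dagger (beals_coifman_plus x z^*)).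

End Scattering.

Section Contour.
Variable S : R.

Definition contour : set C := [set z | complex.Im z = 0 \/ `|z| = S%:C].

Definition corners : set C := [set S%:C; - S%:C].

Definition Omega1 : set C := [set z | 0 < complex.Im z /\ S%:C < `|z|].
Definition Omega2 : set C := [set z | complex.Im z < 0 /\ S%:C < `|z|].
Definition Omega3 : set C := [set z | 0 < complex.Im z /\ `|z| < S%:C].
Definition Omega4 : set C := [set z | complex.Im z < 0 /\ `|z| < S%:C].

(** The sides of the contour: it is oriented with [Omega_plus] on its left. *)
Definition Omega_plus : set C := Omega1 `|` Omega4.
Definition Omega_minus : set C := Omega2 `|` Omega3.

End Contour.

Section Jump.
Context {U : R -> 'M[C]_3} {x0 : R}.
Variables (S : R) (D : jost_data U) (D0 : jost_data (cutoff x0 U)).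

Definition jump_outer (l : R) : 'M[C]_3 :=
  let r1 := refl1 D l in let r2 := refl2 D l in
  mx3 [:: [:: 1 + `|r1| ^+ 2 + `|r2| ^+ 2; r1^*; r2^*];
          [:: r1;                          1;    0   ];
          [:: r2;                          0;    1   ]].

Definition jump_inner (l : R) : 'M[C]_3 :=
  let r1 := refl1 D0 l in let r2 := refl2 D0 l in
  mx3 [:: [:: 1;    - r1^*;          - r2^*         ];
          [:: - r1; 1 + `|r1| ^+ 2;  r1 * r2^*      ];
          [:: - r2; r1^* * r2;       1 + `|r2| ^+ 2 ]].

Definition jump_arc_plus (z : C) : 'M[C]_3 :=
  exp_ad (- (x0%:C * z)) (invmx (beals_coifman D0 x0 z) *m beals_coifman D x0 z).

Definition jump_arc_minus (z : C) : 'M[C]_3 :=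
  exp_ad (- (x0%:C * z)) (invmx (beals_coifman D x0 z) *m beals_coifman D0 x0 z).

(** There is no jump condition at the two corners $\pm S_\infty$ of the contour;
    the value of [jump] there is irrelevant. *)
Definition jump (z : C) : 'M[C]_3 :=
  if complex.Im z == 0 then
    if S < `|complex.Re z| then jump_outer (complex.Re z)
    else jump_inner (complex.Re z)
  else if 0 < complex.Im z then jump_arc_plus z else jump_arc_minus z.

End Jump.

Definition tends_from (Om : set C) (M : C -> 'M[C]_3) (l : C) (L : 'M[C]_3) : Prop :=
  M z @[z --> within Om (nbhs l)] --> L.

(** Normalization $M = I + O(z^{-1})$ as $z\to\infty$.  The jump contour reaches
    infinity along the real axis, and for general $H^{1,1}$ data the reflection
    coefficients are not $O(\lambda^{-1})$ pointwise, so that no solution can be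
    $I + O(z^{-1})$ uniformly up to the real axis: [M] tends to the identity
    uniformly in all directions, and the rate $O(z^{-1})$ holds away from the
    real axis, uniformly on $|\operatorname{Im} z| \ge \delta$ for each
    $\delta > 0$. *)
Definition normalized_at_infinity (Sig : set C) (M : C -> 'M[C]_3) : Prop :=
  (forall e : R, 0 < e -> exists A : R, forall z : C,
     ~ Sig z -> A%:C <= `|z| -> `|M z - 1%:M| <= e%:C) /\
  (forall d : R, 0 < d -> exists A K : R, forall z : C,
     ~ Sig z -> A%:C <= `|z| -> d <= `|complex.Im z| ->
     `|M z - 1%:M| <= K%:C * `|z^-1|).

(** At the corners $\pm S_\infty$ both $\Omega_+$ and $\Omega_-$ consist locally of
    two sectors; there the boundary values are taken from each $\Omega_j$
    separately and carry no jump relation. *)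
Record rhp_solution (S : R) (V : C -> 'M[C]_3) (x : R) (M : C -> 'M[C]_3) : Prop :=
  RHPSolution {
  rhp_analytic : forall z, ~ contour S z -> derivable M z 1;
  rhp_infinity : normalized_at_infinity (contour S) M;
  rhp_boundary : exists Mplus Mminus : C -> 'M[C]_3,
    [/\ forall l, (contour S `\` corners S) l -> tends_from (Omega_plus S) M l (Mplus l),
        forall l, (contour S `\` corners S) l -> tends_from (Omega_minus S) M l (Mminus l),
        {within contour S `\` corners S, continuous Mplus},
        {within contour S `\` corners S, continuous Mminus} &
        forall l, (contour S `\` corners S) l ->
          Mplus l = Mminus l *m exp_ad (l * x%:C) (V l)];
  rhp_corners : forall l, corners S l ->
    forall Om, [\/ Om = Omega1 S, Om = Omega2 S, Om = Omega3 S | Om = Omega4 S] ->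
    exists L, tends_from Om M l L }.

End Defs.

(* Main.v *)
Require Import Defs.
From mathcomp Require Import all_boot all_order all_algebra complex.
From mathcomp Require Import all_classical all_reals all_analysis.
From mathcomp Require Import ring lra.
Set Implicit Arguments.
Unset Strict Implicit.
Unset Printing Implicit Defensive.
Import Order.TTheory GRing.Theory Num.Theory numFieldNormedType.Exports.
Local Open Scope ring_scope.
Local Open Scope complex_scope.
Local Open Scope classical_set_scope.

(** Existence needs no singular integral equation, because a solution can be written down.  Outside
    the circle, in the upper half plane, take the Beals-Coifman solution of the potential at [x].
    Inside the circle $s_{11}$ may vanish, so take there the Beals-Coifman solution of the cut-off
    potential at [x0], which has no poles, and transport it from [x0] to [x] by the Lax equation of
    the full potential.  In the lower half plane take the inverse adjoint at the conjugate point.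
    Outside the circle the Beals-Coifman solution is transported by the same equation, and
    transport conjugates the jump by the free exponential ([propag_jump]), so all jumps need to be
    checked at [x0] only ([base_jump]).  On the arcs the jump matrix is by definition the quotient
    of the two Beals-Coifman solutions at [x0].  On the real axis the jump is the Gram matrix of
    the Beals-Coifman solution ([beals_coifman_gram]): that solution is the unitary Jost matrix
    normalized at plus infinity times a triangular matrix made of the reflection coefficients,
    since the two Jost matrices differ by the scattering matrix ([scattering_frame]).

    Statements about the upper half plane are obtained from the real axis.  A two-constants estimate
    shows that functions analytic in the half plane, bounded there and close on the axis are close
    inside ([boundary_approx], [boundary_identity]).  It gives the determinant $s_{11}$ of the
    Jost columns, hence invertibility ([jost_cols_det]), their Lax equation
    ([jost_cols_evolution]), and their approximation by solutions normalized at a finite base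
    point ([jost_cols_limit]).  For the latter the energy identity of the Lax equation, whose
    potential is anti-Hermitian, bounds every entry by one ([propag_le]).

    The behaviour at infinity uses the Sobolev class, and uses it only through three
    properties: the functions are continuous, their increments obey a Cauchy-Schwarz bound, and
    their tails are integrable.  The off-diagonal entries of a column, or in the other columns the
    first one, are oscillatory integrals against the potential.  Integration by parts in the form of
    an inequality, proved by bisection ([by_parts_le]), makes them $O(1/z)$ away from the real axis
    ([osc_rate]) and arbitrarily small uniformly up to it ([osc_small]); the remaining entries then
    tend to those of the identity ([jost_near]).

    For uniqueness, multiply another solution by the inverse of the explicit one.  The quotient is
    continuous across the contour, bounded at the two points where the circle meets the axis,
    and tends to the identity at infinity.  A Moebius transformation turns the contour into the
    coordinate axes, which are removable for continuous functions, and Liouville's theorem makes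
    the quotient constant ([contour_liouville], [rhp_unique]).

    The complex analysis rests on Goursat's theorem by bisection of rectangles ([goursat]).  Instead
    of Cauchy's formula it uses the maximum principle, for continuous functions that are analytic
    off finitely many horizontal and vertical lines ([maximum_principle]), from which the
    two-constants estimate and Liouville's theorem follow.  The Lax equation has a fundamental
    matrix by Picard iteration ([fundamental_ex]), entire in the spectral parameter by Duhamel's
    formula ([fund_holo]). *)

(** * Moduli, limits and complex derivatives *)

Notation "x ^cj" := (conjc x) (at level 1, left associativity, format "x ^cj") : ring_scope.

Section Modulus.
Context {R : realType}.
Notation C := R[i].
Notation modc := (@Normc.normc R).

Lemma normCE (z : C) : `|z| = (modc z)%:C. Proof. by case: z. Qed.

Lemma modcE (z : C) : modc z = Num.sqrt (complex.Re z ^+ 2 + complex.Im z ^+ 2).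
Proof. by case: z. Qed.

Lemma modc_ge0 (z : C) : 0 <= modc z. Proof. by rewrite modcE sqrtr_ge0. Qed.

Lemma sqr_modc (z : C) : modc z ^+ 2 = complex.Re z ^+ 2 + complex.Im z ^+ 2.
Proof. by rewrite modcE sqr_sqrtr // addr_ge0 // sqr_ge0. Qed.

Lemma modc0 : modc 0 = 0. Proof. exact: Normc.normc0. Qed.
Lemma modc1 : modc 1 = 1. Proof. exact: Normc.normc1. Qed.
Lemma modcM (x y : C) : modc (x * y) = modc x * modc y. Proof. exact: Normc.normcM. Qed.
Lemma modcV (x : C) : modc x^-1 = (modc x)^-1. Proof. exact: Normc.normcV. Qed.
Lemma modcN (x : C) : modc (- x) = modc x. Proof. exact: normcN. Qed.
Lemma modcD (x y : C) : modc (x + y) <= modc x + modc y. Proof. exact: le_normcD. Qed.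
Lemma modcB (x y : C) : modc (x - y) <= modc x + modc y.
Proof. by rewrite -[modc y]modcN; exact: modcD. Qed.
Lemma modcBC (x y : C) : modc (x - y) = modc (y - x).
Proof. by rewrite -modcN opprB. Qed.
Lemma modc_tri (y x z : C) : modc (x - z) <= modc (x - y) + modc (y - z).
Proof. by rewrite -{1}(subrK y x) -addrA; exact: modcD. Qed.
Lemma modc_sub_le (x y : C) : modc x - modc y <= modc (x - y).
Proof. by rewrite lerBlDr -{1}(subrK y x); exact: modcD. Qed.

Lemma modc_eq0 (x : C) : (modc x == 0) = (x == 0).
Proof.
by apply/eqP/eqP => [/Normc.eq0_normc //|->]; rewrite modc0.
Qed.

Lemma modc_gt0 (x : C) : (0 < modc x) = (x != 0).
Proof. by rewrite lt_def modc_ge0 andbT modc_eq0. Qed.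

Lemma modc_real (x : R) : modc x%:C = `|x|.
Proof. by rewrite modcE /= expr0n /= addr0 sqrtr_sqr. Qed.

Lemma modc_conj (x : C) : modc x^cj = modc x.
Proof. by case: x => a b; rewrite !modcE /= sqrrN. Qed.

Lemma modc_i : modc 'i = 1.
Proof. by rewrite modcE /= expr0n expr1n add0r sqrtr1. Qed.

Lemma Re_le_modc (z : C) : `|complex.Re z| <= modc z.
Proof.
rewrite -ler_sqr ?nnegrE ?modc_ge0 // sqr_modc real_normK ?num_real //.
by rewrite lerDl sqr_ge0.
Qed.

Lemma Im_le_modc (z : C) : `|complex.Im z| <= modc z.
Proof.
rewrite -ler_sqr ?nnegrE ?modc_ge0 // sqr_modc real_normK ?num_real //.
by rewrite lerDr sqr_ge0.
Qed.

Lemma modc_le_ReIm (z : C) : modc z <= `|complex.Re z| + `|complex.Im z|.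
Proof.
rewrite -ler_sqr ?nnegrE ?modc_ge0 ?addr_ge0 // sqr_modc.
rewrite sqrrD !real_normK ?num_real // lerD2r lerDl.
by rewrite mulrn_wge0 // mulr_ge0.
Qed.

Lemma eq_modcP (x y : C) : (forall e, 0 < e -> modc (x - y) <= e) -> x = y.
Proof.
move=> h; apply/eqP; rewrite -subr_eq0 -modc_eq0 eq_le modc_ge0 andbT.
by apply/ler_addgt0Pl => e e0; rewrite addr0 h.
Qed.

Lemma modc_sum (I : Type) (s : seq I) (P : pred I) (F : I -> C) :
  modc (\sum_(i <- s | P i) F i) <= \sum_(i <- s | P i) modc (F i).
Proof.
elim/big_rec2: _ => [|i y x _ h]; first by rewrite modc0.
by apply: (le_trans (modcD _ _)); rewrite lerD2l.
Qed.

Lemma ReD (x y : C) : complex.Re (x + y) = complex.Re x + complex.Re y. Proof. by case: x y => [a b] []. Qed.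
Lemma ImD (x y : C) : complex.Im (x + y) = complex.Im x + complex.Im y. Proof. by case: x y => [a b] []. Qed.
Lemma ReN (x : C) : complex.Re (- x) = - complex.Re x. Proof. by case: x. Qed.
Lemma ImN (x : C) : complex.Im (- x) = - complex.Im x. Proof. by case: x. Qed.
Lemma ReB (x y : C) : complex.Re (x - y) = complex.Re x - complex.Re y. Proof. by rewrite ReD ReN. Qed.
Lemma ImB (x y : C) : complex.Im (x - y) = complex.Im x - complex.Im y. Proof. by rewrite ImD ImN. Qed.
Lemma ReM (x y : C) : complex.Re (x * y) = complex.Re x * complex.Re y - complex.Im x * complex.Im y.
Proof. by case: x y => [a b] []. Qed.
Lemma ImM (x y : C) : complex.Im (x * y) = complex.Re x * complex.Im y + complex.Im x * complex.Re y.
Proof. by case: x y => [a b] [] *; rewrite /= addrC; congr (_ + _); rewrite mulrC. Qed.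
Lemma ReJ (x : C) : complex.Re x^cj = complex.Re x. Proof. by case: x. Qed.
Lemma ImJ (x : C) : complex.Im x^cj = - complex.Im x. Proof. by case: x. Qed.
Lemma ReC (x : R) : complex.Re x%:C = x. Proof. by []. Qed.
Lemma ImC (x : R) : complex.Im x%:C = 0. Proof. by []. Qed.
Lemma Rei : complex.Re ('i : C) = 0. Proof. by []. Qed.
Lemma Imi : complex.Im ('i : C) = 1. Proof. by []. Qed.
Lemma Re0 : complex.Re (0 : C) = 0. Proof. by []. Qed.
Lemma Im0 : complex.Im (0 : C) = 0. Proof. by []. Qed.
Lemma Re1 : complex.Re (1 : C) = 1. Proof. by []. Qed.
Lemma Im1 : complex.Im (1 : C) = 0. Proof. by []. Qed.

Definition ReImE := (ReD, ImD, ReN, ImN, ReM, ImM, ReJ, ImJ, ReC, ImC, Rei, Imi, Re0, Im0, Re1, Im1).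

Lemma conjcD (x y : C) : (x + y)^cj = x^cj + y^cj. Proof. exact: rmorphD. Qed.
Lemma conjcN (x : C) : (- x)^cj = - x^cj. Proof. exact: rmorphN. Qed.
Lemma conjcB (x y : C) : (x - y)^cj = x^cj - y^cj. Proof. exact: rmorphB. Qed.
Lemma conjcM (x y : C) : (x * y)^cj = x^cj * y^cj. Proof. exact: rmorphM. Qed.

Lemma eqC (x y : C) : complex.Re x = complex.Re y -> complex.Im x = complex.Im y -> x = y.
Proof. by case: x y => [a b] [c d] /= -> ->. Qed.

Lemma ReSum (I : Type) (s : seq I) (P : pred I) (F : I -> C) :
  complex.Re (\sum_(i <- s | P i) F i) = \sum_(i <- s | P i) complex.Re (F i).
Proof. by elim/big_rec2: _ => // i y x _ <-; rewrite ReD. Qed.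
End Modulus.
Notation modc := Normc.normc.

Section Limits.
Context {R : realType}.
Notation C := R[i].

Definition wlim (A : set C) (f : C -> C) (z L : C) :=
  forall e : R, 0 < e -> exists2 d : R, 0 < d &
    forall w, A w -> modc (w - z) < d -> modc (f w - L) < e.

Lemma wlim_le (A : set C) f z L (k : R) :
  (forall e : R, 0 < e -> exists2 d : R, 0 < d &
    forall w, A w -> modc (w - z) < d -> modc (f w - L) <= k * e) ->
  wlim A f z L.
Proof.
move=> h e e0; have k0 : 0 < `|k| + 1 by rewrite ltr_wpDl.
have [d d0 hd] := h (e / (`|k| + 1)) (divr_gt0 e0 k0).
exists d => // w Aw wz; apply: (le_lt_trans (hd w Aw wz)).
rewrite mulrCA -ltr_pdivlMl // mulVf ?gt_eqF // ltr_pdivrMr // mul1r.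
by rewrite (le_lt_trans (ler_norm k)) // ltrDl.
Qed.

Lemma wlim_sub (A B : set C) f z L : A `<=` B -> wlim B f z L -> wlim A f z L.
Proof.
by move=> AB h e e0; have [d d0 hd] := h e e0; exists d => // w /AB; exact: hd.
Qed.

Lemma wlim_ext (A : set C) f g z L :
  (forall w, A w -> f w = g w) -> wlim A f z L -> wlim A g z L.
Proof.
move=> fg h e e0; have [d d0 hd] := h e e0; exists d => // w Aw.
by rewrite -fg //; exact: hd.
Qed.

Lemma wlim_near (A : set C) f g z L r : 0 < r ->
  (forall w, A w -> modc (w - z) < r -> f w = g w) -> wlim A f z L -> wlim A g z L.
Proof.
move=> r0 fg h e e0; have [d d0 hd] := h e e0.
exists (Num.min d r) => [|w Aw]; first by rewrite lt_min d0.
by rewrite lt_min => /andP[wd wr]; rewrite -fg //; exact: hd.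
Qed.

Lemma wlim_cst A c z : wlim A (fun=> c) z c.
Proof. by move=> e e0; exists 1 => // w _ _; rewrite subrr modc0. Qed.

Lemma wlim_id A z : wlim A id z z.
Proof. by move=> e e0; exists e. Qed.

Lemma wlimD A f g z L M : wlim A f z L -> wlim A g z M ->
  wlim A (fun w => f w + g w) z (L + M).
Proof.
move=> hf hg; apply: (@wlim_le _ _ _ _ 2) => e e0.
have [d d0 hd] := hf e e0; have [d' d'0 hd'] := hg e e0.
exists (Num.min d d') => [|w Aw]; first by rewrite lt_min d0.
rewrite lt_min => /andP[wd wd'].
have -> : f w + g w - (L + M) = (f w - L) + (g w - M) by ring.
apply: (le_trans (modcD _ _)).
by have := hd w Aw wd; have := hd' w Aw wd'; lra.
Qed.

Lemma wlimN A f z L : wlim A f z L -> wlim A (fun w => - f w) z (- L).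
Proof.
move=> h e e0; have [d d0 hd] := h e e0; exists d => // w Aw wd.
by rewrite -opprD modcN; exact: hd.
Qed.

Lemma wlimB A f g z L M : wlim A f z L -> wlim A g z M ->
  wlim A (fun w => f w - g w) z (L - M).
Proof. by move=> hf hg; apply: wlimD => //; exact: wlimN. Qed.

Lemma wlim_bounded A f z L : wlim A f z L ->
  exists2 d : R, 0 < d & forall w, A w -> modc (w - z) < d -> modc (f w) <= modc L + 1.
Proof.
move=> h; have [d d0 hd] := h 1 ltr01; exists d => // w Aw wd.
by have := hd w Aw wd; have := modc_sub_le (f w) L; lra.
Qed.

Lemma wlimM A f g z L M : wlim A f z L -> wlim A g z M ->
  wlim A (fun w => f w * g w) z (L * M).
Proof.
move=> hf hg; apply: (@wlim_le _ _ _ _ (modc M + modc L + 1)) => e e0.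
have [d d0 hd] := hf e e0; have [d' d'0 hd'] := hg e e0.
have [b b0 hb] := wlim_bounded hf.
exists (Num.min b (Num.min d d')) => [|w Aw]; first by rewrite !lt_min b0 d0.
rewrite !lt_min => /and3P[wb wd wd'].
have -> : f w * g w - L * M = (f w - L) * M + f w * (g w - M) by ring.
apply: (le_trans (modcD _ _)); rewrite !modcM.
have h1 : modc (f w - L) * modc M <= e * modc M.
  by rewrite ler_wpM2r ?modc_ge0 // ltW // hd.
have h2 : modc (f w) * modc (g w - M) <= (modc L + 1) * e.
  by rewrite ler_pM ?modc_ge0 ?hb // ltW // hd'.
lra.
Qed.

Lemma wlimV A f z L : L != 0 -> wlim A f z L -> wlim A (fun w => (f w)^-1) z L^-1.
Proof.
move=> L0 hf; have Lp : 0 < modc L by rewrite modc_gt0.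
apply: (@wlim_le _ _ _ _ ((modc L / 2)^-1 * (modc L)^-1)) => e e0.
have [d d0 hd] := hf e e0.
have [d' d'0 hd'] := hf (modc L / 2) (divr_gt0 Lp (ltr0Sn R 1)).
exists (Num.min d d') => [|w Aw]; first by rewrite lt_min d0.
rewrite lt_min => /andP[wd wd'].
have fL : modc L / 2 <= modc (f w).
  have := hd' w Aw wd'; rewrite modcBC; have := modc_sub_le L (f w); lra.
have f0 : f w != 0 by rewrite -modc_gt0 (lt_le_trans _ fL) // divr_gt0.
have -> : (f w)^-1 - L^-1 = - ((f w)^-1 * L^-1 * (f w - L)) by field; rewrite L0 f0.
rewrite modcN !modcM !modcV.
apply: ler_pM; rewrite ?mulr_ge0 ?invr_ge0 ?modc_ge0 //; last by rewrite ltW // hd.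
by rewrite ler_wpM2r ?invr_ge0 ?modc_ge0 // lef_pV2 // posrE ?divr_gt0 // modc_gt0.
Qed.

Lemma wlimJ A f z L : wlim A f z L -> wlim A (fun w => (f w)^cj) z L^cj.
Proof.
move=> h e e0; have [d d0 hd] := h e e0; exists d => // w Aw wd.
by rewrite -conjcB modc_conj; exact: hd.
Qed.

Lemma wlim_sum A (I : Type) (s : seq I) (P : pred I) (f : I -> C -> C) z (L : I -> C) :
  (forall i, wlim A (f i) z (L i)) ->
  wlim A (fun w => \sum_(i <- s | P i) f i w) z (\sum_(i <- s | P i) L i).
Proof.
move=> h; elim: s => [|i s IH].
  by rewrite big_nil; under eq_fun do rewrite big_nil; exact: wlim_cst.
rewrite big_cons; under eq_fun do rewrite big_cons.
by case: ifP => // _; apply: wlimD.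
Qed.

Lemma wlim_prod A (I : Type) (s : seq I) (P : pred I) (f : I -> C -> C) z (L : I -> C) :
  (forall i, wlim A (f i) z (L i)) ->
  wlim A (fun w => \prod_(i <- s | P i) f i w) z (\prod_(i <- s | P i) L i).
Proof.
move=> h; elim: s => [|i s IH].
  by rewrite big_nil; under eq_fun do rewrite big_nil; exact: wlim_cst.
rewrite big_cons; under eq_fun do rewrite big_cons.
by case: ifP => // _; apply: wlimM.
Qed.

Lemma wlim_comp A B f g z L M : (forall w, A w -> B (f w)) ->
  wlim A f z L -> wlim B g L M -> wlim A (fun w => g (f w)) z M.
Proof.
move=> AB hf hg e e0; have [d d0 hd] := hg e e0.
have [d' d'0 hd'] := hf d d0; exists d' => // w Aw wd.
by apply: hd; [exact: AB|exact: hd'].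
Qed.

Definition ccont f z := wlim setT f z (f z).

(** Written without a quotient, so that the increment zero needs no exception and the rules of
    calculus reduce to estimates. *)
Definition cdiff (f : C -> C) (z d : C) :=
  forall e : R, 0 < e -> exists2 r : R, 0 < r &
    forall h, modc h < r -> modc (f (z + h) - f z - d * h) <= e * modc h.

Definition holo f z := exists d, cdiff f z d.

Lemma cdiff_le f z d (k : R) :
  (forall e : R, 0 < e -> exists2 r : R, 0 < r &
    forall h, modc h < r -> modc (f (z + h) - f z - d * h) <= k * e * modc h) ->
  cdiff f z d.
Proof.
move=> H e e0; have k0 : 0 < `|k| + 1 by rewrite ltr_wpDl.
have [r r0 hr] := H (e / (`|k| + 1)) (divr_gt0 e0 k0).
exists r => // h hh; apply: (le_trans (hr h hh)).
rewrite ler_wpM2r ?modc_ge0 // mulrCA -ler_pdivlMl // mulVf ?gt_eqF //.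
rewrite ler_pdivrMr // mul1r.
by rewrite (le_trans (ler_norm k)) // lerDl.
Qed.

Lemma cdiff_near f g z d r : 0 < r ->
  (forall w, modc (w - z) < r -> f w = g w) -> cdiff f z d -> cdiff g z d.
Proof.
move=> r0 fg H e e0; have [s s0 hs] := H e e0.
exists (Num.min s r) => [|h]; first by rewrite lt_min s0.
rewrite lt_min => /andP[hh1 hh2]; rewrite -!fg ?subrr ?modc0 //; first exact: hs.
by rewrite addrAC subrr add0r.
Qed.

Lemma cdiff_cont f z d : cdiff f z d -> ccont f z.
Proof.
move=> H; apply: (@wlim_le _ _ _ _ (1 + modc d)) => e e0.
have [r r0 hr] := H 1 ltr01.
exists (Num.min r e) => [|w _]; first by rewrite lt_min r0.
rewrite lt_min => /andP[w1 w2].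
have := hr (w - z) w1; rewrite [z + _]addrC subrK => h1.
have -> : f w - f z = (f w - f z - d * (w - z)) + d * (w - z) by ring.
apply: (le_trans (modcD _ _)); rewrite modcM.
have : modc d * modc (w - z) <= modc d * e by rewrite ler_wpM2l ?modc_ge0 // ltW.
lra.
Qed.

Lemma holo_cont f z : holo f z -> ccont f z.
Proof. by case=> d /cdiff_cont. Qed.

Lemma cdiff_cst c z : cdiff (fun=> c) z 0.
Proof.
move=> e e0; exists 1 => // h _.
by rewrite subrr mul0r subr0 modc0 mulr_ge0 ?modc_ge0 // ltW.
Qed.

Lemma cdiff_id z : cdiff id z 1.
Proof.
move=> e e0; exists 1 => // h _.
have -> : z + h - z - 1 * h = 0 by ring.
by rewrite modc0 mulr_ge0 ?modc_ge0 // ltW.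
Qed.

Lemma cdiffD f g z a b : cdiff f z a -> cdiff g z b ->
  cdiff (fun w => f w + g w) z (a + b).
Proof.
move=> hf hg; apply: (@cdiff_le _ _ _ 2) => e e0.
have [r r0 hr] := hf e e0; have [s s0 hs] := hg e e0.
exists (Num.min r s) => [|h]; first by rewrite lt_min r0.
rewrite lt_min => /andP[h1 h2].
have -> : f (z + h) + g (z + h) - (f z + g z) - (a + b) * h =
  (f (z + h) - f z - a * h) + (g (z + h) - g z - b * h) by ring.
apply: (le_trans (modcD _ _)).
by have := hr h h1; have := hs h h2; lra.
Qed.

Lemma cdiffN f z a : cdiff f z a -> cdiff (fun w => - f w) z (- a).
Proof.
move=> hf e e0; have [r r0 hr] := hf e e0; exists r => // h h1.
have -> : - f (z + h) - - f z - - a * h = - (f (z + h) - f z - a * h) by ring.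
by rewrite modcN; exact: hr.
Qed.

Lemma cdiffM f g z a b : cdiff f z a -> cdiff g z b ->
  cdiff (fun w => f w * g w) z (a * g z + f z * b).
Proof.
move=> hf hg; apply: (@cdiff_le _ _ _ (modc (g z) + modc (f z) + 1 + modc a)) => e e0.
have [r r0 hr] := hf e e0; have [s s0 hs] := hg e e0.
have [t t0 ht] := cdiff_cont hg e0.
have [t' t'0 ht'] := cdiff_cont hg ltr01.
exists (Num.min (Num.min r s) (Num.min t t')) => [|h]; first by rewrite !lt_min r0 s0 t0.
rewrite !lt_min => /andP[/andP[h1 h2] /andP[h3 h4]].
have -> : f (z + h) * g (z + h) - f z * g z - (a * g z + f z * b) * h =
  (f (z + h) - f z - a * h) * g z + f z * (g (z + h) - g z - b * h) +
  ((f (z + h) - f z - a * h) * (g (z + h) - g z) + a * h * (g (z + h) - g z)) by ring.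
have zh : modc (z + h - z) = modc h by congr (modc _); ring.
apply: (le_trans (modcD _ _)).
have i1 : modc ((f (z + h) - f z - a * h) * g z) <= e * modc h * modc (g z).
  by rewrite modcM ler_wpM2r ?modc_ge0 // hr.
have i2 : modc (f z * (g (z + h) - g z - b * h)) <= modc (f z) * (e * modc h).
  by rewrite modcM ler_wpM2l ?modc_ge0 // hs.
have i3 : modc ((f (z + h) - f z - a * h) * (g (z + h) - g z)) <= e * modc h * 1.
  rewrite modcM ler_pM ?modc_ge0 ?hr // ltW // ht' //; by rewrite zh.
have i4 : modc (a * h * (g (z + h) - g z)) <= modc a * modc h * e.
  rewrite !modcM ler_wpM2l ?mulr_ge0 ?modc_ge0 // ltW // ht //; by rewrite zh.
have := modcD ((f (z + h) - f z - a * h) * g z) (f z * (g (z + h) - g z - b * h)).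
have := modcD ((f (z + h) - f z - a * h) * (g (z + h) - g z)) (a * h * (g (z + h) - g z)).
lra.
Qed.

Lemma cdiffV f z a : f z != 0 -> cdiff f z a ->
  cdiff (fun w => (f w)^-1) z (- a / (f z) ^+ 2).
Proof.
move=> f0 hf.
have hc : wlim setT (fun w => (f w)^-1) z (f z)^-1 by apply: wlimV => //; exact: cdiff_cont hf.
apply: (@cdiff_le _ _ _ ((modc (f z)^-1 + 1) * modc (f z)^-1 + modc a * modc (f z)^-1)) => e e0.
have [r r0 hr] := hf e e0.
have [t t0 ht] := hc e e0.
have [t' t'0 ht'] := hc _ ltr01.
have fp : 0 < modc (f z) by rewrite modc_gt0.
have [u u0 hu] := cdiff_cont hf fp.
exists (Num.min (Num.min r u) (Num.min t t')) => [|h]; first by rewrite !lt_min r0 u0 t0.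
rewrite !lt_min => /andP[/andP[h1 h2] /andP[h3 h4]].
have zh : modc (z + h - z) = modc h by congr (modc _); ring.
have fh0 : f (z + h) != 0.
  apply/eqP => E; have := hu (z + h) I; rewrite zh => /(_ h2).
  by rewrite E sub0r modcN ltxx.
have -> : (f (z + h))^-1 - (f z)^-1 - - a / f z ^+ 2 * h =
  - ((f (z + h))^-1 * (f z)^-1 * (f (z + h) - f z - a * h))
  - a * (f z)^-1 * h * ((f (z + h))^-1 - (f z)^-1).
  by field; rewrite f0 fh0.
apply: (le_trans (modcB _ _)); rewrite modcN !modcM.
have b1 : modc (f (z + h))^-1 <= modc (f z)^-1 + 1.
  have := ht' (z + h) I; rewrite zh => /(_ h4).
  by have := modc_sub_le (f (z + h))^-1 (f z)^-1; lra.
have b2 : modc ((f (z + h))^-1 - (f z)^-1) <= e by rewrite ltW // ht // zh.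
have i1 : modc (f (z + h))^-1 * modc (f z)^-1 * modc (f (z + h) - f z - a * h) <=
   (modc (f z)^-1 + 1) * modc (f z)^-1 * (e * modc h).
  rewrite ler_pM ?mulr_ge0 ?modc_ge0 ?hr //.
  by rewrite ler_wpM2r ?modc_ge0.
have i2 : modc a * modc (f z)^-1 * modc h * modc ((f (z + h))^-1 - (f z)^-1) <=
   modc a * modc (f z)^-1 * modc h * e.
  by rewrite ler_wpM2l ?mulr_ge0 ?modc_ge0.
lra.
Qed.

Lemma cdiff_comp f g z a b : cdiff f z a -> cdiff g (f z) b ->
  cdiff (fun w => g (f w)) z (b * a).
Proof.
move=> hf hg; apply: (@cdiff_le _ _ _ (modc a + 1 + modc b)) => e e0.
have [r r0 hr] := hf e e0; have [r1 r10 hr1] := hf 1 ltr01; have [s s0 hs] := hg e e0.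
have [t t0 ht] := cdiff_cont hf s0.
exists (Num.min (Num.min r r1) t) => [|h]; first by rewrite !lt_min r0 r10 t0.
rewrite !lt_min => /andP[/andP[h1 h2] h3].
have zh : modc (z + h - z) = modc h by congr (modc _); ring.
set k := f (z + h) - f z.
have kE : f (z + h) = f z + k by rewrite /k; ring.
have ks : modc k < s by apply: ht => //; rewrite zh.
have kb : modc k <= (modc a + 1) * modc h.
  have -> : k = (f (z + h) - f z - a * h) + a * h by rewrite /k; ring.
  by apply: (le_trans (modcD _ _)); rewrite modcM; have := hr1 h h2; lra.
rewrite kE.
have -> : g (f z + k) - g (f z) - b * a * h =
  (g (f z + k) - g (f z) - b * k) + b * (f (z + h) - f z - a * h) by rewrite /k; ring.
apply: (le_trans (modcD _ _)); rewrite modcM.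
have i1 : modc (g (f z + k) - g (f z) - b * k) <= e * ((modc a + 1) * modc h).
  by apply: (le_trans (hs k ks)); rewrite ler_wpM2l // ltW.
have i2 : modc b * modc (f (z + h) - f z - a * h) <= modc b * (e * modc h).
  by rewrite ler_wpM2l ?modc_ge0 // hr.
lra.
Qed.

(** Conjugating both the argument and the value conjugates the difference quotient; this makes
    the solution in the lower half plane, defined by reflection, analytic. *)
Lemma cdiffJ f z a : cdiff f z^cj a -> cdiff (fun w => (f w^cj)^cj) z a^cj.
Proof.
move=> hf e e0; have [r r0 hr] := hf e e0; exists r => // h h1.
have -> : (f (z + h)^cj)^cj - (f z^cj)^cj - a^cj * h =
    (f (z^cj + h^cj) - f z^cj - a * h^cj)^cj.
  by rewrite -conjcD; apply: eqC; rewrite !ReImE; ring.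
by rewrite modc_conj -[modc h]modc_conj; apply: hr; rewrite modc_conj.
Qed.

Lemma holo_near f g z r : 0 < r ->
  (forall w, modc (w - z) < r -> f w = g w) -> holo f z -> holo g z.
Proof. by move=> r0 fg [d hd]; exists d; exact: (cdiff_near r0 fg hd). Qed.
Lemma holo_cst c z : holo (fun=> c) z. Proof. by exists 0; exact: cdiff_cst. Qed.
Lemma holo_id z : holo id z. Proof. by exists 1; exact: cdiff_id. Qed.
Lemma holoD f g z : holo f z -> holo g z -> holo (fun w => f w + g w) z.
Proof. by move=> [a ha] [b hb]; exists (a + b); exact: cdiffD. Qed.
Lemma holoN f z : holo f z -> holo (fun w => - f w) z.
Proof. by move=> [a ha]; exists (- a); exact: cdiffN. Qed.
Lemma holoB f g z : holo f z -> holo g z -> holo (fun w => f w - g w) z.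
Proof. by move=> hf hg; apply: holoD => //; exact: holoN. Qed.
Lemma holoM f g z : holo f z -> holo g z -> holo (fun w => f w * g w) z.
Proof. by move=> [a ha] [b hb]; eexists; exact: cdiffM ha hb. Qed.
Lemma holoV f z : f z != 0 -> holo f z -> holo (fun w => (f w)^-1) z.
Proof. by move=> f0 [a ha]; eexists; exact: cdiffV f0 ha. Qed.
Lemma holo_comp f g z : holo f z -> holo g (f z) -> holo (fun w => g (f w)) z.
Proof. by move=> [a ha] [b hb]; exists (b * a); exact: cdiff_comp. Qed.
Lemma holoJ f z : holo f z^cj -> holo (fun w => (f w^cj)^cj) z.
Proof. by move=> [a ha]; eexists; exact: cdiffJ ha. Qed.

Lemma holo_sum (I : Type) (s : seq I) (P : pred I) (f : I -> C -> C) z :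
  (forall i, holo (f i) z) -> holo (fun w => \sum_(i <- s | P i) f i w) z.
Proof.
move=> h; elim: s => [|i s IH].
  by under eq_fun do rewrite big_nil; exact: holo_cst.
under eq_fun do rewrite big_cons.
by case: (P i) => //; apply: holoD.
Qed.

Lemma holo_prod (I : Type) (s : seq I) (P : pred I) (f : I -> C -> C) z :
  (forall i, holo (f i) z) -> holo (fun w => \prod_(i <- s | P i) f i w) z.
Proof.
move=> h; elim: s => [|i s IH].
  by under eq_fun do rewrite big_nil; exact: holo_cst.
under eq_fun do rewrite big_cons.
by case: (P i) => //; apply: holoM.
Qed.

End Limits.

(** * Matrices of functions: entrywise limits and derivatives *)

Section Bridge.
Context {R : realType}.
Notation C := R[i].

Lemma posC (e : C) : 0 < e -> e = (complex.Re e)%:C /\ 0 < complex.Re e.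
Proof.
case: e => a b; rewrite ltcE /= => /andP[/eqP -> a0].
by split.
Qed.

Lemma near_modcP (z : C) (P : C -> Prop) :
  (\forall w \near z, P w) <->
  exists2 d : R, 0 < d & forall w, modc (w - z) < d -> P w.
Proof.
split.
  move=> /nbhs_normP[e /= /posC[-> e0] h]; exists (complex.Re e) => // w wz.
  by apply: h; rewrite /ball_ /= normCE ltcR modcBC.
move=> [d d0 h]; apply/nbhs_normP; exists d%:C => /=; first by rewrite ltcR.
by move=> w; rewrite /ball_ /= normCE ltcR modcBC; exact: h.
Qed.

Lemma norm_mx_leP m n (M : 'M[C]_(m, n)) (e : R) : 0 <= e ->
  (`|M| <= e%:C) <-> (forall i j, modc (M i j) <= e).
Proof.
move=> e0; have e0' : (0 : C) <= e%:C by rewrite lecR.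
rewrite {1}/Num.norm /= /mx_norm.
have -> : e%:C = (NngNum e0')%:num by [].
rewrite num_le; split.
  move/bigmax_leP => [_ h] i j.
  by have := h (i, j) isT; rewrite -num_le /= normCE lecR.
move=> h; apply/bigmax_leP; split; first by rewrite -num_le.
by move=> [i j] _; rewrite -num_le /= normCE lecR.
Qed.

Lemma norm_mx_le m n (M : 'M[C]_(m, n)) (e : R) : 0 <= e ->
  (forall i j, modc (M i j) <= e) -> `|M| <= e%:C.
Proof. by move=> e0 /(norm_mx_leP M e0). Qed.

Lemma norm_mx_ge m n (M : 'M[C]_(m, n)) (e : R) i j : 0 <= e ->
  `|M| <= e%:C -> modc (M i j) <= e.
Proof. by move=> e0 /(norm_mx_leP M e0). Qed.

(** Limits of matrices are taken entry by entry; [cvg_mlimP] identifies them with limits in the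
    norm topology. *)
Definition mlim m n (A : set C) (F : C -> 'M[C]_(m, n)) z L :=
  forall i j, wlim A (fun w => F w i j) z (L i j).

Lemma cvg_withinP (V : normedModType C) (A : set C) (F : C -> V) (z : C) (L : V) :
  F w @[w --> within A (nbhs z)] --> L <->
  (forall e : R, 0 < e -> exists2 d : R, 0 < d &
     forall w, A w -> modc (w - z) < d -> `|F w - L| <= e%:C).
Proof.
split.
  move=> /cvgrPdist_le h e e0.
  have /h : (0 : C) < e%:C by rewrite ltcR.
  rewrite near_withinE => /near_modcP[d d0 hd].
  by exists d => // w Aw wd; rewrite distrC; exact: hd.
move=> h; apply/cvgrPdist_le => e /posC[-> e0]; rewrite near_withinE.
have [d d0 hd] := h _ e0; apply/near_modcP; exists d => // w wd Aw.
by rewrite distrC; exact: hd.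
Qed.

Lemma cvg_mlimP m n (A : set C) (F : C -> 'M[C]_(m, n)) (z : C) (L : 'M[C]_(m, n)) :
  F w @[w --> within A (nbhs z)] --> L <-> mlim A F z L.
Proof.
split.
  move=> /(cvg_withinP (V := 'M[C]_(m, n))) h i j.
  apply: (@wlim_le _ _ _ _ _ 1) => e e0; have [d d0 hd] := h e e0.
  exists d => // w Aw wd.
  by have := norm_mx_ge i j (ltW e0) (hd w Aw wd); rewrite !mxE mul1r.
move=> h; apply/(cvg_withinP (V := 'M[C]_(m, n))) => e e0.
pose P (ij : 'I_m * 'I_n) (d : R) := 0 < d /\
  forall w, A w -> modc (w - z) < d -> modc (F w ij.1 ij.2 - L ij.1 ij.2) < e.
have Pex ij : exists d, P ij d by have [d d0 hd] := h ij.1 ij.2 e e0; exists d.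
have [d hd] := choice Pex.
exists (\big[Num.min/1]_ij d ij).
  by apply/bigmin_gtP; split=> // ij _; case: (hd ij).
move=> w Aw /bigmin_gtP[_ wd]; apply: norm_mx_le; first exact: ltW.
move=> i j; rewrite !mxE ltW //; have [_ H] := hd (i, j).
by apply: H => //; exact: wd.
Qed.

Lemma within_mlimP m n (A : set C) (F : C -> 'M[C]_(m, n)) :
  {within A, continuous F} <-> (forall z, A z -> mlim A F z (F z)).
Proof.
split.
  by move/(@subspace_continuousP C A) => h z Az; apply/cvg_mlimP/h.
by move=> h; apply/(@subspace_continuousP C A) => z Az; apply/cvg_mlimP/h.
Qed.

Lemma within_wlimP (A : set C) (F : C -> C) :
  {within A, continuous F} <-> (forall z, A z -> wlim A F z (F z)).
Proof.
split.
  move/(@subspace_continuousP C A) => h z Az.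
  have /(cvg_withinP (V := C)) H := h z Az.
  apply: (@wlim_le _ _ _ _ _ 1) => e e0; have [d d0 hd] := H e e0.
  by exists d => // w Aw wd; have := hd w Aw wd; rewrite normCE lecR mul1r.
move=> h; apply/(@subspace_continuousP C A) => z Az.
apply/(cvg_withinP (V := C)) => e e0; have [d d0 hd] := h z Az e e0.
by exists d => // w Aw wd; have := hd w Aw wd; rewrite normCE lecR => /ltW.
Qed.

Lemma derivableCP (V : normedModType C) (F : C -> V) (z : C) :
  derivable F z 1 <-> exists L : V, forall e : R, 0 < e -> exists2 d : R, 0 < d &
    forall h : C, h != 0 -> modc h < d -> `|h^-1 *: (F (z + h) - F z) - L| <= e%:C.
Proof.
split.
  move/cvg_ex => [L /cvgrPdist_le H]; exists L => e e0.
  have /H : (0 : C) < e%:C by rewrite ltcR.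
  move=> /near_modcP[d d0 hd]; exists d => // h h0 hh.
  rewrite distrC; have := hd h; rewrite subr0 => /(_ hh h0) /=.
  have -> // : z + h = GRing.scale h (1 : C^o) + z.
  by rewrite addrC; congr (_ + _); rewrite /GRing.scale /= mulr1.
move=> [L H]; apply/cvg_ex; exists L; apply/cvgrPdist_le => e /posC[-> e0].
have [d d0 hd] := H _ e0; apply/near_modcP; exists d => // h; rewrite subr0 => hh h0.
rewrite distrC; have := hd h h0 hh => /=.
have -> // : z + h = GRing.scale h (1 : C^o) + z.
by rewrite addrC; congr (_ + _); rewrite /GRing.scale /= mulr1.
Qed.

Lemma cdiffP (F : C -> C) (z L : C) :
  (forall e : R, 0 < e -> exists2 d : R, 0 < d &
    forall h : C, h != 0 -> modc h < d -> modc (h^-1 * (F (z + h) - F z) - L) <= e)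
  <-> cdiff F z L.
Proof.
have key (h : C) (h0 : h != 0) :
    h * (h^-1 * (F (z + h) - F z) - L) = F (z + h) - F z - L * h by field.
split=> H e e0; have [d d0 hd] := H e e0; exists d => // h.
  move=> hh; have [->|h0] := eqVneq h 0.
    by rewrite addr0 subrr mulr0 subr0 modc0 mulr0.
  by rewrite -key // modcM mulrC ler_wpM2r ?modc_ge0 // hd.
move=> h0 hh; rewrite -(ler_pM2l (x := modc h)) ?modc_gt0 //.
by rewrite -modcM key // [leRHS]mulrC; exact: hd.
Qed.

Lemma derivable_holo (F : C -> C) z : derivable F z 1 <-> holo F z.
Proof.
split.
  move/(derivableCP (V := C)) => [L H]; exists L; apply/cdiffP => e e0.
  have [d d0 hd] := H e e0; exists d => // h h0 hh.
  by have := hd h h0 hh; rewrite normCE lecR.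
move=> [L /cdiffP H]; apply/(derivableCP (V := C)); exists L => e e0.
have [d d0 hd] := H e e0; exists d => // h h0 hh.
by rewrite normCE lecR; exact: hd.
Qed.

Lemma derivable_mx_holo m n (F : C -> 'M[C]_(m, n)) z :
  derivable F z 1 <-> forall i j, holo (fun w => F w i j) z.
Proof.
split.
  move=> /(derivableCP (V := 'M[C]_(m, n))) [L H] i j; exists (L i j).
  apply/cdiffP => e e0; have [d d0 hd] := H e e0; exists d => // h h0 hh.
  by have := norm_mx_ge i j (ltW e0) (hd h h0 hh); rewrite !mxE.
move=> h; pose P (ij : 'I_m * 'I_n) d := cdiff (fun w => F w ij.1 ij.2) z d.
have [L hL] := choice (fun ij : 'I_m * 'I_n => h ij.1 ij.2 : exists d, P ij d).
apply/(derivableCP (V := 'M[C]_(m, n))); exists (\matrix_(i, j) L (i, j)) => e e0.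
pose Q (ij : 'I_m * 'I_n) (d : R) := 0 < d /\ forall k : C, k != 0 -> modc k < d ->
  modc (k^-1 * (F (z + k) ij.1 ij.2 - F z ij.1 ij.2) - L ij) <= e.
have Qex ij : exists d, Q ij d.
  by have /cdiffP H := hL ij; have [d d0 hd] := H e e0; exists d.
have [d hd] := choice Qex.
exists (\big[Num.min/1]_ij d ij).
  by apply/bigmin_gtP; split=> // ij _; case: (hd ij).
move=> k k0 /bigmin_gtP[_ kd]; apply: norm_mx_le; first exact: ltW.
move=> i j; rewrite !mxE; have [_ H] := hd (i, j).
by apply: H => //; exact: kd.
Qed.

End Bridge.

(** * Complex functions of a real variable *)

Section RealVariable.
Context {R : realType}.
Notation C := R[i].

Lemma derive_ge0_le (f df : R -> R) (a b : R) : a <= b ->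
  (forall x, a <= x <= b -> is_derive x 1 f (df x)) ->
  (forall x, a <= x <= b -> 0 <= df x) -> f a <= f b.
Proof.
move=> ab hd hp.
have [| |c cab E] := @MVT_segment R f df a b ab.
- by move=> x /[!in_itv] /andP[/ltW ax /ltW xb]; apply: hd; rewrite ax.
- apply: derivable_within_continuous => x; rewrite in_itv /= => xab.
  by have [] := hd x xab.
- by rewrite -subr_ge0 E mulr_ge0 ?subr_ge0 // hp // -in_itv.
Qed.

(** The two real components are kept apart so that the real mean value theorem applies to
    them. *)
Definition rder (f : R -> C) (x : R) (d : C) :=
  is_derive x 1 (fun t => complex.Re (f t)) (complex.Re d) /\
  is_derive x 1 (fun t => complex.Im (f t)) (complex.Im d).

Definition rcont (f : R -> C) :=
  continuous (fun t => complex.Re (f t)) /\ continuous (fun t => complex.Im (f t)).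

Lemma is_deriveM' (f g : R -> R) (x df dg : R) : is_derive x 1 f df -> is_derive x 1 g dg ->
  is_derive x 1 (fun t => f t * g t) (df * g x + f x * dg).
Proof.
move=> hf hg; apply: is_derive_eq; rewrite /GRing.scale /=; ring.
Qed.
Lemma is_deriveD' (f g : R -> R) (x df dg : R) : is_derive x 1 f df -> is_derive x 1 g dg ->
  is_derive x 1 (fun t => f t + g t) (df + dg).
Proof. by move=> hf hg; apply: is_derive_eq. Qed.
Lemma is_deriveN' (f : R -> R) (x df : R) : is_derive x 1 f df ->
  is_derive x 1 (fun t => - f t) (- df).
Proof. by move=> hf; apply: is_derive_eq. Qed.
Lemma is_deriveB' (f g : R -> R) (x df dg : R) : is_derive x 1 f df -> is_derive x 1 g dg ->
  is_derive x 1 (fun t => f t - g t) (df - dg).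
Proof. by move=> hf hg; apply: is_derive_eq. Qed.

Lemma rder_cst c x : rder (fun=> c) x 0.
Proof. by split; apply: is_derive_cst. Qed.

Lemma rder_eq f x d d' : rder f x d -> d = d' -> rder f x d'.
Proof. by move=> h <-. Qed.

Lemma rderD f g x a b : rder f x a -> rder g x b -> rder (fun t => f t + g t) x (a + b).
Proof.
move=> [f1 f2] [g1 g2]; rewrite /rder ReD ImD; split.
  by under eq_fun do rewrite ReD; exact: is_deriveD'.
by under eq_fun do rewrite ImD; exact: is_deriveD'.
Qed.

Lemma rderN f x a : rder f x a -> rder (fun t => - f t) x (- a).
Proof.
move=> [f1 f2]; rewrite /rder ReN ImN; split.
  by under eq_fun do rewrite ReN; exact: is_deriveN'.
by under eq_fun do rewrite ImN; exact: is_deriveN'.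
Qed.

Lemma rderB f g x a b : rder f x a -> rder g x b -> rder (fun t => f t - g t) x (a - b).
Proof. by move=> hf hg; apply: rderD => //; exact: rderN. Qed.

Lemma rderM f g x a b : rder f x a -> rder g x b ->
  rder (fun t => f t * g t) x (a * g x + f x * b).
Proof.
move=> [f1 f2] [g1 g2]; split.
  under eq_fun do rewrite ReM.
  rewrite !ReImE; apply: (is_derive_eq (is_deriveB' (is_deriveM' f1 g1) (is_deriveM' f2 g2))); ring.
under eq_fun do rewrite ImM.
rewrite !ReImE; apply: (is_derive_eq (is_deriveD' (is_deriveM' f1 g2) (is_deriveM' f2 g1))); ring.
Qed.

Lemma rderZ c f x a : rder f x a -> rder (fun t => c * f t) x (c * a).
Proof. by move=> h; apply: rder_eq (rderM (rder_cst c x) h) _; ring. Qed.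

Lemma rderJ f x a : rder f x a -> rder (fun t => (f t)^cj) x a^cj.
Proof.
move=> [f1 f2]; rewrite /rder ReJ ImJ; split.
  by under eq_fun do rewrite ReJ.
by under eq_fun do rewrite ImJ; exact: is_deriveN'.
Qed.

Lemma rder_real (f : R -> R) (x d : R) : is_derive x 1 f d -> rder (fun t => (f t)%:C) x d%:C.
Proof. by move=> h; split => //=; exact: is_derive_cst. Qed.

Lemma rder_id (x : R) : rder (fun t => t%:C) x 1.
Proof. by apply: (@rder_real id x 1); exact: is_derive_id. Qed.

Lemma rder_sum (I : Type) (s : seq I) (P : pred I) (f : I -> R -> C) x (d : I -> C) :
  (forall i, rder (f i) x (d i)) ->
  rder (fun t => \sum_(i <- s | P i) f i t) x (\sum_(i <- s | P i) d i).
Proof.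
move=> h; elim: s => [|i s IH].
  by rewrite big_nil; under eq_fun do rewrite big_nil; exact: rder_cst.
rewrite big_cons; under eq_fun do rewrite big_cons.
by case: (P i) => //; apply: rderD.
Qed.

Lemma rder_ext f g x d : f =1 g -> rder f x d -> rder g x d.
Proof. by move=> /funext ->. Qed.

Lemma rder_rcont f (d : R -> C) : (forall x, rder f x (d x)) -> rcont f.
Proof.
move=> h; split => x.
  by have [[+ _] _] := h x => /derivable1_diffP/differentiable_continuous.
by have [_ [+ _]] := h x => /derivable1_diffP/differentiable_continuous.
Qed.

Lemma rcont_cst c : rcont (fun=> c). Proof. by split => x; exact: cvg_cst. Qed.
Lemma rcontD f g : rcont f -> rcont g -> rcont (fun t => f t + g t).
Proof.
move=> [f1 f2] [g1 g2]; split => x.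
  by under eq_fun do rewrite ReD; apply: cvgD; [exact: f1|exact: g1].
by under eq_fun do rewrite ImD; apply: cvgD; [exact: f2|exact: g2].
Qed.
Lemma rcontN f : rcont f -> rcont (fun t => - f t).
Proof.
move=> [f1 f2]; split => x.
  by under eq_fun do rewrite ReN; apply: cvgN; exact: f1.
by under eq_fun do rewrite ImN; apply: cvgN; exact: f2.
Qed.
Lemma rcontB f g : rcont f -> rcont g -> rcont (fun t => f t - g t).
Proof. by move=> hf hg; apply: rcontD => //; exact: rcontN. Qed.
Lemma rcontM f g : rcont f -> rcont g -> rcont (fun t => f t * g t).
Proof.
move=> [f1 f2] [g1 g2]; split => x.
  under eq_fun do rewrite ReM; apply: cvgB.
    by apply: cvgM; [exact: f1|exact: g1].
  by apply: cvgM; [exact: f2|exact: g2].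
under eq_fun do rewrite ImM; apply: cvgD.
  by apply: cvgM; [exact: f1|exact: g2].
by apply: cvgM; [exact: f2|exact: g1].
Qed.
Lemma rcontJ f : rcont f -> rcont (fun t => (f t)^cj).
Proof.
move=> [f1 f2]; split => x; first by under eq_fun do rewrite ReJ; exact: f1.
by under eq_fun do rewrite ImJ; apply: cvgN; exact: f2.
Qed.
Lemma rcont_sum (I : Type) (s : seq I) (P : pred I) (f : I -> R -> C) :
  (forall i, rcont (f i)) -> rcont (fun t => \sum_(i <- s | P i) f i t).
Proof.
move=> h; elim: s => [|i s IH].
  by under eq_fun do rewrite big_nil; exact: rcont_cst.
under eq_fun do rewrite big_cons.
by case: (P i) => //; apply: rcontD.
Qed.

Lemma rcont_epsP f : rcont f <-> forall x (e : R), 0 < e -> exists2 d, 0 < d &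
  forall y, `|y - x| < d -> modc (f y - f x) < e.
Proof.
split.
  move=> [f1 f2] x e e0; have e2 : 0 < e / 2 by rewrite divr_gt0.
  have /cvgrPdist_lt/(_ _ e2)/nbhs_normP[d /= d0 hd] := f1 x.
  have /cvgrPdist_lt/(_ _ e2)/nbhs_normP[d' /= d'0 hd'] := f2 x.
  exists (Num.min d d') => [|y]; first by rewrite lt_min d0.
  rewrite lt_min => /andP[y1 y2].
  apply: (le_lt_trans (modc_le_ReIm _)); rewrite ReB ImB.
  rewrite [e]splitr distrC [X in _ + X]distrC; apply: ltrD.
    by apply: hd; rewrite /ball_ /= distrC.
  by apply: hd'; rewrite /ball_ /= distrC.
move=> h; split=> x; apply/cvgrPdist_lt => e e0; have [d d0 hd] := h x e e0;
  apply/nbhs_normP; exists d => // y; rewrite /ball_ /= distrC => yx.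
  rewrite distrC -ReB; exact: le_lt_trans (Re_le_modc _) (hd _ yx).
rewrite distrC -ImB; exact: le_lt_trans (Im_le_modc _) (hd _ yx).
Qed.

Lemma phaseP (I : C) : exists2 c : C, modc c = 1 & complex.Re (c * I) = modc I.
Proof.
have [->|I0] := eqVneq I 0; first by exists 1; rewrite ?modc1 // mulr0 modc0.
have Ip : 0 < modc I by rewrite modc_gt0.
have h2 : modc I * (modc I)^-1 = 1 by rewrite mulfV ?gt_eqF.
exists (I^cj * ((modc I)^-1)%:C).
  by rewrite modcM modc_conj modc_real ger0_norm // invr_ge0 modc_ge0.
have h1 := sqr_modc I.
rewrite !ReImE mulr0 subr0 mulr0 add0r.
transitivity ((modc I)^-1 * (modc I) ^+ 2); first by rewrite h1; ring.
by rewrite mulrC expr2 -mulrA h2 mulr1.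
Qed.

(** A complex mean value inequality has no mean point; a rotation that makes the increment real
    and nonnegative reduces it to the monotonicity of a real function. *)
Lemma rder_le (F f : R -> C) (G g : R -> R) (a b : R) : a <= b ->
  (forall x, a <= x <= b -> rder F x (f x)) ->
  (forall x, a <= x <= b -> is_derive x 1 G (g x)) ->
  (forall x, a <= x <= b -> modc (f x) <= g x) ->
  modc (F b - F a) <= G b - G a.
Proof.
move=> ab dF dG fg; set I := F b - F a.
have [c c1 cI] := phaseP I.
rewrite -cI /I mulrBr ReB -subr_ge0 opprB addrA.
pose H t := G t - complex.Re (c * F t).
suff: H a <= H b by rewrite /H; lra.
apply: (derive_ge0_le (df := fun t => g t - complex.Re (c * f t)) ab) => x xab.
  by apply: is_deriveB'; [exact: dG|have [] := rderZ c (dF x xab)].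
rewrite subr_ge0; apply: le_trans (fg x xab).
apply: (le_trans (ler_norm _)); apply: (le_trans (Re_le_modc _)).
by rewrite modcM c1 mul1r.
Qed.

Lemma rder_le_cst (F f : R -> C) (a b K : R) : a <= b ->
  (forall x, a <= x <= b -> rder F x (f x)) ->
  (forall x, a <= x <= b -> modc (f x) <= K) ->
  modc (F b - F a) <= K * (b - a).
Proof.
move=> ab dF fK; rewrite mulrBr.
apply: (@rder_le F f (fun t => K * t) (fun=> K) a b ab dF) => // x _.
apply: is_derive_eq; rewrite /GRing.scale /=; ring.
Qed.

Lemma rder_eq_cst (F : R -> C) (a b : R) : a <= b ->
  (forall x, a <= x <= b -> rder F x 0) -> F b = F a.
Proof.
move=> ab h; apply: eq_modcP => e e0; apply: le_trans (ltW e0).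
rewrite -(mul0r (b - a)); apply: (@rder_le_cst F (fun=> 0)) => // x _.
by rewrite modc0.
Qed.

Lemma rder_eq_cstT (F : R -> C) : (forall x, rder F x 0) -> forall a b, F b = F a.
Proof.
move=> h a b; have [ab|/ltW ab] := leP a b; first exact: rder_eq_cst.
by apply/esym; exact: rder_eq_cst.
Qed.

End RealVariable.

(** * Oriented integrals of continuous functions *)

Section Primitive.
Context {R : realType}.
Notation C := R[i].

Lemma continuous_integrable (f : R -> R) (a b : R) : continuous f ->
  (@lebesgue_measure R).-integrable `[a, b] (EFin \o f).
Proof.
move=> fc; apply: continuous_compact_integrable; first exact: segment_compact.
exact: continuous_subspaceT.
Qed.

Lemma primitive_ex (f : R -> R) : continuous f ->
  exists2 F : R -> R, (forall x : R, is_derive x 1 F (f x)) & F 0 = 0.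
Proof.
move=> fc.
pose P (N x : R) := (\int[@lebesgue_measure R]_(t in `[- N, x]) f t)%R.
have dP (N x : R) : - N < x -> is_derive x 1 (P N) (f x).
  move=> Nx; have xx : x < x + 1 by rewrite ltrDl.
  have [h1 h2] : derivable (P N) x 1 /\ (P N)^`() x = f x.
    exact: (continuous_FTC1_closed xx (continuous_integrable (- N) (x + 1) fc) Nx (fc x)).
  by apply: (DeriveDef h1); rewrite -derive1E.
have PP (M N x : R) : 0 < M -> 0 < N -> - M < x -> - N < x -> P M x - P M 0 = P N x - P N 0.
  move=> M0 N0 Mx Nx.
  have key : forall a b, - M < a -> - N < a -> a <= b -> P M b - P N b = P M a - P N a.
    move=> a b Ma Na ab; apply/eqP; rewrite eq_le.
    have H (t : R) : a <= t <= b -> is_derive t 1 (fun u => P M u - P N u) (f t - f t).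
      move=> /andP[at_ _]; apply: is_deriveB'; apply: dP; exact: lt_le_trans at_.
    apply/andP; split.
      rewrite -lerN2; apply: (@derive_ge0_le _ (fun u => - (P M u - P N u)) (fun t => - (f t - f t)) _ _ ab).
        by move=> t /H/is_deriveN'.
      by move=> t _; rewrite subrr oppr0.
    apply: (@derive_ge0_le _ (fun u => P M u - P N u) (fun t => f t - f t) _ _ ab) => //.
    by move=> t _; rewrite subrr.
  have M0' : - M < 0 by rewrite oppr_lt0.
  have N0' : - N < 0 by rewrite oppr_lt0.
  have [x0|/ltW x0] := leP 0 x.
    by have := key 0 x M0' N0' x0; lra.
  by have := key x 0 Mx Nx x0; lra.
exists (fun x => P (`|x| + 1) x - P (`|x| + 1) 0); last first.
  by rewrite subrr.
move=> x.
have Np : 0 < `|x| + 2 by rewrite ltr_wpDl.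
have xN : - (`|x| + 2) < x by have := ler_norm (- x); rewrite normrN; lra.
have dx : is_derive x 1 (fun u => P (`|x| + 2) u - P (`|x| + 2) 0) (f x).
  apply: (is_derive_eq (is_deriveB' (dP _ _ xN) (is_derive_cst (P (`|x| + 2) 0) x (1:R)))).
  by rewrite subr0.
apply: (near_eq_is_derive _ dx).
apply/nbhs_normP; exists 1 => //= y; rewrite /ball_ /= => xy.
have yx : `|y| < `|x| + 1 by have := ler_normB x (x - y); rewrite subKr; lra.
have yN := ler_norm (- y); rewrite normrN in yN.
have y0 := normr_ge0 y.
by apply: PP; lra.
Qed.

Definition rprim (f : R -> R) : R -> R :=
  xget (fun=> 0) [set F : R -> R | (forall x : R, is_derive x 1 F (f x)) /\ F 0 = 0].

Lemma rprimP f : continuous f -> forall x : R, is_derive x 1 (rprim f) (f x).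
Proof.
move=> /primitive_ex[F dF F0]; rewrite /rprim; case: xgetP => [G _ [] //|].
by move=> /(_ F) /=; case.
Qed.

(** Defined by primitives, so that orientation and additivity over intervals hold without
    conditions on the end points; [Cint_cint] compares it with the Lebesgue integral. *)
Definition cint (f : R -> C) (a b : R) : C :=
  (rprim (fun t => complex.Re (f t)) b - rprim (fun t => complex.Re (f t)) a) +i*
  (rprim (fun t => complex.Im (f t)) b - rprim (fun t => complex.Im (f t)) a).

Lemma cint_rder f (a x : R) : rcont f -> rder (cint f a) x (f x).
Proof.
move=> [f1 f2]; split.
  apply: (is_derive_eq (is_deriveB' (rprimP f1 x) (is_derive_cst _ x (1:R)))).
  by rewrite subr0.
apply: (is_derive_eq (is_deriveB' (rprimP f2 x) (is_derive_cst _ x (1:R)))).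
by rewrite subr0.
Qed.

Lemma cint_id f a : cint f a a = 0. Proof. by rewrite /cint !subrr. Qed.

Lemma cint_chain f a b c : cint f a c = cint f a b + cint f b c.
Proof. by apply: eqC; rewrite ?ReD ?ImD /cint /=; lra. Qed.

Lemma cint_rev f a b : cint f a b = - cint f b a.
Proof. by apply: eqC; rewrite ?ReN ?ImN /cint /=; lra. Qed.

Lemma cint_FTC (F f : R -> C) a b : rcont f ->
  (forall x, rder F x (f x)) -> cint f a b = F b - F a.
Proof.
move=> fc dF; apply/eqP; rewrite eq_sym subr_eq addrC -subr_eq; apply/eqP.
rewrite (@rder_eq_cstT _ (fun x => F x - cint f a x) _ a b) ?cint_id ?subr0 //.
by move=> x; apply: rder_eq (rderB (dF x) (cint_rder a x fc)) _; rewrite subrr.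
Qed.

Lemma cint_le f (a b K : R) : rcont f -> a <= b ->
  (forall x, a <= x <= b -> modc (f x) <= K) -> modc (cint f a b) <= K * (b - a).
Proof.
move=> fc ab fK; have := @rder_le_cst _ (cint f a) f a b K ab _ fK.
by rewrite cint_id subr0; apply => x _; exact: cint_rder.
Qed.

Lemma cint_le_norm f (a b K : R) : rcont f ->
  (forall x, (a <= x <= b) || (b <= x <= a) -> modc (f x) <= K) ->
  modc (cint f a b) <= K * `|b - a|.
Proof.
move=> fc fK; have [ab|/ltW ab] := leP a b.
  by rewrite ger0_norm ?subr_ge0 //; apply: cint_le => // x xab; apply: fK; rewrite xab.
rewrite cint_rev modcN distrC ger0_norm ?subr_ge0 //.
by apply: cint_le => // x xab; apply: fK; rewrite xab orbT.
Qed.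

Lemma cintD f g a b : rcont f -> rcont g ->
  cint (fun t => f t + g t) a b = cint f a b + cint g a b.
Proof.
move=> fc gc; rewrite (@cint_FTC (fun x => cint f a x + cint g a x)) ?cint_id ?addr0 ?subr0 //.
  exact: rcontD.
by move=> x; apply: rderD; exact: cint_rder.
Qed.

Lemma cintZ c f a b : rcont f -> cint (fun t => c * f t) a b = c * cint f a b.
Proof.
move=> fc; rewrite (@cint_FTC (fun x => c * cint f a x)) ?cint_id ?mulr0 ?subr0 //.
  by apply: rcontM => //; exact: rcont_cst.
by move=> x; apply: rderZ; exact: cint_rder.
Qed.

Lemma cintB f g a b : rcont f -> rcont g ->
  cint (fun t => f t - g t) a b = cint f a b - cint g a b.
Proof.
move=> fc gc; rewrite (@cint_FTC (fun x => cint f a x - cint g a x)) ?cint_id ?subr0 ?addr0 //.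
  exact: rcontB.
by move=> x; apply: rderB; exact: cint_rder.
Qed.

Lemma cint_cst c a b : cint (fun=> c) a b = c * (b - a)%:C.
Proof.
rewrite (@cint_FTC (fun x => c * x%:C)); first by rewrite rmorphB mulrBr.
  exact: rcont_cst.
by move=> x; apply: rder_eq (rderZ c (rder_id x)) _; rewrite mulr1.
Qed.

End Primitive.

(** * Bisection of rectangles *)

Section Bisection.
Context {R : realType}.
Notation C := R[i].

Record rect := Rect { rl : R; rr : R; rb : R; rt : R }.
Definition wf (Q : rect) := rl Q <= rr Q /\ rb Q <= rt Q.
Definition inrect (Q : rect) (z : C) :=
  (rl Q <= complex.Re z <= rr Q) && (rb Q <= complex.Im z <= rt Q).

Definition quarter (h v : bool) (Q : rect) : rect :=
  let mx := (rl Q + rr Q) / 2 in let my := (rb Q + rt Q) / 2 in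
  Rect (if h then mx else rl Q) (if h then rr Q else mx)
       (if v then my else rb Q) (if v then rt Q else my).

Lemma quarter_wf h v Q : wf Q -> wf (quarter h v Q).
Proof. by case: Q => a b c d [/= ? ?]; split; case: h; case: v => /=; lra. Qed.

Lemma quarter_in h v Q z : wf Q -> inrect (quarter h v Q) z -> inrect Q z.
Proof.
case: Q => a b c d [/= h1 h2] /andP[/andP[/= q1 q2] /andP[/= q3 q4]].
by apply/andP; split; apply/andP; split => /=; case: h v q1 q2 q3 q4 => [] [] /=; lra.
Qed.

Lemma in_quarter Q z : inrect Q z -> exists h v, inrect (quarter h v Q) z.
Proof.
case: Q => a b c d /andP[/andP[/= q1 q2] /andP[/= q3 q4]].
exists ((a + b) / 2 < complex.Re z), ((c + d) / 2 < complex.Im z).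
by apply/andP; split; apply/andP; split => /=; case: ltP; lra.
Qed.

(** The common source of compactness arguments below (uniform continuity, extreme values,
    Goursat, local boundedness): a property inherited by one quarter of every rectangle holds
    on arbitrarily small rectangles around one point. *)
Lemma bisection (P : rect -> Prop) (Q0 : rect) : wf Q0 -> P Q0 ->
  (forall Q, wf Q -> P Q -> exists h v, P (quarter h v Q)) ->
  exists2 z : C, inrect Q0 z & forall e : R, 0 < e -> exists Q,
    [/\ wf Q, P Q, inrect Q z, (forall w, inrect Q w -> inrect Q0 w) & rr Q - rl Q < e /\ rt Q - rb Q < e].
Proof.
move=> wf0 P0 step.
have step' Q : exists hv : bool * bool, wf Q -> P Q -> P (quarter hv.1 hv.2 Q).
  have [[wQ PQ]|nQ] := pselect (wf Q /\ P Q).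
    by have [h [v H]] := step Q wQ PQ; exists (h, v).
  by exists (true, true) => wQ PQ; case: nQ.
have [s hs] := choice step'.
pose q n := iter n (fun Q => quarter (s Q).1 (s Q).2 Q) Q0.
have qwf n : wf (q n) by elim: n => // n IH /=; exact: quarter_wf.
have qP n : P (q n) by elim: n => // n IH /=; exact: hs.
have qmono n : [/\ rl (q n) <= rl (q n.+1), rr (q n.+1) <= rr (q n),
    rb (q n) <= rb (q n.+1) & rt (q n.+1) <= rt (q n)].
  have := qwf n; rewrite [q n.+1]/=; case: (q n) => a b c d [/= h1 h2].
  by case: (s _) => [[] []] /=; split; lra.
have lmono n m : (n <= m)%N -> rl (q n) <= rl (q m) /\ rb (q n) <= rb (q m).
  elim: m => [|m IH]; first by rewrite leqn0 => /eqP ->.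
  rewrite leq_eqVlt => /orP[/eqP -> //|]; rewrite ltnS => /IH[h1 h2].
  by have [a1 _ a2 _] := qmono m; split; [exact: le_trans h1 a1|exact: le_trans h2 a2].
have rmono n m : (n <= m)%N -> rr (q m) <= rr (q n) /\ rt (q m) <= rt (q n).
  elim: m => [|m IH]; first by rewrite leqn0 => /eqP ->.
  rewrite leq_eqVlt => /orP[/eqP -> //|]; rewrite ltnS => /IH[h1 h2].
  by have [_ a1 _ a2] := qmono m; split; [exact: le_trans a1 h1|exact: le_trans a2 h2].
have lr n m : rl (q n) <= rr (q m) /\ rb (q n) <= rt (q m).
  have [h1 h2] := lmono n (maxn n m) (leq_maxl _ _).
  have [h3 h4] := rmono m (maxn n m) (leq_maxr _ _).
  by have [h5 h6] := qwf (maxn n m); split; [apply: le_trans h1 _; apply: le_trans h3|apply: le_trans h2 _; apply: le_trans h4].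
pose X := [set rl (q n) | n in [set: nat]]; pose Y := [set rb (q n) | n in [set: nat]].
have X0 : X !=set0 by exists (rl (q 0%N)), 0%N.
have Y0 : Y !=set0 by exists (rb (q 0%N)), 0%N.
have Xu n : ubound X (rr (q n)) by move=> _ [m _ <-]; case: (lr m n).
have Yu n : ubound Y (rt (q n)) by move=> _ [m _ <-]; case: (lr m n).
have Xs : has_sup X by split => //; exists (rr (q 0%N)).
have Ys : has_sup Y by split => //; exists (rt (q 0%N)).
have inq n : inrect (q n) (sup X +i* sup Y).
  apply/andP; split; apply/andP; split => /=.
  - by apply: ub_le_sup; [case: Xs|exists n].
  - exact: ge_sup.
  - by apply: ub_le_sup; [case: Ys|exists n].
  - exact: ge_sup.
exists (sup X +i* sup Y); first exact: (inq 0%N).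
move=> e e0.
have size n : rr (q n) - rl (q n) = (rr Q0 - rl Q0) / 2 ^+ n /\
    rt (q n) - rb (q n) = (rt Q0 - rb Q0) / 2 ^+ n.
  elim: n => [|n [IH1 IH2]]; first by rewrite expr0 !divr1.
  rewrite exprS invfM mulrCA -IH1 [X in _ /\ _ = X]mulrCA -IH2 [q n.+1]/=.
  by case: (q n) => a b c d; case: (s _) => [[] []] /=; split; lra.
pose n := Num.bound (((rr Q0 - rl Q0) + (rt Q0 - rb Q0)) / e).
exists (q n); split => //.
  elim: n => // n IH w /= wq; apply: IH; exact: quarter_in wq.
have [w1 w2] := wf0.
have hb : (rr Q0 - rl Q0) + (rt Q0 - rb Q0) < e * 2 ^+ n.
  rewrite -ltr_pdivrMl // mulrC.
  apply: (@lt_le_trans _ _ n%:R).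
    by apply: archi_boundP; apply: divr_ge0; [lra|exact: ltW].
  by rewrite -natrX ler_nat ltnW // ltn_expl.
have [-> ->] := size n.
by split; rewrite ltr_pdivrMr ?exprn_gt0 //; lra.
Qed.

Lemma inr_dist Q z w e : inrect Q z -> inrect Q w -> rr Q - rl Q < e -> rt Q - rb Q < e ->
  modc (w - z) < 2 * e.
Proof.
case: Q => a b c d /andP[/andP[/= q1 q2] /andP[/= q3 q4]].
move=> /andP[/andP[/= p1 p2] /andP[/= p3 p4]] h1 h2.
apply: (le_lt_trans (modc_le_ReIm _)); rewrite ReB ImB mulr2n mulrDl mul1r.
by apply: ltrD; rewrite ltr_norml; apply/andP; split; lra.
Qed.

Lemma uniform_continuity (f : C -> C) (Q : rect) (e : R) : wf Q -> 0 < e ->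
  (forall z, inrect Q z -> ccont f z) ->
  exists2 d : R, 0 < d & forall z w, inrect Q z -> modc (w - z) < d -> modc (f w - f z) < e.
Proof.
move=> wQ e0 fc.
pose good Q' := exists2 d : R, 0 < d & forall z w, inrect Q' z -> modc (w - z) < d -> modc (f w - f z) < e.
have [//|ng] := pselect (good Q).
have [|z zQ H] := @bisection (fun Q' => ~ good Q') Q wQ ng; last first.
  have [d d0 hd] := fc z zQ (e / 2) (divr_gt0 e0 (ltr0Sn R 1)).
  have d4 : 0 < d / 4 by rewrite divr_gt0.
  have [Q' [wQ' nQ' zQ' _ [s1 s2]]] := H _ d4.
  exfalso; apply: nQ'; exists (d / 2); first by rewrite divr_gt0.
  move=> u w uQ uw.
  have uz := inr_dist zQ' uQ s1 s2.
  have wz := modc_tri u w z.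
  have h1 := hd u I; have h2 := hd w I.
  have := modc_tri (f z) (f w) (f u); rewrite [modc (f z - f u)]modcBC.
  have : modc (f u - f z) < e / 2 by apply: h1; lra.
  have : modc (f w - f z) < e / 2 by apply: h2; lra.
  lra.
move=> Q' wQ' nQ'; apply: contrapT => H; apply: nQ'.
have G h v : good (quarter h v Q').
  by apply: contrapT => ng'; apply: H; exists h, v.
have [d1 p1 h1] := G true true; have [d2 p2 h2] := G true false.
have [d3 p3 h3] := G false true; have [d4 p4 h4] := G false false.
exists (Num.min (Num.min d1 d2) (Num.min d3 d4)); first by rewrite !lt_min p1 p2 p3 p4.
move=> z w /in_quarter[h [v hz]]; rewrite !lt_min => /andP[/andP[w1 w2] /andP[w3 w4]].
by case: h v hz => [] [] hz; [exact: h1|exact: h2|exact: h3|exact: h4].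
Qed.

Lemma rect_EVT (u : C -> R) (Q : rect) : wf Q ->
  (forall z, inrect Q z -> forall e : R, 0 < e -> exists2 d : R, 0 < d &
     forall w, modc (w - z) < d -> `|u w - u z| < e) ->
  exists2 z, inrect Q z & forall w, inrect Q w -> u w <= u z.
Proof.
move=> wQ uc.
have [| |z zQ H] := @bisection (fun Q' => forall z, inrect Q z -> exists2 w, inrect Q' w & u z <= u w) Q wQ.
- by move=> z zQ; exists z.
- move=> Q' wQ' PQ; apply: contrapT => H.
  have G h v : exists2 z, inrect Q z & forall w, inrect (quarter h v Q') w -> u w < u z.
    apply: contrapT => ng; apply: H; exists h, v => z zQ.
    apply: contrapT => nw; apply: ng; exists z => // w wq.
    by rewrite ltNge; apply/negP => le; apply: nw; exists w.
  have [z1 q1 h1] := G true true; have [z2 q2 h2] := G true false.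
  have [z3 q3 h3] := G false true; have [z4 q4 h4] := G false false.
  have [w1 r1 l1] := PQ z1 q1; have [w2 r2 l2] := PQ z2 q2.
  have [w3 r3 l3] := PQ z3 q3; have [w4 r4 l4] := PQ z4 q4.
  have aux z : inrect Q z -> u z < Num.max (Num.max (u z1) (u z2)) (Num.max (u z3) (u z4)).
    move=> zQ; have [w wQ'' le] := PQ z zQ; apply: (le_lt_trans le).
    have [h [v hw]] := in_quarter wQ''; rewrite !lt_max.
    case: h v hw => [] [] hw; apply/orP.
    + by left; apply/orP; left; exact: h1.
    + by left; apply/orP; right; exact: h2.
    + by right; apply/orP; left; exact: h3.
    + by right; apply/orP; right; exact: h4.
  have := aux z1 q1; have := aux z2 q2; have := aux z3 q3; have := aux z4 q4.
  rewrite !lt_max; lra.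
exists z => // w wQ'; rewrite leNgt; apply/negP => lt.
have [d d0 hd] := uc z zQ (u w - u z) ltac:(lra).
have d2 : 0 < d / 2 by rewrite divr_gt0.
have [Q' [wQ2 PQ zQ2 _ [s1 s2]]] := H _ d2.
have [w' w'Q le] := PQ w wQ'.
have := inr_dist zQ2 w'Q s1 s2; rewrite mulrC divfK // => /hd.
by rewrite ltr_norml => /andP[_]; lra.
Qed.

End Bisection.

Section RderEps.
Context {R : realType}.
Notation C := R[i].

Lemma is_deriveP (f : R -> R) (x d : R) : is_derive x 1 f d <->
  forall e : R, 0 < e -> exists2 r : R, 0 < r &
    forall h, `|h| < r -> `|f (x + h) - f x - d * h| <= e * `|h|.
Proof.
have key (h : R) (h0 : h != 0) : `|f (x + h) - f x - d * h| = `|d - h^-1 * (f (x + h) - f x)| * `|h|.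
  by rewrite -normrM distrC; congr (`|_|); field.
split.
  move=> [df fd] e e0.
  have : h^-1 *: ((f \o shift x) h%:A - f x) @[h --> 0^'] --> d.
    by rewrite -fd; apply: df.
  move=> /cvgrPdist_le/(_ _ e0)/nbhs_normP[r /= r0 hr]; exists r => // h hh.
  have [->|h0] := eqVneq h 0; first by rewrite addr0 subrr mulr0 subr0 !normr0 mulr0.
  rewrite key // ler_wpM2r //.
  have := hr h; rewrite /ball_ /= sub0r normrN => /(_ hh h0).
  by rewrite /GRing.scale /= mulr1 [h + x]addrC.
move=> H.
have cv : h^-1 *: ((f \o shift x) h%:A - f x) @[h --> 0^'] --> d.
  apply/cvgrPdist_le => e e0; have [r r0 hr] := H e e0.
  apply/nbhs_normP; exists r => // h; rewrite /ball_ /= sub0r normrN => hh h0.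
  rewrite /GRing.scale /= mulr1 [h + x]addrC.
  have hp : 0 < `|h| by rewrite normr_gt0.
  by rewrite -(ler_pM2r hp) -key // hr.
have dv : derivable f x 1 by apply/cvg_ex; exists d.
by apply: (DeriveDef dv); apply/cvg_lim.
Qed.

Lemma rderP (f : R -> C) (x : R) (d : C) : rder f x d <->
  forall e : R, 0 < e -> exists2 r : R, 0 < r &
    forall h : R, `|h| < r -> modc (f (x + h) - f x - d * h%:C) <= e * `|h|.
Proof.
split.
  move=> [/is_deriveP h1 /is_deriveP h2] e e0; have e2 : 0 < e / 2 by rewrite divr_gt0.
  have [r r0 hr] := h1 _ e2; have [s s0 hs] := h2 _ e2.
  exists (Num.min r s) => [|h]; first by rewrite lt_min r0.
  rewrite lt_min => /andP[hh1 hh2].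
  apply: (le_trans (modc_le_ReIm _)); rewrite !ReImE mulr0 subr0 mulr0 add0r.
  by have := hr h hh1; have := hs h hh2; lra.
move=> H; split; apply/is_deriveP => e e0; have [r r0 hr] := H e e0; exists r => // h hh.
  apply: le_trans (hr h hh); apply: le_trans (Re_le_modc _).
  by rewrite !ReImE mulr0 subr0.
apply: le_trans (hr h hh); apply: le_trans (Im_le_modc _).
by rewrite !ReImE mulr0 add0r.
Qed.

Lemma rder_comp (g : C -> C) (f : R -> C) (x : R) a b :
  cdiff g (f x) b -> rder f x a -> rder (fun t => g (f t)) x (b * a).
Proof.
move=> hg /rderP hf; apply/rderP => e e0.
have k0 : 0 < modc a + 1 + modc b by rewrite -addrA ltr_wpDl ?modc_ge0 // ltr_wpDr ?modc_ge0.
pose e' := e / (modc a + 1 + modc b); have e'0 : 0 < e' by rewrite divr_gt0.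
have eE : e = e' * (modc a + 1 + modc b) by rewrite /e' divfK ?gt_eqF.
have [r r0 hr] := hf _ e'0; have [r1 r10 hr1] := hf 1 ltr01; have [s s0 hs] := hg _ e'0.
have m0 : 0 < modc a + 1 by rewrite ltr_wpDl ?modc_ge0.
exists (Num.min (Num.min r r1) (s / (modc a + 1))) => [|h]; first by rewrite !lt_min r0 r10 divr_gt0.
rewrite !lt_min => /andP[/andP[h1 h2] h3].
set k := f (x + h) - f x.
have kE : f (x + h) = f x + k by rewrite /k; ring.
have kb : modc k <= (modc a + 1) * `|h|.
  have -> : k = (f (x + h) - f x - a * h%:C) + a * h%:C by rewrite /k; ring.
  by apply: (le_trans (modcD _ _)); rewrite modcM modc_real; have := hr1 h h2; lra.
have ks : modc k < s.
  by apply: (le_lt_trans kb); rewrite mulrC -ltr_pdivlMr.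
rewrite kE.
have -> : g (f x + k) - g (f x) - b * a * h%:C =
  (g (f x + k) - g (f x) - b * k) + b * (f (x + h) - f x - a * h%:C) by rewrite /k; ring.
apply: (le_trans (modcD _ _)); rewrite modcM.
have i1 : modc (g (f x + k) - g (f x) - b * k) <= e' * ((modc a + 1) * `|h|).
  by apply: (le_trans (hs k ks)); rewrite ler_wpM2l // ltW.
have i2 : modc b * modc (f (x + h) - f x - a * h%:C) <= modc b * (e' * `|h|).
  by rewrite ler_wpM2l ?modc_ge0 // hr.
rewrite eE; lra.
Qed.

End RderEps.

(** * Goursat's theorem *)

Section Goursat.
Context {R : realType}.
Notation C := R[i].

Definition rect_int (f : C -> C) (a b c d : R) : C :=
  (cint (fun t => f (t +i* c)) a b - cint (fun t => f (t +i* d)) a b)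
  + 'i * (cint (fun t => f (b +i* t)) c d - cint (fun t => f (a +i* t)) c d).

Lemma rect_int_splitx f a m b c d :
  rect_int f a b c d = rect_int f a m c d + rect_int f m b c d.
Proof.
rewrite /rect_int (cint_chain _ a m b) [cint (fun t => f (t +i* d)) a b](cint_chain _ a m b).
by ring.
Qed.

Lemma rect_int_splity f a b c m d :
  rect_int f a b c d = rect_int f a b c m + rect_int f a b m d.
Proof.
rewrite /rect_int (cint_chain (fun t => f (b +i* t)) c m d) (cint_chain (fun t => f (a +i* t)) c m d).
by ring.
Qed.

Lemma rect_int_swapx f a b c d : rect_int f b a c d = - rect_int f a b c d.
Proof.
rewrite /rect_int (cint_rev (fun t => f (t +i* c)) b a) (cint_rev (fun t => f (t +i* d)) b a).
by ring.
Qed.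

Lemma rect_int_swapy f a b c d : rect_int f a b d c = - rect_int f a b c d.
Proof.
rewrite /rect_int (cint_rev (fun t => f (b +i* t)) d c) (cint_rev (fun t => f (a +i* t)) d c).
by ring.
Qed.

Lemma rect_int_degx f a c d : rect_int f a a c d = 0.
Proof. by rewrite /rect_int !cint_id !subrr mulr0 addr0. Qed.

Lemma rect_int_degy f a b c : rect_int f a b c c = 0.
Proof. by rewrite /rect_int !cint_id !subrr mulr0 addr0. Qed.

Lemma horiz_rder (y t : R) : rder (fun t => t +i* y : C) t 1.
Proof. by split => /=; [exact: is_derive_id|exact: is_derive_cst]. Qed.

Lemma vert_rder (x t : R) : rder (fun t => x +i* t : C) t 'i.
Proof. by split => /=; [exact: is_derive_cst|exact: is_derive_id]. Qed.

Lemma ccont_rcont (f : C -> C) (g : R -> C) :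
  (forall z, ccont f z) -> rcont g -> rcont (fun t => f (g t)).
Proof.
move=> fc /rcont_epsP gc; apply/rcont_epsP => x e e0.
have [d d0 hd] := fc (g x) e e0; have [r r0 hr] := gc x d d0.
by exists r => // y /hr h; apply: hd.
Qed.

Lemma horiz_rcont y : rcont (fun t => t +i* y : C).
Proof. by apply: rder_rcont => x; exact: horiz_rder. Qed.
Lemma vert_rcont x : rcont (fun t => x +i* t : C).
Proof. by apply: rder_rcont => t; exact: vert_rder. Qed.

Lemma horiz_fcont (f : C -> C) y : (forall z, ccont f z) -> rcont (fun t => f (t +i* y)).
Proof. by move=> fc; apply: ccont_rcont => //; exact: horiz_rcont. Qed.
Lemma vert_fcont (f : C -> C) x : (forall z, ccont f z) -> rcont (fun t => f (x +i* t)).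
Proof. by move=> fc; apply: ccont_rcont => //; exact: vert_rcont. Qed.

Lemma rect_int_primitive (F f : C -> C) a b c d : (forall z, ccont f z) ->
  (forall z, cdiff F z (f z)) -> rect_int f a b c d = 0.
Proof.
move=> fc dF; have hh y t : rder (fun t => F (t +i* y)) t (f (t +i* y)).
  by apply: rder_eq (rder_comp (dF _) (horiz_rder y t)) _; rewrite mulr1.
have hv x t : rder (fun t => - 'i * F (x +i* t)) t (f (x +i* t)).
  apply: rder_eq (rderZ _ (rder_comp (dF _) (vert_rder x t))) _.
  by rewrite mulrCA mulNr -expr2 sqr_i opprK mulr1.
rewrite /rect_int !(cint_FTC _ _ _ (hh _)) ?(cint_FTC _ _ _ (hv _));
  try exact: horiz_fcont; try exact: vert_fcont.
have i2 : 'i * 'i = -1 :> C by rewrite -expr2 sqr_i.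
rewrite -!mulrBr mulrA mulrN i2 opprK mul1r; ring.
Qed.

Lemma rect_intB f g a b c d : (forall z, ccont f z) -> (forall z, ccont g z) ->
  rect_int (fun z => f z - g z) a b c d = rect_int f a b c d - rect_int g a b c d.
Proof.
move=> fc gc; by rewrite /rect_int !cintB; try exact: horiz_fcont; try exact: vert_fcont; ring.
Qed.

Lemma rect_int_le f a b c d (K : R) : (forall z, ccont f z) -> a <= b -> c <= d ->
  (forall z, inrect (Rect a b c d) z -> modc (f z) <= K) ->
  modc (rect_int f a b c d) <= 2 * K * ((b - a) + (d - c)).
Proof.
move=> fc ab cd fK.
have H y : c <= y <= d -> modc (cint (fun t => f (t +i* y)) a b) <= K * (b - a).
  move=> ycd; apply: cint_le => //; first exact: horiz_fcont.
  by move=> x xab; apply: fK; apply/andP.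
have V x : a <= x <= b -> modc (cint (fun t => f (x +i* t)) c d) <= K * (d - c).
  move=> xab; apply: cint_le => //; first exact: vert_fcont.
  by move=> y ycd; apply: fK; apply/andP.
have h1 := H c ltac:(lra); have h2 := H d ltac:(lra).
have v1 := V a ltac:(lra); have v2 := V b ltac:(lra).
rewrite /rect_int; apply: (le_trans (modcD _ _)); rewrite modcM modc_i mul1r.
have b1 := modcB (cint (fun t => f (t +i* c)) a b) (cint (fun t => f (t +i* d)) a b).
have b2 := modcB (cint (fun t => f (b +i* t)) c d) (cint (fun t => f (a +i* t)) c d).
lra.
Qed.

Definition rint f (Q : rect) := rect_int f (rl Q) (rr Q) (rb Q) (rt Q).

Lemma rint_quarters f (Q : rect) : rint f Q =
  rint f (quarter false false Q) + rint f (quarter true false Q) +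
  (rint f (quarter false true Q) + rint f (quarter true true Q)).
Proof.
case: Q => a b c d; rewrite /rint /=.
by rewrite (rect_int_splity f a b c ((c + d) / 2) d) !(rect_int_splitx f a ((a + b) / 2) b).
Qed.

Lemma affine_ccont (al be : C) z : ccont (fun w => al + be * w) z.
Proof.
by apply: wlimD; [exact: wlim_cst|apply: wlimM; [exact: wlim_cst|exact: wlim_id]].
Qed.

(** Quartering keeps a quarter of the boundary integral while the perimeter is halved; at the
    limit point the function is affine up to an error that is small against the size of the
    rectangle, and affine functions have primitives. *)
Lemma goursat f (Q : rect) : wf Q -> (forall z, ccont f z) ->
  (forall z, inrect Q z -> holo f z) -> rint f Q = 0.
Proof.
move=> wQ fc fh.
pose D (Q' : @rect R) := (rr Q' - rl Q') + (rt Q' - rb Q').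
have D0 : forall Q', wf Q' -> 0 <= D Q' by move=> [a b c d] [/= h1 h2]; rewrite /D /=; lra.
apply/eqP; rewrite -modc_eq0; apply: contraT => n0.
have m0 : 0 < modc (rint f Q) by rewrite lt_def n0 modc_ge0.
have DQ : 0 < D Q.
  rewrite lt_def D0 // andbT; apply/eqP => DQ; case: Q wQ DQ n0 {fh m0} => a b c d [h1 h2].
  rewrite /= in h1 h2.
  rewrite /D /rint; cbn [rl rr rb rt] => E; have -> : a = b by lra.
  by rewrite rect_int_degx modc0 eqxx.
pose k := modc (rint f Q) / D Q ^+ 2.
have k0 : 0 < k by rewrite divr_gt0 // exprn_gt0.
have [| |z zQ H] := @bisection _ (fun Q' => k * D Q' ^+ 2 <= modc (rint f Q') /\ 0 < D Q') Q wQ.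
- by rewrite /k divfK // gt_eqF // exprn_gt0.
- move=> Q' wQ' [PQ DQ']; apply: contrapT => nH.
  have Dq h v : D (quarter h v Q') = D Q' / 2.
    by case: (Q') => a b c d; case: h; case: v; rewrite /D /=; lra.
  have G h v : modc (rint f (quarter h v Q')) < k * D Q' ^+ 2 / 4.
    rewrite ltNge; apply/negP => le; apply: nH; exists h, v; rewrite Dq; split; last by rewrite divr_gt0.
    by apply: le_trans le; rewrite le_eqVlt; apply/orP; left; apply/eqP; field.
  have g1 := G true true; have g2 := G true false; have g3 := G false true; have g4 := G false false.
  move: PQ; rewrite rint_quarters => PQ.
  have := modcD (rint f (quarter false false Q') + rint f (quarter true false Q')) (rint f (quarter false true Q') + rint f (quarter true true Q')).
  have := modcD (rint f (quarter false false Q')) (rint f (quarter true false Q')).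
  have := modcD (rint f (quarter false true Q')) (rint f (quarter true true Q')).
  lra.
have [l hl] := fh z zQ.
have k3 : 0 < k / 4 by rewrite divr_gt0.
have [r r0 hr] := hl _ k3.
have r2 : 0 < r / 2 by rewrite divr_gt0.
have [Q' [wQ' [PQ DQ'] zQ' _ [s1 s2]]] := H _ r2.
pose g w := (f z - l * z) + l * w.
have gc w : ccont g w by exact: affine_ccont.
have gE : rint g Q' = 0.
  apply: (@rect_int_primitive (fun w => (f z - l * z) * w + l / 2 * (w * w))) => // w.
  rewrite /g; have := cdiffD (cdiffM (cdiff_cst (f z - l * z) w) (cdiff_id w))
    (cdiffM (cdiff_cst (l / 2) w) (cdiffM (cdiff_id w) (cdiff_id w))).
  set u := (X in cdiff _ _ X); set v := (X in _ -> cdiff _ _ X).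
  by have -> : u = v; [rewrite /u /v; field|].
have E : rint f Q' = rint (fun w => f w - g w) Q'.
  by rewrite /rint rect_intB // -/(rint f Q') -/(rint g Q') gE subr0.
have B : modc (rint f Q') <= 2 * (k / 4 * D Q') * D Q'.
  rewrite E /rint; apply: rect_int_le; [by move=> w; apply: wlimB; [exact: fc|exact: gc]|by case: wQ'|by case: wQ'|].
  case: (Q') zQ' s1 s2 wQ' => a b c d zQ' s1 s2 wQ' w wI.
  have := inr_dist zQ' wI s1 s2; rewrite mulrC divfK // => /hr.
  rewrite [z + _]addrC subrK /g.
  have -> : f w - f z - l * (w - z) = f w - (f z - l * z + l * w) by ring.
  move=> h; apply: (le_trans h); rewrite ler_wpM2l //; first exact: ltW.
  move: zQ' wI => /andP[/andP[/= q1 q2] /andP[/= q3 q4]].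
  move=> /andP[/andP[/= p1 p2] /andP[/= p3 p4]].
  apply: (le_trans (modc_le_ReIm _)); rewrite ReB ImB /D /=.
  by apply: lerD; rewrite ler_norml; apply/andP; split; lra.
have : 0 < k * D Q' ^+ 2 by rewrite mulr_gt0 // exprn_gt0.
by move: PQ B; rewrite expr2; lra.
Qed.

Lemma cint_shrink (g h : R -> C) (a b s K e : R) : rcont g -> rcont h -> 0 <= s -> 0 <= e ->
  a + s <= b - s -> (forall t, a <= t <= b -> modc (g t) <= K) ->
  (forall t, a + s <= t <= b - s -> modc (g t - h t) <= e) ->
  modc (cint g a b - cint h (a + s) (b - s)) <= e * (b - a) + 2 * s * K.
Proof.
move=> gc hc s0 e0 ab gK gh.
have -> : cint g a b - cint h (a + s) (b - s) =
    cint g a (a + s) + (cint (fun t => g t - h t) (a + s) (b - s) + cint g (b - s) b).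
  by rewrite cintB // (cint_chain g a (a + s) b) (cint_chain g (a + s) (b - s) b); ring.
have i1 : modc (cint g a (a + s)) <= K * (a + s - a).
  by apply: cint_le => //; [lra|move=> t tt; apply: gK; lra].
have i3 : modc (cint g (b - s) b) <= K * (b - (b - s)).
  by apply: cint_le => //; [lra|move=> t tt; apply: gK; lra].
have i2 := cint_le (rcontB gc hc) ab gh.
apply: (le_trans (modcD _ _)); apply: (le_trans (lerD i1 (modcD _ _))).
have : e * (b - s - (a + s)) <= e * (b - a) by rewrite ler_wpM2l //; lra.
lra.
Qed.

(** Continuity lets the boundary escape the holomorphy hypothesis: shrink the rectangle. *)
Lemma goursat_interior f (a b c d : R) : a <= b -> c <= d -> (forall z, ccont f z) ->
  (forall z : C, a < complex.Re z < b -> c < complex.Im z < d -> holo f z) -> rect_int f a b c d = 0.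
Proof.
move=> ab cd fc fh.
have [E|abn] := eqVneq a b.
  by rewrite E rect_int_degx.
have [E|cdn] := eqVneq c d.
  by rewrite E rect_int_degy.
have ab' : a < b by rewrite lt_neqAle abn.
have cd' : c < d by rewrite lt_neqAle cdn.
pose Q := Rect a b c d; have wQ : wf Q by [].
have [zM zMQ zMmax] : exists2 z, inrect Q z & forall w, inrect Q w -> modc (f w) <= modc (f z).
  apply: (rect_EVT (u := fun z => modc (f z))) => // z zQ e e0.
  have [r r0 hr] := fc z e e0; exists r => // w wz; apply: le_lt_trans (hr w I wz).
  rewrite ler_norml; have := modc_sub_le (f w) (f z); have := modc_sub_le (f z) (f w).
  by rewrite [modc (f z - _)]modcBC; lra.
set K := modc (f zM); have K0 : 0 <= K by exact: modc_ge0.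
apply: eq_modcP => e e0; rewrite subr0.
pose e' := e / (4 * ((b - a) + (d - c) + 1)).
have L0 : 0 < (b - a) + (d - c) + 1 by lra.
have e'0 : 0 < e' by rewrite divr_gt0 // mulr_gt0.
have eE : e' * (4 * ((b - a) + (d - c) + 1)) = e by rewrite /e' divfK // gt_eqF // mulr_gt0.
clearbody e'.
have [r r0 hr] := uniform_continuity wQ e'0 (fun z _ => fc z).
pose s := Num.min (Num.min (r / 2) ((b - a) / 4)) (Num.min ((d - c) / 4) (e / (16 * (K + 1)))).
have s0 : 0 < s by rewrite !lt_min !divr_gt0 ?subr_gt0 ?mulr_gt0 //; lra.
have [s1 s2 s3 s4] : [/\ s <= r / 2, s <= (b - a) / 4, s <= (d - c) / 4 & s <= e / (16 * (K + 1))].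
  by split; rewrite /s !ge_min lexx ?orbT.
have sK : 8 * s * K <= e / 2.
  apply: (@le_trans _ _ (8 * s * (K + 1))); first by rewrite ler_wpM2l ?lerDl // mulr_ge0 // ltW.
  by move: s4; rewrite ler_pdivlMr ?mulr_gt0 //; lra.
rewrite -/K in zMmax; clearbody s K; clear s4.
have G0 : rint f (Rect (a + s) (b - s) (c + s) (d - s)) = 0.
  apply: goursat => //; first by split => /=; lra.
  move=> z /andP[/andP[/= q1 q2] /andP[/= q3 q4]].
  by apply: fh; apply/andP; split; lra.
have zMmax' x y : a <= x <= b -> c <= y <= d -> modc (f (x +i* y)) <= K.
  by move=> xx yy; apply: zMmax; apply/andP.
have shift (x y x' y' : R) : a <= x <= b -> c <= y <= d -> `|x' - x| + `|y' - y| < r ->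
    modc (f (x +i* y) - f (x' +i* y')) <= e'.
  move=> xx yy xy; rewrite modcBC; apply/ltW/hr; first by apply/andP.
  by apply: le_lt_trans xy; apply: (le_trans (modc_le_ReIm _)); rewrite ReB ImB.
have s0' : 0 <= s by exact: ltW.
have e'0' : 0 <= e' by exact: ltW.
have sr : `|s| < r by rewrite ger0_norm //; lra.
have hs x : `|x - x| + `|s| < r by rewrite subrr normr0 add0r.
have hs' x : `|s| + `|x - x| < r by rewrite subrr normr0 addr0.
have bt x : a + s <= x <= b - s -> a <= x <= b.
  by move=> /andP[x1 x2]; apply/andP; split; [apply: le_trans x1; rewrite lerDl|apply: (le_trans x2); rewrite gerBl].
have bt' x : c + s <= x <= d - s -> c <= x <= d.
  by move=> /andP[x1 x2]; apply/andP; split; [apply: le_trans x1; rewrite lerDl|apply: (le_trans x2); rewrite gerBl].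
have aab : a <= a <= b by rewrite lexx.
have bab : a <= b <= b by rewrite lexx andbT.
have ccd : c <= c <= d by rewrite lexx.
have dcd : c <= d <= d by rewrite lexx andbT.
have sab : a + s <= b - s by clear -s2 ab'; lra.
have scd : c + s <= d - s by clear -s3 cd'; lra.
have h1 := @cint_shrink (fun t => f (t +i* c)) (fun t => f (t +i* (c + s))) a b s K e'
  (horiz_fcont c fc) (horiz_fcont _ fc) s0' e'0' sab (fun t tt => zMmax' t c tt ccd)
  (fun t tt => shift t c t (c + s) (bt t tt) ccd ltac:(by rewrite [c + s]addrC addrK)).
have h2 := @cint_shrink (fun t => f (t +i* d)) (fun t => f (t +i* (d - s))) a b s K e'
  (horiz_fcont d fc) (horiz_fcont _ fc) s0' e'0' sab (fun t tt => zMmax' t d tt dcd)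
  (fun t tt => shift t d t (d - s) (bt t tt) dcd ltac:(by rewrite [d - s]addrC addrK normrN)).
have v1 := @cint_shrink (fun t => f (a +i* t)) (fun t => f ((a + s) +i* t)) c d s K e'
  (vert_fcont a fc) (vert_fcont _ fc) s0' e'0' scd (fun t tt => zMmax' a t aab tt)
  (fun t tt => shift a t (a + s) t aab (bt' t tt) ltac:(by rewrite [a + s]addrC addrK)).
have v2 := @cint_shrink (fun t => f (b +i* t)) (fun t => f ((b - s) +i* t)) c d s K e'
  (vert_fcont b fc) (vert_fcont _ fc) s0' e'0' scd (fun t tt => zMmax' b t bab tt)
  (fun t tt => shift b t (b - s) t bab (bt' t tt) ltac:(by rewrite [b - s]addrC addrK normrN)).
rewrite -[rect_int f a b c d]subr0 -G0 /rint; cbn [rl rr rb rt]; rewrite /rect_int.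
set I1 := cint _ a b; set I2 := cint _ a b; set I3 := cint _ c d; set I4 := cint _ c d.
set J1 := cint _ (a + s) _; set J2 := cint _ (a + s) _; set J3 := cint _ (c + s) _; set J4 := cint _ (c + s) _.
have -> : I1 - I2 + 'i * (I3 - I4) - (J1 - J2 + 'i * (J3 - J4)) =
   ((I1 - J1) - (I2 - J2)) + 'i * ((I3 - J3) - (I4 - J4)) by ring.
apply: (le_trans (modcD _ _)); rewrite modcM modc_i mul1r.
apply: (le_trans (lerD (modcB _ _) (modcB _ _))).
move: h1 h2 v1 v2; rewrite -/I1 -/I2 -/I3 -/I4 -/J1 -/J2 -/J3 -/J4 => h1 h2 v1 v2.
clear -h1 h2 v1 v2 eE sK e'0; lra.
Qed.

(** Analyticity above height [m] off finitely many horizontal and vertical lines.  Such lines are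
    removable for continuous functions, and they are where the glued functions below are only
    known to be continuous. *)
Definition hol_on (m : R) (f : C -> C) := (forall z, ccont f z) /\
  exists X Y : seq R, forall z, m < complex.Im z ->
    complex.Re z \notin X -> complex.Im z \notin Y -> holo f z.

Lemma goursat_lines m f (a b c d : R) : hol_on m f -> m < c -> m < d ->
  rect_int f a b c d = 0.
Proof.
move=> [fc [X [Y fh]]].
wlog ab : a b c d / a <= b.
  move=> H mc md; have [ab|/ltW ba] := leP a b; first exact: H.
  by rewrite rect_int_swapx H // oppr0.
wlog cd : a b c d ab / c <= d.
  move=> H mc md; have [cd|/ltW dc] := leP c d; first exact: H.
  by rewrite rect_int_swapy H // oppr0.
move=> mc _.
have step1 : forall a b c d, a <= b -> c <= d -> m < c ->
    (forall x, x \in X -> ~~ (a < x < b)) -> (forall y, y \in Y -> ~~ (c < y < d)) ->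
    rect_int f a b c d = 0.
  move=> a' b' c' d' ab' cd' mc' hX hY; apply: goursat_interior => // z zx zy.
  apply: fh; first by case/andP: zy => zy _; exact: lt_trans mc' zy.
    by apply/negP => /hX; rewrite zx.
  by apply/negP => /hY; rewrite zy.
have step2 : forall Y' : seq R, forall c d, c <= d -> m < c ->
    (forall y, y \in Y -> c < y < d -> y \in Y') -> 
    forall a b, a <= b -> (forall x, x \in X -> ~~ (a < x < b)) -> rect_int f a b c d = 0.
  elim=> [|y0 Y' IH] c' d' cd' mc' hY a' b' ab' hX.
    by apply: step1 => // y yY; apply/negP => /(hY y yY); rewrite in_nil.
  have [y0cd|ny0] := boolP (c' < y0 < d').
    rewrite (rect_int_splity _ _ _ _ y0) !IH ?addr0 //; try lra.
      move=> y yY yy; have := hY y yY; rewrite in_cons => /(_ ltac:(lra)) /orP[/eqP E|//].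
      by move: yy; rewrite E; lra.
    move=> y yY yy; have := hY y yY; rewrite in_cons => /(_ ltac:(lra)) /orP[/eqP E|//].
    by move: yy; rewrite E; lra.
  apply: IH => // y yY yy; have := hY y yY yy; rewrite in_cons => /orP[/eqP E|//].
  by move: ny0; rewrite -E yy.
suff step3 : forall X' : seq R, forall a b, a <= b ->
    (forall x, x \in X -> a < x < b -> x \in X') -> rect_int f a b c d = 0.
  by apply: (step3 X).
elim=> [|x0 X' IH] a' b' ab' hX.
  by apply: (step2 Y) => // x xX; apply/negP => /(hX x xX); rewrite in_nil.
have [x0ab|nx0] := boolP (a' < x0 < b').
  rewrite (rect_int_splitx _ _ x0) !IH ?addr0 //; try lra.
    move=> x xX xx; have := hX x xX; rewrite in_cons => /(_ ltac:(lra)) /orP[/eqP E|//].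
    by move: xx; rewrite E; lra.
  move=> x xX xx; have := hX x xX; rewrite in_cons => /(_ ltac:(lra)) /orP[/eqP E|//].
  by move: xx; rewrite E; lra.
apply: IH => // x xX xx; have := hX x xX xx; rewrite in_cons => /orP[/eqP E|//].
by move: nx0; rewrite -E xx.
Qed.

End Goursat.

(** * The maximum principle *)

Section MaxPrinciple.
Context {R : realType}.
Notation C := R[i].

Lemma ReIm_eta (z : C) : complex.Re z +i* complex.Im z = z. Proof. by case: z. Qed.

Lemma ReMr (a : R) (z : C) : complex.Re (a%:C * z) = a * complex.Re z.
Proof. by rewrite ReM ImC mul0r subr0. Qed.
Lemma ImMr (a : R) (z : C) : complex.Im (a%:C * z) = a * complex.Im z.
Proof. by rewrite ImM ImC mul0r addr0. Qed.

(** Integrating along a horizontal and then a vertical segment; Goursat's theorem makes the order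
    irrelevant, and this gives both partial derivatives. *)
Lemma hol_on_primitive (m m' : R) (f : C -> C) : m < m' -> hol_on m f ->
  exists2 F : C -> C, hol_on m' F & forall z, m' < complex.Im z -> cdiff F z (f z).
Proof.
move=> mm fm; have fc := fm.1.
pose F0 (z : C) := cint (fun t => f (t +i* (m' + 1))) 0 (complex.Re z) +
  'i * cint (fun t => f (complex.Re z +i* t)) (m' + 1) (complex.Im z).
have dF0 (z : C) : m < complex.Im z -> cdiff F0 z (f z).
  move=> mz; apply: (@cdiff_le _ _ _ _ 2) => e e0.
  have [r r0 hr] := fc z e e0.
  exists (Num.min (r / 2) (complex.Im z - m)) => [|h]; first by rewrite lt_min divr_gt0 // subr_gt0.
  rewrite lt_min => /andP[h1 h2].
  case: z mz hr h2 => x y /= my hr h2; case: h h1 h2 => p q h1 h2.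
  set h := p +i* q in h1 h2 *.
  have pq1 : `|p| <= modc h by exact: (Re_le_modc h).
  have pq2 : `|q| <= modc h by exact: (Im_le_modc h).
  have q0 : m < y + q by have := ler_norm (- q); rewrite normrN; clear -pq2 h2; lra.
  have rc u := horiz_fcont u fc; have vc u := vert_fcont u fc.
  have G : rect_int f x (x + p) (m' + 1) y = 0.
    by apply: goursat_lines fm _ _ => //; clear -mm; lra.
  have E : F0 (x +i* y + h) - F0 (x +i* y) - f (x +i* y) * h =
     cint (fun t => f (t +i* y) - f (x +i* y)) x (x + p) +
     'i * cint (fun t => f ((x + p) +i* t) - f (x +i* y)) y (y + q).
    have -> : x +i* y + h = (x + p) +i* (y + q) by [].
    rewrite /F0; cbn [complex.Re complex.Im].
    rewrite !cintB //; try exact: rcont_cst.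
    rewrite !cint_cst !(addrC _ p, addrC _ q) !addrK -!(addrC x, addrC y).
    have -> : h = p%:C + 'i * q%:C.
      by apply: eqC; rewrite !ReImE /= ?mulr0 ?mul0r ?mul1r ?subr0 ?addr0 ?add0r.
    move: G; rewrite /rect_int.
    rewrite (cint_chain (fun t => f (t +i* (m' + 1))) 0 x (x + p)).
    rewrite (cint_chain (fun t => f ((x + p) +i* t)) (m' + 1) y (y + q)).
    set A := cint (fun t => f (t +i* (m' + 1))) x _; set B := cint (fun t => f (t +i* y)) _ _.
    set D := cint (fun t => f (x +i* t)) _ _; set D' := cint _ (m' + 1) y.
    move=> G.
    have -> : A = B - 'i * (D' - D) by rewrite -[A]subr0 -G; ring.
    ring.
  rewrite E; apply: (le_trans (modcD _ _)); rewrite modcM modc_i mul1r.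
  have i1 : modc (cint (fun t => f (t +i* y) - f (x +i* y)) x (x + p)) <= e * `|x + p - x|.
    apply: cint_le_norm; first by apply: rcontB => //; exact: rcont_cst.
    move=> t tt; apply/ltW/hr => //; apply: (le_lt_trans (modc_le_ReIm _)); rewrite ReB ImB /= subrr normr0 addr0.
    apply: (@le_lt_trans _ _ `|p|); last by clear -pq1 h1 r0; lra.
    by clear -tt; have := ler_norm p; have := ler_norm (- p); rewrite normrN ler_norml => *; apply/andP; split; move: tt => /orP[/andP[]|/andP[]]; lra.
  have i2 : modc (cint (fun t => f ((x + p) +i* t) - f (x +i* y)) y (y + q)) <= e * `|y + q - y|.
    apply: cint_le_norm; first by apply: rcontB => //; exact: rcont_cst.
    move=> t tt; apply/ltW/hr => //; apply: (le_lt_trans (modc_le_ReIm _)); rewrite ReB ImB /= [x + p]addrC addrK.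
    apply: (@le_lt_trans _ _ (`|p| + `|q|)); last by clear -pq1 pq2 h1 r0; lra.
    rewrite lerD2l.
    by clear -tt; have := ler_norm q; have := ler_norm (- q); rewrite normrN ler_norml => *; apply/andP; split; move: tt => /orP[/andP[]|/andP[]]; lra.
  move: i1 i2; rewrite [x + p]addrC [y + q]addrC !addrK => i1 i2.
  apply: (le_trans (lerD i1 i2)).
  have : e * `|p| <= e * modc h by rewrite ler_wpM2l // ltW.
  have : e * `|q| <= e * modc h by rewrite ler_wpM2l // ltW.
  by clear; lra.
pose k (z : C) : C := complex.Re z +i* Num.max (complex.Im z) m'.
have kE z : m' <= complex.Im z -> k z = z.
  by move=> mz; rewrite /k max_l // ReIm_eta.
exists (fun z => F0 (k z)).
  split.
    move=> z; apply: (@wlim_comp _ _ setT k F0 _ (k z)) => //; last first.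
      apply: cdiff_cont; apply: dF0; apply: (lt_le_trans mm).
      by rewrite /k /= le_max lexx orbT.
    move=> e e0; exists (e / 2) => [|w _ wz]; first by rewrite divr_gt0.
    apply: (le_lt_trans (modc_le_ReIm _)); rewrite ReB ImB /k /= -ReB.
    have h1 := Re_le_modc (w - z); have h2 := Im_le_modc (w - z); rewrite ImB in h2.
    have h3 : `|Num.max (complex.Im w) m' - Num.max (complex.Im z) m'| <= `|complex.Im w - complex.Im z|.
      clear; have := ler_norm (complex.Im w - complex.Im z); have := ler_norm (- (complex.Im w - complex.Im z)).
      rewrite normrN => a b; rewrite ler_norml; apply/andP.
      by split; case: (leP (complex.Im w) m') => ?; case: (leP (complex.Im z) m') => ?; lra.
    by clear -h1 h2 h3 wz; lra.
  exists [::], [::] => z mz _ _; exists (f z).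
  apply: (@cdiff_near _ F0 _ z (f z) (complex.Im z - m')) => [|w wz|]; first by rewrite subr_gt0.
    rewrite kE //; have := Im_le_modc (w - z); rewrite ImB.
    by have := ler_norm (- (complex.Im w - complex.Im z)); rewrite normrN; clear -wz; lra.
  by apply: dF0; exact: lt_trans mm mz.
move=> z mz; apply: (@cdiff_near _ F0 _ z (f z) (complex.Im z - m')) => [|w wz|]; first by rewrite subr_gt0.
  rewrite kE //; have := Im_le_modc (w - z); rewrite ImB.
  by have := ler_norm (- (complex.Im w - complex.Im z)); rewrite normrN; clear -wz; lra.
by apply: dF0; exact: lt_trans mm mz.
Qed.

Lemma cdiffB_aux (f g : C -> C) z a b : cdiff f z a -> cdiff g z b ->
  cdiff (fun w => f w - g w) z (a - b).
Proof. by move=> hf hg; apply: cdiffD => //; exact: cdiffN. Qed.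

Definition on_edge (Q : @rect R) (z : C) := inrect Q z /\
  (complex.Re z = rl Q \/ complex.Re z = rr Q \/ complex.Im z = rb Q \/ complex.Im z = rt Q).

Definition max_principle (m : R) (f : C -> C) := forall Q (K : R), wf Q -> m < rb Q ->
  (forall z, on_edge Q z -> modc (f z) <= K) -> forall z, inrect Q z -> modc (f z) <= K.

(** Obtained by applying the mean value inequality to the remainder along the segment from [z]
    to [z + h]. *)
Lemma taylor2 (m : R) (g g1 : C -> C) (z g2 : C) : m < complex.Im z ->
  (forall w, m < complex.Im w -> cdiff g w (g1 w)) -> cdiff g1 z g2 ->
  forall e : R, 0 < e -> exists2 r : R, 0 < r & forall h, modc h < r ->
    modc (g (z + h) - g z - g1 z * h - g2 / 2 * (h * h)) <= e * modc h ^+ 2.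
Proof.
move=> mz dg dg1 e e0; have [r r0 hr] := dg1 e e0.
exists (Num.min r (complex.Im z - m)) => [|h]; first by rewrite lt_min r0 subr_gt0.
rewrite lt_min => /andP[h1 h2].
pose E (s : R) := g (z + s%:C * h) - (g1 z * h) * s%:C - (g2 / 2 * (h * h)) * (s%:C * s%:C).
have dE s : 0 <= s <= 1 -> rder E s ((g1 (z + s%:C * h) - g1 z - g2 * (s%:C * h)) * h).
  move=> /andP[s0 s1].
  have ms : m < complex.Im (z + s%:C * h).
    rewrite ImD ImM /= mul0r addr0.
    have := Im_le_modc h => h3.
    have : s * `|complex.Im h| <= 1 * modc h by rewrite ler_pM.
    have : `|s * complex.Im h| = s * `|complex.Im h| by rewrite normrM ger0_norm.
    have := ler_norm (- (s * complex.Im h)); rewrite normrN.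
    by clear -h2; lra.
  have dpath : rder (fun t : R => z + t%:C * h) s h.
    by apply: rder_eq (rderD (rder_cst z s) (rderM (rder_id s) (rder_cst h s))) _; ring.
  apply: rder_eq (rderB (rderB (rder_comp (dg _ ms) dpath) (rderZ _ (rder_id s)))
     (rderZ _ (rderM (rder_id s) (rder_id s)))) _.
  by field.
have -> : g (z + h) - g z - g1 z * h - g2 / 2 * (h * h) = E 1 - E 0.
  have -> : E 1 = g (z + h) - g1 z * h - g2 / 2 * (h * h).
    by rewrite /E !mulr1 mul1r.
  have -> : E 0 = g z by rewrite /E !mulr0 mul0r addr0 !subr0.
  ring.
have := @rder_le_cst _ E _ 0 1 (e * modc h ^+ 2) ler01 dE.
rewrite subr0 mulr1; apply => s /andP[s0 s1]; rewrite modcM expr2 [leRHS]mulrA.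
rewrite ler_wpM2r ?modc_ge0 //.
have sh : modc (s%:C * h) <= modc h by rewrite modcM modc_real ger0_norm // ler_piMl ?modc_ge0.
apply: (le_trans (hr _ (le_lt_trans sh h1))).
by rewrite ler_wpM2l // ltW.
Qed.

(** The sum over the four points [z + h, z + ih, z - h, z - ih] kills the first and second
    order terms, so that adding a multiple of the squared modulus rules out an interior
    maximum. *)
Lemma max_principle_C2 (m : R) (g g1 g2 : C -> C) :
  (forall w, m < complex.Im w -> cdiff g w (g1 w)) ->
  (forall w, m < complex.Im w -> cdiff g1 w (g2 w)) -> max_principle m g.
Proof.
move=> dg dg1 Q K wQ mQ gK z1 z1Q; rewrite leNgt; apply/negP => Kz.
have [c c1 cz] := phaseP (g z1).
pose D := (rr Q - rl Q) + (rt Q - rb Q) + 1.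
have D0 : 0 < D by case: wQ; rewrite /D; lra.
(* small enough that the correction cannot lift the edge to the value at [z1] *)
pose e := (modc (g z1) - K) / (2 * D ^+ 2).
have e0 : 0 < e by rewrite divr_gt0 ?subr_gt0 // mulr_gt0 // exprn_gt0.
pose u (z : C) := complex.Re (c * g z) + e * modc (z - z1) ^+ 2.
have gc z : m < complex.Im z -> ccont g z by move=> /dg; exact: cdiff_cont.
have [z2 z2Q max2] : exists2 z, inrect Q z & forall w, inrect Q w -> u w <= u z.
  apply: rect_EVT => // z zQ ep ep0.
  have mz : m < complex.Im z by case/andP: zQ => _ /andP[+ _]; exact: lt_le_trans.
  have uc : wlim setT (fun w => c * g w + e%:C * ((w - z1) * (w - z1)^cj)) z
      (c * g z + e%:C * ((z - z1) * (z - z1)^cj)).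
    apply: wlimD; first by apply: wlimM; [exact: wlim_cst|exact: gc].
    apply: wlimM; first exact: wlim_cst.
    by apply: wlimM; [|apply: wlimJ]; apply: wlimB; [exact: wlim_id|exact: wlim_cst|exact: wlim_id|exact: wlim_cst].
  have uE w : u w = complex.Re (c * g w + e%:C * ((w - z1) * (w - z1)^cj)).
    rewrite /u sqr_modc [in RHS]ReD; congr (_ + _).
    set v := w - z1; rewrite [in RHS]ReM ReC ImC mul0r subr0; congr (_ * _).
    by rewrite ReM ReJ ImJ; ring.
  have [r r0 hr] := uc ep ep0; exists r => // w wz.
  rewrite !uE -ReB; exact: le_lt_trans (Re_le_modc _) (hr w I wz).
have u1 : u z1 = modc (g z1) by rewrite /u cz subrr modc0 expr0n mulr0 addr0.
have h12 := max2 z1 z1Q.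
have mz2 : m < complex.Im z2 by case/andP: z2Q => _ /andP[+ _]; exact: lt_le_trans.
have nedge : ~ on_edge Q z2.
  move=> ed; have := gK z2 ed.
  have : complex.Re (c * g z2) <= modc (g z2).
    apply: (le_trans (ler_norm _)); apply: (le_trans (Re_le_modc _)).
    by rewrite modcM c1 mul1r.
  have : e * modc (z2 - z1) ^+ 2 <= e * D ^+ 2.
    rewrite ler_wpM2l ?(ltW e0) // lerXn2r ?nnegrE ?modc_ge0 ?(ltW D0) //.
    move: (z1Q) (z2Q) => /andP[/andP[q1 q2] /andP[q3 q4]] /andP[/andP[p1 p2] /andP[p3 p4]].
    apply: (le_trans (modc_le_ReIm _)); rewrite ReB ImB /D.
    have i1 : `|complex.Re z2 - complex.Re z1| <= rr Q - rl Q.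
      by clear -q1 q2 p1 p2; rewrite ler_norml; apply/andP; split; lra.
    have i2 : `|complex.Im z2 - complex.Im z1| <= rt Q - rb Q.
      by clear -q3 q4 p3 p4; rewrite ler_norml; apply/andP; split; lra.
    by clear -i1 i2; lra.
  have -> : e * D ^+ 2 = (modc (g z1) - K) / 2 by rewrite /e; field; rewrite gt_eqF.
  move: h12; rewrite u1 /u; clear -Kz; lra.
have int2 : rl Q < complex.Re z2 < rr Q /\ rb Q < complex.Im z2 < rt Q.
  move: (z2Q) => /andP[/andP[q1 q2] /andP[q3 q4]].
  rewrite !lt_neqAle q1 q2 q3 q4 !andbT; split; apply/andP; split; apply/eqP => E; apply: nedge;
    split=> //; [by left|by right; left|by right; right; left|by right; right; right].
have e8 : 0 < e / 2 by rewrite divr_gt0.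
have [r r0 hr] := taylor2 mz2 dg (dg1 _ mz2) e8.
case: int2 => /andP[a1 a2] /andP[a3 a4].
pose t := Num.min (r / 2) (Num.min (Num.min (complex.Re z2 - rl Q) (rr Q - complex.Re z2))
  (Num.min (complex.Im z2 - rb Q) (rt Q - complex.Im z2))).
have t0 : 0 < t by rewrite !lt_min divr_gt0 // !subr_gt0 a1 a2 a3 a4.
have [t1 [t2 t3] [t4 t5]] : [/\ t <= r / 2, t <= complex.Re z2 - rl Q /\ t <= rr Q - complex.Re z2
   & t <= complex.Im z2 - rb Q /\ t <= rt Q - complex.Im z2].
  by split; [|split|split]; rewrite /t !ge_min lexx ?orbT.
have tr : t < r by clear -t1 r0; lra.
clearbody t.
have mt : modc t%:C = t by rewrite modc_real ger0_norm // ltW.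
have mit : modc ('i * t%:C) = t by rewrite modcM modc_i mul1r.
have inQ h : `|complex.Re h| <= t -> `|complex.Im h| <= t -> u (z2 + h) <= u z2.
  move=> k1 k2; apply: max2; move: k1 k2; rewrite !ler_norml => /andP[k1 k2] /andP[k3 k4].
  by apply/andP; rewrite ReD ImD; split; apply/andP; split; clear -k1 k2 k3 k4 t2 t3 t4 t5; lra.
have at_ : `|t| <= t by rewrite ger0_norm // ltW.
have a0 : `|0 : R| <= t by rewrite normr0 ltW.
have b1 : u (z2 + t%:C) <= u z2 by exact: inQ.
have b2 : u (z2 - t%:C) <= u z2 by apply: inQ; rewrite ?ReN ?ImN /= ?normrN ?oppr0.
have b3 : u (z2 + 'i * t%:C) <= u z2.
  by apply: inQ; rewrite ?ReM ?ImM /= ?mulr0 ?mul0r ?mul1r ?subr0 ?addr0 ?add0r.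
have b4 : u (z2 - 'i * t%:C) <= u z2.
  by apply: inQ; rewrite ?ReN ?ImN ?ReM ?ImM /= ?normrN ?mulr0 ?mul0r ?mul1r ?subr0 ?addr0 ?add0r.
have T1 := hr t%:C ltac:(by rewrite mt); have T2 := hr (- t%:C) ltac:(by rewrite modcN mt).
have T3 := hr ('i * t%:C) ltac:(by rewrite mit); have T4 := hr (- ('i * t%:C)) ltac:(by rewrite modcN mit).
rewrite !modcN ?mt ?mit in T1 T2 T3 T4.
set E1 := (X in modc X) in T1; set E2 := (X in modc X) in T2.
set E3 := (X in modc X) in T3; set E4 := (X in modc X) in T4.
have i2 : 'i * 'i = -1 :> C by rewrite -expr2 sqr_i.
have S : g (z2 + t%:C) + g (z2 - t%:C) + g (z2 + 'i * t%:C) + g (z2 - 'i * t%:C) - 4 * g z2 =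
    (E1 + E2) + (E3 + E4).
  have i2' : ('i * t%:C) * ('i * t%:C) = - (t%:C * t%:C) by rewrite mulrACA i2 mulN1r.
  by rewrite /E1 /E2 /E3 /E4 !mulrNN i2'; ring.
have SE : complex.Re (c * g (z2 + t%:C)) + complex.Re (c * g (z2 - t%:C)) + complex.Re (c * g (z2 + 'i * t%:C))
    + complex.Re (c * g (z2 - 'i * t%:C)) - 4 * complex.Re (c * g z2) = complex.Re (c * ((E1 + E2) + (E3 + E4))).
  rewrite -S mulrBr !mulrDr ReB !ReD; congr (_ - _).
  rewrite mulrCA; have -> : (4 : C) = (4 : R)%:C by rewrite rmorph_nat.
  by rewrite ReMr.
have SB : `|complex.Re (c * ((E1 + E2) + (E3 + E4)))| <= 4 * (e / 2 * t ^+ 2).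
  apply: (le_trans (Re_le_modc _)); rewrite modcM c1 mul1r.
  apply: (le_trans (modcD _ _)); apply: (le_trans (lerD (modcD _ _) (modcD _ _))).
  by clear -T1 T2 T3 T4; lra.
have N : modc (z2 + t%:C - z1) ^+ 2 + modc (z2 - t%:C - z1) ^+ 2 + modc (z2 + 'i * t%:C - z1) ^+ 2
   + modc (z2 - 'i * t%:C - z1) ^+ 2 = 4 * modc (z2 - z1) ^+ 2 + 4 * t ^+ 2.
  rewrite !sqr_modc !(ReD, ImD, ReN, ImN, ReM, ImM) /=; ring.
have ep : 0 < e * t ^+ 2 by rewrite mulr_gt0 // exprn_gt0.
have N2 := congr1 (fun v => e * v) N; rewrite /= !mulrDr in N2.
have := ler_norm (- complex.Re (c * (E1 + E2 + (E3 + E4)))); rewrite normrN.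
move: b1 b2 b3 b4; rewrite /u; move: N2 SB SE.
rewrite ![e * (4 * _)]mulrCA.
clear -ep; lra.
Qed.

(** The maximum principle passes to locally uniform limits, here of difference quotients. *)
Lemma max_principle_lim (m : R) (F f : C -> C) :
  (forall z, m < complex.Im z -> cdiff F z (f z)) ->
  (forall z, m < complex.Im z -> ccont f z) ->
  (forall h : R, h != 0 -> max_principle m (fun z => (h%:C)^-1 * (F (z + h%:C) - F z))) ->
  max_principle m f.
Proof.
move=> dF fc H Q K wQ mQ fK z zQ; apply/ler_addgt0Pr => e e0.
have e2 : 0 < e / 2 by rewrite divr_gt0.
have mI w : inrect Q w -> m < complex.Im w by case/andP=> _ /andP[+ _]; exact: lt_le_trans.
have [d d0 hd] := uniform_continuity wQ e2 (fun z zQ => fc z (mI z zQ)).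
pose h := d / 2; have h0 : 0 < h by rewrite divr_gt0.
have hn : h%:C != 0 :> C by rewrite -modc_gt0 modc_real normr_gt0 gt_eqF.
have app w : inrect Q w -> modc ((h%:C)^-1 * (F (w + h%:C) - F w) - f w) <= e / 2.
  move=> wQ'.
  have dG s : 0 <= s <= h -> rder (fun s : R => F (w + s%:C) - f w * s%:C) s (f (w + s%:C) - f w).
    move=> _; apply: rder_eq (rderB (rder_comp (b := f (w + s%:C)) _ (rderD (rder_cst w s) (rder_id s))) (rderZ _ (rder_id s))) _; last by ring.
    by apply: dF; rewrite ImD /= addr0; exact: mI.
  have := @rder_le_cst _ _ _ 0 h (e / 2) (ltW h0) dG.
  rewrite addr0 mulr0 subr0 subr0 => le.
  have -> : (h%:C)^-1 * (F (w + h%:C) - F w) - f w = (h%:C)^-1 * (F (w + h%:C) - f w * h%:C - F w) by field.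
  rewrite modcM modcV modc_real ger0_norm ?(ltW h0) // mulrC ler_pdivrMr //.
  apply: le => s /andP[s0 sh]; apply/ltW/hd => //.
  rewrite [w + _]addrC addrK modc_real ger0_norm //; rewrite /h in sh; clear -sh d0; lra.
have hn' : h != 0 by rewrite gt_eqF.
have := H h hn' Q (K + e / 2) wQ mQ.
move=> /(_ _ z zQ) mp.
have {}mp : modc ((h%:C)^-1 * (F (z + h%:C) - F z)) <= K + e / 2.
  apply: mp => w wE; have := fK w wE; have := app w wE.1.
  have := modc_sub_le ((h%:C)^-1 * (F (w + h%:C) - F w)) (f w); clear; lra.
have := app z zQ; rewrite modcBC; have := modc_sub_le (f z) ((h%:C)^-1 * (F (z + h%:C) - F z)).
by clear -mp; lra.
Qed.

(** Without Cauchy's formula one does not know that [f] has a derivative that is again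
    differentiable.  But [f] has a primitive, which has a primitive: double difference quotients of
    the latter are twice differentiable, obey the maximum principle, and converge to [f] in two
    steps. *)
Theorem maximum_principle (m m' : R) (f : C -> C) : m < m' -> hol_on m f -> max_principle m' f.
Proof.
move=> mm hf.
pose m1 := m + (m' - m) / 2; have [m01 m12] : m < m1 /\ m1 < m' by rewrite /m1; clear -mm; lra.
have [F hF dF] := hol_on_primitive m01 hf.
have [F1 hF1 dF1] := hol_on_primitive m12 hF.
have dF' z : m' < complex.Im z -> cdiff F z (f z) by move=> mz; apply: dF; exact: lt_trans mz.
pose q (h : R) (G : C -> C) z := (h%:C)^-1 * (G (z + h%:C) - G z).
have dq (h : R) (G g : C -> C) : (forall z, m' < complex.Im z -> cdiff G z (g z)) ->
    forall z, m' < complex.Im z -> cdiff (q h G) z (q h g z).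
  move=> dG z mz; rewrite /q.
  have d1 : cdiff (fun w => w + h%:C) z 1.
    by have := cdiffD (cdiff_id z) (cdiff_cst h%:C z); rewrite addr0.
  have mz' : m' < complex.Im (z + h%:C) by rewrite ImD /= addr0.
  have := cdiffM (cdiff_cst (h%:C)^-1 z) (cdiffB_aux (cdiff_comp d1 (dG _ mz')) (dG _ mz)).
  by rewrite mul0r add0r mulr1.
apply: (max_principle_lim dF') => [z _|h h0]; first exact: hf.1.
apply: (max_principle_lim (F := q h F1)); first exact: dq.
  move=> z mz; apply: (cdiff_cont (d := q h f z)); exact: dq.
move=> k k0; apply: (@max_principle_C2 _ (q k (q h F1)) (q k (q h F)) (q k (q h f))).
  exact: dq (dq _ _ _ dF1).
exact: dq (dq _ _ _ dF').
Qed.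

End MaxPrinciple.

(** * The exponential function, two constants and Liouville *)

Section MaxPrincipleConsequences.
Context {R : realType}.
Notation C := R[i].

(** By uniform continuity the lower edge may lie on the boundary of the half-plane. *)
Lemma maximum_principle_closed (m : R) (f : C -> C) (Q : @rect R) (K : R) :
  hol_on m f -> wf Q -> m <= rb Q ->
  (forall z, on_edge Q z -> modc (f z) <= K) ->
  forall z, inrect Q z -> modc (f z) <= K.
Proof.
move=> hf wQ mQ fK z zQ.
have [ez|ez] := eqVneq (complex.Im z) (rb Q).
  by apply: fK; split=> //; right; right; left.
apply/ler_addgt0Pr => e e0.
have [d d0 hd] := uniform_continuity wQ e0 (fun w _ => hf.1 w).
move: (zQ) => /andP[z1 /andP[z2 z3]].
have z2' : rb Q < complex.Im z by rewrite lt_neqAle eq_sym ez.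
pose s := Num.min (d / 2) (complex.Im z - rb Q).
have s0 : 0 < s by rewrite lt_min divr_gt0 // subr_gt0.
have [s1 s2] : s <= d / 2 /\ s <= complex.Im z - rb Q by split; rewrite /s ge_min lexx ?orbT.
clearbody s.
pose Q' := Rect (rl Q) (rr Q) (rb Q + s) (rt Q).
have zQ' : inrect Q' z.
  by rewrite /inrect z1 /= z3 andbT; clear -s2; lra.
have wQ' : wf Q' by case: wQ => w1 w2; split => //=; clear -s2 z3; lra.
have mm : m < m + s / 2 by rewrite ltrDl divr_gt0.
apply: (maximum_principle mm hf wQ') => //=; first by clear -mQ s0; lra.
move=> w [wQ'1 we].
have wQ1 : inrect Q w.
  by case/andP: wQ'1 => w1 /andP[/= w2 w3]; rewrite /inrect w1 w3 andbT; clear -w2 s0; lra.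
have e0' := ltW e0.
case: we => [we|[we|[we|we]]] /=.
- by apply: le_trans (_ : K <= _); [apply: fK; split => //; left|rewrite lerDl].
- by apply: le_trans (_ : K <= _); [apply: fK; split => //; right; left|rewrite lerDl].
- pose w0 : C := complex.Re w +i* rb Q.
  have w0Q : inrect Q w0.
    by case/andP: wQ1 => w1 _; case: wQ => _ w2; rewrite /inrect /= w1 lexx.
  have k0 : modc (f w0) <= K by apply: fK; split => //; right; right; left.
  have : modc (f w - f w0) < e.
    apply: hd => //; apply: (le_lt_trans (modc_le_ReIm _)).
    rewrite ReB ImB /= subrr normr0 add0r we /= addrAC subrr add0r ger0_norm ?(ltW s0) //.
    by clear -s1 d0; lra.
  by have := modc_sub_le (f w) (f w0); clear -k0; lra.
- by apply: le_trans (_ : K <= _); [apply: fK; split => //; right; right; right|rewrite lerDl].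
Qed.

Lemma Re_cexp (z : C) : complex.Re (cexp z) = expR (complex.Re z) * cos (complex.Im z).
Proof. by rewrite /cexp ReMr. Qed.
Lemma Im_cexp (z : C) : complex.Im (cexp z) = expR (complex.Re z) * sin (complex.Im z).
Proof. by rewrite /cexp ImMr. Qed.

Lemma cexpD (z w : C) : cexp (z + w) = cexp z * cexp w.
Proof.
apply: eqC.
  by rewrite (ReM (cexp z)) !Re_cexp !Im_cexp ReD ImD expRD cosD; ring.
by rewrite (ImM (cexp z)) !Re_cexp !Im_cexp ReD ImD expRD sinD; ring.
Qed.

Lemma cexp0 : cexp (0 : C) = 1.
Proof. by rewrite /cexp /= expR0 cos0 sin0 mul1r. Qed.

Lemma modc_cexp (z : C) : modc (cexp z) = expR (complex.Re z).
Proof.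
rewrite /cexp modcM modc_real ger0_norm ?expR_ge0 // modcE /= cos2Dsin2.
by rewrite sqrtr1 mulr1.
Qed.

Lemma cexpJ (z : C) : (cexp z)^cj = cexp z^cj.
Proof.
by rewrite /cexp conjcM ReJ ImJ cosN sinN; congr (_ * _); apply: eqC => //=; rewrite oppr0.
Qed.

Lemma cexp_ray (h : C) (s : R) :
  rder (fun t => cexp (t%:C * h)) s (h * cexp (s%:C * h)).
Proof.
case: h => a b.
have da : is_derive s 1 (fun t : R => t * a) a.
  by apply: is_derive_eq; rewrite /GRing.scale /=; ring.
have db : is_derive s 1 (fun t : R => t * b) b.
  by apply: is_derive_eq; rewrite /GRing.scale /=; ring.
have de : is_derive s 1 (fun t : R => expR (t * a)) (expR (s * a) * a).
  by apply: (@is_derive1_comp _ expR (fun t : R => t * a)).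
have dc : is_derive s 1 (fun t : R => cos (t * b)) (- sin (s * b) * b).
  by apply: (@is_derive1_comp _ cos (fun t : R => t * b)).
have ds : is_derive s 1 (fun t : R => sin (t * b)) (cos (s * b) * b).
  by apply: (@is_derive1_comp _ sin (fun t : R => t * b)).
have E t : cexp (t%:C * (a +i* b)) = (expR (t * a) * cos (t * b)) +i* (expR (t * a) * sin (t * b)).
  by apply: eqC; rewrite ?Re_cexp ?Im_cexp ReMr ImMr.
split.
  under eq_fun do rewrite E /=; rewrite E ReM /=.
  by apply: is_derive_eq (is_deriveM' de dc) _; ring.
under eq_fun do rewrite E /=; rewrite E ImM /=.
by apply: is_derive_eq (is_deriveM' de ds) _; ring.
Qed.

(** The remainder of the exponential is estimated along the ray from the origin, where
    [cexp_ray] gives a real-variable derivative. *)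
Lemma cexp_diff (z : C) : cdiff cexp z (cexp z).
Proof.
suff h0 : cdiff (@cexp R) 0 1.
  apply: (@cdiff_le _ _ _ _ (modc (cexp z))) => e e0; have [r r0 hr] := h0 e e0.
  exists r => // h /hr; rewrite add0r cexp0 => le.
  have -> : cexp (z + h) - cexp z - cexp z * h = cexp z * (cexp h - 1 - 1 * h) by rewrite cexpD; ring.
  by rewrite modcM -mulrA ler_wpM2l ?modc_ge0.
move=> e e0; pose k := expR 1 : R.
have k0 : 0 < k by exact: expR_gt0.
exists (Num.min 1 (e / k)) => [|h]; first by rewrite lt_min ltr01 divr_gt0.
rewrite lt_min => /andP[h1 h2].
have bnd s : 0 <= s <= 1 -> modc (cexp (s%:C * h)) <= k.
  move=> /andP[s0 s1]; rewrite modc_cexp ler_expR ReMr.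
  apply: (le_trans (ler_norm _)); rewrite normrM ger0_norm //.
  apply: (@le_trans _ _ (1 * modc h)); last by rewrite mul1r ltW.
  by rewrite ler_pM // Re_le_modc.
have h01 : (0 : R) <= 1 by [].
have near1 s : 0 <= s <= 1 -> modc (cexp (s%:C * h) - 1) <= modc h * k.
  move=> /andP[s0 s1].
  have := @rder_le_cst _ _ _ 0 s (modc h * k) s0 (fun t _ => cexp_ray h t).
  rewrite mul0r cexp0 subr0 => le; apply: (le_trans (le _)).
    by move=> t /andP[t0 ts]; rewrite modcM ler_wpM2l ?modc_ge0 // bnd // t0 (le_trans ts).
  by rewrite ler_piMr // mulr_ge0 ?modc_ge0 // ltW.
have dE s : 0 <= s <= 1 -> rder (fun t => cexp (t%:C * h) - h * t%:C) s (h * (cexp (s%:C * h) - 1)).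
  by move=> _; apply: rder_eq (rderB (cexp_ray h s) (rderZ h (rder_id s))) _; ring.
have := @rder_le_cst _ _ _ 0 1 (modc h * (modc h * k)) h01 dE.
rewrite mul1r mul0r mulr0 cexp0 mulr1 subr0 subr0 mulr1 add0r => le.
have -> : cexp h - 1 - h = cexp h - h - 1 by ring.
apply: (le_trans (le _)).
  by move=> s s01; rewrite modcM ler_wpM2l ?modc_ge0 // near1.
rewrite mulrC ler_wpM2r ?modc_ge0 //.
by move: h2; rewrite ltr_pdivlMr // => /ltW.
Qed.

Lemma rder_cexp (f : R -> C) x d : rder f x d ->
  rder (fun t => cexp (f t)) x (cexp (f x) * d).
Proof. by move=> h; exact: rder_comp (cexp_diff _) h. Qed.

Lemma holo_cexp (f : C -> C) z : holo f z -> holo (fun w => cexp (f w)) z.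
Proof. by move=> h; apply: (holo_comp (g := cexp)) => //; exists (cexp (f z)); exact: cexp_diff. Qed.

Definition upper_cont (F : C -> C) :=
  forall z, Cplus_closed z -> wlim (@Cplus_closed R) F z (F z).

(** Two-constants theorem: multiply by the exponential of [n (iw - w^2)], whose modulus is
    at most one on the real axis and at most [exp (- n / 4)] on the three other sides of the
    rectangle, and equals [exp (- 3 n / 16)] at the point [i / 4]: the bound on the three sides
    is beaten by taking [n] large. *)
Lemma two_constants (F : C -> C) (z0 : C) (B eta : R) (n : nat) :
  upper_cont F -> (forall z, Cplus z -> holo F z) -> Cplus z0 ->
  (forall z, inrect (Rect (complex.Re z0 - 2 * complex.Im z0) (complex.Re z0 + 2 * complex.Im z0)
      0 (2 * complex.Im z0)) z -> modc (F z) <= B) ->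
  (forall l : R, modc (F l%:C) <= eta) ->
  modc (F z0) <= (eta + B * expR (- n%:R / 4)) * expR (3 * n%:R / 16).
Proof.
move=> Fc Fh z0p FB Fe; set x0 := complex.Re z0; set y0 := complex.Im z0.
have y0p : 0 < y0 by [].
have B0 : 0 <= B.
  apply: le_trans (FB z0 _); first exact: modc_ge0.
  by apply/andP; split; apply/andP; split => /=; rewrite -?/x0 -?/y0; clear -y0p; lra.
have e0 : 0 <= eta by apply: le_trans (Fe 0); exact: modc_ge0.
(* affine change of variable that sends [i / 4] to [z0]; the clamp [k] extends the function
   continuously below the real axis *)
pose t := 4 * y0; have t0 : 0 < t by rewrite mulr_gt0.
pose a (w : C) : C := x0%:C + t%:C * w.
pose phi (w : C) : C := n%:R * ('i * w - w * w).
pose k (w : C) : C := complex.Re w +i* Num.max (complex.Im w) 0.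
pose G w := F (a (k w)) * cexp (phi w).
have kE w : 0 <= complex.Im w -> k w = w by move=> w0; rewrite /k max_l // ReIm_eta.
have aIm w : complex.Im (a w) = t * complex.Im w.
  by rewrite /a ImD ImC add0r ImMr.
have aRe w : complex.Re (a w) = x0 + t * complex.Re w.
  by rewrite /a ReD ReC ReMr.
have ak w : Cplus_closed (a (k w)).
  suff : 0 <= complex.Im (a (k w)) by [].
  by rewrite aIm mulr_ge0 ?(ltW t0) //= le_max lexx orbT.
have hphi w : holo (fun w => cexp (phi w)) w.
  apply: holo_cexp; apply: holoM; first exact: holo_cst.
  apply: holoB; first by apply: holoM; [exact: holo_cst|exact: holo_id].
  by apply: holoM; exact: holo_id.
have acont w : ccont a w.
  by rewrite /a; exact: affine_ccont.
have kcont w : ccont k w.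
  move=> e ep; exists (e / 2) => [|v _ vw]; first by rewrite divr_gt0.
  apply: (le_lt_trans (modc_le_ReIm _)); rewrite ReB ImB /k /= -ReB.
  have h1 := Re_le_modc (v - w); have h2 := Im_le_modc (v - w); rewrite ImB in h2.
  have h3 : `|Num.max (complex.Im v) 0 - Num.max (complex.Im w) 0| <= `|complex.Im v - complex.Im w|.
    clear; have := ler_norm (complex.Im v - complex.Im w); have := ler_norm (- (complex.Im v - complex.Im w)).
    rewrite normrN => u1 u2; rewrite ler_norml; apply/andP.
    by split; case: (leP (complex.Im v) 0) => ?; case: (leP (complex.Im w) 0) => ?; lra.
  by clear -h1 h2 h3 vw; lra.
have hG : hol_on 0 G.
  split.
    move=> w; apply: wlimM; last exact: holo_cont (hphi w).
    apply: (@wlim_comp _ setT (@Cplus_closed R) (fun w => a (k w)) F w (a (k w))) => //.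
      by apply: (@wlim_comp _ setT setT k a w (k w)) => //; [exact: kcont|exact: acont].
    exact: Fc.
  exists [::], [::] => w w0 _ _; apply: holoM => //.
  apply: (@holo_near _ (fun w => F (a w)) _ w (complex.Im w)) => //.
    move=> v vw; rewrite kE //; have := Im_le_modc (v - w); rewrite ImB.
    by have := ler_norm (- (complex.Im v - complex.Im w)); rewrite normrN; clear -vw w0; lra.
  apply: (holo_comp (g := F)); last first.
    by apply: Fh; suff : 0 < complex.Im (a w) by []; rewrite aIm mulr_gt0.
  by apply: holoD; [exact: holo_cst|apply: holoM; [exact: holo_cst|exact: holo_id]].
pose Q := Rect (-1/2) (1/2) 0 (1/2 : R).
pose w0 : C := 0 +i* (1/4).
have phiRe x y : complex.Re (phi (x +i* y)) = n%:R * (- y - x ^+ 2 + y ^+ 2).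
  rewrite /phi; have -> : (n%:R : C) = (n%:R : R)%:C by rewrite rmorph_nat.
  by rewrite ReMr /=; congr (_ * _); ring.
have aw0 : a (k w0) = z0.
  apply: eqC; first by rewrite aRe /= mulr0 addr0.
  by rewrite aIm /= max_l; [rewrite /t -/y0; field|clear; lra].
have wQ : wf Q by split => /=; clear; lra.
have w0Q : inrect Q w0 by apply/andP; split; apply/andP; split => /=; clear; lra.
have edge w : on_edge Q w -> modc (G w) <= eta + B * expR (- n%:R / 4).
  move=> [wI we]; rewrite /G modcM modc_cexp.
  have wIm : 0 <= complex.Im w by case/andP: wI => _ /andP[].
  rewrite kE //.
  have FBw : modc (F (a w)) <= B.
    apply: FB; rewrite -/x0 -/y0; case/andP: wI => /andP[/= v1 v2] /andP[/= v3 v4].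
    rewrite /inrect aRe aIm /= /t; apply/andP; split; apply/andP; split.
    - by have := mulr_ge0 (ltW y0p) (_ : 0 <= complex.Re w + 1/2); clear -v1; move=> /(_ ltac:(lra)); lra.
    - by have := mulr_ge0 (ltW y0p) (_ : 0 <= 1/2 - complex.Re w); clear -v2; move=> /(_ ltac:(lra)); lra.
    - by rewrite !mulr_ge0 // ltW.
    - by have := mulr_ge0 (ltW y0p) (_ : 0 <= 1/2 - complex.Im w); clear -v4; move=> /(_ ltac:(lra)); lra.
  have side : complex.Re (phi w) <= - n%:R / 4 -> modc (F (a w)) * expR (complex.Re (phi w)) <= eta + B * expR (- n%:R / 4).
    move=> h; apply: (@le_trans _ _ (B * expR (- n%:R / 4))); last by rewrite lerDr.
    by rewrite ler_pM ?modc_ge0 ?expR_ge0 // ler_expR.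
  have n0 : 0 <= n%:R :> R by [].
  case: w wI we wIm FBw side => x y /andP[/andP[/= v1 v2] /andP[/= v3 v4]] we wIm FBw; rewrite phiRe => side.
  case: we => [/= we|[/= we|[/= we|/= we]]].
  - apply: side; rewrite we.
    by have := mulr_ge0 n0 (mulr_ge0 v3 (_ : 0 <= 1 - y)); clear -v4 we; rewrite expr2 => /(_ ltac:(lra)); lra.
  - apply: side; rewrite we.
    by have := mulr_ge0 n0 (mulr_ge0 v3 (_ : 0 <= 1 - y)); clear -v4 we; rewrite expr2 => /(_ ltac:(lra)); lra.
  - apply: (@le_trans _ _ (eta * 1)); last by rewrite mulr1 lerDl mulr_ge0 // expR_ge0.
    rewrite ler_pM ?modc_ge0 ?expR_ge0 //.
      have -> : a (x +i* y) = (x0 + t * x)%:C by apply: eqC; rewrite ?aRe ?aIm //= we mulr0.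
      exact: Fe.
    rewrite expR_le1 we; have := mulr_ge0 n0 (sqr_ge0 x); clear; lra.
  - apply: side; rewrite we.
    by have := mulr_ge0 n0 (sqr_ge0 x); clear; lra.
have := @maximum_principle_closed 0 G Q _ hG wQ (lexx 0) edge w0 w0Q.
rewrite /G aw0 modcM modc_cexp phiRe -ler_pdivlMr ?expR_gt0 // => H; apply: (le_trans H).
rewrite -expRN ler_wpM2l //; first by rewrite addr_ge0 // mulr_ge0 // expR_ge0.
by rewrite ler_expR; clear; lra.
Qed.

(** Liouville's theorem for functions whose only exceptional set is the pair of coordinate
    axes, with boundedness in place of continuity at the origin.  The product of the identity
    with the squared difference quotient at [a] is continuous everywhere, hence obeys the
    maximum principle, and tends to zero on large squares. *)
Lemma liouville (H : C -> C) (B r0 r1 : R) : 0 < r0 ->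
  (forall w, complex.Re w != 0 -> complex.Im w != 0 -> holo H w) ->
  (forall w, w != 0 -> ccont H w) ->
  (forall w, modc w < r0 -> modc (H w) <= B) ->
  (forall w, r1 < modc w -> modc (H w) <= B) ->
  forall w, w != 0 -> H w = H (1 +i* 1).
Proof.
move=> r00 Hh Hc H0 H1; set a : C := 1 +i* 1.
have an0 : a != 0 by apply/eqP => -[] /eqP; rewrite oner_eq0.
have [d dH] : holo H a by apply: Hh; rewrite /= oner_eq0.
pose K w := if w == a then d else (H w - H a) / (w - a).
pose B' := B + modc (H a).
have a2 : modc a <= 2.
  by apply: (le_trans (modc_le_ReIm _)); rewrite /= normr1; clear; lra.
have a1 : 1 <= modc a by have := Re_le_modc a; rewrite /= normr1.
have Ka : ccont K a.
  move=> e e0; have e2 : 0 < e / 2 by rewrite divr_gt0.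
  have [r rp hr] := dH _ e2; exists r => // w _ wa; rewrite /K eqxx.
  case: eqVneq => [_|wna]; first by rewrite subrr modc0.
  have wn : w - a != 0 by rewrite subr_eq0.
  have wp : 0 < modc (w - a) by rewrite modc_gt0.
  have := hr (w - a) wa; rewrite [a + _]addrC subrK => le.
  have -> : (H w - H a) / (w - a) - d = (H w - H a - d * (w - a)) / (w - a) by field.
  rewrite modcM modcV ltr_pdivrMr //; apply: (le_lt_trans le).
  by rewrite ltr_pM2r // ltr_pdivrMr // mulr_natr mulr2n ltrDl.
have Kc w : w != 0 -> ccont K w.
  move=> wn; have [->//|wna] := eqVneq w a.
  have wp : 0 < modc (w - a) by rewrite modc_gt0 subr_eq0.
  apply: (@wlim_near _ setT (fun v => (H v - H a) / (v - a)) K w _ (modc (w - a)) wp).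
    move=> v _ vw; rewrite /K; case: eqVneq => // E; move: vw.
    by rewrite E modcBC ltxx.
  rewrite /K (negPf wna); apply: wlimM; first by apply: wlimB; [exact: Hc|exact: wlim_cst].
  apply: wlimV; first by rewrite subr_eq0.
  by apply: wlimB; [exact: wlim_id|exact: wlim_cst].
pose T w := w * (K w * K w).
have hT m : hol_on m T.
  split.
    move=> w; have [->|wn] := eqVneq w 0; last first.
      by apply: wlimM; [exact: wlim_id|apply: wlimM; exact: Kc].
    have T00 : T 0 = 0 by rewrite /T mul0r.
    rewrite /ccont T00; apply: (@wlim_le _ _ _ _ _ ((2 * B') * (2 * B'))) => e e0.
    exists (Num.min e (Num.min r0 (1/2))) => [|v _]; first by rewrite !lt_min e0 r00 divr_gt0.
    rewrite subr0 subr0 !lt_min => /and3P[v1 v2 v3].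
    have va : 1/2 <= modc (v - a).
      by rewrite modcBC; have := modc_sub_le a v; clear -a1 v3; lra.
    have KB : modc (K v) <= 2 * B'.
      rewrite /K; case: eqVneq => [E|_]; first by move: va; rewrite E subrr modc0; clear; lra.
      rewrite modcM modcV.
      have h1 : modc (H v - H a) <= B' by apply: (le_trans (modcB _ _)); rewrite lerD2r H0.
      have vp : 0 < modc (v - a) by clear -va; lra.
      rewrite ler_pdivrMr //.
      have B'0 : 0 <= B' by apply: le_trans h1; exact: modc_ge0.
      apply: (le_trans h1).
      by have := mulr_ge0 B'0 (_ : 0 <= modc (v - a) - 1/2); rewrite subr_ge0 => /(_ va); clear; lra.
    rewrite /T !modcM mulrC ler_pM ?mulr_ge0 ?modc_ge0 // ?(ltW v1) //.
    by rewrite ler_pM ?modc_ge0.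
  exists [:: 0; 1], [:: 0; 1] => w _; rewrite !in_cons !orbF !negb_or => /andP[w1 w2] /andP[w3 w4].
  have wna : w != a by apply/eqP => E; move: w2; rewrite E /= eqxx.
  have wp : 0 < modc (w - a) by rewrite modc_gt0 subr_eq0.
  have hK : holo K w.
    apply: (@holo_near _ (fun v => (H v - H a) / (v - a)) K w (modc (w - a)) wp).
      move=> v vw; rewrite /K; case: eqVneq => // E; move: vw.
      by rewrite E modcBC ltxx.
    apply: holoM; first by apply: holoB; [exact: Hh|exact: holo_cst].
    apply: holoV; first by rewrite subr_eq0.
    by apply: holoB; [exact: holo_id|exact: holo_cst].
  by apply: holoM; [exact: holo_id|exact: holoM].
move=> w1 w1n; have [->//|w1a] := eqVneq w1 a.
have B'0 : 0 <= B'.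
  rewrite addr_ge0 ?modc_ge0 //; apply: le_trans (H0 0 _); first exact: modc_ge0.
  by rewrite modc0.
have Tle (rho : R) : 4 <= rho -> r1 < rho -> modc w1 <= rho -> modc (T w1) <= 8 * B' ^+ 2 / rho.
  move=> rho4 rhor rhow.
  pose Q := Rect (- rho) rho (- rho) rho.
  have wQ : wf Q by split => /=; clear -rho4; lra.
  apply: (@maximum_principle_closed (- rho) T Q _ (hT _) wQ (lexx _)); last first.
    have := Re_le_modc w1; have := Im_le_modc w1; rewrite !ler_norml => /andP[i1 i2] /andP[i3 i4].
    by apply/andP; split; apply/andP; split => /=; clear -i1 i2 i3 i4 rhow; lra.
  move=> w [/andP[/andP[/= q1 q2] /andP[/= q3 q4]] we].
  have wl : rho <= modc w.
    have := Re_le_modc w; have := Im_le_modc w.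
    have := ler_norm (complex.Re w); have := ler_norm (- complex.Re w).
    have := ler_norm (complex.Im w); have := ler_norm (- complex.Im w).
    by rewrite !normrN; case: we => /= [->|[->|[->|->]]]; clear; lra.
  have wu : modc w <= 2 * rho.
    have i1 : `|complex.Re w| <= rho by rewrite ler_norml q1.
    have i2 : `|complex.Im w| <= rho by rewrite ler_norml q3.
    by apply: (le_trans (modc_le_ReIm _)); clear -i1 i2; lra.
  have wa : rho / 2 <= modc (w - a) by have := modc_sub_le w a; clear -wl a2 rho4; lra.
  have KB : modc (K w) <= 2 * B' / rho.
    have rp : 0 < rho by clear -rho4; lra.
    rewrite /K; case: eqVneq => [E|_]; first by move: wa; rewrite E subrr modc0; clear -rp; lra.
    rewrite modcM modcV.
    have h1 : modc (H w - H a) <= B'.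
      by apply: (le_trans (modcB _ _)); rewrite lerD2r H1 //; exact: lt_le_trans wl.
    have h2 : (modc (w - a))^-1 <= 2 / rho.
      by rewrite -[2 / rho]invf_div lef_pV2 // posrE ?divr_gt0 //; apply: lt_le_trans wa; rewrite divr_gt0.
    rewrite [2 * B']mulrC -mulrA.
    by rewrite ler_pM ?modc_ge0 // invr_ge0 modc_ge0.
  have rp : 0 < rho by clear -rho4; lra.
  rewrite /T !modcM.
  apply: (@le_trans _ _ (2 * rho * ((2 * B' / rho) * (2 * B' / rho)))).
    by rewrite ler_pM ?mulr_ge0 ?modc_ge0 // ler_pM ?modc_ge0.
  by rewrite le_eqVlt; apply/orP; left; apply/eqP; field; rewrite gt_eqF.
have T0 : T w1 = 0.
  apply: eq_modcP => e e0; rewrite subr0.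
  pose rho := Num.max (Num.max 4 (r1 + 1)) (Num.max (modc w1) (8 * B' ^+ 2 / e)).
  have [h1 h2 h3 h4] : [/\ 4 <= rho, r1 + 1 <= rho, modc w1 <= rho & 8 * B' ^+ 2 / e <= rho].
    by split; rewrite /rho !le_max lexx ?orbT.
  apply: (le_trans (Tle rho h1 _ h3)); first by clear -h2; lra.
  have rp : 0 < rho by clear -h1; lra.
  by rewrite ler_pdivrMr // [e * _]mulrC -ler_pdivrMr.
move/eqP: T0; rewrite /T mulf_eq0 (negPf w1n) /= mulf_eq0 orbb /K (negPf w1a).
rewrite mulf_eq0 invr_eq0 [w1 - a == 0]subr_eq0 (negPf w1a) orbF subr_eq0.
by move/eqP.
Qed.

End MaxPrincipleConsequences.

(** * Linear differential equations *)

Section LinearODE.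
Context {R : realType}.
Notation C := R[i].

Lemma half_pow_small (E e : R) : 0 <= E -> 0 < e -> exists n : nat, E / 2 ^+ n <= e.
Proof.
move=> E0 e0; exists (Num.bound (E / e)).
rewrite ler_pdivrMr ?exprn_gt0 // mulrC -ler_pdivrMr //.
apply: (@le_trans _ _ (Num.bound (E / e))%:R).
  by apply/ltW/archi_boundP; rewrite divr_ge0 // ltW.
by rewrite -natrX ler_nat ltnW // ltn_expl.
Qed.

Lemma geometric_limitR (s : nat -> R) (E : R) :
  (forall n, `|s n.+1 - s n| <= E / 2 ^+ n) ->
  exists l, forall n, `|s n - l| <= 2 * E / 2 ^+ n.
Proof.
move=> h; pose d n := 2 * E / 2 ^+ n.
have E0 : 0 <= E by have := le_trans (normr_ge0 _) (h 0%N); rewrite expr0 divr1.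
have d0 n : 0 <= d n by rewrite /d divr_ge0 ?mulr_ge0 // exprn_ge0.
have dS n : d n = d n.+1 + E / 2 ^+ n.
  by rewrite /d exprS; field; rewrite expf_neq0.
have dec n : s n.+1 + d n.+1 <= s n + d n.
  have := h n; rewrite ler_norml => /andP[_]; rewrite [d n]dS; clear; lra.
have inc n : s n - d n <= s n.+1 - d n.+1.
  have := h n; rewrite ler_norml => /andP[+ _]; rewrite [d n]dS; clear; lra.
have mono n m : (n <= m)%N -> s n - d n <= s m - d m /\ s m + d m <= s n + d n.
  elim: m => [|m IH]; first by rewrite leqn0 => /eqP ->.
  rewrite leq_eqVlt => /orP[/eqP -> //|]; rewrite ltnS => /IH[h1 h2].
  by split; [exact: le_trans h1 (inc m)|exact: le_trans (dec m) h2].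
have cross n m : s n - d n <= s m + d m.
  have [h1 _] := mono n (maxn n m) (leq_maxl _ _).
  have [_ h2] := mono m (maxn n m) (leq_maxr _ _).
  by apply: (le_trans h1); apply: le_trans h2; have := d0 (maxn n m); clear; lra.
pose X := [set s n - d n | n in [set: nat]].
have X0 : X !=set0 by exists (s 0%N - d 0%N), 0%N.
have Xu n : ubound X (s n + d n) by move=> _ [m _ <-].
exists (sup X) => n; rewrite -/(d n).
have h1 : s n - d n <= sup X by apply: ub_le_sup; [exists (s 0%N + d 0%N)|exists n].
have h2 : sup X <= s n + d n by apply: ge_sup.
by rewrite ler_norml; apply/andP; clear -h1 h2; split; lra.
Qed.

Lemma geometric_limit (s : nat -> C) (E : R) :
  (forall n, modc (s n.+1 - s n) <= E / 2 ^+ n) ->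
  exists l, forall n, modc (s n - l) <= 4 * E / 2 ^+ n.
Proof.
move=> h.
have [a ha] : exists l, forall n, `|complex.Re (s n) - l| <= 2 * E / 2 ^+ n.
  apply: (@geometric_limitR (fun n => complex.Re (s n))) => n; rewrite -ReB.
  exact: le_trans (Re_le_modc _) (h n).
have [b hb] : exists l, forall n, `|complex.Im (s n) - l| <= 2 * E / 2 ^+ n.
  apply: (@geometric_limitR (fun n => complex.Im (s n))) => n; rewrite -ImB.
  exact: le_trans (Im_le_modc _) (h n).
exists (a +i* b) => n; apply: (le_trans (modc_le_ReIm _)); rewrite ReB ImB /=.
apply: (le_trans (lerD (ha n) (hb n))); rewrite -!mulrA; clear; lra.
Qed.

Lemma rcont_bounded (f : R -> C) (L : R) : rcont f ->
  exists2 K : R, 0 <= K & forall x, `|x| <= L -> modc (f x) <= K.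
Proof.
move=> [f1 f2]; have [L0|L0] := leP 0 L; last first.
  by exists 0 => // x xL; have := le_lt_trans xL L0; rewrite ltNge normr_ge0.
have LL : - L <= L by clear -L0; lra.
have c1 : {within `[- L, L], continuous (fun x => `|complex.Re (f x)|)}.
  by apply: continuous_subspaceT => x; apply: cvg_norm; exact: f1.
have c2 : {within `[- L, L], continuous (fun x => `|complex.Im (f x)|)}.
  by apply: continuous_subspaceT => x; apply: cvg_norm; exact: f2.
have [a _ ha] := EVT_max LL c1; have [b _ hb] := EVT_max LL c2.
exists (`|complex.Re (f a)| + `|complex.Im (f b)|); first by rewrite addr_ge0.
move=> x; rewrite ler_norml => xL; apply: (le_trans (modc_le_ReIm _)).
by apply: lerD; [apply: ha|apply: hb]; rewrite in_itv.
Qed.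

(** The exponential weight turns the Picard operator into a contraction on every interval. *)
Lemma cint_weight (f : R -> C) (k m L : R) : 0 < k -> 0 <= m -> rcont f ->
  (forall t, `|t| <= L -> modc (f t) <= m * expR (k * `|t|)) ->
  forall x, `|x| <= L -> modc (cint f 0 x) <= m / k * expR (k * `|x|).
Proof.
move=> k0 m0 fc fm x xL.
have mk : 0 <= m / k by rewrite divr_ge0 // ltW.
have [x0|/ltW x0] := leP 0 x.
  have dG (t : R) : 0 <= t <= x -> is_derive t 1 (fun t => m / k * expR (k * t)) (m * expR (k * t)).
    move=> _; have d1 : is_derive t 1 (fun t : R => k * t) k.
      by apply: is_derive_eq; rewrite /GRing.scale /=; ring.
    have d2 : is_derive t 1 (fun t : R => expR (k * t)) (expR (k * t) * k).
      exact: (@is_derive1_comp _ expR (fun t : R => k * t)).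
    apply: (is_derive_eq (is_deriveM' (is_derive_cst (m / k) t 1) d2)).
    by rewrite /=; field; rewrite gt_eqF.
  have := @rder_le _ (cint f 0) f _ _ 0 x x0 (fun t _ => cint_rder 0 t fc) dG.
  rewrite cint_id subr0 => le; apply: (le_trans (le _)).
    move=> t /andP[t0 tx]; rewrite -{2}(ger0_norm t0) fm // ger0_norm //.
    by rewrite (ger0_norm x0) in xL; exact: le_trans xL.
  by rewrite (ger0_norm x0) lerBlDr lerDl mulr_ge0 // expR_ge0.
have dG (t : R) : x <= t <= 0 -> is_derive t 1 (fun t => - (m / k) * expR (- k * t)) (m * expR (- k * t)).
  move=> _; have d1 : is_derive t 1 (fun t : R => - k * t) (- k).
    by apply: is_derive_eq; rewrite /GRing.scale /=; ring.
  have d2 : is_derive t 1 (fun t : R => expR (- k * t)) (expR (- k * t) * - k).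
    exact: (@is_derive1_comp _ expR (fun t : R => - k * t)).
  apply: (is_derive_eq (is_deriveM' (is_derive_cst (- (m / k)) t 1) d2)).
  by rewrite /=; field; rewrite gt_eqF.
have := @rder_le _ (cint f x) f _ _ x 0 x0 (fun t _ => cint_rder x t fc) dG.
rewrite cint_id subr0 => le; rewrite cint_rev modcN; apply: (le_trans (le _)).
  move=> t /andP[t0 tx]; have -> : - k * t = k * `|t| by rewrite ler0_norm // mulrN mulNr.
  by apply: fm; rewrite (ler0_norm tx); apply: le_trans xL; rewrite (ler0_norm x0) lerN2.
rewrite (ler0_norm x0) !mulNr opprK mulrN addrC lerBlDr lerDl.
by rewrite mulr_ge0 // expR_ge0.
Qed.

Variables (I : finType) (A : I -> I -> R -> C) (c : I -> C).
Hypothesis Ac : forall i j, rcont (A i j).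

Let rhs (y : I -> R -> C) i t := \sum_j A i j t * y j t.

Let rhs_cont y : (forall i, rcont (y i)) -> forall i, rcont (rhs y i).
Proof. by move=> yc i; apply: rcont_sum => j; exact: rcontM. Qed.

Let picard (n : nat) : I -> R -> C := iter n (fun y i x => c i + cint (rhs y i) 0 x) (fun i _ => c i).

Let picard_cont n i : rcont (picard n i).
Proof.
elim: n i => [|n IH] i /=; first exact: rcont_cst.
apply: rcontD; first exact: rcont_cst.
by apply: rder_rcont => x; apply: cint_rder; exact: rhs_cont.
Qed.

Let rhs_bound (K m : R) (y : I -> C) (B : I -> I -> C) :
  (forall i j, modc (B i j) <= K) -> (forall j, modc (y j) <= m) -> 0 <= K ->
  forall i, modc (\sum_j B i j * y j) <= #|I|%:R * K * m.
Proof.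
move=> BK ym K0 i; apply: (le_trans (modc_sum _ _ _)).
apply: (@le_trans _ _ (\sum_(j : I) K * m)).
  by apply: ler_sum => j _; rewrite modcM ler_pM ?modc_ge0.
by rewrite sumr_const -mulrA mulr_natl.
Qed.

Let A_bound L : exists2 K : R, 0 <= K & forall i j x, `|x| <= L -> modc (A i j x) <= K.
Proof.
have H (ij : I * I) : exists K : R, 0 <= K /\ forall x, `|x| <= L -> modc (A ij.1 ij.2 x) <= K.
  by have [K K0 hK] := rcont_bounded L (Ac ij.1 ij.2); exists K.
have [K hK] := choice H.
exists (\sum_ij K ij); first by apply: sumr_ge0 => ij _; case: (hK ij).
move=> i j x xL; have [_ /(_ x xL) h] := hK (i, j); apply: (le_trans h).
rewrite (bigD1 (i, j)) //= lerDl; apply: sumr_ge0 => ij _; by case: (hK ij).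
Qed.

Let picard_step L : exists2 E : R, 0 <= E & forall n i x, `|x| <= L ->
  modc (picard n.+1 i x - picard n i x) <= E / 2 ^+ n.
Proof.
have [K K0 AK] := A_bound L.
pose k := 2 * (#|I|%:R * K + 1); have nK : 0 <= #|I|%:R * K by rewrite mulr_ge0.
have k0 : 0 < k by rewrite /k mulr_gt0 // ltr_wpDl.
have H i : exists M : R, 0 <= M /\ forall x, `|x| <= L -> modc (picard 1 i x - picard 0 i x) <= M.
  by have [M M0 hM] := rcont_bounded L (rcontB (picard_cont 1 i) (picard_cont 0 i)); exists M.
have [M hM] := choice H.
pose M0 := \sum_i M i.
have M00 : 0 <= M0 by apply: sumr_ge0 => i _; case: (hM i).
have MM i : M i <= M0.
  by rewrite /M0 (bigD1 i) //= lerDl; apply: sumr_ge0 => j _; case: (hM j).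
have main n i x : `|x| <= L ->
    modc (picard n.+1 i x - picard n i x) <= M0 / 2 ^+ n * expR (k * `|x|).
  elim: n i x => [|n IH] i x xL.
    apply: (@le_trans _ _ M0); first by case: (hM i) => _ /(_ x xL) h; exact: le_trans h (MM i).
    by rewrite expr0 divr1 ler_peMr // -expR0 ler_expR mulr_ge0 // ltW.
  have e1 : picard n.+2 i x - picard n.+1 i x =
      cint (fun t => rhs (picard n.+1) i t - rhs (picard n) i t) 0 x.
    by rewrite cintB; try (exact: rhs_cont); rewrite /=; ring.
  rewrite e1.
  have -> : M0 / 2 ^+ n.+1 = (M0 / 2 ^+ n * (k / 2)) / k.
    by rewrite exprS; field; rewrite expf_neq0 // gt_eqF.
  apply: (cint_weight k0 _ _ _ xL).
  - by apply: mulr_ge0; apply: divr_ge0 => //; exact: ltW.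
  - by apply: rcontB; exact: rhs_cont.
  move=> t tL; rewrite -sumrB; under eq_bigr do rewrite -mulrBr.
  apply: (le_trans (@rhs_bound K _ (fun j => picard n.+1 j t - picard n j t) (fun i j => A i j t) _ _ K0 i)).
  - by move=> i' j; exact: AK.
  - by move=> j; exact: IH.
  have : 0 <= M0 / 2 ^+ n * expR (k * `|t|) by rewrite !mulr_ge0 ?expR_ge0 // invr_ge0 exprn_ge0.
  set Y := M0 / 2 ^+ n * expR (k * `|t|) => Y0.
  have -> : M0 / 2 ^+ n * (k / 2) * expR (k * `|t|) = (k / 2) * Y by rewrite /Y; ring.
  by apply: ler_wpM2r => //; rewrite /k mulrAC divff // mul1r lerDl.
exists (M0 * expR (k * L)) => [|n i x xL]; first by rewrite mulr_ge0 ?expR_ge0.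
 apply: (le_trans (main n i x xL)).
rewrite -[leRHS]mulrA [expR (k * L) / _]mulrC mulrA ler_wpM2l //.
  by rewrite mulr_ge0 // invr_ge0 exprn_ge0.
by rewrite ler_expR ler_wpM2l // ltW.
Qed.

(** Picard iteration converges geometrically in the weighted norm of every interval, hence
    globally. *)
Lemma ode_ex : exists y : I -> R -> C,
  (forall i x, rder (y i) x (\sum_j A i j x * y j x)) /\ forall i, y i 0 = c i.
Proof.
have lim_ex (ix : I * R) : exists l, exists E : R, forall n, modc (picard n ix.1 ix.2 - l) <= E / 2 ^+ n.
  have [E _ hE] := picard_step `|ix.2|.
  have [l hl] := geometric_limit (fun n => hE n ix.1 ix.2 (lexx _)).
  by exists l, (4 * E).
have [y0 hy0] := choice lim_ex; pose y i x := y0 (i, x).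
have unif L : exists2 E : R, 0 <= E & forall n i x, `|x| <= L -> modc (picard n i x - y i x) <= E / 2 ^+ n.
  have [E E0 hE] := picard_step L.
  exists (4 * E) => [|n i x xL]; first by rewrite mulr_ge0.
  have [l hl] := geometric_limit (fun n => hE n i x xL).
  suff -> : y i x = l by exact: hl.
  have [E' /= hE'] := hy0 (i, x).
  have E'0 : 0 <= E' by have := le_trans (modc_ge0 _) (hE' 0%N); rewrite expr0 divr1.
  apply: eq_modcP => e e0.
  have [N hN] : exists N, (4 * E + E') / 2 ^+ N <= e by apply: half_pow_small => //; rewrite addr_ge0 // mulr_ge0.
  apply: le_trans hN; rewrite mulrDl [leRHS]addrC.
  apply: (le_trans (modc_tri (picard N i x) _ _)); apply: lerD; last exact: hl.
  by rewrite modcBC; exact: hE'.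
have yc i : rcont (y i).
  apply/rcont_epsP => x e e0; have e4 : 0 < e / 4 by rewrite divr_gt0.
  have [E E0 hE] := unif (`|x| + 1).
  have [N hN] := half_pow_small E0 e4.
  have /rcont_epsP/(_ x _ e4)[d d0 hd] := picard_cont N i.
  exists (Num.min 1 d) => [|t]; first by rewrite lt_min ltr01.
  rewrite lt_min => /andP[t1 t2].
  have tL : `|t| <= `|x| + 1 by have := ler_normD x (t - x); rewrite [x + _]addrC subrK; lra.
  have xL : `|x| <= `|x| + 1 by rewrite lerDl.
  have h1 := hE N i t tL; have h2 := hE N i x xL; have h3 := hd t t2.
  rewrite modcBC in h1.
  apply: (le_lt_trans (modc_tri (picard N i t) _ _)).
  have := modc_tri (picard N i x) (picard N i t) (y i x).
  by lra.
have yE i x : y i x = c i + cint (rhs y i) 0 x.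
  apply: eq_modcP => e e0.
  have [K K0 AK] := A_bound `|x|; have [E E0 hE] := unif `|x|.
  have P0 : 0 <= E + #|I|%:R * K * E * `|x| by rewrite addr_ge0 // !mulr_ge0.
  have [N hN] := half_pow_small P0 e0.
  apply: le_trans hN.
  have -> : y i x - (c i + cint (rhs y i) 0 x) =
    (y i x - picard N.+1 i x) + cint (fun t => rhs (picard N) i t - rhs y i t) 0 x.
    by rewrite cintB; [|exact: rhs_cont|exact: rhs_cont]; rewrite /=; ring.
  rewrite mulrDl; apply: (le_trans (modcD _ _)); apply: lerD.
    rewrite modcBC; apply: (le_trans (hE N.+1 i x (lexx _))).
    rewrite ler_wpM2l // lef_pV2 ?posrE ?exprn_gt0 // exprS.
    by rewrite ler_peMl // ?exprn_ge0 // ler1n.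
  have -> : #|I|%:R * K * E * `|x| / 2 ^+ N = #|I|%:R * K * (E / 2 ^+ N) * `|x - 0|.
    by rewrite subr0; ring.
  apply: cint_le_norm; first by apply: rcontB; exact: rhs_cont.
  move=> t tt; rewrite -sumrB; under eq_bigr do rewrite -mulrBr.
  have tx : `|t| <= `|x|.
    have := ler_norm x; have := ler_norm (- x); rewrite normrN ler_norml.
    by move: tt => /orP[|] /andP[]; move=> *; apply/andP; split; lra.
  apply: (@rhs_bound K _ (fun j => picard N j t - y j t) (fun i j => A i j t) _ _ K0 i).
    by move=> i' j; exact: AK.
  by move=> j; exact: hE.
exists y; split=> [i x|i]; last by rewrite yE cint_id addr0.
apply: (@rder_ext _ (fun x => c i + cint (rhs y i) 0 x)); first by move=> t; rewrite -yE.
apply: rder_eq (rderD (rder_cst (c i) x) (cint_rder 0 x (rhs_cont yc i))) _.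
by rewrite add0r.
Qed.

End LinearODE.

(** * The Lax equation and its fundamental matrix *)

Section MatrixCalculus.
Context {R : realType}.
Notation C := R[i].
Notation M3 := 'M[C]_3.

Lemma conjc_sum (I : Type) (s : seq I) (P : pred I) (f : I -> C) :
  (\sum_(i <- s | P i) f i)^cj = \sum_(i <- s | P i) conjc (f i).
Proof. by elim/big_rec2: _ => [|i y x _ <-]; rewrite ?conjc0 ?conjcD. Qed.

Lemma daggerE (A : M3) i j : dagger A i j = (A j i)^cj.
Proof. by rewrite /dagger !mxE. Qed.

Lemma daggerM (A B : M3) : dagger (A *m B) = dagger B *m dagger A.
Proof.
apply/matrixP => i j; rewrite daggerE !mxE conjc_sum; apply: eq_bigr => k _.
by rewrite !daggerE conjcM mulrC.
Qed.

Lemma daggerD (A B : M3) : dagger (A + B) = dagger A + dagger B.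
Proof. by apply/matrixP => i j; rewrite daggerE !mxE conjcD. Qed.
Lemma daggerZ (c : C) (A : M3) : dagger (c *: A) = c^cj *: dagger A.
Proof. by apply/matrixP => i j; rewrite daggerE !mxE conjcM. Qed.
Lemma daggerK (A : M3) : dagger (dagger A) = A.
Proof. by apply/matrixP => i j; rewrite !daggerE conjcK. Qed.
Lemma dagger1 : dagger (1%:M : M3) = 1%:M.
Proof.
apply/matrixP => i j; rewrite daggerE !mxE eq_sym.
by case: eqP => _; rewrite ?conjc1 ?conjc0.
Qed.
Lemma det_dagger (A : M3) : \det (dagger A) = (\det A)^cj.
Proof. by rewrite /dagger (det_map_mx (@conjc R : {rmorphism C -> C})) det_tr. Qed.

Definition mrder (F : R -> M3) (x : R) (D : M3) := forall i j, rder (fun t => F t i j) x (D i j).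
Definition mrcont (F : R -> M3) := forall i j, rcont (fun t => F t i j).

Lemma mrder_eq F x D D' : mrder F x D -> D = D' -> mrder F x D'.
Proof. by move=> h <-. Qed.

Lemma mrder_cst A x : mrder (fun=> A) x 0.
Proof. by move=> i j; rewrite mxE; exact: rder_cst. Qed.

Lemma mrderM F G x D E : mrder F x D -> mrder G x E ->
  mrder (fun t => F t *m G t) x (D *m G x + F x *m E).
Proof.
move=> hF hG i j; rewrite !mxE -big_split /=.
apply: (@rder_ext _ (fun t => \sum_k F t i k * G t k j)); first by move=> t; rewrite mxE.
by apply: rder_sum => k; exact: rderM.
Qed.

Lemma mrder_dagger F x D : mrder F x D -> mrder (fun t => dagger (F t)) x (dagger D).
Proof.
move=> hF i j; rewrite daggerE.
by apply: (@rder_ext _ (fun t => (F t j i)^cj)); [move=> t; rewrite daggerE|exact: rderJ].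
Qed.

Lemma mrder_mrcont F (D : R -> M3) : (forall x, mrder F x (D x)) -> mrcont F.
Proof. by move=> h i j; apply: rder_rcont => x; exact: h. Qed.

Lemma mrder_cstT F : (forall x, mrder F x 0) -> forall a b, F a = F b.
Proof.
move=> h a b; apply/matrixP => i j; apply: (rder_eq_cstT (F := fun t => F t i j)) => x.
by have := h x i j; rewrite mxE.
Qed.

Lemma mrcontM F G : mrcont F -> mrcont G -> mrcont (fun t => F t *m G t).
Proof.
move=> hF hG i j; rewrite (_ : (fun _ => _) = fun t => \sum_k F t i k * G t k j).
  by apply: rcont_sum => k; exact: rcontM.
by apply/funext => t; rewrite mxE.
Qed.

Lemma mrcont_cst A : mrcont (fun=> A). Proof. by move=> i j; exact: rcont_cst. Qed.

Lemma mrcont_dagger F : mrcont F -> mrcont (fun t => dagger (F t)).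
Proof.
move=> hF i j; rewrite (_ : (fun _ => _) = fun t => (F t j i)^cj); first exact: rcontJ.
by apply/funext => t; rewrite daggerE.
Qed.

Lemma mul3_le (A B : M3) (a b : R) : 0 <= a -> (forall i j, modc (A i j) <= a) ->
  (forall i j, modc (B i j) <= b) -> forall i j, modc ((A *m B) i j) <= 3 * a * b.
Proof.
move=> a0 hA hB i j; rewrite mxE; apply: (le_trans (modc_sum _ _ _)).
apply: (@le_trans _ _ (\sum_(k < 3) a * b)).
  by apply: ler_sum => k _; rewrite modcM ler_pM ?modc_ge0.
by rewrite sumr_const card_ord -mulrA mulr_natl.
Qed.

Definition sg : M3 := diag_mx sigma_diag.

Lemma sigma_diagJ (j : 'I_3) : (sigma_diag 0 j : C)^cj = sigma_diag 0 j.
Proof. by rewrite mxE; case: ifP => _; rewrite ?conjcN conjc1. Qed.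

Lemma dagger_sg : dagger sg = sg.
Proof.
apply/matrixP => i j; rewrite daggerE /sg mxE [in RHS]mxE eq_sym.
by case: eqP => [->|_]; rewrite ?mulr1n ?mulr0n ?sigma_diagJ ?conjc0.
Qed.

Lemma sg_le i j : modc (sg i j) <= 1.
Proof.
rewrite /sg mxE; case: eqP => _; rewrite ?mulr0n ?modc0 // mulr1n mxE.
by case: ifP => _; rewrite ?modcN modc1.
Qed.

Lemma exp_sigmaD (a b : C) : exp_sigma (a + b) = exp_sigma a *m exp_sigma b.
Proof.
rewrite /exp_sigma mulmx_diag; congr diag_mx; apply/rowP => j; rewrite !mxE.
by rewrite -cexpD; congr cexp; ring.
Qed.

Lemma exp_sigma0 : exp_sigma (0 : C) = 1%:M.
Proof.
rewrite /exp_sigma; apply/matrixP => i j; rewrite !mxE mulr0 mul0r cexp0.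
by case: eqP.
Qed.

Lemma exp_sigmaNK (w : C) : exp_sigma w *m exp_sigma (- w) = 1%:M.
Proof. by rewrite -exp_sigmaD subrr exp_sigma0. Qed.

Lemma exp_sigmaKN (w : C) : exp_sigma (- w) *m exp_sigma w = 1%:M.
Proof. by rewrite -exp_sigmaD addNr exp_sigma0. Qed.

Lemma dagger_exp_sigma (w : C) : dagger (exp_sigma w) = exp_sigma (- w^cj).
Proof.
apply/matrixP => i j; rewrite daggerE /exp_sigma mxE [in RHS]mxE eq_sym.
case: eqP => [->|_]; last by rewrite !mulr0n conjc0.
rewrite !mulr1n !mxE cexpJ; congr cexp; rewrite !conjcM.
have -> : ('i : C)^cj = - 'i by apply: eqC; rewrite ?ReN ?ImN //= oppr0.
by case: ifP => _; rewrite ?conjcN conjc1; ring.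
Qed.

Lemma exp_adE (w : C) (B : M3) i j :
  exp_ad w B i j = cexp ('i * w * (sigma_diag 0 i - sigma_diag 0 j)) * B i j.
Proof.
rewrite /exp_ad /exp_sigma mul_diag_mx mul_mx_diag !mxE.
have -> : 'i * w * ((if i == j1 then -1 else 1) - (if j == j1 then -1 else 1)) =
  'i * w * (if i == j1 then -1 else 1) + 'i * - w * (if j == j1 then -1 else 1) by ring.
by rewrite cexpD; ring.
Qed.

Lemma exp_adD (a b : C) (B : M3) : exp_ad (a + b) B = exp_ad a (exp_ad b B).
Proof.
apply/matrixP => i j; rewrite !exp_adE mulrA -cexpD; congr (cexp _ * _); ring.
Qed.

Lemma exp_ad0 (B : M3) : exp_ad 0 B = B.
Proof. by apply/matrixP => i j; rewrite exp_adE mulr0 mul0r cexp0 mul1r. Qed.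

Lemma exp_adM (w : C) (A B : M3) : exp_ad w (A *m B) = exp_ad w A *m exp_ad w B.
Proof.
by rewrite /exp_ad !mulmxA; congr (_ *m _ *m _); rewrite -!mulmxA exp_sigmaKN mulmx1.
Qed.

Lemma exp_ad1 (w : C) : exp_ad w 1%:M = 1%:M :> M3.
Proof. by rewrite /exp_ad mulmx1 exp_sigmaNK. Qed.

Lemma dagger_exp_ad (w : C) (B : M3) : dagger (exp_ad w B) = exp_ad w^cj (dagger B).
Proof. by rewrite /exp_ad !daggerM !dagger_exp_sigma conjcN opprK mulmxA. Qed.

Lemma exp_sigma_rder (z : C) (x : R) :
  mrder (fun t => exp_sigma (t%:C * z)) x (('i * z) *: sg *m exp_sigma (x%:C * z)).
Proof.
move=> i j; rewrite -scalemxAl mxE /sg /exp_sigma mulmx_diag !mxE.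
apply: (@rder_ext _ (fun t => cexp (t%:C * ('i * z * sigma_diag 0 i)) *+ (i == j))).
  by move=> t; rewrite !mxE; congr (cexp _ *+ _); ring.
case: eqP => [->|_]; last by rewrite !mulr0n mulr0; exact: rder_cst.
rewrite !mulr1n; apply: rder_eq (cexp_ray _ x) _; rewrite !mxE mulrA; congr (_ * cexp _); ring.
Qed.

End MatrixCalculus.

Section Fundamental.
Context {R : realType}.
Notation C := R[i].
Notation M3 := 'M[C]_3.

(** [Phi] is the fundamental matrix, normalized at the origin, of the Lax equation with
    spectral parameter [z] and continuous anti-Hermitian potential [U]. *)
Record fundamental (U : R -> M3) (Phi : R -> C -> M3) : Prop := Fundamental {
  fund_cont : mrcont U;
  fund_anti : forall y, dagger (U y) = - U y;
  fund_der : forall x z, mrder (Phi^~ z) x ((('i * z) *: sg + U x) *m Phi x z);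
  fund_0 : forall z, Phi 0 z = 1%:M }.

Lemma fundamental_ex (U : R -> M3) : mrcont U -> (forall y, dagger (U y) = - U y) ->
  exists Phi, fundamental U Phi.
Proof.
move=> Uc Ua.
have H (z : C) : exists P : R -> M3, (forall x, mrder P x ((('i * z) *: sg + U x) *m P x)) /\ P 0 = 1%:M.
  pose A (i j : 'I_3) (x : R) : C := (('i * z) *: sg + U x) i j.
  have Ac i j : rcont (A i j).
    rewrite (_ : A i j = fun x => ('i * z) * sg i j + U x i j); last by apply/funext => x; rewrite /A !mxE.
    by apply: rcontD; [exact: rcont_cst|exact: Uc].
  have Hj (j : 'I_3) := ode_ex (fun i => (1%:M : M3) i j) Ac.
  have [y hy] := choice Hj.
  exists (fun x => \matrix_(i, j) y j i x); split.
    move=> x i j; have [dy _] := hy j.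
    rewrite mxE; under eq_bigr do rewrite [in X in _ * X]mxE.
    by apply: (@rder_ext _ (y j i)) (dy i x) => t; rewrite mxE.
  by apply/matrixP => i j; rewrite mxE; have [_ ->] := hy j.
have [P hP] := choice H.
by exists (fun x z => P z x); split => //; [move=> x z; case: (hP z)|move=> z; case: (hP z)].
Qed.

Variables (U : R -> M3) (Phi : R -> C -> M3).
Hypothesis F : fundamental U Phi.

(** The generator is anti-Hermitian up to conjugation of [z], which makes the adjoint of the
    solution at the conjugate parameter an inverse ([fund_inv]). *)
Lemma lax_anti (z : C) x : dagger (('i * z^cj) *: sg + U x) = - (('i * z) *: sg + U x).
Proof.
rewrite daggerD daggerZ dagger_sg (fund_anti F) conjcM conjcK opprD; congr (_ + _).
by rewrite -scaleNr; congr (_ *: _); rewrite -mulNr; congr (_ * _); apply: eqC; rewrite ?ReN ?ImN //= oppr0.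
Qed.

Lemma fund_pair_der (z w : C) x : mrder (fun t => dagger (Phi t z^cj) *m Phi t w) x
  (('i * (w - z)) *: (dagger (Phi x z^cj) *m sg *m Phi x w)).
Proof.
apply: mrder_eq (mrderM (mrder_dagger (fund_der F x z^cj)) (fund_der F x w)) _.
rewrite daggerM lax_anti mulmxA -mulmxDl -mulmxDr addrC.
rewrite [X in _ *m X *m _](_ : _ = ('i * (w - z)) *: sg).
  by rewrite -scalemxAr -scalemxAl.
rewrite opprD addrACA subrr addr0 -scaleNr -scalerDl; congr (_ *: _); ring.
Qed.

Lemma fund_inv (z : C) x : dagger (Phi x z^cj) *m Phi x z = 1%:M.
Proof.
have h := @mrder_cstT _ (fun t => dagger (Phi t z^cj) *m Phi t z) _ x 0.
rewrite h; first by rewrite !(fund_0 F) dagger1 mulmx1.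
by move=> y; apply: mrder_eq (fund_pair_der z z y) _; rewrite subrr mulr0 scale0r.
Qed.

Lemma fund_inv' (z : C) x : Phi x z *m dagger (Phi x z^cj) = 1%:M.
Proof. by apply: mulmx1C; exact: fund_inv. Qed.

Lemma fund_mrcont z : mrcont (Phi^~ z).
Proof. exact: (mrder_mrcont (fun x => fund_der F x z)). Qed.

(** Energy estimate: only the diagonal part of the equation changes the norm. *)
Lemma lax_energy (z : C) (y : 'I_3 -> R -> C) (x : R) :
  (forall i, rder (y i) x (\sum_j (('i * z) *: sg + U x) i j * y j x)) ->
  is_derive x 1 (fun t => \sum_i modc (y i t) ^+ 2)
    (- 2 * complex.Im z * \sum_i (complex.Re (sigma_diag 0 i) * modc (y i x) ^+ 2)).
Proof.
move=> dy.
have d2 : rder (fun t => \sum_i conjc (y i t) * y i t) x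
    (\sum_i (conjc (\sum_j (('i * z) *: sg + U x) i j * y j x) * y i x
      + conjc (y i x) * (\sum_j (('i * z) *: sg + U x) i j * y j x))).
  by apply: rder_sum => i; apply: rderM => //; exact: rderJ.
have [d1 _] := d2.
have E t : complex.Re (\sum_i conjc (y i t) * y i t) = \sum_i modc (y i t) ^+ 2.
  by rewrite ReSum; apply: eq_bigr => i _; rewrite sqr_modc ReM ReJ ImJ; ring.
rewrite (_ : (fun t => _) = fun t => complex.Re (\sum_i conjc (y i t) * y i t)); last first.
  by apply/funext => t; rewrite E.
apply: is_derive_eq d1 _.
have anti i j : U x j i = - conjc (U x i j).
  have := congr1 (fun A : M3 => A j i) (fund_anti F x); rewrite daggerE mxE => ->.
  by rewrite opprK.
have -> : \sum_i (conjc (\sum_j (('i * z) *: sg + U x) i j * y j x) * y i x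
      + conjc (y i x) * (\sum_j (('i * z) *: sg + U x) i j * y j x)) =
   \sum_i (('i * z + conjc ('i * z)) * sigma_diag 0 i * (conjc (y i x) * y i x)).
  rewrite big_split /=.
  have e1 : \sum_i conjc (\sum_j (('i * z) *: sg + U x) i j * y j x) * y i x =
     \sum_i (conjc ('i * z) * sigma_diag 0 i * (conjc (y i x) * y i x)) + \sum_i \sum_j conjc (U x i j) * conjc (y j x) * y i x.
    rewrite -big_split; apply: eq_bigr => i _ /=.
    rewrite conjc_sum mulr_suml (eq_bigr (fun j => conjc ('i * z) * conjc (sg i j) * conjc (y j x) * y i x + conjc (U x i j) * conjc (y j x) * y i x)).
      rewrite big_split /=; congr (_ + _).
      rewrite (bigD1 i) //= big1 ?addr0 => [|j ji].
        by rewrite /sg mxE eqxx mulr1n sigma_diagJ; ring.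
      by rewrite /sg mxE eq_sym (negPf ji) mulr0n conjc0 mulr0 !mul0r.
    by move=> j _; rewrite !conjcM !mxE conjcD !conjcM; ring.
  have e2 : \sum_i conjc (y i x) * (\sum_j (('i * z) *: sg + U x) i j * y j x) =
     \sum_i (('i * z) * sigma_diag 0 i * (conjc (y i x) * y i x)) + \sum_i \sum_j conjc (y i x) * U x i j * y j x.
    rewrite -big_split; apply: eq_bigr => i _ /=.
    rewrite mulr_sumr (eq_bigr (fun j => ('i * z) * sg i j * conjc (y i x) * y j x + conjc (y i x) * U x i j * y j x)).
      rewrite big_split /=; congr (_ + _).
      rewrite (bigD1 i) //= big1 ?addr0 => [|j ji].
        by rewrite /sg mxE eqxx mulr1n; ring.
      by rewrite /sg mxE eq_sym (negPf ji) mulr0n mulr0 !mul0r.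
    by move=> j _; rewrite !mxE; ring.
  have e3 : \sum_i \sum_j conjc (U x i j) * conjc (y j x) * y i x = - \sum_i \sum_j conjc (y i x) * U x i j * y j x.
    rewrite exchange_big /= -sumrN; apply: eq_bigr => i _; rewrite -sumrN; apply: eq_bigr => j _.
    by rewrite (anti j i); ring.
  rewrite e1 e2 e3 addrACA addNr addr0 -big_split; apply: eq_bigr => i _ /=; ring.
rewrite ReSum mulr_sumr; apply: eq_bigr => i _.
have -> : conjc (y i x) * y i x = (modc (y i x) ^+ 2)%:C.
  by apply: eqC; rewrite ?ReM ?ImM ReJ ImJ ?sqr_modc //=; ring.
have -> : 'i * z + conjc ('i * z) = (- 2 * complex.Im z)%:C.
  by apply: eqC; rewrite ?ReD ?ImD ?ReJ ?ImJ ?ReM ?ImM /=; ring.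
have es : (sigma_diag 0 i : C) = (complex.Re (sigma_diag 0 i : C))%:C.
  by rewrite mxE; case: ifP => _; apply: eqC; rewrite //= oppr0.
by rewrite [in LHS]es -mulrA ReMr [in LHS]ReMr ReC.
Qed.

End Fundamental.

(** * Analyticity in the spectral parameter *)

Section FundamentalSpectral.
Context {R : realType}.
Notation C := R[i].
Notation M3 := 'M[C]_3.

Lemma rder_le_abs (F f : R -> C) (x K : R) :
  (forall t, `|t| <= `|x| -> rder F t (f t)) ->
  (forall t, `|t| <= `|x| -> modc (f t) <= K) -> modc (F x - F 0) <= K * `|x|.
Proof.
move=> dF fK; have [x0|/ltW x0] := leP 0 x.
  rewrite (ger0_norm x0) -{2}[x]subr0; apply: rder_le_cst => // t /andP[t0 tx].
    by apply: dF; rewrite !ger0_norm.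
  by apply: fK; rewrite !ger0_norm.
rewrite modcBC (ler0_norm x0) -[- x]add0r; apply: rder_le_cst => // t /andP[tx t0].
  by apply: dF; rewrite !ler0_norm // lerN2.
by apply: fK; rewrite !ler0_norm // lerN2.
Qed.

Lemma derive_expR (c t : R) : is_derive t 1 (fun t : R => expR (c * t)) (expR (c * t) * c).
Proof.
have d1 : is_derive t 1 (fun t : R => c * t) c.
  by apply: is_derive_eq; rewrite /GRing.scale /=; ring.
exact: (@is_derive1_comp _ expR (fun t : R => c * t)).
Qed.

Lemma gronwall (N dN : R -> R) (k : R) : (forall t : R, is_derive t 1 N (dN t)) ->
  (forall t, `|dN t| <= k * N t) -> forall x, N x <= N 0 * expR (k * `|x|).
Proof.
move=> hN hk x; have [x0|/ltW x0] := leP 0 x.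
  have := @derive_ge0_le _ (fun t => - (N t * expR (- k * t)))
    (fun t => - (dN t * expR (- k * t) + N t * (expR (- k * t) * - k))) 0 x x0.
  rewrite mulr0 expR0 mulr1 lerN2 (ger0_norm x0) => le.
  have {}le : N x * expR (- k * x) <= N 0.
    apply: le => t _; first by apply: is_deriveN'; apply: is_deriveM' => //; exact: derive_expR.
    have -> : - (dN t * expR (- k * t) + N t * (expR (- k * t) * - k)) = (k * N t - dN t) * expR (- k * t) by ring.
    by rewrite mulr_ge0 ?expR_ge0 // subr_ge0 (le_trans (ler_norm _)).
  by rewrite -ler_pdivrMr ?expR_gt0 // -expRN -mulNr.
have := @derive_ge0_le _ (fun t => N t * expR (k * t))
  (fun t => dN t * expR (k * t) + N t * (expR (k * t) * k)) x 0 x0.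
rewrite mulr0 expR0 mulr1 (ler0_norm x0) => le.
have {}le : N x * expR (k * x) <= N 0.
  apply: le => t _; first by apply: is_deriveM' => //; exact: derive_expR.
  have -> : dN t * expR (k * t) + N t * (expR (k * t) * k) = (k * N t + dN t) * expR (k * t) by ring.
  rewrite mulr_ge0 ?expR_ge0 // -lerBlDr sub0r.
  by apply: le_trans (hk t); rewrite -normrN ler_norm.
by rewrite mulrN expRN ler_pdivlMr // expR_gt0.
Qed.

Variables (U : R -> M3) (Phi : R -> C -> M3).
Hypothesis F : fundamental U Phi.

Lemma fund_col_der z i j x :
  rder (fun t => Phi t z i j) x (\sum_k (('i * z) *: sg + U x) i k * Phi x z k j).
Proof. by have := fund_der F x z i j; rewrite mxE. Qed.

Lemma fund_bound z x i j : modc (Phi x z i j) ^+ 2 <= expR (2 * `|complex.Im z| * `|x|).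
Proof.
pose N t := \sum_i modc (Phi t z i j) ^+ 2.
have dN t := lax_energy F (fun i => fund_col_der z i j t).
have N0 : N 0 = 1.
  rewrite /N (bigD1 j) //= big1 => [|k kj]; rewrite (fund_0 F) mxE.
    by rewrite eqxx modc1 expr1n addr0.
  by rewrite (negPf kj) modc0 expr0n.
have le : N x <= N 0 * expR (2 * `|complex.Im z| * `|x|).
  apply: (gronwall dN) => t; rewrite -!mulrA !normrM normrN normr_nat.
  rewrite ler_wpM2l // ler_wpM2l //.
  apply: (le_trans (ler_norm_sum _ _ _)); apply: ler_sum => k _.
  rewrite normrM [X in _ * X]ger0_norm ?exprn_ge0 ?modc_ge0 // ler_piMl ?exprn_ge0 ?modc_ge0 //.
  by rewrite mxE; case: ifP => _; rewrite ?ReN ?Re1 ?normrN normr1.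
apply: (le_trans _ (le_trans le _)); last by rewrite N0 mul1r.
by rewrite /N (bigD1 i) //= lerDl; apply: sumr_ge0 => k _; rewrite exprn_ge0 // modc_ge0.
Qed.

(** Locally uniform in the spectral parameter, as needed to differentiate under Duhamel's
    integral. *)
Lemma fund_unif_bound z (x : R) : exists2 B : R, 0 <= B & forall h (y : R) i j, modc h < 1 -> `|y| <= `|x| ->
  modc (Phi y (z + h) i j) <= B.
Proof.
pose E := expR (2 * (`|complex.Im z| + 1) * `|x|) : R.
exists (E + 1) => [|h y i j h1 yx]; first by rewrite addr_ge0 // expR_ge0.
have le : modc (Phi y (z + h) i j) ^+ 2 <= E.
  apply: (le_trans (fund_bound _ _ _ _)); rewrite ler_expR.
  apply: ler_pM => //.
  rewrite ler_wpM2l // ImD; apply: (le_trans (ler_normD _ _)); rewrite lerD2l.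
  exact: le_trans (Im_le_modc h) (ltW h1).
have m0 := modc_ge0 (Phi y (z + h) i j); have E0 : 0 <= E by exact: expR_ge0.
rewrite leNgt; apply/negP => lt.
have : E + 1 <= modc (Phi y (z + h) i j) ^+ 2.
  apply: (@le_trans _ _ (modc (Phi y (z + h) i j))); first exact: ltW.
  by rewrite expr2 ler_peMr // (le_trans _ (ltW lt)) // lerDr.
by move=> h2; have := le_trans h2 le; rewrite gerDl ler10.
Qed.

Let Psi z w y := dagger (Phi y z^cj) *m sg *m Phi y w.

Let Psi_bound (B : R) (A : M3) z y b : 0 <= B -> (forall i j, modc (Phi y z^cj i j) <= B) ->
  (forall i j, modc (A i j) <= b) ->
  forall i j, modc ((dagger (Phi y z^cj) *m sg *m A) i j) <= 3 * (3 * B * 1) * b.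
Proof.
move=> B0 hB hA; apply: mul3_le => //; first by rewrite !mulr_ge0.
apply: mul3_le => // i j; last exact: sg_le.
by rewrite daggerE modc_conj.
Qed.

Let conj_bound z (x : R) : exists2 B : R, 0 <= B & (forall (y : R) i j, `|y| <= `|x| -> modc (Phi y z^cj i j) <= B) /\
  forall h (y : R) i j, modc h < 1 -> `|y| <= `|x| -> modc (Phi y (z + h) i j) <= B.
Proof.
have [B1 B10 h1] := fund_unif_bound z x; have [B2 B20 h2] := fund_unif_bound z^cj x.
exists (B1 + B2); first exact: addr_ge0.
split=> [y i j yx|h y i j hh yx].
  have := h2 0 y i j; rewrite addr0 modc0 => /(_ ltr01 yx) h; apply: (le_trans h).
  by rewrite lerDr.
by apply: (le_trans (h1 h y i j hh yx)); rewrite lerDl.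
Qed.

Let fund_diff z w y : Phi y w - Phi y z = Phi y z *m (dagger (Phi y z^cj) *m Phi y w - 1%:M).
Proof. by rewrite mulmxBr mulmxA (fund_inv' F) mul1mx mulmx1. Qed.

Lemma fund_lipschitz z (x : R) : exists2 K : R, 0 <= K & forall h (y : R) i j, modc h < 1 -> `|y| <= `|x| ->
  modc (Phi y (z + h) i j - Phi y z i j) <= K * modc h.
Proof.
have [B B0 [hB1 hB2]] := conj_bound z x.
exists (3 * B * (3 * (3 * B * 1) * B * `|x|)) => [|h y i j hh yx]; first by rewrite !mulr_ge0.
have e : Phi y (z + h) i j - Phi y z i j = (Phi y (z + h) - Phi y z) i j by rewrite !mxE.
rewrite e fund_diff -[X in _ <= X]mulrA; apply: mul3_le => // [i' j'|i' j'].
  by have := hB2 0 y i' j'; rewrite addr0 modc0; apply.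
have hP0 : (1%:M : M3) i' j' = (dagger (Phi 0 z^cj) *m Phi 0 (z + h)) i' j'.
  by rewrite !(fund_0 F) dagger1 mulmx1.
rewrite [X in modc X]mxE [X in _ + X]mxE hP0.
have := @rder_le_abs (fun t => (dagger (Phi t z^cj) *m Phi t (z + h)) i' j')
  (fun t => (('i * (z + h - z)) *: Psi z (z + h) t) i' j') y (modc h * (3 * (3 * B * 1) * B)).
move=> le; apply: (le_trans (le _ _)).
- by move=> t _; exact: (fund_pair_der F z (z + h) t).
- move=> t ty; have tx := le_trans ty yx.
  rewrite mxE addrAC subrr add0r !modcM modc_i mul1r ler_wpM2l ?modc_ge0 //.
  apply: Psi_bound => // [i'' j''|i'' j'']; [exact: hB1|exact: hB2].
rewrite -[leLHS]mulrA [leRHS]mulrC; apply: ler_wpM2l; first exact: modc_ge0.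
by apply: ler_wpM2l yx; rewrite !mulr_ge0.
Qed.

(** Duhamel's formula expresses the increment of [Phi] in the spectral parameter by an integral
    over [Phi] at both parameters; by the Lipschitz bound one of them may be frozen. *)
Lemma fund_holo x z i j : holo (fun w => Phi x w i j) z.
Proof.
have [B B0 [hB1 hB2]] := conj_bound z x.
have [K K0 hK] := fund_lipschitz z x.
have Psic i' j' : rcont (fun t => Psi z z t i' j').
  apply: mrcontM; last exact: fund_mrcont F z.
  apply: mrcontM; [apply: mrcont_dagger; exact: fund_mrcont F _|exact: mrcont_cst].
pose G (y : R) : M3 := \matrix_(i, j) cint (fun t => Psi z z t i j) 0 y.
exists ((Phi x z *m ('i *: G x)) i j).
apply: (@cdiff_le _ _ _ _ (3 * B * (3 * (3 * B * 1) * K * `|x|))) => e e0.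
exists (Num.min 1 e) => [|h]; first by rewrite lt_min ltr01.
rewrite lt_min => /andP[h1 h2].
have -> : Phi x (z + h) i j - Phi x z i j - (Phi x z *m ('i *: G x)) i j * h =
   (Phi x z *m ((dagger (Phi x z^cj) *m Phi x (z + h) - 1%:M) - ('i * h) *: G x)) i j.
  rewrite mulmxBr -fund_diff [RHS]mxE ![in RHS]mxE; congr (_ - _).
  rewrite [in LHS]mxE mulr_suml; apply: eq_bigr => k _; rewrite !mxE; ring.
have c0 : 0 <= 3 * (3 * B * 1) * K * `|x| by rewrite !mulr_ge0.
apply: (@le_trans _ _ (3 * B * (3 * (3 * B * 1) * K * `|x| * (modc h * modc h)))); last first.
  rewrite -!(mulrA (3 * B)); apply: ler_wpM2l; first by rewrite mulr_ge0.
  rewrite -(mulrA (3 * (3 * B * 1) * K * `|x|)); apply: ler_wpM2l => //.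
  by apply: ler_wpM2r; [exact: modc_ge0|exact: ltW].
apply: mul3_le => // [i' j'|i' j'].
  by have := hB2 0 x i' j'; rewrite addr0 modc0; apply.
pose L t := (dagger (Phi t z^cj) *m Phi t (z + h)) i' j' - ('i * h) * G t i' j'.
have -> : (dagger (Phi x z^cj) *m Phi x (z + h) - 1%:M - ('i * h) *: G x) i' j' = L x - L 0.
  have -> : L 0 = (1%:M : M3) i' j'.
    by rewrite /L !(fund_0 F) dagger1 mulmx1 [G _ _ _]mxE cint_id mulr0 subr0.
  by rewrite /L [X in X = _]mxE [X in X + _ = _]mxE [X in _ + X = _]mxE [X in _ + X - _ = _]mxE [X in _ - X = _]mxE; ring.
have := @rder_le_abs L (fun t => ('i * h) * (dagger (Phi t z^cj) *m sg *m (Phi t (z + h) - Phi t z)) i' j')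
  x (modc h * (3 * (3 * B * 1) * (K * modc h))).
move=> le; apply: (le_trans (le _ _)).
- move=> t _; apply: rder_eq (rderB (fund_pair_der F z (z + h) t i' j') (rderZ ('i * h) _)) _.
    apply: (@rder_ext _ (fun y => cint (fun t => Psi z z t i' j') 0 y)); first by move=> y; rewrite mxE.
    exact: cint_rder (Psic i' j').
  rewrite mulmxBr -/(Psi z (z + h) t) -/(Psi z z t) mxE [in RHS]mxE [(- Psi z z t) _ _]mxE.
  by rewrite addrAC subrr add0r; ring.
- move=> t tx; rewrite !modcM modc_i mul1r ler_wpM2l ?modc_ge0 //.
  apply: Psi_bound => // [i'' j''|i'' j'']; first exact: hB1.
  by rewrite !mxE; exact: hK.
by rewrite le_eqVlt; apply/orP; left; apply/eqP; ring.
Qed.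

End FundamentalSpectral.

(** * Lebesgue integrals of complex functions *)

Section LebesgueToPrimitive.
Context {R : realType}.
Notation C := R[i].
Notation mu := (@lebesgue_measure R).
Notation measR := (@measurable _ (measurableTypeR R)).

Lemma Rintegral_rprim (f : R -> R) (a b : R) : continuous f -> a <= b ->
  (\int[mu]_(t in `]a, b]) f t)%R = rprim f b - rprim f a.
Proof.
move=> fc; rewrite le_eqVlt => /orP[/eqP ->|ab].
  by rewrite subrr set_itvoc0 // Rintegral_set0.
rewrite Rintegral_itv_obnd_cbnd; last first.
  apply: integrableS (continuous_integrable a b fc) => //.
  by apply: subset_itv; rewrite bnd_simp.
have d (t : R) : is_derive t 1 (rprim f) (f t) := rprimP fc t.
have cr : continuous (rprim f).
  by move=> t; have [/derivable1_diffP/differentiable_continuous + _] := d t.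
have := @continuous_FTC2 _ f (rprim f) a b ab (continuous_subspaceT fc).
rewrite /Rintegral => ->.
- by rewrite -EFinB.
- split=> [t _| |]; first by have [] := d t.
    exact/cvg_at_right_filter/cr.
  exact/cvg_at_left_filter/cr.
- by move=> t _; rewrite derive1E; have [_ ->] := d t.
Qed.

Lemma Cint_cint (f : R -> C) (a b : R) : rcont f -> a <= b -> Cint `]a, b] f = cint f a b.
Proof. by move=> [f1 f2] ab; rewrite /Cint !Rintegral_rprim. Qed.

Lemma eq_Cint (D : set R) (f g : R -> C) : (forall y, D y -> f y = g y) -> Cint D f = Cint D g.
Proof.
by move=> fg; rewrite /Cint; congr (_ +i* _); apply: eq_Rintegral => y;
  rewrite inE => Dy; rewrite fg.
Qed.

Lemma Cint_itvB (f : R -> C) (a b : itv_bound R) (x : R) :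
  Cintegrable [set` Interval a b] f -> (a <= BRight x)%O -> (BRight x <= b)%O ->
  Cint [set` Interval a b] f - Cint [set` Interval a (BRight x)] f =
  Cint [set` Interval (BRight x) b] f.
Proof.
move=> [f1 f2] ax xb; apply: eqC; rewrite ?ReB ?ImB /=.
  exact: (Rintegral_itvB f1).
exact: (Rintegral_itvB f2).
Qed.

Lemma Cint_obnd_cbnd (f : R -> C) (x : R) (b : itv_bound R) :
  Cintegrable [set` Interval (BRight x) b] f ->
  Cint [set` Interval (BRight x) b] f = Cint [set` Interval (BLeft x) b] f.
Proof. by move=> [f1 f2]; rewrite /Cint !Rintegral_itv_obnd_cbnd. Qed.

Lemma CintegrableS (A B : set R) (f : R -> C) : measR B -> measR A -> A `<=` B ->
  Cintegrable B f -> Cintegrable A f.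
Proof. by move=> mB mA AB [f1 f2]; split; [exact: integrableS f1|exact: integrableS f2]. Qed.

Lemma eq_Cintegrable (D : set R) (f g : R -> C) : measR D ->
  (forall y, D y -> f y = g y) -> Cintegrable D f -> Cintegrable D g.
Proof.
move=> mD fg [f1 f2]; split.
  by apply: (eq_integrable mD _ _ _ f1) => y; rewrite inE => Dy /=; rewrite fg.
by apply: (eq_integrable mD _ _ _ f2) => y; rewrite inE => Dy /=; rewrite fg.
Qed.

Lemma CintegrableD (D : set R) (f g : R -> C) : measR D ->
  Cintegrable D f -> Cintegrable D g -> Cintegrable D (fun y => f y + g y).
Proof.
move=> mD [f1 f2] [g1 g2]; split.
  apply: (eq_integrable mD _ _ _ (integrableD mD f1 g1)) => y _ /=; by rewrite -EFinD -ReD.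
apply: (eq_integrable mD _ _ _ (integrableD mD f2 g2)) => y _ /=; by rewrite -EFinD -ImD.
Qed.

Lemma CintegrableZ (D : set R) (c : C) (f : R -> C) : measR D ->
  Cintegrable D f -> Cintegrable D (fun y => c * f y).
Proof.
move=> mD [f1 f2]; split.
  apply: (eq_integrable mD _ _ _ (integrableB mD (integrableZl mD (complex.Re c) f1) (integrableZl mD (complex.Im c) f2))) => y _ /=.
  by rewrite -!EFinM -EFinB ReM.
apply: (eq_integrable mD _ _ _ (integrableD mD (integrableZl mD (complex.Re c) f2) (integrableZl mD (complex.Im c) f1))) => y _ /=.
by rewrite -!EFinM -EFinD ImM.
Qed.

Lemma CintD (D : set R) (f g : R -> C) : measR D ->
  Cintegrable D f -> Cintegrable D g -> Cint D (fun y => f y + g y) = Cint D f + Cint D g.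
Proof.
move=> mD [f1 f2] [g1 g2]; apply: eqC; rewrite ?ReD ?ImD /=.
  by under eq_Rintegral do rewrite ReD; rewrite RintegralD.
by under eq_Rintegral do rewrite ImD; rewrite RintegralD.
Qed.

Lemma CintZ (D : set R) (c : C) (f : R -> C) : measR D ->
  Cintegrable D f -> Cint D (fun y => c * f y) = c * Cint D f.
Proof.
move=> mD [f1 f2]; apply: eqC.
  rewrite ReM /=; under eq_Rintegral do rewrite ReM.
  rewrite RintegralB ?RintegralZl //.
    exact: (integrableZl mD (complex.Re c) f1).
  exact: (integrableZl mD (complex.Im c) f2).
rewrite ImM /=; under eq_Rintegral do rewrite ImM.
rewrite RintegralD ?RintegralZl //.
  exact: (integrableZl mD (complex.Re c) f2).
exact: (integrableZl mD (complex.Im c) f1).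
Qed.

Lemma CintegrableMr (D : set R) (I : Type) (s : seq I) (c : I -> C) (f : I -> R -> C) : measR D ->
  (forall i, Cintegrable D (f i)) -> Cintegrable D (fun y => \sum_(i <- s) f i y * c i).
Proof.
move=> mD h; elim: s => [|i s IH].
  apply: (eq_Cintegrable (f := fun=> 0) mD) => [y _|]; first by rewrite big_nil.
  by split; exact: integrable0.
apply: (eq_Cintegrable (f := fun y => c i * f i y + \sum_(i <- s) f i y * c i) mD).
  by move=> y _; rewrite big_cons mulrC.
by apply: CintegrableD => //; exact: CintegrableZ.
Qed.

Lemma Cint_sumr (D : set R) (I : Type) (s : seq I) (c : I -> C) (f : I -> R -> C) : measR D ->
  (forall i, Cintegrable D (f i)) ->
  Cint D (fun y => \sum_(i <- s) f i y * c i) = \sum_(i <- s) Cint D (f i) * c i.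
Proof.
move=> mD h; elim: s => [|i s IH].
  rewrite big_nil (eq_Cint (g := fun=> 0)) => [|y _]; last by rewrite big_nil.
  by rewrite /Cint /= !Rintegral_cst //= !mul0r.
rewrite big_cons (eq_Cint (g := fun y => c i * f i y + \sum_(i <- s) f i y * c i)); last first.
  by move=> y _; rewrite big_cons mulrC.
rewrite CintD //; [|exact: CintegrableZ|exact: CintegrableMr].
by rewrite CintZ // IH mulrC.
Qed.

(** Dominated convergence: every point leaves the sets [B n]. *)
Lemma Rintegral_tail (D : set R) (B : nat -> set R) (f : R -> R) (e : R) :
  measR D -> (forall n, measR (B n)) -> mu.-integrable D (EFin \o f) ->
  (forall x, exists N, forall n, (N <= n)%N -> ~ B n x) -> 0 < e ->
  exists N, forall n, (N <= n)%N -> `|(\int[mu]_(x in D `&` B n) f x)%R| <= e.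
Proof.
move=> mD mB fi Bx e0.
have int_n n : mu.-integrable D (EFin \o (f \_ (B n))).
  rewrite -restrict_EFin; apply/integrable_restrict => //.
  by apply: integrableS fi => //; exact: measurableI.
have mr n := measurable_int _ (int_n n).
have cv : (\int[mu]_(x in D) (EFin \o (f \_ (B n))) x)%E @[n --> \oo] --> (\int[mu]_(x in D) (cst 0 x))%E.
  apply: (@dominated_cvg _ _ _ mu D mD _ _ (abse \o (EFin \o f))) => //.
  - move=> x _; have [N hN] := Bx x.
    apply: cvg_near_cst; exists N => // n /= Nn.
    by rewrite patchE memNset //; exact: hN.
  - exact: integrable_abse.
  - move=> n x _ /=; rewrite patchE; case: ifP => _ //.
    by rewrite normr0 lee_fin.
rewrite integral0 in cv.
have cv' : fine (\int[mu]_(x in D) (EFin \o f \_ (B n)) x)%E @[n --> \oo] --> (0 : R) by exact: fine_cvg cv.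
have /cvgrPdist_le/(_ _ e0)[N _ hN] := cv'.
exists N => n Nn; have := hN n Nn; rewrite sub0r normrN /=.
by rewrite Rintegral_mkcondr.
Qed.

End LebesgueToPrimitive.

(** * What is used of the Sobolev class *)

Section SobolevData.
Context {R : realType}.
Notation C := R[i].
Notation mu := (@lebesgue_measure R).

(** The only trace of the square-integrable derivative: a Cauchy-Schwarz bound on increments
    in terms of a bounded monotone function (a multiple of the integral of its square), with
    a free parameter replacing the square root. *)
Definition sobolev (u : R -> C) (gam : R -> R) (W : R) := [/\
  forall s t, s <= t -> gam s <= gam t,
  forall t, 0 <= gam t <= W &
  forall s t lam : R, s <= t -> 0 < lam ->
    modc (u t - u s) <= (lam * (t - s) + (gam t - gam s) / lam) / 2].

(** Cauchy-Schwarz in the form of the arithmetic-geometric inequality, integrated. *)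
Lemma sqr_integrable_bound (g : R -> R) : g \in Lfun mu 2%:E ->
  exists gam W, [/\ forall s t, s <= t -> gam s <= gam t, forall t, 0 <= gam t <= W &
    forall s t lam : R, s <= t -> 0 < lam ->
      `|(\int[mu]_(y in `[s, t]) g y)%R| <= (lam * (t - s) + (gam t - gam s) / lam) / 2].
Proof.
move=> g2; have gi := Lfun2_integrable_sqr g2.
move: g2; rewrite inE => /andP[+ _]; rewrite inE /= => mg.
pose gam t := (\int[mu]_(y in `]-oo, t]) (g y ^+ 2))%R.
have giS (D : set (measurableTypeR R)) : measurable D -> mu.-integrable D (EFin \o (fun y => g y ^+ 2)).
  by move=> mD; exact: integrableS gi.
have gamB s t : s <= t -> gam t - gam s = (\int[mu]_(y in `]s, t]) (g y ^+ 2))%R.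
  by move=> st; apply: Rintegral_itvB; [exact: giS|by []|rewrite bnd_simp].
have mono s t : s <= t -> gam s <= gam t.
  by move=> st; rewrite -subr_ge0 gamB //; apply: Rintegral_ge0 => y _; exact: sqr_ge0.
exists gam, (\int[mu]_y (g y ^+ 2))%R; split => //.
  move=> t; rewrite Rintegral_ge0 => [|y _]; last exact: sqr_ge0.
  rewrite -subr_ge0; have := @Rintegral_itvB R (fun y => g y ^+ 2) (BInfty R true) (BInfty R false) t.
  rewrite set_itvNyy => -> //; first by apply: Rintegral_ge0 => y _; exact: sqr_ge0.
move=> s t lam st lam0.
have m1 : mu.-integrable `[s, t] (EFin \o (fun=> lam / 2)).
  by apply: continuous_integrable => x; exact: cvg_cst.
have bound y : `|g y| <= lam / 2 + (2 * lam)^-1 * g y ^+ 2.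
  have h0 : 0 <= (`|g y| - lam) ^+ 2 by exact: sqr_ge0.
  rewrite -[g y ^+ 2]real_normK ?num_real //.
  have l2 : 0 < 2 * lam by rewrite mulr_gt0.
  rewrite -subr_ge0; have -> : lam / 2 + (2 * lam)^-1 * `|g y| ^+ 2 - `|g y| = (2 * lam)^-1 * (`|g y| - lam) ^+ 2.
    by field; rewrite gt_eqF.
  by rewrite mulr_ge0 // invr_ge0 ltW.
have iq : mu.-integrable `[s, t] (EFin \o (fun y => g y ^+ 2)) := giS _ (measurable_itv _).
have i2 : mu.-integrable `[s, t] (EFin \o (fun y => (2 * lam)^-1 * g y ^+ 2)).
  have := integrableZl _ (2 * lam)^-1 (giS `[s, t] _).
  by apply => //; exact: measurable_itv.
have i1 : mu.-integrable `[s, t] (EFin \o (fun y => lam / 2 + (2 * lam)^-1 * g y ^+ 2)).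
  by have := integrableD _ m1 i2; apply; exact: measurable_itv.
have ig : mu.-integrable `[s, t] (EFin \o g).
  apply: le_integrable i1 => //.
    by apply/measurable_realfun.measurable_EFinP; apply: measurable_funTS.
  move=> y _ /=; rewrite lee_fin; apply: (le_trans (bound y)); exact: ler_norm.
have ian : mu.-integrable `[s, t] (EFin \o (fun y => `|g y|)) by exact: integrable_norm.
apply: (le_trans (le_normr_Rintegral _ ig)) => //.
apply: (le_trans (le_Rintegral _ ian i1 _)) => //.
rewrite RintegralD //.
rewrite Rintegral_cst //= lebesgue_measure_itv /= lte_fin RintegralZl //.
have <- : (\int[mu]_(y in `]s, t]) (g y ^+ 2))%R = (\int[mu]_(y in `[s, t]) (g y ^+ 2))%R.
  by apply: Rintegral_itv_obnd_cbnd; exact: (giS _ (measurable_itv _)).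
rewrite -gamB // le_eqVlt; apply/orP; left; apply/eqP.
case: ltP => [_|ts]; first by rewrite -EFinB /=; field; rewrite gt_eqF.
have -> : s = t by apply/eqP; rewrite eq_le st.
by rewrite /= mulr0 !subrr mulr0; field; rewrite gt_eqF.
Qed.

Lemma H11_sobolev (u : R -> C) : H11 u -> exists gam W, sobolev u gam W.
Proof.
move=> [[g [[g1 g2] ug]] _].
have [a [A [a1 a2 a3]]] := sqr_integrable_bound g1.
have [b [B [b1 b2 b3]]] := sqr_integrable_bound g2.
exists (fun t => 2 * (a t + b t)), (2 * (A + B)); split.
- by move=> s t st; rewrite ler_pM2l // lerD // ?a1 ?b1.
- move=> t; have /andP[h1 h2] := a2 t; have /andP[h3 h4] := b2 t.
  by rewrite mulr_ge0 ?addr_ge0 //= ler_pM2l // lerD.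
move=> s t lam st l0; rewrite ug //; apply: (le_trans (modc_le_ReIm _)).
have l2 : 0 < lam / 2 by rewrite divr_gt0.
apply: (le_trans (lerD (a3 s t _ st l2) (b3 s t _ st l2))).
rewrite le_eqVlt; apply/orP; left; apply/eqP.
by rewrite /=; field; rewrite gt_eqF.
Qed.

(** The parameter is chosen so large that the bounded monotone term is small; then short
    intervals give small increments. *)
Lemma sobolev_rcont u gam W : sobolev u gam W -> rcont u.
Proof.
move=> [g1 g2 g3]; apply/rcont_epsP => x e e0.
have W0 : 0 <= W by have /andP[] := g2 0; exact: le_trans.
pose lam := (W + 1) / e; have l0 : 0 < lam by rewrite divr_gt0 // ltr_wpDl.
have aux s t : s <= t -> lam * (t - s) < e -> modc (u t - u s) < e.
  move=> st h; apply: (le_lt_trans (g3 s t lam st l0)).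
  have : (gam t - gam s) / lam < e.
    have /andP[h1 h2] := g2 t; have /andP[h3 h4] := g2 s.
    rewrite ltr_pdivrMr // /lam mulrC divfK ?gt_eqF //.
    by clear -h2 h3; lra.
  by clear -h; lra.
exists (e / lam) => [|y]; first by rewrite divr_gt0.
rewrite ltr_pdivlMr // mulrC => h.
have [xy|/ltW yx] := leP x y.
  by apply: aux => //; rewrite ger0_norm ?subr_ge0 in h.
by rewrite modcBC; apply: aux => //; rewrite distrC ger0_norm ?subr_ge0 in h.
Qed.

Lemma modc_continuous (u : R -> C) : rcont u -> continuous (fun y => modc (u y)).
Proof.
move=> /rcont_epsP uc x; apply/cvgrPdist_lt => e e0; have [d d0 hd] := uc x e e0.
apply/nbhs_normP; exists d => // y; rewrite /ball_ /= distrC => /hd.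
apply: le_lt_trans; rewrite ler_norml.
have := modc_sub_le (u x) (u y); have := modc_sub_le (u y) (u x); rewrite [modc (u x - u y)]modcBC.
by clear; lra.
Qed.

(** Primitive of the modulus: the finite-interval form of integrability. *)
Definition absprim (u : R -> C) : R -> R := rprim (fun y => modc (u y)).

Lemma absprimP u (x : R) : rcont u -> is_derive x 1 (absprim u) (modc (u x)).
Proof. by move=> uc; apply: rprimP; exact: modc_continuous. Qed.

Lemma absprim_mono (u : R -> C) (s t : R) : rcont u -> s <= t -> absprim u s <= absprim u t.
Proof.
move=> uc st; apply: (derive_ge0_le st (df := fun y => modc (u y))) => x _; first exact: absprimP.
exact: modc_ge0.
Qed.

Definition tails_vanish (u : R -> C) := forall e : R, 0 < e -> exists2 A : R, 0 < A &
  forall s t, s <= t -> (t <= - A) || (A <= s) -> absprim u t - absprim u s <= e.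

(** The weight yields integrability by the arithmetic-geometric inequality. *)
Lemma H11_tails (u : R -> C) : H11 u -> tails_vanish u.
Proof.
move=> hu; have [gam [W0 hs]] := H11_sobolev hu; have uc := sobolev_rcont hs.
have [_ [h1 h2]] := hu.
have i1 := Lfun2_integrable_sqr h1; have i2 := Lfun2_integrable_sqr h2.
pose phi (y : R) : R := complex.Re (y%:C * u y) ^+ 2 + complex.Im (y%:C * u y) ^+ 2.
have phiE y : phi y = y ^+ 2 * modc (u y) ^+ 2.
  by rewrite /phi -sqr_modc modcM modc_real exprMn real_normK ?num_real.
have phic : continuous phi.
  have -> : phi = (fun y => (y * modc (u y)) * (y * modc (u y))).
    by apply/funext => y; rewrite phiE -exprMn expr2.
  have mc := modc_continuous uc.
  have mc' : continuous (fun y : R => y * modc (u y)).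
    by move=> y; apply: cvgM; [exact: cvg_id|exact: mc].
  by move=> y; apply: cvgM; exact: mc'.
have ip : mu.-integrable setT (EFin \o phi) by exact: integrableD i1 i2.
pose W := (\int[mu]_y phi y)%R.
have phi0 y : 0 <= phi y by rewrite phiE mulr_ge0 // sqr_ge0.
have ipS (D : set (measurableTypeR R)) : measurable D -> mu.-integrable D (EFin \o phi).
  by move=> mD; exact: integrableS ip.
have hW s t : s <= t -> rprim phi t - rprim phi s <= W.
  move=> st; rewrite -Rintegral_rprim //.
  have e1 := @Rintegral_itvB R phi (BInfty R true) (BInfty R false) t ltac:(by rewrite set_itvNyy).
  have e2 := @Rintegral_itvB R phi (BInfty R true) (BRight t) s (ipS _ _).
  rewrite -e2 // ?bnd_simp //.
  have p1 : 0 <= (\int[mu]_(y in [set` Interval (BRight t) +oo%O]) phi y)%R by apply: Rintegral_ge0.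
  have p2 : 0 <= (\int[mu]_(y in [set` Interval -oo%O (BRight s)]) phi y)%R by apply: Rintegral_ge0.
  rewrite -e1 // set_itvNyy in p1; rewrite /W.
  by move: p1 p2; clear; lra.
have Wge0 : 0 <= W by apply: Rintegral_ge0.
move=> e e0; pose lam := (W + 1) / e; have l0 : 0 < lam by rewrite divr_gt0 // ltr_wpDl.
exists (lam / e) => [|s t st hst]; first by rewrite divr_gt0.
have le0 : 0 < lam / e by rewrite divr_gt0.
have nz y : s <= y <= t -> y != 0.
  move=> /andP[y1 y2]; case/orP: hst => h; [rewrite lt_eqF //|rewrite gt_eqF //]; clear -y1 y2 h le0; lra.
(* majorizes the primitive of the modulus: 2|u| <= lam / y^2 + y^2 |u|^2 / lam *)
pose G (y : R) := (- lam * y^-1 + lam^-1 * rprim phi y) / 2.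
have dG (y : R) : s <= y <= t -> is_derive y 1 G ((lam / y ^+ 2 + phi y / lam) / 2).
  move=> /nz y0.
  have d1 : is_derive y 1 (fun t : R => t^-1) (- y ^- 2).
    by apply: is_derive_eq; [apply: is_deriveV|rewrite /GRing.scale /= mulr1].
  have d2 := is_deriveM' (is_derive_cst (- lam) y 1) d1.
  have d3 := is_deriveM' (is_derive_cst lam^-1 y 1) (rprimP phic y).
  have d4 := is_deriveM' (is_deriveD' d2 d3) (is_derive_cst (2^-1 : R) y 1).
  by apply: (is_derive_eq d4); rewrite /=; field; rewrite gt_eqF.
have key : absprim u t - absprim u s <= G t - G s.
  have := @derive_ge0_le _ (fun y => G y - absprim u y) (fun y => (lam / y ^+ 2 + phi y / lam) / 2 - modc (u y)) s t st.
  move=> h; have {}h : G s - absprim u s <= G t - absprim u t.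
    apply: h => y yst; first by apply: is_deriveB'; [exact: dG|exact: absprimP].
    have y0 := nz y yst; rewrite phiE.
    have -> : (lam / y ^+ 2 + y ^+ 2 * modc (u y) ^+ 2 / lam) / 2 - modc (u y) =
       (2 * lam)^-1 * (lam / `|y| - `|y| * modc (u y)) ^+ 2.
      rewrite -[y ^+ 2]real_normK ?num_real //.
      have ny : `|y| != 0 by rewrite normr_eq0.
      have nl : lam != 0 by rewrite gt_eqF.
      by field; rewrite ny nl.
    by rewrite mulr_ge0 ?sqr_ge0 // invr_ge0 mulr_ge0 // ltW.
  by clear -h; lra.
apply: (le_trans key).
have w := hW s t st.
have wl : lam^-1 * (rprim phi t - rprim phi s) <= e.
  apply: (@le_trans _ _ (lam^-1 * W)); first by rewrite ler_wpM2l // invr_ge0 ltW.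
  rewrite mulrC ler_pdivrMr // /lam mulrC divfK ?gt_eqF //.
  by clear; lra.
have inv : - lam * t^-1 + lam * s^-1 <= e.
  case/orP: hst => h.
    have t0 : t < 0 by clear -h le0; lra.
    have s0 : s < 0 by clear -st t0; lra.
    have : lam * s^-1 <= 0 by rewrite pmulr_rle0 // invr_le0 ltW.
    have : - lam * t^-1 <= e.
      rewrite mulNr -mulrN -invrN ler_pdivrMr ?oppr_gt0 //.
      by rewrite mulrC -ler_pdivrMr // -lerN2 opprK.
    by clear; lra.
  have s0 : 0 < s by clear -h le0; lra.
  have t0 : 0 < t by clear -st s0; lra.
  have : - lam * t^-1 <= 0 by rewrite mulNr oppr_le0 mulr_ge0 ?invr_ge0 // ltW.
  have : lam * s^-1 <= e by rewrite ler_pdivrMr // mulrC -ler_pdivrMr.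
  by clear; lra.
by rewrite /G; move: wl inv; clear; lra.
Qed.

(** Integration by parts without a pointwise derivative of [u]: the term that would contain it is
    replaced by its Cauchy-Schwarz bound.  All terms are additive over intervals, so a failure
    would persist under bisection; but on short intervals [u] and [w] are nearly constant and the
    inequality is the bound on the increment of [u]. *)
Lemma by_parts_le (u w w' : R -> C) (gam G g : R -> R) (W p q : R) : sobolev u gam W ->
  p <= q -> (forall y, rder w y (w' y)) -> rcont w' ->
  (forall y : R, is_derive y 1 G (g y)) -> (forall y, p <= y <= q -> modc (w y) ^+ 2 <= g y) ->
  modc (u q * w q - u p * w p - cint (fun y => u y * w' y) p q) <=
    (gam q - gam p + (G q - G p)) / 2.
Proof.
move=> hs pq dw w'c dG wg; have uc := sobolev_rcont hs; have [g1 g2 g3] := hs.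
have wc := rder_rcont dw.
pose B s t := u t * w t - u s * w s - cint (fun y => u y * w' y) s t.
have uwc : rcont (fun y => u y * w' y) by exact: rcontM.
have Badd s m t : B s t = B s m + B m t.
  by rewrite /B (cint_chain _ s m t); ring.
apply/ler_addgt0Pr => e e0; rewrite -/(B p q).
(* the error [e] is distributed proportionally to length, which keeps [M] additive *)
pose e' := e / (q - p + 1); have qp : 0 < q - p + 1 by clear -pq; lra.
have e'0 : 0 < e' by rewrite divr_gt0.
pose M (s t : R) := (gam t - gam s + (G t - G s)) / 2 + e' * (t - s).
have [le|lt] := leP (modc (B p q)) (M p q).
  apply: (le_trans le); rewrite /M lerD2l /e' mulrAC ler_pdivrMr // ler_wpM2l ?(ltW e0) //.
  by clear; lra.
exfalso.
have [| | |z zQ H] := @bisection _ (fun Q => M (rl Q) (rr Q) < modc (B (rl Q) (rr Q)) /\ rl Q < rr Q) (Rect p q 0 0).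
- by split.
- split => //=; rewrite lt_neqAle pq andbT; apply/eqP => E; move: lt.
  rewrite E /M /B cint_id !subrr modc0 addr0 mul0r mulr0 addr0 ltxx //.
- move=> [a b c d] [/= ab cd] [/= MB ab'].
  have hm1 : a < (a + b) / 2 by clear -ab'; lra.
  have hm2 : (a + b) / 2 < b by clear -ab'; lra.
  have [h|h] := leP (modc (B a ((a + b) / 2))) (M a ((a + b) / 2)); last by exists false, false.
  exists true, false; split => //=.
  have := modcD (B a ((a + b) / 2)) (B ((a + b) / 2) b); rewrite -Badd.
  have -> : M ((a + b) / 2) b = M a b - M a ((a + b) / 2) by rewrite /M; lra.
  by clear -h MB; lra.
set y := complex.Re z.
have [K K0 hK] := rcont_bounded (`|y| + 1) w'c.
pose eta := Num.min 1 (e' / (2 * (K + 1))).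
have K1 : 0 < 2 * (K + 1) by rewrite mulr_gt0 // ltr_wpDl.
have eta0 : 0 < eta by rewrite lt_min ltr01 divr_gt0.
have etaK : eta * (2 * (K + 1)) <= e' by rewrite -ler_pdivlMr // /eta ge_min lexx orbT.
have eta4 : 0 < eta / 4 by rewrite divr_gt0.
have /rcont_epsP/(_ y _ eta4)[d d0 hd] := uc.
have w2c : rcont (fun y => w y * (w y)^cj) by apply: rcontM => //; exact: rcontJ.
have /rcont_epsP/(_ y _ eta4)[d' d'0 hd'] := w2c.
pose r := Num.min 1 (Num.min d d'); have r0 : 0 < r by rewrite !lt_min ltr01 d0.
have [r1 r2 r3] : [/\ r <= 1, r <= d & r <= d'] by split; rewrite /r !ge_min lexx ?orbT.
have [[a b c0 d1] [[/= ab _] [/= MB ab'] zI zS [/= s1 _]]] := H r r0.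
have /andP[/andP[/= ay yb] _] := zI; rewrite -/y in ay yb.
have pa : p <= a /\ b <= q.
  have /andP[cI1 cI2] := zI.
  have /zS/andP[/andP[/= h1 _] _] : inrect (Rect a b c0 d1) (a +i* complex.Im z) by rewrite /inrect /= lexx ab cI2.
  have /zS/andP[/andP[_ /= h2] _] : inrect (Rect a b c0 d1) (b +i* complex.Im z) by rewrite /inrect /= lexx ab cI2.
  by split.
have tn t : a <= t <= b -> `|t - y| < r.
  by move=> /andP[t1 t2]; rewrite ltr_norml; clear -t1 t2 ay yb s1; apply/andP; split; lra.
have abb : a <= b <= b by rewrite ab lexx.
have aab : a <= a <= b by rewrite ab lexx.
have osc t : a <= t <= b -> modc (u a - u t) <= eta / 2.
  move=> tab; have h1 := hd t (lt_le_trans (tn t tab) r2); have h2 := hd a (lt_le_trans (tn a aab) r2).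
  have := modc_tri (u y) (u a) (u t); rewrite [modc (u y - u t)]modcBC.
  by clear -h1 h2; lra.
have w2 t : modc (w t) ^+ 2 = modc (w t * (w t)^cj) by rewrite modcM modc_conj expr2.
have osc2 t : a <= t <= b -> modc (w b) ^+ 2 - eta <= g t.
  move=> tab; apply: le_trans (wg t _); last first.
    by case: pa => pa1 pa2; move: tab => /andP[t1 t2]; rewrite (le_trans pa1) ?(le_trans t2).
  have h1 := hd' t (lt_le_trans (tn t tab) r3); have h2 := hd' b (lt_le_trans (tn b abb) r3).
  rewrite !w2; set X := w b * _ in h2 *; set Y := w t * _ in h1 *; set Z := w y * _ in h1 h2 *.
  have := modc_sub_le X Y; have := modc_tri Z X Y; rewrite [modc (Z - Y)]modcBC.
  by clear -h1 h2 eta0; lra.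
have BE : B a b = (u b - u a) * w b + cint (fun t => (u a - u t) * w' t) a b.
  have c1 : rcont (fun t => u a * w' t) by apply: rcontM => //; exact: rcont_cst.
  have -> : (fun t => (u a - u t) * w' t) = (fun t => u a * w' t - u t * w' t).
    by apply/funext => t; rewrite mulrBl.
  by rewrite cintB // cintZ // (cint_FTC _ _ w'c dw) /B; ring.
have B1 : modc (u b - u a) * modc (w b) <= (modc (w b) ^+ 2 * (b - a) + (gam b - gam a)) / 2.
  have gg : 0 <= gam b - gam a by rewrite subr_ge0 g1.
  have [w0|w0] := eqVneq (modc (w b)) 0.
    by rewrite w0 mulr0 expr0n mul0r add0r divr_ge0.
  have wp : 0 < modc (w b) by rewrite lt_def w0 modc_ge0.
  have := ler_wpM2r (modc_ge0 (w b)) (g3 a b _ ab wp).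
  by congr (_ <= _); field.
have B2 : modc (cint (fun t => (u a - u t) * w' t) a b) <= eta / 2 * K * (b - a).
  apply: cint_le => //; first by apply: rcontM => //; apply: rcontB => //; exact: rcont_cst.
  move=> t tab; rewrite modcM ler_pM ?modc_ge0 ?osc // hK //.
  have := tn t tab; have := ler_normD (t - y) y; rewrite subrK; clear -r1; lra.
have GG : (modc (w b) ^+ 2 - eta) * (b - a) <= G b - G a.
  have dd (t : R) : is_derive t 1 (fun t => G t - (modc (w b) ^+ 2 - eta) * t) (g t - (modc (w b) ^+ 2 - eta)).
    apply: (is_derive_eq (is_deriveB' (dG t) (is_deriveM' (is_derive_cst _ t 1) (is_derive_id t 1)))).
    by rewrite mul0r add0r mulr1.
  have h : G a - (modc (w b) ^+ 2 - eta) * a <= G b - (modc (w b) ^+ 2 - eta) * b.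
    apply: (@derive_ge0_le _ (fun t : R => G t - (modc (w b) ^+ 2 - eta) * t) (fun t : R => g t - (modc (w b) ^+ 2 - eta)) a b ab (fun t _ => dd t)) => t tab.
    by rewrite subr_ge0 osc2.
  by clear -h; lra.
have := modcD ((u b - u a) * w b) (cint (fun t => (u a - u t) * w' t) a b); rewrite -BE modcM => tot.
have eab : eta * (2 * (K + 1)) * (b - a) <= e' * (b - a) by rewrite ler_wpM2r // subr_ge0.
have pos1 : 0 < eta * (b - a) by rewrite mulr_gt0 // subr_gt0.
have pos2 : 0 <= eta * K * (b - a) by rewrite !mulr_ge0 ?subr_ge0 // ltW.
move: MB; rewrite /M; clear -B1 B2 GG tot eab pos1 pos2; lra.
Qed.

End SobolevData.

(** * Volterra equations in the rotating frame *)

Section AbsoluteContinuity.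
Context {R : realType}.
Notation C := R[i].
Notation mu := (@lebesgue_measure R).
Notation measR := (@measurable _ (measurableTypeR R)).

(** Absolute continuity of the integral, on subintervals. *)
Lemma Rintegral_ac (f : R -> R) (a b e : R) : mu.-integrable `]a, b] (EFin \o f) -> 0 < e ->
  exists2 d : R, 0 < d & forall s t, a <= s -> s <= t -> t <= b -> t - s < d ->
    `|(\int[mu]_(y in `]s, t]) f y)%R| <= e.
Proof.
move=> fi e0; pose g := f \_ `]a, b].
have gi : mu.-integrable setT (EFin \o g).
  by rewrite -restrict_EFin; apply/integrable_restrict => //=; rewrite setTI.
have [d [d0 hd]] := integral_normr_continuous gi e0.
exists d => // s t as_ st tb ts.
have mst : measR `]s, t] by exact: measurable_itv.
have sub : `]s, t] `<=` `]a, b] by apply: subset_itv; rewrite bnd_simp.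
have -> : (\int[mu]_(y in `]s, t]) f y)%R = (\int[mu]_(y in `]s, t]) g y)%R.
  apply: eq_Rintegral => y; rewrite inE => /sub yab; rewrite /g patchE ifT //.
  by rewrite inE.
have gst : mu.-integrable `]s, t] (EFin \o g) by exact: integrableS gi.
have m_lt : (mu `]s, t] < d%:E)%E.
  rewrite lebesgue_measure_itv /= lte_fin; case: ifPn => _; last by rewrite lte_fin.
  by rewrite -EFinD lte_fin.
by apply: (le_trans (le_normr_Rintegral mst gst)); exact/ltW/hd.
Qed.

Lemma CintegrableU (f : R -> C) (a : R) : Cintegrable `]-oo, a] f -> Cintegrable `]a, +oo[ f ->
  Cintegrable setT f.
Proof.
have aux (g : R -> R) : mu.-integrable `]-oo, a] (EFin \o g) -> mu.-integrable `]a, +oo[ (EFin \o g) ->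
    mu.-integrable setT (EFin \o g).
  move=> i1 i2.
  have j1 : mu.-integrable setT (EFin \o (g \_ `]-oo, a])).
    by rewrite -restrict_EFin; apply/integrable_restrict => //=; rewrite setTI.
  have j2 : mu.-integrable setT (EFin \o (g \_ `]a, +oo[)).
    by rewrite -restrict_EFin; apply/integrable_restrict => //=; rewrite setTI.
  have := integrableD measurableT j1 j2.
  apply: eq_integrable => // y _ /=; rewrite !patchE -EFinD; congr (_%:E).
  have [ya|ay] := leP y a.
    rewrite ifT ?inE /= ?in_itv //= ifF ?addr0 //; apply/negbTE.
    by rewrite notin_setE /= in_itv /= andbT; apply/negP; rewrite -leNgt.
  rewrite ifF ?add0r ?ifT ?inE /= ?in_itv /= ?ay //; apply/negbTE.
  by rewrite notin_setE /= in_itv /=; apply/negP; rewrite -ltNge.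
by move=> [f1 f2] [f3 f4]; split; exact: aux.
Qed.

(** Freezing the function to the left of [a] gives continuity on the whole line, which is what the
    calculus of primitives asks for. *)
Lemma volterra_continuous (p h : R -> C) (a : R) :
  (forall x, a <= x -> Cintegrable `]a, x] h) ->
  (forall s t, a <= s -> s <= t -> p t - p s = Cint `]s, t] h) ->
  rcont (fun x => p (Num.max a x)).
Proof.
move=> hi hp; apply/rcont_epsP => x e e0.
pose b := Num.max a x + 1; have ab : a <= b by rewrite /b; have := le_max a a x; rewrite lexx /=; lra.
have [i1 i2] := hi b ab; have e4 : 0 < e / 4 by rewrite divr_gt0.
have [d1 d10 h1] := Rintegral_ac i1 e4; have [d2 d20 h2] := Rintegral_ac i2 e4.
exists (Num.min 1 (Num.min d1 d2)) => [|y]; first by rewrite !lt_min ltr01 d10.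
rewrite !lt_min => /and3P[y1 y2 y3].
have aux s t : a <= s -> s <= t -> t <= b -> t - s <= `|y - x| -> modc (p t - p s) < e.
  move=> as_ st tb ts; rewrite hp //; apply: (le_lt_trans (modc_le_ReIm _)).
  have := h1 s t as_ st tb (le_lt_trans ts y2); have := h2 s t as_ st tb (le_lt_trans ts y3).
  by rewrite /Cint /=; set A := `|_|; set B := `|_|; clear -e0; lra.
have yx := ler_norm (y - x); have yx' := ler_norm (x - y); rewrite distrC in yx'.
have [xy|/ltW yx0] := leP x y.
  by apply: aux; rewrite ?/b; case: (leP a x); case: (leP a y); move: yx yx' y1; clear -xy; lra.
rewrite modcBC; apply: aux; rewrite ?/b.
- by case: (leP a y); clear; lra.
- by case: (leP a x); case: (leP a y); clear -yx0; lra.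
- by clear; lra.
- by case: (leP a x); case: (leP a y); move: yx yx'; clear -yx0; lra.
Qed.

End AbsoluteContinuity.

Section RotatedFundamental.
Context {R : realType}.
Notation C := R[i].
Notation M3 := 'M[C]_3.

Lemma ord3E (P : 'I_3 -> Prop) : P j1 -> P j2 -> P j3 -> forall i, P i.
Proof.
move=> h1 h2 h3 [[|[|[|m]]] lt] //; [rewrite (_ : Ordinal _ = j1)|rewrite (_ : Ordinal _ = j2)|rewrite (_ : Ordinal _ = j3)] => //;
exact: val_inj.
Qed.

Lemma sum3 (V : nmodType) (F : 'I_3 -> V) : \sum_i F i = F j1 + (F j2 + F j3).
Proof.
rewrite !big_ord_recl big_ord0 addr0; congr (F _ + (F _ + F _)); exact: val_inj.
Qed.

Lemma det3 (A : M3) : \det A =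
  A j1 j1 * (A j2 j2 * A j3 j3 - A j2 j3 * A j3 j2) -
  A j1 j2 * (A j2 j1 * A j3 j3 - A j2 j3 * A j3 j1) +
  A j1 j3 * (A j2 j1 * A j3 j2 - A j2 j2 * A j3 j1).
Proof.
have d2 (B : 'M[C]_2) : \det B = B 0 0 * B 1 1 - B 0 1 * B 1 0.
  rewrite (expand_det_row _ 0) !big_ord_recl big_ord0 /cofactor !det_mx11 !mxE /= addr0.
  rewrite expr0 expr1 mul1r mulN1r mulrN; congr (_ * B _ _ - _ * B _ _); try exact: val_inj.
  by congr (B _ _); exact: val_inj.
rewrite (expand_det_row _ j1) sum3 /cofactor !d2 !mxE /= expr0 expr1 sqrrN expr1n.
pose lf := (fun (i : 'I_3) (j : 'I_2) => lift i j).
have l1 : lift j1 0 = j2 by exact: val_inj.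
have l2 : lift j1 1 = j3 by exact: val_inj.
have l3 : lift j2 0 = j1 by exact: val_inj.
have l4 : lift j2 1 = j3 by exact: val_inj.
have l5 : lift j3 0 = j1 by exact: val_inj.
have l6 : lift j3 1 = j2 by exact: val_inj.
by rewrite l1 l2 l3 l4 l5 l6; ring.
Qed.

Lemma exp_sigma_sg (w : C) : exp_sigma w *m @sg R = @sg R *m exp_sigma w.
Proof. exact: diag_mxC. Qed.

Variables (U : R -> M3) (Phi : R -> C -> M3).
Hypothesis F : fundamental U Phi.
Hypothesis U0 : forall y i, U y i i = 0.

(** The fundamental matrix in the rotating frame: the spectral term disappears, so this matrix
    has limits at infinity and determinant one. *)
Definition rot (x : R) (z : C) : M3 := exp_sigma (- (x%:C * z)) *m Phi x z.

Lemma rot_der z x : mrder (rot^~ z) x (exp_ad (- (x%:C * z)) (U x) *m rot x z).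
Proof.
have h := mrderM (exp_sigma_rder (- z) x) (fund_der F x z).
have E : (fun t => exp_sigma (t%:C * - z) *m Phi t z) = rot^~ z by apply/funext => t; rewrite /rot mulrN.
rewrite E in h; apply: (mrder_eq h); rewrite /rot /exp_ad opprK -!mulmxA (mulmxA (exp_sigma _) (exp_sigma _)).
rewrite exp_sigmaNK mul1mx !mulrN mulmxDl mulmxDr -!scalemxAl -!scalemxAr scaleNr !mulmxA -exp_sigma_sg.
by rewrite addrA addNr add0r.
Qed.

Lemma rot_dagger_mul (x l : R) : dagger (rot x l%:C) *m rot x l%:C = 1%:M.
Proof.
rewrite /rot daggerM dagger_exp_sigma mulmxA -(mulmxA (dagger _)).
have -> : - (- (x%:C * l%:C))^cj = x%:C * l%:C by apply: eqC; rewrite ?ReImE; ring.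
rewrite exp_sigmaNK mulmx1; have := fund_inv F l%:C x.
by have -> : (l%:C)^cj = l%:C by apply: eqC; rewrite ?ReImE ?oppr0.
Qed.

Lemma rot_mul_dagger (x l : R) : rot x l%:C *m dagger (rot x l%:C) = 1%:M.
Proof. exact/mulmx1C/rot_dagger_mul. Qed.

Lemma rot0 z : rot 0 z = 1%:M.
Proof. by rewrite /rot (fund_0 F) mulmx1 mul0r oppr0 exp_sigma0. Qed.

(** The generator in the rotating frame is traceless. *)
Lemma rot_det x z : \det (rot x z) = 1.
Proof.
have d t : rder (fun t => \det (rot t z)) t 0.
  have -> : (fun t => \det (rot t z)) = (fun t =>
    rot t z j1 j1 * (rot t z j2 j2 * rot t z j3 j3 - rot t z j2 j3 * rot t z j3 j2) -
    rot t z j1 j2 * (rot t z j2 j1 * rot t z j3 j3 - rot t z j2 j3 * rot t z j3 j1) +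
    rot t z j1 j3 * (rot t z j2 j1 * rot t z j3 j2 - rot t z j2 j2 * rot t z j3 j1)).
    by apply/funext => s; rewrite det3.
  have r := rot_der z t; set A := exp_ad _ _ in r.
  have Ai i : A i i = 0 by rewrite exp_adE U0 mulr0.
  have m2 i j k l := rderB (rderM (r j2 i) (r j3 j)) (rderM (r j2 k) (r j3 l)).
  apply: (rder_eq (rderD (rderB (rderM (r j1 j1) (m2 j2 j3 j3 j2)) (rderM (r j1 j2) (m2 j1 j3 j3 j1)))
    (rderM (r j1 j3) (m2 j1 j2 j2 j1)))).
  move: Ai; clear; move: A (rot t z) => A B Ai.
  rewrite !mxE !sum3 !Ai; ring.
by rewrite (rder_eq_cstT d 0) rot0 det1.
Qed.

(** A solution is first continuous, being an indefinite integral; then its integrand is continuous,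
    so it is differentiable and solves the same equation as [rot], hence is a multiple of it. *)
Lemma volterra_evolution (l a : R) (p h : R -> M3) :
  (forall x, a <= x -> mx_integrable `]a, x] h) ->
  (forall s t, a <= s -> s <= t -> p t - p s = mx_int `]s, t] h) ->
  (forall y, a < y -> h y = exp_ad (- (y%:C * l%:C)) (U y) *m p y) ->
  forall x, a <= x -> p x = rot x l%:C *m (dagger (rot a l%:C) *m p a).
Proof.
move=> hi hp hE.
have tU : mrcont (fun y => exp_ad (- (y%:C * l%:C)) (U y)).
  have c i j : rcont (fun y => cexp ('i * (- (y%:C * l%:C)) * (sigma_diag 0 i - sigma_diag 0 j))).
    apply: rder_rcont => x; apply: rder_cexp.
    have -> : (fun y : R => 'i * - (y%:C * l%:C) * (sigma_diag 0 i - sigma_diag 0 j)) =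
      (fun y => (- 'i * l%:C * (sigma_diag 0 i - sigma_diag 0 j)) * y%:C) by apply/funext => y; ring.
    exact: rderZ (rder_id x).
  move=> i j; have -> : (fun y => exp_ad (- (y%:C * l%:C)) (U y) i j) =
    (fun y => cexp ('i * (- (y%:C * l%:C)) * (sigma_diag 0 i - sigma_diag 0 j)) * U y i j).
    by apply/funext => y; rewrite exp_adE.
  by apply: rcontM => //; exact: (fund_cont F).
pose g y := exp_ad (- (y%:C * l%:C)) (U y) *m p (Num.max a y).
have gc : mrcont g.
  apply: mrcontM => // i j; apply: (volterra_continuous (p := fun x => p x i j) (h := fun y => h y i j)).
    by move=> x ax; exact: hi.
  by move=> s t as_ st; have := congr1 (fun A : M3 => A i j) (hp s t as_ st); rewrite !mxE.
pose P x : M3 := \matrix_(i, j) (p a i j + cint (fun y => g y i j) a x).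
have dP x : mrder P x (g x).
  move=> i j; have -> : (fun t => P t i j) = (fun t => p a i j + cint (fun y => g y i j) a t).
    by apply/funext => t; rewrite mxE.
  by apply: (rder_eq (rderD (rder_cst _ _) (cint_rder a x (gc i j)))); rewrite add0r.
have PE x : a <= x -> P x = p x.
  move=> ax; apply/matrixP => i j; rewrite mxE -(Cint_cint (gc i j) ax).
  have := congr1 (fun A : M3 => A i j) (hp a x (lexx a) ax); rewrite !mxE => E.
  rewrite -[RHS](subrK (p a i j)) E addrC; congr (_ + _); apply: eq_Cint => y.
  by rewrite /= in_itv /= => /andP[ay _]; rewrite /g hE // max_r // ltW.
have dG x : a <= x -> mrder (fun t => dagger (rot t l%:C) *m P t) x 0.
  move=> ax; apply: (mrder_eq (mrderM (mrder_dagger (rot_der l%:C x)) (dP x))).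
  rewrite daggerM dagger_exp_ad (fund_anti F) /g max_r // PE // -mulmxA.
  have -> : (- (x%:C * l%:C))^cj = - (x%:C * l%:C) by apply: eqC; rewrite ?ReImE; ring.
  rewrite -mulmxDr -mulmxDl; set A := exp_ad _ (- _).
  have -> : A = - exp_ad (- (x%:C * l%:C)) (U x) by rewrite /A /exp_ad mulmxN mulNmx.
  by rewrite addNr mul0mx mulmx0.
move=> x ax; rewrite -(PE a) // -(PE x) //.
have E : dagger (rot x l%:C) *m P x = dagger (rot a l%:C) *m P a.
  apply/matrixP => i j; apply: (rder_eq_cst (F := fun t => (dagger (rot t l%:C) *m P t) i j) ax).
  by move=> y /andP[ay _]; have := dG y ay i j; rewrite [(0 : M3) i j]mxE.
by rewrite -E mulmxA rot_mul_dagger mul1mx.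
Qed.

End RotatedFundamental.

(** * Jost functions on the real axis *)

Section JostLine.
Context {R : realType}.
Notation C := R[i].
Notation M3 := 'M[C]_3.
Notation mu := (@lebesgue_measure R).
Notation measR := (@measurable _ (measurableTypeR R)).

Lemma unitary_le (W : M3) i j : dagger W *m W = 1%:M -> modc (W i j) <= 1.
Proof.
move=> h; have := congr1 (fun A : M3 => complex.Re (A j j)) h; rewrite !mxE ReSum eqxx Re1 => E.
rewrite -(@expr_le1 _ 2) ?modc_ge0 // -E (bigD1 i) //= daggerE.
have t (z : C) : complex.Re (z^cj * z) = modc z ^+ 2 by rewrite sqr_modc !ReImE; ring.
rewrite t lerDl; apply: sumr_ge0 => k _; by rewrite daggerE t sqr_ge0.
Qed.

Lemma unitary_change (P Q g : M3) : dagger P *m P = 1%:M -> dagger Q *m Q = 1%:M ->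
  dagger (P *m (dagger Q *m g)) *m (P *m (dagger Q *m g)) = dagger g *m g.
Proof.
move=> hP hQ; rewrite !daggerM daggerK -!mulmxA (mulmxA (dagger P)) hP mul1mx (mulmxA Q).
by rewrite (mulmx1C hQ) mul1mx.
Qed.

Lemma unitary_mul (P Q : M3) : dagger P *m P = 1%:M -> dagger Q *m Q = 1%:M ->
  dagger (P *m dagger Q) *m (P *m dagger Q) = 1%:M.
Proof.
move=> hP hQ; have := unitary_change 1%:M hP hQ.
by rewrite !mulmx1 dagger1.
Qed.

Lemma det_change (P Q g : M3) : \det P = 1 -> \det Q = 1 ->
  \det (P *m (dagger Q *m g)) = \det g.
Proof.
have c1 : (1 : C)^cj = 1 by apply: eqC; rewrite ?ReImE ?oppr0.
by move=> hP hQ; rewrite !det_mulmx det_dagger hP hQ c1 !mul1r.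
Qed.

Lemma exp_ad_le (w : C) (A : M3) i j : complex.Im w = 0 -> modc (exp_ad w A i j) = modc (A i j).
Proof.
move=> w0; rewrite exp_adE modcM modc_cexp.
rewrite (_ : complex.Re _ = 0) ?expR0 ?mul1r //.
by rewrite !mxE; case: ifP => _; case: ifP => _; rewrite !ReImE w0 !(mulr0, mul0r, oppr0, subr0, subrr).
Qed.

Lemma exp_ad_integrable (w : C) (D : set R) (h : R -> M3) : measR D ->
  mx_integrable D h -> mx_integrable D (fun y => exp_ad w (h y)).
Proof.
move=> mD hi i j; pose c : C := cexp ('i * w * (sigma_diag 0 i - sigma_diag 0 j)).
apply: (eq_Cintegrable (f := fun y => c * h y i j) mD) => [y _|]; first by rewrite exp_adE.
by apply: CintegrableZ.
Qed.

Lemma exp_ad_int (w : C) (D : set R) (h : R -> M3) : measR D -> mx_integrable D h ->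
  mx_int D (fun y => exp_ad w (h y)) = exp_ad w (mx_int D h).
Proof.
move=> mD hi; apply/matrixP => i j; rewrite exp_adE [LHS]mxE [mx_int D h i j]mxE -(CintZ _ mD (hi i j)).
by apply: eq_Cint => y _; rewrite exp_adE.
Qed.

Lemma ev_ord3 (P : 'I_3 -> nat -> Prop) : (forall i, exists N, forall n, (N <= n)%N -> P i n) ->
  exists N, forall n, (N <= n)%N -> forall i, P i n.
Proof.
move=> h; have [a ha] := h j1; have [b hb] := h j2; have [c hc] := h j3.
exists (maxn a (maxn b c)) => n; rewrite !geq_max => /and3P[na nb nc].
by apply: ord3E; [exact: ha|exact: hb|exact: hc].
Qed.

Lemma mx_int_tail (D : set R) (B : nat -> set R) (h : R -> M3) (e : R) :
  measR D -> (forall n, measR (B n)) -> mx_integrable D h ->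
  (forall x, exists N, forall n, (N <= n)%N -> ~ B n x) -> 0 < e ->
  exists N, forall n, (N <= n)%N -> forall i j, modc (mx_int (D `&` B n) h i j) <= e.
Proof.
move=> mD mB hi Bx e0; apply: ev_ord3 => i; apply: ev_ord3 => j.
have [h1 h2] := hi i j; have e2 : 0 < e / 2 by rewrite divr_gt0.
have [N1 H1] := Rintegral_tail mD mB h1 Bx e2; have [N2 H2] := Rintegral_tail mD mB h2 Bx e2.
exists (maxn N1 N2) => n; rewrite geq_max => /andP[n1 n2]; rewrite mxE.
apply: (le_trans (modc_le_ReIm _)); have := H1 n n1; have := H2 n n2; rewrite /Cint /=.
by set a := `|_|; set b := `|_|; clear; lra.
Qed.

(** Jost functions seen in the rotating frame: the spectral parameter now only enters through
    the potential. *)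
Definition frame (l : R) (m : R -> R -> M3) (x : R) : M3 := exp_ad (- (x%:C * l%:C)) (m x l).

Definition frame_integrand (Q : R -> M3) (l : R) (m : R -> R -> M3) (y : R) : M3 :=
  exp_ad (- (y%:C * l%:C)) (Q y *m m y l).

Lemma frame_integrandE Q l m y :
  frame_integrand Q l m y = exp_ad (- (y%:C * l%:C)) (Q y) *m frame l m y.
Proof. exact: exp_adM. Qed.

Lemma jost_integrandE Q m (x l y : R) :
  jost_integrand Q m x l y = exp_ad (x%:C * l%:C) (frame_integrand Q l m y).
Proof.
rewrite /jost_integrand /frame_integrand -exp_adD; congr (exp_ad _ _).
by apply: eqC; rewrite !ReImE; ring.
Qed.

Lemma frame_integrable Q l m (x : R) (D : set R) : measR D ->
  mx_integrable D (jost_integrand Q m x l) -> mx_integrable D (frame_integrand Q l m).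
Proof.
move=> mD hi.
have := exp_ad_integrable (- (x%:C * l%:C)) mD hi.
move=> h i j; apply: (eq_Cintegrable mD _ (h i j)) => y _.
by rewrite jost_integrandE -exp_adD addNr exp_ad0.
Qed.

Lemma frame_int Q l m (x : R) (D : set R) : measR D ->
  mx_integrable D (jost_integrand Q m x l) ->
  exp_ad (- (x%:C * l%:C)) (mx_int D (jost_integrand Q m x l)) = mx_int D (frame_integrand Q l m).
Proof.
move=> mD hi; rewrite -(exp_ad_int _ mD hi); apply/matrixP => i j; rewrite [LHS]mxE [RHS]mxE.
by apply: eq_Cint => y _; rewrite jost_integrandE -exp_adD addNr exp_ad0.
Qed.

Lemma exp_adDr (w : C) (A B : M3) : exp_ad w (A + B) = exp_ad w A + exp_ad w B.
Proof. by rewrite /exp_ad mulmxDr mulmxDl. Qed.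

Lemma exp_adNr (w : C) (A : M3) : exp_ad w (- A) = - exp_ad w A.
Proof. by rewrite /exp_ad mulmxN mulNmx. Qed.

Lemma frame_minus Q m l : jost_minus Q m -> forall x, mx_integrable `]-oo, x] (frame_integrand Q l m) /\
  frame l m x = 1%:M + mx_int `]-oo, x] (frame_integrand Q l m).
Proof.
move=> J x; have [hi E] := J x l; have mD : measR `]-oo, x] by exact: measurable_itv.
split; first exact: frame_integrable hi.
rewrite -(frame_int mD hi) /frame E.
rewrite exp_adDr.
by rewrite (exp_ad1 (- (x%:C * l%:C))).
Qed.

Lemma frame_plus Q m l : jost_plus Q m -> forall x, mx_integrable `[x, +oo[ (frame_integrand Q l m) /\
  frame l m x = 1%:M - mx_int `[x, +oo[ (frame_integrand Q l m).
Proof.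
move=> J x; have [hi E] := J x l; have mD : measR `[x, +oo[ by exact: measurable_itv.
split; first exact: frame_integrable hi.
rewrite -(frame_int mD hi) /frame E.
rewrite exp_adDr exp_adNr.
by rewrite (exp_ad1 (- (x%:C * l%:C))).
Qed.

Lemma frame_minus_incr Q m l : jost_minus Q m -> forall s t, s <= t ->
  mx_integrable `]s, t] (frame_integrand Q l m) /\
  frame l m t - frame l m s = mx_int `]s, t] (frame_integrand Q l m).
Proof.
move=> J s t st; have [hs Es] := frame_minus l J s; have [ht Et] := frame_minus l J t.
split=> [i j|].
  apply: (CintegrableS _ _ _ (ht i j)); try exact: measurable_itv.
  by apply: subset_itvr; rewrite bnd_simp.
rewrite Es Et opprD addrACA subrr add0r; apply/matrixP => i j; rewrite !mxE.
by apply: (Cint_itvB (ht i j)); rewrite bnd_simp.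
Qed.

Lemma frame_plus_incr Q m l : jost_plus Q m -> forall s t, s <= t ->
  mx_integrable `]s, t] (frame_integrand Q l m) /\
  frame l m t - frame l m s = mx_int `]s, t] (frame_integrand Q l m).
Proof.
move=> J s t st; have [hs Es] := frame_plus l J s; have [ht Et] := frame_plus l J t.
have os (x : R) i j : Cintegrable `[x, +oo[ (fun y => frame_integrand Q l m y i j) ->
    Cintegrable `]x, +oo[ (fun y => frame_integrand Q l m y i j).
  move=> h; apply: (CintegrableS _ _ _ h); try exact: measurable_itv.
  by apply: subset_itvr; rewrite bnd_simp.
split=> [i j|].
  apply: (CintegrableS _ _ _ (hs i j)); try exact: measurable_itv.
  by apply: subset_itv; rewrite bnd_simp.
rewrite Es Et; apply/matrixP => i j; rewrite !mxE.
have hs' := os s i j (hs i j); have ht' := os t i j (ht i j).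
have e := @Cint_itvB _ (fun y => frame_integrand Q l m y i j) (BRight s) +oo%O t hs' _ _.
rewrite !bnd_simp in e; move: (e st isT); rewrite (Cint_obnd_cbnd hs') (Cint_obnd_cbnd ht') => <-.
by set A := Cint _ _; set B := Cint _ _; ring.
Qed.

Lemma frame_plus_limit Q m l : jost_plus Q m -> forall e : R, 0 < e ->
  exists N, forall n, (N <= n)%N -> forall i j, modc (frame l m n%:R i j - (1%:M : M3) i j) <= e.
Proof.
move=> J e e0; have [h0 _] := frame_plus l J 0.
have [||x|N hN] := @mx_int_tail `[0, +oo[ (fun n => `[n%:R, +oo[%classic) _ e _ _ h0 _ e0.
- exact: measurable_itv.
- by move=> n; exact: measurable_itv.
- have := archi_boundP (normr_ge0 x); set N := Num.bound _ => xN; exists N => n Nn.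
  rewrite /= in_itv /= andbT; apply/negP; rewrite -ltNge.
  apply: (le_lt_trans (ler_norm x)); apply: (lt_le_trans xN); by rewrite ler_nat.
exists N => n Nn i j; have [_ ->] := frame_plus l J n%:R.
rewrite !mxE addrAC subrr add0r modcN; have := hN n Nn i j; rewrite mxE.
by rewrite setIidr //; apply: subset_itvr; rewrite bnd_simp.
Qed.

Lemma frame_minus_limit Q m l : jost_minus Q m -> forall e : R, 0 < e ->
  exists N, forall n, (N <= n)%N -> forall i j, modc (frame l m (- n%:R) i j - (1%:M : M3) i j) <= e.
Proof.
move=> J e e0; have [h0 _] := frame_minus l J 0.
have [||x|N hN] := @mx_int_tail `]-oo, 0] (fun n => `]-oo, - n%:R]%classic) _ e _ _ h0 _ e0.
- exact: measurable_itv.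
- by move=> n; exact: measurable_itv.
- have := archi_boundP (normr_ge0 x); set N := Num.bound _ => xN; exists N => n Nn.
  rewrite /= in_itv /=; apply/negP; rewrite -ltNge ltrNl.
  have := ler_norm (- x); rewrite normrN => h; apply: (le_lt_trans h); apply: (lt_le_trans xN).
  by rewrite ler_nat.
exists N => n Nn i j; have [_ ->] := frame_minus l J (- n%:R).
rewrite !mxE addrAC subrr add0r; have := hN n Nn i j; rewrite mxE.
by rewrite setIidr //; apply: subset_itvl; rewrite bnd_simp oppr_le0.
Qed.

Lemma prod3_close (x y z x' y' z' : C) (e : R) : modc x <= 2 -> modc y' <= 2 -> modc y <= 2 -> modc z' <= 2 ->
  modc (x - x') <= e -> modc (y - y') <= e -> modc (z - z') <= e ->
  modc (x * (y * z) - x' * (y' * z')) <= 12 * e.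
Proof.
move=> hx hy' hy hz' ex ey ez; have e0 : 0 <= e := le_trans (modc_ge0 _) ex.
have -> : x * (y * z) - x' * (y' * z') = x * (y * (z - z')) + (x * ((y - y') * z') + (x - x') * (y' * z')) by ring.
apply: (le_trans (modcD _ _)).
have h2 := modcD (x * ((y - y') * z')) ((x - x') * (y' * z')).
have b (p q r : C) (u v w : R) : modc p <= u -> modc q <= v -> modc r <= w -> modc (p * (q * r)) <= u * (v * w).
  by move=> h3 h4 h5; rewrite !modcM !ler_pM ?mulr_ge0 ?modc_ge0.
have := b _ _ _ _ _ _ hx hy ez; have := b _ _ _ _ _ _ hx ey hz'; have := b _ _ _ _ _ _ ex hy' hz'.
by move: h2; clear; lra.
Qed.

Lemma det_near1 (A : M3) (e : R) : e <= 1 -> (forall i j, modc (A i j - (1%:M : M3) i j) <= e) ->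
  modc (\det A - 1) <= 72 * e.
Proof.
move=> e1 hA.
have I1 i j : modc ((1%:M : M3) i j) <= 1.
  by rewrite mxE; case: (i == j); rewrite ?mulr1n ?mulr0n ?modc1 ?modc0 ?ler01.
have I2 i j : modc ((1%:M : M3) i j) <= 2 by have := I1 i j; clear; lra.
have A2 i j : modc (A i j) <= 2.
  have := modcD (A i j - (1%:M : M3) i j) ((1%:M : M3) i j); rewrite subrK.
  by have := hA i j; have := I1 i j; move: e1; clear; lra.
rewrite -(det1 _ 3) !det3.
have t i j k : modc (A j1 i * (A j2 j * A j3 k) - (1%:M : M3) j1 i * ((1%:M : M3) j2 j * (1%:M : M3) j3 k)) <= 12 * e.
  by apply: prod3_close.
move: (t j1 j2 j3) (t j1 j3 j2) (t j2 j1 j3) (t j2 j3 j1) (t j3 j1 j2) (t j3 j2 j1).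
set a1 := _ - _; set a2 := _ - _; set a3 := _ - _; set a4 := _ - _; set a5 := _ - _; set a6 := _ - _.
move=> t1 t2 t3 t4 t5 t6.
set B := (X in modc X <= _).
have -> : B = (a1 - a2) - (a3 - a4) + (a5 - a6) by rewrite /B /a1 /a2 /a3 /a4 /a5 /a6; ring.
have h1 := modcB a1 a2; have h2 := modcB a3 a4; have h3 := modcB a5 a6.
have h4 := modcB (a1 - a2) (a3 - a4); have h5 := modcD ((a1 - a2) - (a3 - a4)) (a5 - a6).
by move: t1 t2 t3 t4 t5 t6 h1 h2 h3 h4 h5; clear; lra.
Qed.

Lemma unitary_near1 (A : M3) (e : R) : e <= 1 -> (forall i j, modc (A i j - (1%:M : M3) i j) <= e) ->
  forall i j, modc ((dagger A *m A) i j - (1%:M : M3) i j) <= 5 * e.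
Proof.
move=> e1 hA i j; set Dl := A - 1%:M.
have hD k m : modc (Dl k m) <= e by have := hA k m; rewrite !mxE.
have e0 : 0 <= e := le_trans (modc_ge0 _) (hD i j).
have hD' k m : modc (dagger Dl k m) <= e by rewrite daggerE modc_conj.
have -> : A = 1%:M + Dl by rewrite addrC subrK.
have -> : dagger (1%:M + Dl) *m (1%:M + Dl) = 1%:M + (Dl + dagger Dl + dagger Dl *m Dl).
  by rewrite daggerD dagger1 mulmxDl mul1mx mulmxDr mulmx1 !addrA.
set X := dagger Dl *m Dl.
have -> : (1%:M + (Dl + dagger Dl + X)) i j - (1%:M : M3) i j = Dl i j + dagger Dl i j + X i j.
  have aD (P P' : M3) : (P + P') i j = P i j + P' i j by rewrite mxE.
  by rewrite !aD; ring.
have h : modc (X i j) <= _ := mul3_le e0 hD' hD i j.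
have ee : 3 * e * e <= 3 * e by rewrite ler_piMr // mulr_ge0.
have t1 := modcD (Dl i j + dagger Dl i j) (X i j).
have t2 := modcD (Dl i j) (dagger Dl i j).
have := hD i j; have := hD' i j; move: h ee t1 t2.
by clear; lra.
Qed.

Section Evolution.
Variables (U : R -> M3) (Phi : R -> C -> M3).
Hypothesis F : fundamental U Phi.
Hypothesis U0 : forall y i, U y i i = 0.
Variables (Q : R -> M3) (a : R) (mm mp : R -> R -> M3).
Hypothesis QU : forall y, a < y -> Q y = U y.
Hypothesis Jm : jost_minus Q mm.
Hypothesis Jp : jost_plus Q mp.
Variable l : R.

Lemma frame_minus_evolution x : a <= x ->
  frame l mm x = rot Phi x l%:C *m (dagger (rot Phi a l%:C) *m frame l mm a).
Proof.
apply: (volterra_evolution F (h := frame_integrand Q l mm)) => [y ay|s t _ st|y ay].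
- by have [] := frame_minus_incr l Jm ay.
- by have [] := frame_minus_incr l Jm st.
by rewrite frame_integrandE QU.
Qed.

Lemma frame_plus_evolution x : a <= x ->
  frame l mp x = rot Phi x l%:C *m (dagger (rot Phi a l%:C) *m frame l mp a).
Proof.
apply: (volterra_evolution F (h := frame_integrand Q l mp)) => [y ay|s t _ st|y ay].
- by have [] := frame_plus_incr l Jp ay.
- by have [] := frame_plus_incr l Jp st.
by rewrite frame_integrandE QU.
Qed.

Lemma frame_plus_far (e : R) : 0 < e -> exists2 x, a <= x &
  forall i j, modc (frame l mp x i j - (1%:M : M3) i j) <= e.
Proof.
move=> e0; have [N hN] := frame_plus_limit l Jp e0.
have := archi_boundP (normr_ge0 a); set M := Num.bound _ => aM.
exists (maxn N M)%:R; last by apply: hN; rewrite leq_maxl.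
apply: (le_trans (ler_norm a)); apply/ltW/(lt_le_trans aM); by rewrite ler_nat leq_maxr.
Qed.

(** The Gram matrix is constant along the evolution and tends to the identity. *)
Lemma frame_plus_unitary : dagger (frame l mp a) *m frame l mp a = 1%:M.
Proof.
apply/matrixP => i j; apply: eq_modcP => e e0.
pose d := Num.min 1 (e / 5); have d0 : 0 < d by rewrite lt_min ltr01 divr_gt0.
have [x ax hx] := frame_plus_far d0.
have E : dagger (frame l mp x) *m frame l mp x = dagger (frame l mp a) *m frame l mp a.
  rewrite (frame_plus_evolution ax).
  exact: unitary_change (rot_dagger_mul F x l) (rot_dagger_mul F a l).
have d1 : d <= 1 by rewrite /d ge_min lexx.
have := unitary_near1 d1 hx i j; rewrite E => h; apply: (le_trans h).
have : d <= e / 5 by rewrite /d ge_min lexx orbT.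
by lra.
Qed.

(** Likewise, the frame removes the only trace of the generator. *)
Lemma frame_plus_det : \det (frame l mp a) = 1.
Proof.
apply: eq_modcP => e e0.
pose d := Num.min 1 (e / 72); have d0 : 0 < d by rewrite lt_min ltr01 divr_gt0.
have [x ax hx] := frame_plus_far d0.
have E : \det (frame l mp x) = \det (frame l mp a).
  rewrite (frame_plus_evolution ax).
  exact: det_change (rot_det F U0 x l%:C) (rot_det F U0 a l%:C).
have d1 : d <= 1 by rewrite /d ge_min lexx.
rewrite -E; apply: (le_trans (det_near1 d1 hx)).
have : d <= e / 72 by rewrite /d ge_min lexx orbT.
by lra.
Qed.

(** On the half line where both Jost functions evolve classically they differ by a constant
    factor; splitting the integral that defines the scattering matrix at the end of that half
    line identifies it with this factor. *)
Lemma scattering_frame : scattering_matrix Q mm l = dagger (frame l mp a) *m frame l mm a.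
Proof.
set K := RHS.
have pK : frame l mp a *m K = frame l mm a.
  by rewrite /K mulmxA (mulmx1C frame_plus_unitary) mul1mx.
have hK y : a < y -> frame_integrand Q l mm y = frame_integrand Q l mp y *m K.
  move=> ay; rewrite !frame_integrandE (frame_minus_evolution (ltW ay)) (frame_plus_evolution (ltW ay)) -pK.
  by rewrite !mulmxA.
have hKE (y : R) i j : `]a, +oo[%classic y ->
    frame_integrand Q l mm y i j = \sum_k frame_integrand Q l mp y i k * K k j.
  by rewrite /= in_itv /= andbT => ay; rewrite (hK y ay) [LHS]mxE.
have [ip Ep] := frame_plus l Jp a; have [im Em] := frame_minus l Jm a.
have mo : measR `]a, +oo[ by exact: measurable_itv.
have ip' i j : Cintegrable `]a, +oo[ (fun y => frame_integrand Q l mp y i j).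
  apply: (CintegrableS _ _ _ (ip i j)); try exact: measurable_itv.
  by apply: subset_itvr; rewrite bnd_simp.
have iK i j : Cintegrable `]a, +oo[ (fun y => frame_integrand Q l mm y i j).
  apply: (eq_Cintegrable mo _ (CintegrableMr (index_enum 'I_3) (fun k => K k j) mo (fun k => ip' i k))) => y ay.
  by rewrite (hKE y i j ay).
have iT i j := CintegrableU (im i j) (iK i j).
have SE : scattering_matrix Q mm l = 1%:M + mx_int setT (frame_integrand Q l mm).
  have -> : frame_integrand Q l mm = jost_integrand Q mm 0 l.
    by apply/funext => y; rewrite jost_integrandE mul0r exp_ad0.
  reflexivity.
have iE : mx_int setT (frame_integrand Q l mm) = mx_int `]-oo, a] (frame_integrand Q l mm) +
    mx_int `[a, +oo[ (frame_integrand Q l mp) *m K.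
  apply/matrixP => i j; rewrite !mxE.
  have := @Cint_itvB _ (fun y => frame_integrand Q l mm y i j) -oo%O +oo%O a.
  rewrite set_itvNyy => /(_ (iT i j) isT isT) /eqP; rewrite subr_eq addrC => /eqP ->; congr (_ + _).
  rewrite (eq_Cint (fun y ay => hKE y i j ay)).
  rewrite (Cint_sumr (index_enum 'I_3) (fun k => K k j) mo (fun k => ip' i k)).
  have e k : Cint `]a, +oo[ (fun y => frame_integrand Q l mp y i k) =
      mx_int `[a, +oo[ (frame_integrand Q l mp) i k.
    by rewrite [RHS]mxE; exact: Cint_obnd_cbnd (ip' i k).
  by apply: eq_bigr => k _; rewrite e.
rewrite SE iE addrA -Em -pK.
have -> : mx_int `[a, +oo[ (frame_integrand Q l mp) = 1%:M - frame l mp a by rewrite Ep opprB addrC subrK.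
by rewrite mulmxBl mul1mx addrC subrK.
Qed.

End Evolution.

Section Tails.
Variables (U : R -> M3) (Phi : R -> C -> M3).
Hypothesis F : fundamental U Phi.
Variables (T t : R -> R).
Hypothesis dT : forall y : R, is_derive y 1 T (t y).
Hypothesis Ut : forall y i j, modc (U y i j) <= t y.
Variable l : R.

Lemma rot_close x y : y <= x -> forall i j,
  modc ((rot Phi x l%:C *m dagger (rot Phi y l%:C)) i j - (1%:M : M3) i j) <= 3 * (T x - T y).
Proof.
move=> yx i j; rewrite -(rot_mul_dagger F y l) mulrBr.
pose W s := rot Phi s l%:C *m dagger (rot Phi y l%:C).
have dW s := mrderM (rot_der F l%:C s) (mrder_cst (dagger (rot Phi y l%:C)) s).
have dG (s : R) : is_derive s 1 (fun s => 3 * T s) (3 * t s).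
  apply: (is_derive_eq (is_deriveM' (is_derive_cst (3 : R) s 1) (dT s))).
  by rewrite mul0r add0r.
apply: (rder_le (F := fun s => W s i j) (G := fun s => 3 * T s) yx (fun s _ => dW s i j) (fun s _ => dG s)) => s _.
rewrite mulmx0 addr0 -mulmxA -/(W s).
have Wu : dagger (W s) *m W s = 1%:M.
  exact: unitary_mul (rot_dagger_mul F s l) (rot_dagger_mul F y l).
have t0 : 0 <= t s := le_trans (modc_ge0 _) (Ut s i j).
have -> : 3 * t s = 3 * t s * 1 by rewrite mulr1.
apply: mul3_le => // [k m|k m]; last exact: unitary_le.
rewrite exp_ad_le ?Ut //; by rewrite !ReImE; ring.
Qed.

(** A solution normalized at infinity stays as close to the identity as the total variation of
    the potential that separates it from infinity, uniformly in the spectral parameter. *)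
Lemma frame_close (f : R -> M3) (x tau : R) :
  (forall y, f x = rot Phi x l%:C *m (dagger (rot Phi y l%:C) *m f y)) ->
  (forall e : R, 0 < e -> exists2 y, `|T x - T y| <= tau &
    forall i j, modc (f y i j - (1%:M : M3) i j) <= e) ->
  forall i j, modc (f x i j - (1%:M : M3) i j) <= 3 * tau.
Proof.
move=> fE fl i j; apply/ler_addgt0Pr => e e0.
have e3 : 0 < e / 3 by rewrite divr_gt0.
have [y ty hy] := fl _ e3.
pose W := rot Phi x l%:C *m dagger (rot Phi y l%:C).
have Wu : dagger W *m W = 1%:M.
  exact: unitary_mul (rot_dagger_mul F x l) (rot_dagger_mul F y l).
have W1 : modc (W i j - (1%:M : M3) i j) <= 3 * tau.
  have [yx|/ltW xy] := leP y x.
    apply: (le_trans (rot_close yx i j)); rewrite ler_pM2l //.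
    exact: le_trans (ler_norm _) ty.
  have := rot_close xy j i; have -> : rot Phi y l%:C *m dagger (rot Phi x l%:C) = dagger W.
    by rewrite /W daggerM daggerK.
  rewrite daggerE; have -> : (1%:M : M3) j i = ((1%:M : M3) i j)^cj.
    by rewrite -daggerE dagger1.
  rewrite -conjcB modc_conj => h; apply: (le_trans h); rewrite ler_pM2l //.
  by apply: le_trans ty; rewrite distrC ler_norm.
have hE : f x = W + W *m (f y - 1%:M) by rewrite mulmxBr mulmx1 addrC subrK (fE y) mulmxA.
rewrite hE.
have -> : (W + W *m (f y - 1%:M)) i j - (1%:M : M3) i j = (W i j - (1%:M : M3) i j) + (W *m (f y - 1%:M)) i j.
  by rewrite [in LHS]mxE addrAC.
apply: (le_trans (modcD _ _)); apply: lerD => //.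
have := @mul3_le _ W (f y - 1%:M) 1 (e / 3) ler01 (fun k m => unitary_le k m Wu) _ i j.
by rewrite mulr1 mulrCA divff ?mulr1 // ?pnatr_eq0 //; apply => k m; have := hy k m; rewrite !mxE.
Qed.

End Tails.
End JostLine.

(** * From the real axis to the upper half plane *)

Section BoundaryDetermines.
Context {R : realType}.
Notation C := R[i].

Lemma upper_cont_bounded (F : C -> C) (Q : @rect R) : upper_cont F -> wf Q -> 0 <= rb Q ->
  exists2 K : R, 0 <= K & forall z, inrect Q z -> modc (F z) <= K.
Proof.
move=> Fc wQ Q0; apply: contrapT => no.
pose P (Q' : @rect R) := 0 <= rb Q' /\ ~ exists2 K : R, 0 <= K & forall z, inrect Q' z -> modc (F z) <= K.
have [|Q' wQ' [Q'0 hP]|z zQ hz] := @bisection _ P Q wQ; first by split.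
  apply: contrapT => all.
  have h h v : exists2 K : R, 0 <= K & forall z, inrect (quarter h v Q') z -> modc (F z) <= K.
    apply: contrapT => hn; apply: all; exists h, v; split=> //.
    case: v hn => _ //=; have [_] := wQ'; move: Q'0; clear; lra.
  have [a a0 ha] := h false false; have [b b0 hb] := h false true.
  have [c c0 hc] := h true false; have [d d0 hd] := h true true.
  apply: hP; exists (a + b + (c + d)) => [|z zQ]; first by rewrite !addr_ge0.
  have [h' [v' hz]] := in_quarter zQ.
  case: h' hz => hz; case: v' hz => hz; [have := hd z hz|have := hc z hz|have := hb z hz|have := ha z hz];
  move: a0 b0 c0 d0; clear; lra.
have z0 : Cplus_closed z.
  by have /andP[_ /andP[h _]] := zQ; exact: le_trans h.
have [d d0 hd] := Fc z z0 1 ltr01.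
have d2 : 0 < d / 2 by rewrite divr_gt0.
have [Q' [wQ' [Q'0 hP] zQ' _ [w1 w2]]] := hz _ d2.
apply: hP; exists (modc (F z) + 1) => [|w wQ'']; first by rewrite addr_ge0 ?modc_ge0.
have w0 : Cplus_closed w.
  by have /andP[_ /andP[h _]] := wQ''; exact: le_trans h.
have dw : modc (w - z) < d by have := inr_dist zQ' wQ'' w1 w2; rewrite mulrC divfK // pnatr_eq0.
have := hd w w0 dw; have := modc_sub_le (F w) (F z); clear; lra.
Qed.

(** Functions analytic in the upper half plane that are bounded there and uniformly close on
    the real axis are close inside.  The bound enters the two-constants estimate with an
    exponentially small factor, so any locally uniform bound will do. *)
Lemma boundary_approx (F : C -> C) (G : R -> C -> C) (A1 K : R) :
  upper_cont F -> (forall z, Cplus z -> holo F z) ->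
  (forall A, A1 <= A -> upper_cont (G A)) ->
  (forall A z, A1 <= A -> Cplus z -> holo (G A) z) ->
  (forall A z, A1 <= A -> Cplus_closed z -> modc (G A z) <= K) ->
  (forall e : R, 0 < e -> exists A0, forall A (l : R), A0 <= A -> modc (F l%:C - G A l%:C) <= e) ->
  forall z, Cplus_closed z -> forall e : R, 0 < e -> exists A0, forall A, A0 <= A ->
    modc (F z - G A z) <= e.
Proof.
move=> Fc Fh Gc Gh GK FG z zc e e0.
have [z0|z0] := eqVneq (complex.Im z) 0.
  have [A0 hA] := FG e e0; exists A0 => A hAA.
  have -> : z = (complex.Re z)%:C by apply: eqC; rewrite ?ReC ?ImC.
  exact: hA.
have zp : Cplus z by rewrite /Cplus /= lt_def z0.
pose Q := Rect (complex.Re z - 2 * complex.Im z) (complex.Re z + 2 * complex.Im z) 0 (2 * complex.Im z).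
have zp' : 0 < complex.Im z := zp.
have wQ : wf Q by split => /=; move: zp'; clear; lra.
have [B B0 hB] := upper_cont_bounded Fc wQ (lexx 0).
have K0 : 0 <= K by apply: le_trans (GK A1 z (lexx _) zc); exact: modc_ge0.
(* the bound [B + K] enters with the factor exp (- n / 16); [n] is fixed before [A] *)
pose n := Num.bound (32 * (B + K + 1) / e).
have BK : 0 < B + K + 1 by move: B0 K0; clear; lra.
have hn : 32 * (B + K + 1) / e < n%:R by apply: archi_boundP; rewrite divr_ge0 ?mulr_ge0 ?ltW.
have small : (B + K) * expR (- n%:R / 4) * expR (3 * n%:R / 16) <= e / 2.
  rewrite -mulrA -expRD; have -> : - n%:R / 4 + 3 * n%:R / 16 = - (n%:R / 16) :> R by field.
  rewrite expRN ler_pdivrMr ?expR_gt0 //.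
  have h1 := expR_ge1Dx (n%:R / 16 : R); have e2 : 0 <= e / 2 by rewrite divr_ge0 ?ltW.
  apply: le_trans (ler_wpM2l e2 h1); move: hn; rewrite ltr_pdivrMr //.
  by move: B0 K0 e0; clear; lra.
pose eta := e / 2 * expR (- (3 * n%:R / 16)).
have eta0 : 0 < eta by rewrite mulr_gt0 ?divr_gt0 // expR_gt0.
have [A0 hA] := FG eta eta0; exists (Num.max A0 A1) => A; rewrite ge_max => /andP[AA0 AA1].
have := @two_constants _ (fun w => F w - G A w) z (B + K) eta n _ _ zp _ _.
move=> h.
have -> : e = eta * expR (3 * n%:R / 16) + e / 2.
  by rewrite /eta -mulrA -expRD addNr expR0 mulr1; field.
apply: (le_trans (h _ _ _ _)); last by rewrite mulrDl lerD2l.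
- by move=> w wc; apply: wlimB; [exact: Fc|exact: Gc].
- by move=> w wc; apply: holoB; [exact: Fh|exact: Gh].
- move=> w wQw; apply: (le_trans (modcB _ _)); apply: lerD; first exact: hB.
  by apply: GK => //; have /andP[_ /andP[]] := wQw.
- by move=> l; exact: hA.
Qed.

Lemma boundary_identity (F : C -> C) :
  upper_cont F -> (forall z, Cplus z -> holo F z) -> (forall l : R, F l%:C = 0) ->
  forall z, Cplus_closed z -> F z = 0.
Proof.
move=> Fc Fh F0 z zc; apply: eq_modcP => e e0.
have [||||A0 hA] := @boundary_approx F (fun _ _ => 0) 0 0 Fc Fh _ _ _ _ z zc e e0.
- by move=> A _ w _; exact: wlim_cst.
- by move=> A w _ _; exact: holo_cst.
- by move=> A w _ _; rewrite modc0.
- by move=> e' /ltW e'0; exists 0 => A l' _; rewrite F0 subrr modc0.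
exact: hA (lexx A0).
Qed.

Lemma entire_upper_cont (F : C -> C) : (forall z, holo F z) -> upper_cont F.
Proof. by move=> h z _; apply: wlim_sub (holo_cont (h z)). Qed.

End BoundaryDetermines.

Section Propagator.
Context {R : realType}.
Notation C := R[i].
Notation M3 := 'M[C]_3.
Variables (U : R -> M3) (Phi : R -> C -> M3).
Hypothesis F : fundamental U Phi.

(** Transport of a solution normalized by the free exponential on the right: if [B] is the
    value at [p] of a solution of the Lax equation times $e^{-iz\sigma p}$, then this is its
    value at [x]. *)
Definition propag (x p : R) (z : C) (B : M3) : M3 :=
  Phi x z *m dagger (Phi p z^cj) *m B *m exp_sigma (- (z * (x - p)%:C)).

Lemma propag_id p z B : propag p p z B = B.
Proof. by rewrite /propag (fund_inv' F) mul1mx subrr mulr0 oppr0 exp_sigma0 mulmx1. Qed.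

Lemma propag_entry x p z i k : propag x p z 1%:M i k =
  cexp (- ('i * (z * (x - p)%:C) * sigma_diag 0 k)) * (Phi x z *m dagger (Phi p z^cj)) i k.
Proof.
rewrite /propag mulmx1; move: (Phi x z *m _) => A.
rewrite /exp_sigma mul_mx_diag [LHS]mxE [X in _ * X = _]mxE [LHS]mulrC.
by rewrite mulrN mulNr.
Qed.

Lemma propag_holo x p i k z : holo (fun w => propag x p w 1%:M i k) z.
Proof.
have -> : (fun w => propag x p w 1%:M i k) = (fun w =>
    cexp ((- ('i * (x - p)%:C * sigma_diag 0 k)) * w) * \sum_j Phi x w i j * (Phi p w^cj k j)^cj).
  apply/funext => w; rewrite propag_entry; congr (cexp _ * _); first by ring.
  by rewrite [LHS]mxE; apply: eq_bigr => j _; rewrite daggerE.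
apply: holoM.
  by apply: holo_cexp; apply: holoM; [exact: holo_cst|exact: holo_id].
apply: holo_sum => j; apply: holoM; first exact: fund_holo F _ _ _ _.
exact: (holoJ (fund_holo F p z^cj k j)).
Qed.

(** Energy estimate: each Jost column is contracted when moved away from its base point in the
    direction in which its exponential factor decays. *)
Lemma propag_le x p z i k : 0 <= complex.Im z -> complex.Re (sigma_diag 0 k) * (x - p) <= 0 ->
  modc (propag x p z 1%:M i k) <= 1.
Proof.
move=> z0; set s := complex.Re _ => sx.
pose y j t := (Phi t z *m dagger (Phi p z^cj)) j k.
have dy j t : rder (y j) t (\sum_m (('i * z) *: @sg R + U t) j m * y m t).
  have := mrderM (fund_der F t z) (mrder_cst (dagger (Phi p z^cj)) t) j k.
  by rewrite mulmx0 addr0 -mulmxA => h; apply: (rder_eq h); rewrite [LHS]mxE.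
have dE t := lax_energy F (fun j => dy j t).
pose N2 t := expR (2 * complex.Im z * s * (t - p)) * \sum_j modc (y j t) ^+ 2.
have s2 : s = 1 \/ s = - 1.
  by rewrite /s mxE; case: ifP => _; [right; rewrite ReN Re1|left; rewrite Re1].
have sle j : `|s * complex.Re (sigma_diag 0 j : C)| <= 1.
  rewrite mxE; case: ifP => _; rewrite ?ReN Re1; case: s2 => ->;
  by rewrite ?mulrN ?mulr1 ?opprK ?normrN ?normr1.
have dN (t : R) : is_derive t 1 (fun t => s * N2 t) (s * (expR (2 * complex.Im z * s * (t - p)) * (2 * complex.Im z * s) *
    (\sum_j modc (y j t) ^+ 2) + expR (2 * complex.Im z * s * (t - p)) *
    (- 2 * complex.Im z * \sum_j (complex.Re (sigma_diag 0 j) * modc (y j t) ^+ 2)))).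
  have d1 : is_derive t 1 (fun t : R => expR (2 * complex.Im z * s * (t - p)))
      (expR (2 * complex.Im z * s * (t - p)) * (2 * complex.Im z * s)).
    have e1 := derive_expR (2 * complex.Im z * s) t.
    have e2 := is_deriveM' e1 (is_derive_cst (expR (- (2 * complex.Im z * s * p))) t 1).
    have fE : (fun t : R => expR (2 * complex.Im z * s * t) * expR (- (2 * complex.Im z * s * p))) =
      (fun t : R => expR (2 * complex.Im z * s * (t - p))).
      by apply/funext => r; rewrite -expRD mulrBr.
    rewrite fE in e2; apply: (is_derive_eq e2).
    by rewrite mulr0 addr0 mulrAC -expRD -mulrBr.
  have d2 := is_deriveM' (is_derive_cst s t 1) (is_deriveM' d1 (dE t)).
  by apply: (is_derive_eq d2); rewrite mul0r add0r.
have pos t : 0 <= s * (expR (2 * complex.Im z * s * (t - p)) * (2 * complex.Im z * s) *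
    (\sum_j modc (y j t) ^+ 2) + expR (2 * complex.Im z * s * (t - p)) *
    (- 2 * complex.Im z * \sum_j (complex.Re (sigma_diag 0 j) * modc (y j t) ^+ 2))).
  set E := expR _.
  have -> : s * (E * (2 * complex.Im z * s) * (\sum_j modc (y j t) ^+ 2) + E *
     (- 2 * complex.Im z * \sum_j (complex.Re (sigma_diag 0 j) * modc (y j t) ^+ 2))) =
     2 * complex.Im z * E * \sum_j ((1 - s * complex.Re (sigma_diag 0 j)) * modc (y j t) ^+ 2).
    have -> : \sum_j ((1 - s * complex.Re (sigma_diag 0 j)) * modc (y j t) ^+ 2) =
       \sum_j modc (y j t) ^+ 2 - s * \sum_j (complex.Re (sigma_diag 0 j) * modc (y j t) ^+ 2).
      by rewrite mulr_sumr -sumrB; apply: eq_bigr => j _; rewrite mulrBl mul1r mulrA.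
    set a := \sum_j _; set b := \sum_j _.
    have ss : s * s = 1 by case: s2 => ->; rewrite ?mulr1 // mulrNN mulr1.
    transitivity (2 * complex.Im z * E * ((s * s) * a - s * b)); first by ring.
    by rewrite ss mul1r.
  apply: mulr_ge0; first by rewrite !mulr_ge0 ?expR_ge0.
  apply: sumr_ge0 => j _; rewrite mulr_ge0 ?sqr_ge0 // subr_ge0.
  exact: le_trans (ler_norm _) (sle j).
have Np : N2 p = 1.
  rewrite /N2 subrr mulr0 expR0 mul1r (eq_bigr (fun j => (j == k)%:R)) => [|j _].
    by rewrite (bigD1 k) //= eqxx big1 ?addr0 // => j /negbTE ->.
  by rewrite /y (fund_inv' F) mxE; case: (j == k); rewrite ?mulr1n ?mulr0n ?modc1 ?modc0 ?expr1n // expr0n.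
have Nx : N2 x <= 1.
  rewrite -Np; case: s2 => E; rewrite E in sx.
    have xp : x <= p by move: sx; rewrite mul1r subr_le0.
    have := derive_ge0_le xp (fun t _ => dN t) (fun t _ => pos t).
    by rewrite E !mul1r.
  have px : p <= x by move: sx; rewrite mulN1r oppr_le0 subr_ge0.
  have := derive_ge0_le px (fun t _ => dN t) (fun t _ => pos t).
  by rewrite E !mulN1r lerN2.
rewrite -(@expr_le1 _ 2) ?modc_ge0 //; apply: le_trans Nx.
rewrite propag_entry modcM modc_cexp exprMn -expRM_natl /N2.
have -> : complex.Re (- ('i * (z * (x - p)%:C) * sigma_diag 0 k)) = complex.Im z * s * (x - p).
  rewrite /s !mxE; case: ifP => _; rewrite !ReImE.
    by rewrite !(mulr0, mul0r, oppr0, subr0, addr0, add0r); ring.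
  by rewrite !(mulr0, mul0r, oppr0, subr0, addr0, add0r); ring.
have -> : 2 * (complex.Im z * s * (x - p)) = 2 * complex.Im z * s * (x - p) by ring.
apply: ler_wpM2l; first exact: expR_ge0.
rewrite (bigD1 i) //= lerDl.
by apply: sumr_ge0 => j _; exact: sqr_ge0.
Qed.

(** On the real axis the truncated Jost functions are the transition matrices of the rotating
    frame. *)
Lemma propag_frame (x p l : R) :
  exp_ad (- (x%:C * l%:C)) (propag x p l%:C 1%:M) = rot Phi x l%:C *m dagger (rot Phi p l%:C).
Proof.
rewrite /propag /exp_ad /rot daggerM dagger_exp_sigma mulmx1 opprK.
have -> : (l%:C)^cj = l%:C by apply: eqC; rewrite ?ReImE ?oppr0.
have -> : - (- (p%:C * l%:C))^cj = p%:C * l%:C by apply: eqC; rewrite ?ReImE; ring.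
rewrite -!mulmxA -exp_sigmaD; congr (_ *m (_ *m (_ *m exp_sigma _))).
by apply: eqC; rewrite ?ReImE; ring.
Qed.

Lemma frame_propag (m : R -> R -> M3) (x p l : R) :
  frame l m x = rot Phi x l%:C *m (dagger (rot Phi p l%:C) *m frame l m p) ->
  m x l = propag x p l%:C (m p l).
Proof.
move=> h.
have -> : m x l = exp_ad (x%:C * l%:C) (frame l m x) by rewrite /frame -exp_adD subrr exp_ad0.
rewrite h /propag /exp_ad /frame /rot daggerM dagger_exp_sigma /exp_ad.
have -> : (l%:C)^cj = l%:C by apply: eqC; rewrite ?ReImE ?oppr0.
have -> : - (- (p%:C * l%:C))^cj = p%:C * l%:C by apply: eqC; rewrite ?ReImE; ring.
rewrite opprK !mulmxA exp_sigmaNK mul1mx -!mulmxA; congr (_ *m (_ *m _)).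
rewrite !mulmxA exp_sigmaNK mul1mx -!mulmxA -exp_sigmaD; congr (_ *m exp_sigma _).
by apply: eqC; rewrite ?ReImE; ring.
Qed.

End Propagator.

(** * Jost columns and their determinant *)

Section DetLimits.
Context {R : realType}.
Notation C := R[i].

Lemma wlim_det n (A : set C) (F : C -> 'M[C]_n) z (L : 'M[C]_n) :
  (forall i j, wlim A (fun w => F w i j) z (L i j)) -> wlim A (fun w => \det (F w)) z (\det L).
Proof.
move=> h; apply: wlim_sum => s; apply: wlimM; first exact: wlim_cst.
by apply: wlim_prod => i; exact: h.
Qed.

Lemma holo_det n (F : C -> 'M[C]_n) z :
  (forall i j, holo (fun w => F w i j) z) -> holo (fun w => \det (F w)) z.
Proof.
move=> h; apply: holo_sum => s; apply: holoM; first exact: holo_cst.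
by apply: holo_prod => i; exact: h.
Qed.

Lemma det_exp_ad (w : C) (A : 'M[C]_3) : \det (exp_ad w A) = \det A.
Proof. by rewrite /exp_ad !det_mulmx mulrAC -det_mulmx exp_sigmaNK det1 mul1r. Qed.

End DetLimits.

Section JostColumns.
Context {R : realType}.
Notation C := R[i].
Notation M3 := 'M[C]_3.

Lemma extends_entry (f : R -> 'cV[C]_3) (G : C -> 'cV[C]_3) i : extends_to_Cplus f G ->
  [/\ forall l : R, G l%:C i 0 = f l i 0, upper_cont (fun z => G z i 0) &
      forall z, Cplus z -> holo (fun z => G z i 0) z].
Proof.
move=> [h1 h2 h3]; split; first by move=> l; rewrite h1.
  by move=> z zc; have /within_mlimP/(_ z zc i 0) := h2.
by move=> z zc; have /derivable_mx_holo/(_ i 0) := h3 z zc.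
Qed.

Lemma extends_scalar (f : R -> C) (G : C -> C) : extends_to_Cplus f G ->
  [/\ forall l : R, G l%:C = f l, upper_cont G & forall z, Cplus z -> holo G z].
Proof.
move=> [h1 h2 h3]; split => //; first by move=> z zc; have /within_wlimP/(_ z zc) := h2.
by move=> z zc; apply/derivable_holo/h3.
Qed.

Section Data.
Context {Q : R -> M3}.
Variable D : jost_data Q.

Definition cols3 (a b c : 'cV[C]_3) : M3 := row_mx a (row_mx b c).

Lemma cols3E a b c i : [/\ cols3 a b c i j1 = a i 0, cols3 a b c i j2 = b i 0 & cols3 a b c i j3 = c i 0].
Proof.
have e1 : j1 = lshift (1 + 1) (0 : 'I_1) by exact: val_inj.
have e2 : j2 = rshift 1 (lshift 1 (0 : 'I_1)) by exact: val_inj.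
have e3 : j3 = rshift 1 (rshift 1 (0 : 'I_1)) by exact: val_inj.
split.
- by rewrite e1 [LHS]row_mxEl.
- by rewrite e2 [LHS]row_mxEr [LHS]row_mxEl.
- by rewrite e3 [LHS]row_mxEr [LHS]row_mxEr.
Qed.

(** The Jost columns before the division by $s_{11}$: regular in the whole closed half plane. *)
Definition jost_cols (x : R) (z : C) : M3 := cols3 (m1minus D x z) (m2plus D x z) (m3plus D x z).

Definition jost_cols_real (x l : R) : M3 :=
  cols3 (col j1 (mminus D x l)) (col j2 (mplus D x l)) (col j3 (mplus D x l)).

Lemma jost_colsP x i k : [/\ forall l : R, jost_cols x l%:C i k = jost_cols_real x l i k,
  upper_cont (fun z => jost_cols x z i k) & forall z, Cplus z -> holo (fun z => jost_cols x z i k) z].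
Proof.
have [a1 a2 a3] := extends_entry i (m1minusP D x).
have [b1 b2 b3] := extends_entry i (m2plusP D x).
have [c1 c2 c3] := extends_entry i (m3plusP D x).
have E1 z : jost_cols x z i j1 = m1minus D x z i 0 by have [] := cols3E (m1minus D x z) (m2plus D x z) (m3plus D x z) i.
have E2 z : jost_cols x z i j2 = m2plus D x z i 0 by have [] := cols3E (m1minus D x z) (m2plus D x z) (m3plus D x z) i.
have E3 z : jost_cols x z i j3 = m3plus D x z i 0 by have [] := cols3E (m1minus D x z) (m2plus D x z) (m3plus D x z) i.
have R1 l : jost_cols_real x l i j1 = col j1 (mminus D x l) i 0.
  by have [] := cols3E (col j1 (mminus D x l)) (col j2 (mplus D x l)) (col j3 (mplus D x l)) i.
have R2 l : jost_cols_real x l i j2 = col j2 (mplus D x l) i 0.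
  by have [] := cols3E (col j1 (mminus D x l)) (col j2 (mplus D x l)) (col j3 (mplus D x l)) i.
have R3 l : jost_cols_real x l i j3 = col j3 (mplus D x l) i 0.
  by have [] := cols3E (col j1 (mminus D x l)) (col j2 (mplus D x l)) (col j3 (mplus D x l)) i.
have [F1 F2 F3] : [/\ (fun z => jost_cols x z i j1) = (fun z => m1minus D x z i 0),
  (fun z => jost_cols x z i j2) = (fun z => m2plus D x z i 0) &
  (fun z => jost_cols x z i j3) = (fun z => m3plus D x z i 0)] by split; apply/funext.
move: k; apply: ord3E; split; rewrite ?F1 ?F2 ?F3 //.
- by move=> l; rewrite E1 R1.
- by move=> l; rewrite E2 R2.
- by move=> l; rewrite E3 R3.
Qed.

Lemma s11E : [/\ forall l : R, s11 D l%:C = smx D l j1 j1, upper_cont (s11 D) &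
  forall z, Cplus z -> holo (s11 D) z].
Proof. exact: extends_scalar (s11P D). Qed.

Lemma beals_coifman_entry x z i : [/\ beals_coifman_plus D x z i j1 = (s11 D z)^-1 * jost_cols x z i j1,
  beals_coifman_plus D x z i j2 = jost_cols x z i j2 & beals_coifman_plus D x z i j3 = jost_cols x z i j3].
Proof.
have [h1 h2 h3] := cols3E ((s11 D z)^-1 *: m1minus D x z) (m2plus D x z) (m3plus D x z) i.
have [k1 k2 k3] := cols3E (m1minus D x z) (m2plus D x z) (m3plus D x z) i.
rewrite /jost_cols k1 k2 k3; split; [rewrite -[LHS]/(cols3 _ _ _ i j1) h1 mxE|exact: h2|exact: h3] => //.
Qed.

Lemma beals_coifman_det x z : \det (beals_coifman_plus D x z) = (s11 D z)^-1 * \det (jost_cols x z).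
Proof.
have E i := beals_coifman_entry x z i.
have [[a1 a2 a3] [b1 b2 b3] [c1 c2 c3]] := And3 (E j1) (E j2) (E j3).
by rewrite !det3 a1 a2 a3 b1 b2 b3 c1 c2 c3; ring.
Qed.

Section At.
Variables (U : R -> M3) (Phi : R -> C -> M3).
Hypothesis F : fundamental U Phi.
Hypothesis U0 : forall y i, U y i i = 0.
Variable a : R.
Hypothesis QU : forall y, a < y -> Q y = U y.

Let frameK (l : R) (m : R -> R -> M3) x : m x l = exp_ad (x%:C * l%:C) (frame l m x).
Proof. by rewrite /frame -exp_adD subrr exp_ad0. Qed.

Let wJ (x l : R) : (x%:C * l%:C : C)^cj = x%:C * l%:C.
Proof. by apply: eqC; rewrite ?ReImE; ring. Qed.

Lemma jost_unitary l : dagger (mplus D a l) *m mplus D a l = 1%:M.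
Proof.
have h := frame_plus_unitary F QU (mplusP D) l.
by rewrite frameK dagger_exp_ad wJ -exp_adM h exp_ad1.
Qed.

Lemma jost_scattering l : mminus D a l = mplus D a l *m exp_ad (a%:C * l%:C) (smx D l).
Proof.
rewrite /smx (scattering_frame F QU (mminusP D) (mplusP D) l) (frameK l (mplus D)) -exp_adM.
have u := mulmx1C (frame_plus_unitary F QU (mplusP D) l).
by rewrite mulmxA u mul1mx -frameK.
Qed.

Lemma jost_plus_det l : \det (mplus D a l) = 1.
Proof.
have h := frame_plus_det F U0 QU (mplusP D) l.
by rewrite (frameK l (mplus D)) det_exp_ad h.
Qed.

(** On the real axis both Jost matrices differ by the scattering matrix, so that the determinant of
    the mixed columns is its corner entry; both sides are analytic.  This makes the
    Beals-Coifman solution invertible wherever $s_{11}$ does not vanish. *)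
Lemma jost_cols_det z : Cplus_closed z -> \det (jost_cols a z) = s11 D z.
Proof.
move=> zc; have [s1 s2 s3] := s11E.
apply/eqP; rewrite -subr_eq0; apply/eqP.
apply: (@boundary_identity _ (fun z => \det (jost_cols a z) - s11 D z)) zc.
- move=> w wc; apply: wlimB; last exact: s2.
  by apply: wlim_det => i j; have [_ h _] := jost_colsP a i j; exact: h.
- move=> w wc; apply: holoB; last exact: s3.
  by apply: holo_det => i j; have [_ _ h] := jost_colsP a i j; exact: h.
move=> l; apply/eqP; rewrite subr_eq0; apply/eqP; rewrite s1.
pose L : M3 := cols3 (col j1 (exp_ad (a%:C * l%:C) (smx D l))) (col j2 1%:M) (col j3 1%:M).
have -> : jost_cols a l%:C = mplus D a l *m L.
  apply/matrixP => i k; have [-> _ _] := jost_colsP a i k; rewrite [RHS]mxE.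
  have e := cols3E (col j1 (exp_ad (a%:C * l%:C) (smx D l))) (col j2 1%:M) (col j3 1%:M).
  have [r1 r2 r3] := cols3E (col j1 (mminus D a l)) (col j2 (mplus D a l)) (col j3 (mplus D a l)) i.
  move: k; apply: ord3E; rewrite /jost_cols_real ?r1 ?r2 ?r3 [LHS]mxE.
  - rewrite jost_scattering [LHS]mxE; apply: eq_bigr => j _; have [h _ _] := e j.
    by rewrite /L h [X in _ = _ * X]mxE.
  - rewrite -[LHS]mulr1 (bigD1 j2) //= big1 ?addr0 => [|j /negbTE jn]; have [_ h _] := e j2; last first.
      by have [_ h' _] := e j; rewrite /L h' !mxE jn mulr0.
    by rewrite /L h !mxE.
  - rewrite -[LHS]mulr1 (bigD1 j3) //= big1 ?addr0 => [|j /negbTE jn]; have [_ _ h] := e j3; last first.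
      by have [_ _ h'] := e j; rewrite /L h' !mxE jn mulr0.
    by rewrite /L h !mxE.
rewrite det_mulmx jost_plus_det mul1r det3.
have e := cols3E (col j1 (exp_ad (a%:C * l%:C) (smx D l))) (col j2 1%:M) (col j3 1%:M).
have [x1 x2 x3] := e j1; have [y1 y2 y3] := e j2; have [z1 z2 z3] := e j3.
rewrite /L x1 x2 x3 y2 y3 z2 z3.
have c2 i : (col j2 (1%:M : M3)) i 0 = (i == j2)%:R by rewrite !mxE.
have c3 i : (col j3 (1%:M : M3)) i 0 = (i == j3)%:R by rewrite !mxE.
rewrite !c2 !c3 [col j1 _ j1 0]mxE exp_adE subrr mulr0 cexp0 mul1r /=.
by ring.
Qed.

End At.
End Data.

End JostColumns.

(** * Jost columns as limits of classical solutions *)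

Section FullLine.
Context {R : realType}.
Notation C := R[i].
Notation M3 := 'M[C]_3.

Lemma wlim_mulmx m n p (A : set C) (F : C -> 'M[C]_(m, n)) (G : C -> 'M[C]_(n, p)) z
    (L : 'M[C]_(m, n)) (M : 'M[C]_(n, p)) :
  mlim A F z L -> mlim A G z M -> mlim A (fun w => F w *m G w) z (L *m M).
Proof.
move=> hF hG i j; rewrite mxE.
apply: (@wlim_ext _ A (fun w => \sum_k F w i k * G w k j)) => [w _|]; first by rewrite mxE.
by apply: wlim_sum => k; apply: wlimM; [exact: hF|exact: hG].
Qed.

Lemma holo_mulmx m n p (F : C -> 'M[C]_(m, n)) (G : C -> 'M[C]_(n, p)) z :
  (forall i j, holo (fun w => F w i j) z) -> (forall i j, holo (fun w => G w i j) z) ->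
  forall i j, holo (fun w => (F w *m G w) i j) z.
Proof.
move=> hF hG i j; apply: (@holo_near _ (fun w => \sum_k F w i k * G w k j) _ z 1 ltr01) => [w _|].
  by rewrite mxE.
by apply: holo_sum => k; apply: holoM; [exact: hF|exact: hG].
Qed.

Section Propag.
Variables (U : R -> M3) (Phi : R -> C -> M3).
Hypothesis F : fundamental U Phi.

Let exp_sigma_holo (r : R) i j z : holo (fun w => exp_sigma (- (w * r%:C)) i j) z.
Proof.
apply: (@holo_near _ (fun w => cexp ((- 'i * r%:C * sigma_diag 0 j) * w) * (i == j)%:R) _ z 1 ltr01) => [w _|].
  rewrite /exp_sigma [RHS]mxE; case: (i =P j) => [->|_]; last by rewrite mulr0 mulr0n.
  by rewrite mulr1 mulr1n [RHS]mxE; congr (cexp _); ring.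
apply: holoM; last exact: holo_cst.
by apply: holo_cexp; apply: holoM; [exact: holo_cst|exact: holo_id].
Qed.

Let transition_holo (x p : R) i j z : holo (fun w => (Phi x w *m dagger (Phi p w^cj)) i j) z.
Proof.
apply: holo_mulmx => i' j'; first exact: fund_holo F _ _ _ _.
apply: (@holo_near _ (fun w => (Phi p w^cj j' i')^cj) _ z 1 ltr01) => [w _|]; first by rewrite daggerE.
exact: (holoJ (fund_holo F p z^cj j' i')).
Qed.

Lemma holo_propag x p (B : C -> M3) z : (forall i j, holo (fun w => B w i j) z) ->
  forall i j, holo (fun w => propag Phi x p w (B w) i j) z.
Proof.
move=> hB; apply: holo_mulmx => i j; last exact: exp_sigma_holo.
by apply: holo_mulmx => // i' j'; exact: transition_holo.
Qed.

Lemma wlim_propag x p (A : set C) (B : C -> M3) z (L : M3) : mlim A B z L ->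
  mlim A (fun w => propag Phi x p w (B w)) z (propag Phi x p z L).
Proof.
have sub f : holo f z -> wlim A f z (f z).
  by move=> h; apply: wlim_sub (holo_cont h).
move=> hB; apply: wlim_mulmx => [|i j]; last exact: (sub _ (exp_sigma_holo _ _ _ _)).
by apply: wlim_mulmx => // i' j'; exact: (sub _ (transition_holo _ _ _ _ _)).
Qed.

(** The free exponential multiplies from the right but is diagonal. *)
Lemma propag_col x p z (A B : M3) k : (forall i, A i k = B i k) ->
  forall i, propag Phi x p z A i k = propag Phi x p z B i k.
Proof.
move=> AB i; rewrite /propag /exp_sigma !mul_mx_diag [LHS]mxE [RHS]mxE; congr (_ * _).
by rewrite [LHS]mxE [RHS]mxE; apply: eq_bigr => j _; rewrite AB.
Qed.

Lemma propag_diag x p z (A : M3) (d : 'rV[C]_3) :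
  propag Phi x p z (A *m diag_mx d) = propag Phi x p z A *m diag_mx d.
Proof. by rewrite /propag /exp_sigma -!mulmxA; congr (_ *m (_ *m (_ *m _))); rewrite diag_mxC. Qed.

End Propag.

Section Full.
Variables (U : R -> M3) (Phi : R -> C -> M3).
Hypothesis F : fundamental U Phi.
Hypothesis U0 : forall y i, U y i i = 0.
Variable D : jost_data U.

Let evol_any (f : R -> M3) (l : R) :
  (forall a x, a <= x -> f x = rot Phi x l%:C *m (dagger (rot Phi a l%:C) *m f a)) ->
  forall x y, f x = rot Phi x l%:C *m (dagger (rot Phi y l%:C) *m f y).
Proof.
move=> h x y; pose a := Num.min x y.
have ax : a <= x by rewrite /a ge_min lexx.
have ay : a <= y by rewrite /a ge_min lexx orbT.
rewrite (h a x ax) (h a y ay) (mulmxA (dagger (rot Phi y _))) (rot_dagger_mul F) mul1mx //.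
Qed.

Lemma mminus_frame l x y :
  frame l (mminus D) x = rot Phi x l%:C *m (dagger (rot Phi y l%:C) *m frame l (mminus D) y).
Proof.
by apply: evol_any => a x' ax; apply: (frame_minus_evolution F (Q := U) (a := a) _ (mminusP D)).
Qed.

Lemma mplus_frame l x y :
  frame l (mplus D) x = rot Phi x l%:C *m (dagger (rot Phi y l%:C) *m frame l (mplus D) y).
Proof.
by apply: evol_any => a x' ax; apply: (frame_plus_evolution F (Q := U) (a := a) _ (mplusP D)).
Qed.

Let real_cols x l : [/\ forall i, jost_cols_real D x l i j1 = mminus D x l i j1,
  forall i, jost_cols_real D x l i j2 = mplus D x l i j2 &
  forall i, jost_cols_real D x l i j3 = mplus D x l i j3].
Proof.
by split=> i; have [r1 r2 r3] := cols3E (col j1 (mminus D x l)) (col j2 (mplus D x l)) (col j3 (mplus D x l)) i;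
  rewrite /jost_cols_real ?r1 ?r2 ?r3 mxE.
Qed.

(** The Lax equation holds on the real axis by [frame_propag]; both sides being analytic, it
    holds in the half plane. *)
Lemma jost_cols_evolution x p z : Cplus_closed z ->
  jost_cols D x z = propag Phi x p z (jost_cols D p z).
Proof.
move=> zc; apply/matrixP => i k; apply/eqP; rewrite -subr_eq0; apply/eqP.
apply: (@boundary_identity _ (fun z => jost_cols D x z i k - propag Phi x p z (jost_cols D p z) i k)) zc.
- move=> w wc; apply: wlimB; first by have [_ h _] := jost_colsP D x i k; exact: h.
  apply: (wlim_propag F) => i' k'; have [_ h _] := jost_colsP D p i' k'; exact: h.
- move=> w wc; apply: holoB; first by have [_ _ h] := jost_colsP D x i k; exact: h.
  apply: (holo_propag F) => i' k'; have [_ _ h] := jost_colsP D p i' k'; exact: h.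
move=> l; apply/eqP; rewrite subr_eq0; apply/eqP.
have E i' k' y : jost_cols D y l%:C i' k' = jost_cols_real D y l i' k'.
  by have [-> _ _] := jost_colsP D y i' k'.
have em := frame_propag (mminus_frame l x p); have ep := frame_propag (mplus_frame l x p).
have [x1 x2 x3] := real_cols x l; have [p1 p2 p3] := real_cols p l.
rewrite E; move: k; apply: ord3E.
- rewrite x1 em; apply: propag_col => i'; by rewrite E p1.
- rewrite x2 ep; apply: propag_col => i'; by rewrite E p2.
- rewrite x3 ep; apply: propag_col => i'; by rewrite E p3.
Qed.

Lemma beals_coifman_evolution x p z : Cplus_closed z ->
  beals_coifman_plus D x z = propag Phi x p z (beals_coifman_plus D p z).
Proof.
move=> zc; pose d : 'rV[C]_3 := \row_j (if j == j1 then (s11 D z)^-1 else 1).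
have E y : beals_coifman_plus D y z = jost_cols D y z *m diag_mx d.
  apply/matrixP => i; rewrite mul_mx_diag => k; rewrite [RHS]mxE [X in _ * X]mxE.
  by have [h1 h2 h3] := beals_coifman_entry D y z i; move: k; apply: ord3E; rewrite ?h1 ?h2 ?h3 /= ?mulr1 // mulrC.
by rewrite !E (jost_cols_evolution x p zc) propag_diag.
Qed.

Variables (T t : R -> R).
Hypothesis dT : forall y : R, is_derive y 1 T (t y).
Hypothesis Ut : forall y i j, modc (U y i j) <= t y.
Hypothesis Ttail : forall e : R, 0 < e -> exists2 A : R, 0 < A &
  forall r s, r <= s -> (s <= - A) || (A <= r) -> T s - T r <= e.

Let natfar (A : R) : exists N : nat, forall n, (N <= n)%N -> A <= n%:R.
Proof.
have := archi_boundP (normr_ge0 A); set N := Num.bound _ => h; exists N => n Nn.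
apply: (le_trans (ler_norm A)); apply/ltW/(lt_le_trans h); by rewrite ler_nat.
Qed.

Lemma mminus_near (e : R) : 0 < e -> exists2 A0, 0 < A0 & forall A l, A0 <= A -> forall i j,
  modc (frame l (mminus D) (- A) i j - (1%:M : M3) i j) <= e.
Proof.
move=> e0; have e3 : 0 < e / 3 by rewrite divr_gt0.
have [A0 A00 hA] := Ttail e3; exists A0 => // A l AA i j.
have T0 r s : r <= s -> T r <= T s.
  move=> rs; apply: (derive_ge0_le rs (fun y _ => dT y)) => y _.
  exact: le_trans (modc_ge0 _) (Ut y j1 j1).
have -> : e = 3 * (e / 3) by rewrite mulrCA divff ?mulr1 // pnatr_eq0.
apply: (frame_close F dT Ut (l := l) (f := frame l (mminus D))) => [y|e' e'0]; first exact: mminus_frame.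
have [N1 h1] := frame_minus_limit l (mminusP D) e'0; have [N2 h2] := natfar A.
exists (- (maxn N1 N2)%:R); last by apply: h1; exact: leq_maxl.
have nA : A <= (maxn N1 N2)%:R by apply: h2; exact: leq_maxr.
have nA' : - (maxn N1 N2)%:R <= - A by rewrite lerN2.
rewrite ger0_norm ?subr_ge0 ?T0 //; apply: hA => //.
by rewrite lerN2 AA.
Qed.

Lemma mplus_near (e : R) : 0 < e -> exists2 A0, 0 < A0 & forall A l, A0 <= A -> forall i j,
  modc (frame l (mplus D) A i j - (1%:M : M3) i j) <= e.
Proof.
move=> e0; have e3 : 0 < e / 3 by rewrite divr_gt0.
have [A0 A00 hA] := Ttail e3; exists A0 => // A l AA i j.
have T0 r s : r <= s -> T r <= T s.
  move=> rs; apply: (derive_ge0_le rs (fun y _ => dT y)) => y _.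
  exact: le_trans (modc_ge0 _) (Ut y j1 j1).
have -> : e = 3 * (e / 3) by rewrite mulrCA divff ?mulr1 // pnatr_eq0.
apply: (frame_close F dT Ut (l := l) (f := frame l (mplus D))) => [y|e' e'0]; first exact: mplus_frame.
have [N1 h1] := frame_plus_limit l (mplusP D) e'0; have [N2 h2] := natfar A.
exists ((maxn N1 N2)%:R); last by apply: h1; exact: leq_maxl.
have nA : A <= (maxn N1 N2)%:R by apply: h2; exact: leq_maxr.
rewrite distrC ger0_norm ?subr_ge0 ?T0 //; apply: hA => //.
by rewrite AA orbT.
Qed.

(** The point at which a column is normalized: $-A$ for the first one, $A$ for the other two.  In
    the closed upper half plane the energy estimate then bounds it by one at [x]. *)
Definition jost_base (k : 'I_3) (A : R) : R := complex.Re (sigma_diag 0 k : C) * A.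

Lemma jost_baseE A : [/\ jost_base j1 A = - A, jost_base j2 A = A & jost_base j3 A = A].
Proof. by split; rewrite /jost_base mxE /= ?ReN ?Re1 ?mulN1r ?mul1r. Qed.

Let frame_propag_close (m : R -> R -> M3) (x p l e : R) :
  frame l m x = rot Phi x l%:C *m (dagger (rot Phi p l%:C) *m frame l m p) ->
  (forall i j, modc (frame l m p i j - (1%:M : M3) i j) <= e) ->
  forall i j, modc (m x l i j - propag Phi x p l%:C 1%:M i j) <= 3 * e.
Proof.
move=> h he i j.
have w0 : complex.Im (- (x%:C * l%:C) : C) = 0 by rewrite !ReImE !(mulr0, mul0r, addr0, oppr0).
have E : exp_ad (- (x%:C * l%:C)) (m x l - propag Phi x p l%:C 1%:M) =
   rot Phi x l%:C *m dagger (rot Phi p l%:C) *m (frame l m p - 1%:M).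
  rewrite exp_adDr exp_adNr propag_frame -/(frame l m x) h mulmxBr mulmx1 mulmxA //.
have -> : m x l i j - propag Phi x p l%:C 1%:M i j = (m x l - propag Phi x p l%:C 1%:M) i j.
  by rewrite [RHS]mxE [X in _ = _ + X]mxE.
rewrite -(exp_ad_le _ i j w0) E.
have Wu := unitary_mul (rot_dagger_mul F x l) (rot_dagger_mul F p l).
have := @mul3_le _ (rot Phi x l%:C *m dagger (rot Phi p l%:C)) (frame l m p - 1%:M) 1 e ler01
  (fun k n => unitary_le k n Wu) _ i j.
rewrite mulr1; apply => k n; have := he k n.
by rewrite [X in _ -> modc X <= _]mxE [X in _ -> modc (_ + X) <= _]mxE.
Qed.

(** On the real axis, moving the normalization from infinity to a distant base point changes the
    solution little; the truncated solutions are bounded by one in the closed half plane, so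
    [boundary_approx] carries the limit inside. *)
Lemma jost_cols_limit x i k z : Cplus_closed z -> forall e : R, 0 < e ->
  exists A0, forall A, A0 <= A -> modc (jost_cols D x z i k - propag Phi x (jost_base k A) z 1%:M i k) <= e.
Proof.
have [h1 h2 h3] := jost_colsP D x i k.
move=> zc; apply: (@boundary_approx _ (fun z => jost_cols D x z i k)
  (fun A z => propag Phi x (jost_base k A) z 1%:M i k) `|x| 1 h2 h3 _ _ _ _ z zc).
- by move=> A _; apply: entire_upper_cont => w; exact: (propag_holo F).
- by move=> A w _ _; exact: (propag_holo F).
- move=> A w xA wc; apply: (propag_le F) => //; rewrite /jost_base.
  have h := ler_norm x; have h' := ler_norm (- x); rewrite normrN in h'.
  rewrite mxE; case: ifP => _; rewrite ?ReN Re1; lra.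
move=> e e0; have e3 : 0 < e / 3 by rewrite divr_gt0.
have [A1 _ hA1] := mminus_near e3; have [A2 _ hA2] := mplus_near e3.
exists (Num.max A1 A2) => A l; rewrite ge_max => /andP[AA1 AA2].
have -> : e = 3 * (e / 3) by rewrite mulrCA divff ?mulr1 // pnatr_eq0.
rewrite h1; have [r1 r2 r3] := real_cols x l; clear h1 h2 h3.
have [b1 b2 b3] := jost_baseE A.
move: k; apply: ord3E; rewrite ?r1 ?r2 ?r3 ?b1 ?b2 ?b3;
  apply: frame_propag_close => //; first exact: mminus_frame.
- by move=> i' j'; exact: hA1.
- exact: mplus_frame.
- by move=> i' j'; exact: hA2.
- exact: mplus_frame.
- by move=> i' j'; exact: hA2.
Qed.

(** The scattering matrix is $p^\dagger q$ in the frame at $A$, where $p$ is close to the identity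
    and $q$ to the transition matrix from $-A$. *)
Lemma s11_limit z : Cplus_closed z -> forall e : R, 0 < e ->
  exists A0, forall A, A0 <= A -> modc (s11 D z - propag Phi A (- A) z 1%:M j1 j1) <= e.
Proof.
have [h1 h2 h3] := s11E D.
move=> zc; apply: (@boundary_approx _ (s11 D)
  (fun A z => propag Phi A (- A) z 1%:M j1 j1) 0 1 h2 h3 _ _ _ _ z zc).
- by move=> A _; apply: entire_upper_cont => w; exact: (propag_holo F).
- by move=> A w _ _; exact: (propag_holo F).
- move=> A w A0 wc; apply: (propag_le F) => //.
  by rewrite mxE /= mulN1r oppr_le0 opprK addr_ge0.
move=> e e0; pose d := Num.min (1 / 3) (e / 9).
have d0 : 0 < d by rewrite lt_min !divr_gt0.
have [A1 _ hA1] := mminus_near d0; have [A2 _ hA2] := mplus_near d0.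
exists (Num.max A1 A2) => A l; rewrite ge_max => /andP[AA1 AA2].
have d3 : d <= 1 / 3 by rewrite /d ge_min lexx.
have d9 : d <= e / 9 by rewrite /d ge_min lexx orbT.
pose W := rot Phi A l%:C *m dagger (rot Phi (- A) l%:C).
have Wu := unitary_mul (rot_dagger_mul F A l) (rot_dagger_mul F (- A) l).
pose q := frame l (mminus D) A; pose p := frame l (mplus D) A.
have hq i j : modc (q i j - W i j) <= 3 * d.
  have -> : q i j - W i j = (W *m (frame l (mminus D) (- A) - 1%:M)) i j.
    by rewrite mulmxBr mulmx1 [RHS]mxE [X in _ = _ + X]mxE /q (mminus_frame l A (- A)) mulmxA.
  have := @mul3_le _ W (frame l (mminus D) (- A) - 1%:M) 1 d ler01 (fun k n => unitary_le k n Wu) _ i j.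
  rewrite mulr1; apply => k n; have := hA1 A l AA1 k n.
  by rewrite [X in _ -> modc X <= _]mxE [X in _ -> modc (_ + X) <= _]mxE.
have hp i j : modc ((dagger p - 1%:M) i j) <= d.
  have := hA2 A l AA2 j i; rewrite -modc_conj conjcB -!daggerE dagger1 -/p.
  by rewrite [X in _ -> modc X <= _]mxE [X in _ -> modc (_ + X) <= _]mxE.
have q2 i j : modc (q i j) <= 2.
  have := modcD (q i j - W i j) (W i j); rewrite subrK; have := hq i j; have := unitary_le i j Wu.
  by move: d3; rewrite /W; lra.
have SE : smx D l = q + (dagger p - 1%:M) *m q.
  rewrite mulmxBl mul1mx addrC subrK /smx.
  exact: (scattering_frame F (Q := U) (a := A) (fun _ _ => erefl) (mminusP D) (mplusP D)).
have WE : propag Phi A (- A) l%:C 1%:M j1 j1 = W j1 j1.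
  by rewrite /W -propag_frame exp_adE subrr mulr0 cexp0 mul1r.
rewrite h1 SE WE.
have -> : (q + (dagger p - 1%:M) *m q) j1 j1 - W j1 j1 =
  (q j1 j1 - W j1 j1) + ((dagger p - 1%:M) *m q) j1 j1 by rewrite [in LHS]mxE addrAC.
apply: (le_trans (modcD _ _)).
have := mul3_le (ltW d0) hp q2 j1 j1; have := hq j1 j1.
set a := modc _; set b := modc _; move: d9; lra.
Qed.

End Full.
End FullLine.

(** * Oscillatory integrals against the potential *)

Section PotentialEntries.
Context {R : realType}.
Notation C := R[i].
Notation M3 := 'M[C]_3.
Variables u v : R -> C.

Lemma potentialE (y : R) : [/\ forall i, potential u v y i i = 0,
  potential u v y j1 j2 = u y /\ potential u v y j1 j3 = v y,
  potential u v y j2 j1 = - (u y)^cj /\ potential u v y j3 j1 = - (v y)^cj &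
  potential u v y j2 j3 = 0 /\ potential u v y j3 j2 = 0].
Proof. by split; [apply: ord3E|split|split|split]; rewrite mxE. Qed.

Lemma potential_anti (y : R) : dagger (potential u v y) = - potential u v y.
Proof.
have [d [e1 e2] [e3 e4] [e5 e6]] := potentialE y.
have c0 : (0 : C)^cj = 0 by apply: eqC; rewrite ?ReImE ?oppr0.
have cK (z : C) : z^cj^cj = z by apply: eqC; rewrite !ReImE ?opprK.
apply/matrixP => i j; rewrite daggerE [RHS]mxE; move: i j; apply: ord3E; apply: ord3E;
by rewrite ?d ?e1 ?e2 ?e3 ?e4 ?e5 ?e6 ?conjcN ?cK ?c0 ?oppr0 ?opprK.
Qed.

Lemma potential_mrcont : rcont u -> rcont v -> mrcont (potential u v).
Proof.
move=> uc vc i j.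
have E k m (f : R -> C) : (forall y, potential u v y k m = f y) -> (fun y => potential u v y k m) = f.
  by move=> h; apply/funext.
move: i j; apply: ord3E; apply: ord3E;
  [rewrite (E _ _ (fun=> 0))|rewrite (E _ _ u)|rewrite (E _ _ v)|rewrite (E _ _ (fun y => - (u y)^cj))|
   rewrite (E _ _ (fun=> 0))|rewrite (E _ _ (fun=> 0))|rewrite (E _ _ (fun y => - (v y)^cj))|
   rewrite (E _ _ (fun=> 0))|rewrite (E _ _ (fun=> 0))];
  try (by move=> y; have [d [e1 e2] [e3 e4] [e5 e6]] := potentialE y; rewrite ?d ?e1 ?e2 ?e3 ?e4 ?e5 ?e6);
  try exact: rcont_cst; rewrite //.
- by apply: rcontN; exact: rcontJ.
- by apply: rcontN; exact: rcontJ.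
Qed.

Lemma potential_le (y : R) i j : modc (potential u v y i j) <= modc (u y) + modc (v y).
Proof.
have [d [e1 e2] [e3 e4] [e5 e6]] := potentialE y.
have h0 : 0 <= modc (u y) + modc (v y) by rewrite addr_ge0 ?modc_ge0.
move: i j; apply: ord3E; apply: ord3E; rewrite ?d ?e1 ?e2 ?e3 ?e4 ?e5 ?e6 ?modcN ?modc_conj ?modc0 //.
- by rewrite lerDl modc_ge0.
- by rewrite lerDr modc_ge0.
- by rewrite lerDl modc_ge0.
- by rewrite lerDr modc_ge0.
Qed.

End PotentialEntries.

Section Oscillation.
Context {R : realType}.
Notation C := R[i].
Notation M3 := 'M[C]_3.

Lemma modc2 : modc (2 : C) = 2.
Proof.
have -> : (2 : C) = (2 : R)%:C by rewrite rmorph_nat.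
by rewrite modc_real ger0_norm.
Qed.

(** Beyond some radius the tails contribute at most one each, and the bounded interval left over
    contributes a fixed amount. *)
Lemma bounded_variation (f : R -> C) : rcont f -> tails_vanish f ->
  exists2 L : R, 0 <= L & forall s t, s <= t -> absprim f t - absprim f s <= L.
Proof.
move=> fc ft; have [A A0 hA] := ft 1 ltr01.
have mono s t := @absprim_mono _ f s t fc.
have AA : - A <= A by move: A0; clear; lra.
exists (1 + 1 + (absprim f A - absprim f (- A))) => [|s t st].
  by have := mono _ _ AA; clear; lra.
have h1 : absprim f t <= absprim f A + 1.
  have [tA|/ltW At] := leP t A; first by have := mono _ _ tA; clear; lra.
  by have := hA A t At; rewrite lexx orbT => /(_ isT); clear; lra.
have h2 : absprim f (- A) - 1 <= absprim f s.
  have [sA|/ltW As] := leP (- A) s; first by have := mono _ _ sA; clear; lra.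
  by have := hA s (- A) As; rewrite lexx => /(_ isT); clear; lra.
by move: h1 h2; clear; lra.
Qed.

(** On an interval of length one the modulus varies by at most [(1 + W) / 2], and its integral is
    at most [L]. *)
Lemma sobolev_bounded (f : R -> C) gam W L : sobolev f gam W ->
  (forall s t, s <= t -> absprim f t - absprim f s <= L) ->
  forall y, modc (f y) <= L + (1 + W) / 2.
Proof.
move=> hs hL y; have fc := sobolev_rcont hs; have [g1 g2 g3] := hs.
pose m := modc (f y) - (1 + W) / 2.
have y1 : y <= y + 1 by rewrite lerDl.
have low t : y <= t <= y + 1 -> m <= modc (f t).
  move=> /andP[t1 t2]; have := g3 y t 1 t1 ltr01; rewrite mul1r divr1.
  have := g2 t; have := g2 y => /andP[a1 _] /andP[_ a2].
  have := modc_sub_le (f y) (f t); rewrite [modc (f y - f t)]modcBC /m; move: t2 a1 a2; clear; lra.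
have dd (t : R) : is_derive t 1 (fun t => absprim f t - m * t) (modc (f t) - m).
  apply: (is_derive_eq (is_deriveB' (absprimP t fc) (is_deriveM' (is_derive_cst m t 1) (is_derive_id t 1)))).
  by rewrite mul0r add0r mulr1.
have := @derive_ge0_le _ _ _ y (y + 1) y1 (fun t _ => dd t).
move=> h; have {}h : absprim f y - m * y <= absprim f (y + 1) - m * (y + 1).
  by apply: h => t ty; rewrite subr_ge0 low.
have := hL y (y + 1) y1; move: h; rewrite /m; clear; lra.
Qed.

(** Decay of an oscillatory integral: the kernel is integrated, and the derivative falls partly
    on the amplitude [a], partly on the rough function [f], where only a Cauchy-Schwarz bound
    is available.  The factor [modc th] in [w] balances the two terms of that bound. *)
Lemma osc_bound (f a a' : R -> C) (gam T t G g : R -> R) (W M L x p q : R) (th : C) :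
  sobolev f gam W -> (forall y, modc (f y) <= M) -> p <= q -> th != 0 ->
  (forall y, rder a y (a' y)) -> rcont a' ->
  (forall y, p <= y <= q -> modc (a y) <= 1) -> (forall y, p <= y <= q -> modc (a' y) <= t y) ->
  (forall y : R, is_derive y 1 T (t y)) -> T q - T p <= L ->
  (forall y, p <= y <= q -> modc (cexp (th * (y - x)%:C)) <= 1) ->
  (forall y : R, is_derive y 1 G (g y)) ->
  (forall y, p <= y <= q -> modc (cexp (th * (y - x)%:C)) ^+ 2 <= g y) ->
  modc (cint (fun y => f y * (cexp (th * (y - x)%:C) * a y)) p q) <=
    (2 * M + (W + (G q - G p)) / 2 + M * L) / modc th.
Proof.
move=> hs fM pq th0 da a'c a1 a't dT TL K1 dG Kg.
have fc := sobolev_rcont hs; have [g1 g2 g3] := hs.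
pose K (y : R) := cexp (th * (y - x)%:C).
have M0 : 0 <= M := le_trans (modc_ge0 _) (fM 0).
have dK y : rder K y (K y * th).
  apply: rder_cexp; apply: (rder_eq (rderZ th (rder_real (is_deriveB' (is_derive_id y 1) (is_derive_cst x y 1))))).
  by rewrite subr0 mulr1.
have Kc := rder_rcont dK; have ac := rder_rcont da.
have mt : 0 < modc th by rewrite modc_gt0.
(* a unimodular factor, so that [w'] contains the integrand with the positive factor [modc th] *)
pose c : C := (modc th)%:C / th.
have c1 : modc c = 1 by rewrite /c modcM modcV modc_real ger0_norm ?modc_ge0 // divff // gt_eqF.
pose w y := c * (K y * a y).
pose w' y := (modc th)%:C * (K y * a y) + c * (K y * a' y).
have dw y : rder w y (w' y).
  apply: (rder_eq (rderZ c (rderM (dK y) (da y)))); rewrite mulrDr /w'; congr (_ + _).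
  by rewrite /c; field.
have w'c : rcont w'.
  apply: rcontD; apply: rcontM; try exact: rcont_cst; exact: rcontM.
have wb y : p <= y <= q -> modc (w y) ^+ 2 <= g y.
  move=> ypq; apply: le_trans (Kg y ypq); rewrite /w modcM c1 mul1r modcM exprMn.
  rewrite -[leRHS]mulr1; apply: ler_wpM2l; first exact: sqr_ge0.
  by rewrite expr_le1 ?modc_ge0 // a1.
have bp := by_parts_le hs pq dw w'c dG wb.
pose I := cint (fun y => f y * (K y * a y)) p q; pose J := cint (fun y => f y * (K y * a' y)) p q.
have hc1 : rcont (fun y => f y * (K y * a y)) by apply: rcontM => //; exact: rcontM.
have hc2 : rcont (fun y => f y * (K y * a' y)) by apply: rcontM => //; exact: rcontM.
have E : cint (fun y => f y * w' y) p q = (modc th)%:C * I + c * J.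
  have -> : (fun y => f y * w' y) = (fun y => (modc th)%:C * (f y * (K y * a y)) + c * (f y * (K y * a' y))).
    by apply/funext => y; rewrite /w'; ring.
  by rewrite cintD ?cintZ //; apply: rcontM => //; exact: rcont_cst.
have hJ : modc J <= M * L.
  have dMT (y : R) : is_derive y 1 (fun y => M * T y) (M * t y).
    apply: (is_derive_eq (is_deriveM' (is_derive_cst M y 1) (dT y))).
    by rewrite mul0r add0r.
  have := @rder_le _ (cint (fun y => f y * (K y * a' y)) p) (fun y => f y * (K y * a' y)) (fun y => M * T y)
    (fun y => M * t y) p q pq (fun y _ => cint_rder p y hc2) (fun y _ => dMT y).
  rewrite cint_id subr0 -/J -mulrBr => h; apply: (le_trans (h _)); last by rewrite ler_wpM2l.
  move=> y ypq; rewrite modcM [modc (K y * _)]modcM; apply: ler_pM => //; rewrite ?mulr_ge0 ?modc_ge0 //.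
  rewrite -[leRHS]mul1r; apply: ler_pM; rewrite ?modc_ge0 ?a't //; exact: K1.
have wle y : p <= y <= q -> modc (f y * w y) <= M.
  move=> ypq; rewrite modcM /w [modc (c * _)]modcM c1 mul1r modcM -[leRHS]mulr1; apply: ler_pM; rewrite ?mulr_ge0 ?modc_ge0 //.
  rewrite -[leRHS]mulr1; apply: ler_pM; rewrite ?modc_ge0 //; [exact: K1|exact: a1].
have wp := wle p; have wq := wle q; rewrite !lexx pq /= in wp wq.
rewrite -/I ler_pdivlMr // mulrC.
have -> : modc th * modc I = modc ((modc th)%:C * I) by rewrite modcM modc_real ger0_norm // modc_ge0.
set X := (modc th)%:C * I in E *.
have -> : X = f q * w q - f p * w p - (f q * w q - f p * w p - cint (fun y => f y * w' y) p q) - c * J.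
  by rewrite E; ring.
set B := f q * w q - f p * w p - cint _ _ _ in bp *.
have t1 := modcB (f q * w q - f p * w p - B) (c * J).
have t2 := modcB (f q * w q - f p * w p) B; have t3 := modcB (f q * w q) (f p * w p).
rewrite [modc (c * J)]modcM c1 mul1r in t1.
have gg : gam q - gam p <= W by have /andP[_ h1] := g2 q; have /andP[h2 _] := g2 p; clear -h1 h2; lra.
move: (wp isT) (wq isT) hJ bp t1 t2 t3 gg; clear; lra.
Qed.

Variables (u v : R -> C).
Hypotheses (hu : H11 u) (hv : H11 v).

Definition pot_abs (y : R) : R := modc (u y) + modc (v y).
Definition pot_prim (y : R) : R := absprim u y + absprim v y.

Lemma H11_rcont (f : R -> C) : H11 f -> rcont f.
Proof. by move=> hf; have [gam [W hs]] := H11_sobolev hf; exact: sobolev_rcont hs. Qed.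

Lemma pot_primP (y : R) : is_derive y 1 pot_prim (pot_abs y).
Proof. by apply: is_deriveD'; apply: absprimP; exact: H11_rcont. Qed.

Lemma pot_abs_ge0 y : 0 <= pot_abs y.
Proof. by rewrite addr_ge0 ?modc_ge0. Qed.

Lemma pot_tail (e : R) : 0 < e -> exists2 A : R, 0 < A &
  forall r s, r <= s -> (s <= - A) || (A <= r) -> pot_prim s - pot_prim r <= e.
Proof.
move=> e0; have e2 : 0 < e / 2 by rewrite divr_gt0.
have [A A0 hA] := H11_tails hu e2; have [B B0 hB] := H11_tails hv e2.
exists (A + B) => [|r s rs h]; first by rewrite addr_gt0.
have h1 : (s <= - A) || (A <= r).
  by case/orP: h => h; apply/orP; [left|right]; move: h B0; lra.
have h2 : (s <= - B) || (B <= r).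
  by case/orP: h => h; apply/orP; [left|right]; move: h A0; lra.
have := hA r s rs h1; have := hB r s rs h2; rewrite /pot_prim; lra.
Qed.

Definition pot_like (gam : R -> R) (W : R) (f : R -> C) :=
  sobolev f gam W /\ forall y, modc (f y) <= pot_abs y.

Lemma pot_like_ex : exists gam W, forall f : R -> C,
  [\/ f = u, f = v, f = (fun y => (u y)^cj) | f = (fun y => (v y)^cj)] -> pot_like gam W f.
Proof.
have [g1 [W1 [a1 a2 a3]]] := H11_sobolev hu; have [g2 [W2 [b1 b2 b3]]] := H11_sobolev hv.
exists (fun y => g1 y + g2 y), (W1 + W2) => f hf.
have base : (forall s t, s <= t -> g1 s + g2 s <= g1 t + g2 t) /\ (forall t, 0 <= g1 t + g2 t <= W1 + W2).
  split; first by move=> s t st; apply: lerD; [exact: a1|exact: b1].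
  by move=> t; have /andP[h1 h2] := a2 t; have /andP[h3 h4] := b2 t; rewrite addr_ge0 // lerD.
have su s t lam : s <= t -> 0 < lam -> modc (u t - u s) <= (lam * (t - s) + (g1 t + g2 t - (g1 s + g2 s)) / lam) / 2.
  move=> st l0; apply: (le_trans (a3 s t lam st l0)); rewrite ler_pM2r // lerD2l ler_pM2r ?invr_gt0 //.
  by have := b1 s t st; lra.
have sv s t lam : s <= t -> 0 < lam -> modc (v t - v s) <= (lam * (t - s) + (g1 t + g2 t - (g1 s + g2 s)) / lam) / 2.
  move=> st l0; apply: (le_trans (b3 s t lam st l0)); rewrite ler_pM2r // lerD2l ler_pM2r ?invr_gt0 //.
  by have := a1 s t st; lra.
have [base1 base2] := base.
case: hf => ->; split; try (split => //).
- by move=> y; rewrite lerDl modc_ge0.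
- by move=> y; rewrite lerDr modc_ge0.
- by move=> s t lam; rewrite -conjcB modc_conj; exact: su.
- by move=> y; rewrite modc_conj lerDl modc_ge0.
- by move=> s t lam; rewrite -conjcB modc_conj; exact: sv.
- by move=> y; rewrite modc_conj lerDr modc_ge0.
Qed.

(** Decay of the oscillatory integrals in one predicate, because it is used with two values of
    [beta]: arbitrarily small up to the real axis, and of order $1/|z|$ away from it.  The sign [s]
    is the direction in which the kernel decays; the bound on [a'] is the one that the Lax equation
    gives for the entries of a column. *)
Definition osc (z : C) (beta : R) := forall (f a a' : R -> C) (p q x s : R),
  [\/ f = u, f = v, f = (fun y => (u y)^cj) | f = (fun y => (v y)^cj)] ->
  (s = 1) \/ (s = -1) -> p <= q -> (forall y, p <= y <= q -> 0 <= s * (y - x)) ->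
  (forall y, rder a y (a' y)) -> rcont a' ->
  (forall y, p <= y <= q -> modc (a y) <= 1) -> (forall y, p <= y <= q -> modc (a' y) <= pot_abs y) ->
  modc (cint (fun y => f y * (cexp ((2 * 'i * z * s%:C) * (y - x)%:C) * a y)) p q) <= beta.

Let kernel (z : C) (s r : R) : 0 <= complex.Im z ->
  modc (cexp ((2 * 'i * z * s%:C) * r%:C)) = expR (- (2 * complex.Im z) * (s * r)).
Proof.
move=> z0; rewrite modc_cexp; congr expR.
have -> : 2 * 'i * z * s%:C * r%:C = ('i * z) * (2 * s * r)%:C by rewrite !rmorphM /= rmorph_nat; ring.
rewrite !ReImE !(mulr0, mul0r, subr0, addr0, sub0r, mul1r, add0r); ring.
Qed.

Let consts : exists gam W M L, [/\ forall f : R -> C,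
  [\/ f = u, f = v, f = (fun y => (u y)^cj) | f = (fun y => (v y)^cj)] ->
     pot_like gam W f /\ forall y, modc (f y) <= M,
  0 <= W, 0 <= M, 0 <= L & forall s t, s <= t -> pot_prim t - pot_prim s <= L].
Proof.
have [gam [W hW]] := pot_like_ex.
have [L1 L10 hL1] := bounded_variation (H11_rcont hu) (H11_tails hu).
have [L2 L20 hL2] := bounded_variation (H11_rcont hv) (H11_tails hv).
have [|su _] := hW u; first by constructor 1.
have [|sv _] := hW v; first by constructor 2.
have W0 : 0 <= W by have [_ h _] := su; have /andP[] := h 0; exact: le_trans.
have bu := sobolev_bounded su hL1; have bv := sobolev_bounded sv hL2.
exists gam, W, (L1 + L2 + (1 + W) / 2), (L1 + L2); split => //.
- move=> f hf; split; first exact: hW.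
  move=> y; have := bu y; have := bv y.
  case: hf => ->; rewrite ?modc_conj; move: L10 L20; lra.
- by move: L10 L20 W0; lra.
- by rewrite addr_ge0.
- by move=> s t st; have := hL1 s t st; have := hL2 s t st; rewrite /pot_prim; lra.
Qed.

Lemma osc_rate (d : R) : 0 < d -> exists2 K : R, 0 <= K &
  forall z, d <= complex.Im z -> osc z (K / modc z).
Proof.
move=> d0; have [gam [W [M [L [hf W0 M0 L0 hL]]]]] := consts.
pose X := 2 * M + (W + (4 * d)^-1) / 2 + M * L.
have d4 : 0 < (4 * d)^-1 by rewrite invr_gt0 mulr_gt0.
have X0 : 0 <= X by rewrite !addr_ge0 ?mulr_ge0 ?divr_ge0 ?addr_ge0 // ltW.
exists X => // z dz f a a' p q x s hfam hs pq side da a'c a1 a't.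
have [[sob fabs] fM] := hf f hfam.
have z0 : 0 <= complex.Im z by apply: le_trans dz; exact: ltW.
have zn : z != 0 by apply/eqP => E; move: dz; rewrite E Im0 leNgt d0.
have s0 : s * s = 1 by case: hs => ->; rewrite ?mulr1 // mulrNN mulr1.
have sC : modc (s%:C : C) = 1 by rewrite modc_real; case: hs => ->; rewrite ?normrN normr1.
have m2 := modc2.
have thE : modc (2 * 'i * z * s%:C) = 2 * modc z by rewrite !modcM sC modc_i m2 !mulr1.
have zm : 0 < modc z by rewrite modc_gt0.
have th0 : 2 * 'i * z * s%:C != 0 by rewrite -modc_gt0 thE mulr_gt0.
pose g (y : R) := expR (- (4 * d * s) * (y - x)).
(* bounded by 1 / (4 d) on the side where the kernel decays, independently of the interval *)
pose G (y : R) := - (s / (4 * d)) * expR (- (4 * d * s) * (y - x)).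
have dn : d != 0 by rewrite gt_eqF.
have dG (y : R) : is_derive y 1 G (g y).
  have e1 := derive_expR (- (4 * d * s)) y.
  have e2 := is_deriveM' (is_derive_cst (- (s / (4 * d)) * expR (4 * d * s * x)) y 1) e1.
  have fE : (fun y : R => - (s / (4 * d)) * expR (4 * d * s * x) * expR (- (4 * d * s) * y)) = G.
    by apply/funext => r; rewrite /G -mulrA -expRD; congr (_ * expR _); ring.
  rewrite fE in e2; apply: (is_derive_eq e2); rewrite mul0r add0r.
  have -> : - (s / (4 * d)) * expR (4 * d * s * x) * (expR (- (4 * d * s) * y) * - (4 * d * s)) =
    (s * s) * (expR (4 * d * s * x) * expR (- (4 * d * s) * y)) by field.
  by rewrite s0 mul1r -expRD /g; congr expR; ring.
have g1 y : p <= y <= q -> 0 <= g y <= 1.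
  move=> ypq; rewrite expR_ge0 /= -expR0 ler_expR mulNr oppr_le0 -!mulrA mulr_ge0 //.
  by rewrite mulr_ge0 ?side // ltW.
have k1 y : p <= y <= q -> modc (cexp (2 * 'i * z * s%:C * (y - x)%:C)) <= 1.
  move=> ypq; rewrite kernel // -expR0 ler_expR mulNr oppr_le0 mulr_ge0 ?side // mulr_ge0 //.
have k2 y : p <= y <= q -> modc (cexp (2 * 'i * z * s%:C * (y - x)%:C)) ^+ 2 <= g y.
  move=> ypq; rewrite kernel // -expRM_natl ler_expR.
  have := ler_wpM2r (side y ypq) dz.
  have -> : - (4 * d * s) * (y - x) = - 4 * (d * (s * (y - x))) by ring.
  have -> : 2 * (- (2 * complex.Im z) * (s * (y - x))) = - 4 * (complex.Im z * (s * (y - x))) by ring.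
  set r := d * _; set r' := _ * (s * _); lra.
have ppq : p <= p <= q by rewrite lexx.
have qpq : p <= q <= q by rewrite pq lexx.
have := osc_bound sob fM pq th0 da a'c a1 a't pot_primP (hL p q pq) k1 dG k2.
move=> h; apply: (le_trans h); rewrite thE.
have dGle : G q - G p <= (4 * d)^-1.
  have /andP[p1 p2] := g1 p ppq; have /andP[q1 q2] := g1 q qpq.
  have -> : G q - G p = (4 * d)^-1 * (s * (g p - g q)).
    by rewrite /G -/(g q) -/(g p); ring.
  rewrite -[leRHS]mulr1 ler_pM2l //; case: hs => ->; move: p1 p2 q1 q2; lra.
have : (2 * M + (W + (G q - G p)) / 2 + M * L) <= X.
  by rewrite /X lerD2r lerD2l ler_pM2r // lerD2l.
move=> h'; apply: (@le_trans _ _ (X / (2 * modc z))); first by rewrite ler_pM2r // invr_gt0 mulr_gt0.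
rewrite ler_wpM2l // lef_pV2 ?posrE ?mulr_gt0 //; move: zm; lra.
Qed.

(** Uniformly up to the real axis the tails of the potential carry no oscillation and are simply
    small; on the remaining bounded interval the kernel is merely bounded. *)
Lemma osc_small (e : R) : 0 < e -> exists2 Z : R, 0 < Z &
  forall z, 0 <= complex.Im z -> Z <= modc z -> osc z e.
Proof.
move=> e0; have [gam [W [M [L [hf W0 M0 L0 hL]]]]] := consts.
have e4 : 0 < e / 4 by rewrite divr_gt0.
have [B B0 hB] := pot_tail e4.
pose X := 2 * M + (W + 2 * B) / 2 + M * L.
have X0 : 0 <= X by rewrite !addr_ge0 ?mulr_ge0 ?divr_ge0 ?addr_ge0 ?mulr_ge0 // ltW.
exists ((X + 1) / e) => [|z z0 Zz f a a' p q x s hfam hs pq side da a'c a1 a't].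
  by rewrite divr_gt0 // ltr_wpDl.
have zm : 0 < modc z by apply: lt_le_trans Zz; rewrite divr_gt0 // ltr_wpDl.
have [[sob fabs] fM] := hf f hfam.
have sC : modc (s%:C : C) = 1 by rewrite modc_real; case: hs => ->; rewrite ?normrN normr1.
have m2 := modc2.
have thE : modc (2 * 'i * z * s%:C) = 2 * modc z by rewrite !modcM sC modc_i m2 !mulr1.
have th0 : 2 * 'i * z * s%:C != 0 by rewrite -modc_gt0 thE mulr_gt0.
pose h y := f y * (cexp (2 * 'i * z * s%:C * (y - x)%:C) * a y).
have hc : rcont h.
  apply: rcontM; first exact: sobolev_rcont sob.
  apply: rcontM; last exact: rder_rcont da.
  have dK y : rder (fun y => cexp (2 * 'i * z * s%:C * (y - x)%:C)) y
     (cexp (2 * 'i * z * s%:C * (y - x)%:C) * (2 * 'i * z * s%:C)).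
    apply: rder_cexp; apply: (rder_eq (rderZ _ (rder_real (is_deriveB' (is_derive_id y 1) (is_derive_cst x y 1))))).
    by rewrite subr0 mulr1.
  exact: rder_rcont dK.
have k1 y : p <= y <= q -> modc (cexp (2 * 'i * z * s%:C * (y - x)%:C)) <= 1.
  by move=> ypq; rewrite kernel // -expR0 ler_expR mulNr oppr_le0 mulr_ge0 ?side // mulr_ge0.
(* the part of [p, q] that lies in [-B, B], degenerate if there is none *)
pose p' := Num.min (Num.max p (- B)) q; pose q' := Num.max (Num.min q B) p'.
have pp' : p <= p' by rewrite /p' le_min pq le_max lexx.
have p'q : p' <= q by rewrite /p' ge_min lexx orbT.
have p'q' : p' <= q' by rewrite /q' le_max lexx orbT.
have q'q : q' <= q by rewrite /q' ge_max ge_min lexx p'q.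
have tail r t : p <= r -> r <= t -> t <= q -> (r = t) \/ (t <= - B) || (B <= r) -> modc (cint h r t) <= e / 4.
  move=> pr rt tq [->|hrt]; first by rewrite cint_id modc0 ltW.
  apply: le_trans (hB r t rt hrt).
  have := @rder_le _ (cint h r) h pot_prim pot_abs r t rt (fun y _ => cint_rder r y hc) (fun y _ => pot_primP y).
  rewrite cint_id subr0; apply => y /andP[ry yt].
  have ypq : p <= y <= q by rewrite (le_trans pr) // (le_trans yt).
  rewrite /h modcM [modc (cexp _ * _)]modcM -[leRHS]mulr1; apply: ler_pM; rewrite ?mulr_ge0 ?modc_ge0 //.
  rewrite -[leRHS]mulr1; apply: ler_pM; rewrite ?modc_ge0 //; [exact: k1|exact: a1].
have t1 : modc (cint h p p') <= e / 4.
  apply: tail => //; have [pB|Bp] := leP p (- B).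
    by right; apply/orP; left; rewrite /p' max_r // ge_min lexx.
  by left; rewrite /p' max_l ?min_l // ltW.
have t2 : modc (cint h q' q) <= e / 4.
  apply: tail => //; first exact: le_trans p'q'.
  have [qB|Bq] := leP q B; last by right; apply/orP; right; rewrite /q' (min_r (ltW Bq)) le_max lexx.
  by left; rewrite /q' min_l // max_l.
have len : q' - p' <= 2 * B.
  have h1 : p' = q \/ - B <= p'.
    rewrite /p'; have := leP (Num.max p (- B)) q; case=> _; [right|by left].
    by rewrite le_max lexx orbT.
  have h2 : q' = p' \/ q' <= B.
    rewrite /q'; have := leP (Num.min q B) p'; case=> _; [by left|right].
    by rewrite ge_min lexx orbT.
  case: h1 => h1; case: h2 => h2; clearbody p' q'; move: p'q q'q B0 h1 h2; lra.
have t3 : modc (cint h p' q') <= e / 2.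
  have sub y : p' <= y <= q' -> p <= y <= q.
    by move=> /andP[h1 h2]; rewrite (le_trans pp') // (le_trans h2).
  have := @osc_bound f a a' gam pot_prim pot_abs id (fun=> 1) W M L x p' q' _ sob fM p'q' th0 da a'c
    (fun y hy => a1 y (sub y hy)) (fun y hy => a't y (sub y hy)) pot_primP (hL p' q' p'q')
    (fun y hy => k1 y (sub y hy)) (fun y => is_derive_id y 1) _.
  rewrite thE => hb; apply: (le_trans (hb _)).
    by move=> y hy; rewrite expr_le1 ?modc_ge0 // k1 // sub.
  apply: (@le_trans _ _ (X / (2 * modc z))).
    rewrite ler_pM2r ?invr_gt0 ?mulr_gt0 // /X lerD2r lerD2l ler_pM2r // lerD2l //.
  rewrite ler_pdivrMr ?mulr_gt0 //; move: Zz; rewrite ler_pdivrMr //; lra.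
have -> : cint h p q = cint h p p' + (cint h p' q' + cint h q' q).
  by rewrite -(cint_chain h p' q' q) -cint_chain.
have b1 := modcD (cint h p p') (cint h p' q' + cint h q' q); have b2 := modcD (cint h p' q') (cint h q' q).
move: t1 t2 t3 b1 b2; lra.
Qed.

End Oscillation.

(** * Asymptotics of the Jost columns *)

Section ColumnAsymptotics.
Context {R : realType}.
Notation C := R[i].
Notation M3 := 'M[C]_3.

Lemma variation_of_constants (b r : R -> C) (th : C) (p q x : R) :
  (forall y, rder b y (- th * b y + r y)) -> rcont r ->
  cint (fun y => cexp (th * (y - x)%:C) * r y) p q =
  cexp (th * (q - x)%:C) * b q - cexp (th * (p - x)%:C) * b p.
Proof.
move=> db rc; pose K (y : R) := cexp (th * (y - x)%:C).
have dK y : rder K y (K y * th).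
  apply: rder_cexp; apply: (rder_eq (rderZ th (rder_real (is_deriveB' (is_derive_id y 1) (is_derive_cst x y 1))))).
  by rewrite subr0 mulr1.
have Kc := rder_rcont dK.
apply: (cint_FTC (F := fun y => K y * b y)) => [|y]; first exact: rcontM.
by apply: (rder_eq (rderM (dK y) (db y))); rewrite /K; ring.
Qed.

Variables (u v : R -> C).
Hypotheses (hu : H11 u) (hv : H11 v).
Variable Phi : R -> C -> M3.
Hypothesis F : fundamental (potential u v) Phi.

Lemma pot_variation : exists2 L : R, 0 <= L & forall s t, s <= t -> pot_prim u v t - pot_prim u v s <= L.
Proof.
have [L1 L10 hL1] := bounded_variation (H11_rcont hu) (H11_tails hu).
have [L2 L20 hL2] := bounded_variation (H11_rcont hv) (H11_tails hv).
exists (L1 + L2) => [|s t st]; first by rewrite addr_ge0.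
by have := hL1 s t st; have := hL2 s t st; rewrite /pot_prim; lra.
Qed.

Lemma propag_ode p z k i y : rder (fun y => propag Phi y p z 1%:M i k) y
  ('i * z * (sigma_diag 0 i - sigma_diag 0 k) * propag Phi y p z 1%:M i k +
   \sum_m potential u v y i m * propag Phi y p z 1%:M m k).
Proof.
pose Tm y := Phi y z *m dagger (Phi p z^cj).
pose c y := cexp (- ('i * (z * (y - p)%:C) * sigma_diag 0 k)).
have E m : (fun y => propag Phi y p z 1%:M m k) = (fun y => c y * Tm y m k).
  by apply/funext => r; rewrite propag_entry.
have E' r m : propag Phi r p z 1%:M m k = c r * Tm r m k by rewrite propag_entry.
have dT : rder (fun y => Tm y i k) y (\sum_m (('i * z) *: @sg R + potential u v y) i m * Tm y m k).
  have := mrderM (fund_der F y z) (mrder_cst (dagger (Phi p z^cj)) y) i k.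
  by rewrite mulmx0 addr0 -mulmxA => h; apply: (rder_eq h); rewrite [LHS]mxE.
have dc : rder c y (c y * (- ('i * z * sigma_diag 0 k))).
  have -> : c = (fun y : R => cexp ((- ('i * z * sigma_diag 0 k)) * (y - p)%:C)).
    by apply/funext => r; rewrite /c; congr cexp; ring.
  apply: rder_cexp; apply: (rder_eq (rderZ _ (rder_real (is_deriveB' (is_derive_id y 1) (is_derive_cst p y 1))))).
  by rewrite subr0 mulr1.
rewrite E; apply: (rder_eq (rderM dc dT)); rewrite E'.
have -> : \sum_m potential u v y i m * propag Phi y p z 1%:M m k = c y * \sum_m potential u v y i m * Tm y m k.
  by rewrite mulr_sumr; apply: eq_bigr => m _; rewrite E'; ring.
have -> : \sum_m (('i * z) *: @sg R + potential u v y) i m * Tm y m k =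
    'i * z * sigma_diag 0 i * Tm y i k + \sum_m potential u v y i m * Tm y m k.
  have sgE m : (('i * z) *: @sg R) i m = 'i * z * (sigma_diag 0 i * (i == m)%:R).
    by rewrite mxE /sg [X in _ * X]mxE mulr_natr.
  have -> : \sum_m (('i * z) *: @sg R + potential u v y) i m * Tm y m k =
     \sum_m (('i * z * (sigma_diag 0 i * (i == m)%:R)) * Tm y m k + potential u v y i m * Tm y m k).
    have aD (P P' : M3) m : (P + P') i m = P i m + P' i m by rewrite mxE.
    by apply: eq_bigr => m _; rewrite aD sgE mulrDl.
  rewrite big_split /=; congr (_ + _); rewrite (bigD1 i) //= eqxx mulr1 big1 ?addr0 // => m /negbTE mi.
  by rewrite eq_sym mi !mulr0 mul0r.
by ring.
Qed.

Lemma propag_base p z i k : propag Phi p p z 1%:M i k = (i == k)%:R.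
Proof. by rewrite (propag_id F) mxE. Qed.

Variables (L : R) (z : C) (beta : R).
Hypothesis hL : forall s t, s <= t -> pot_prim u v t - pot_prim u v s <= L.
Hypothesis z0 : 0 <= complex.Im z.
Hypothesis hosc : osc u v z beta.

Let N p k i y := propag Phi y p z 1%:M i k.

Let N_rcont p k i : rcont (N p k i).
Proof. exact: rder_rcont (propag_ode p z k i). Qed.

Let sig : [/\ sigma_diag 0 j1 = -1 :> C, sigma_diag 0 j2 = 1 :> C & sigma_diag 0 j3 = 1 :> C].
Proof. by split; rewrite mxE. Qed.

Let uc := H11_rcont hu.
Let vc := H11_rcont hv.

Let N1_der p k y : rder (N p k j1) y ('i * z * (sigma_diag 0 j1 - sigma_diag 0 k) * N p k j1 y +
  (u y * N p k j2 y + v y * N p k j3 y)).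
Proof.
apply: (rder_eq (propag_ode p z k j1 y)); rewrite sum3.
by have [d [-> ->] _ _] := potentialE u v y; rewrite d mul0r add0r.
Qed.

Let N2_der p k y : rder (N p k j2) y ('i * z * (sigma_diag 0 j2 - sigma_diag 0 k) * N p k j2 y +
  - ((u y)^cj * N p k j1 y)).
Proof.
apply: (rder_eq (propag_ode p z k j2 y)); rewrite sum3.
by have [d _ [-> _] [-> _]] := potentialE u v y; rewrite d !mul0r !addr0 mulNr.
Qed.

Let N3_der p k y : rder (N p k j3) y ('i * z * (sigma_diag 0 j3 - sigma_diag 0 k) * N p k j3 y +
  - ((v y)^cj * N p k j1 y)).
Proof.
apply: (rder_eq (propag_ode p z k j3 y)); rewrite sum3.
by have [d _ [_ ->] [_ ->]] := potentialE u v y; rewrite d !mul0r !addr0 mulNr.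
Qed.

Let small_incr (f r : R -> C) (K s t : R) : 0 <= K -> s <= t -> (forall y, rder f y (r y)) ->
  (forall y, s <= y <= t -> modc (r y) <= K * pot_abs u v y) -> modc (f t - f s) <= K * L.
Proof.
move=> K0 st df rK.
have dK (y : R) : is_derive y 1 (fun y => K * pot_prim u v y) (K * pot_abs u v y).
  apply: (is_derive_eq (is_deriveM' (is_derive_cst K y 1) (pot_primP hu hv y))).
  by rewrite mul0r add0r.
apply: (le_trans (rder_le st (fun y _ => df y) (fun y _ => dK y) rK)).
by rewrite -mulrBr ler_wpM2l // hL.
Qed.

Let beta0 : 0 <= beta.
Proof.
have := @hosc u (fun=> 0) (fun=> 0) 0 0 0 1 (Or41 _ _ _ erefl) (or_introl erefl) (lexx _).
move=> h; apply: le_trans (h _ _ _ _ _); first exact: modc_ge0.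
- by move=> y /andP[y1 y2]; rewrite (@le_anti _ _ y 0) ?y1 ?y2 // subrr mulr0.
- by move=> y; exact: rder_cst.
- exact: rcont_cst.
- by move=> y _; rewrite modc0.
- by move=> y _; rewrite modc0 pot_abs_ge0.
Qed.

Let fam_conj (f : R -> C) : f = u \/ f = v ->
  [\/ (fun y => (f y)^cj) = u, (fun y => (f y)^cj) = v, (fun y => (f y)^cj) = (fun y => (u y)^cj) |
      (fun y => (f y)^cj) = (fun y => (v y)^cj)].
Proof. by case=> ->; [constructor 3|constructor 4]. Qed.

Let pair_le (a b : C) (y : R) (K : R) : modc a <= K -> modc b <= K ->
  modc (u y * a + v y * b) <= K * pot_abs u v y.
Proof.
move=> aK bK; apply: (le_trans (modcD _ _)); rewrite !modcM /pot_abs mulrDr.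
by apply: lerD; rewrite mulrC ler_wpM2r ?modc_ge0.
Qed.

Let minus_le p y i : p <= y -> modc (N p j1 i y) <= 1.
Proof.
move=> py; apply: (propag_le F) => //; have [-> _ _] := sig.
by rewrite ReN Re1 mulN1r oppr_le0 subr_ge0.
Qed.

Let plus_le p y i k : k != j1 -> y <= p -> modc (N p k i y) <= 1.
Proof.
move=> k1 py; apply: (propag_le F) => //.
have [_ s2 s3] := sig; move: k k1; apply: ord3E => //= _; by rewrite ?s2 ?s3 Re1 mul1r subr_le0.
Qed.

(** The two decaying entries are oscillatory integrals of the first entry, which is bounded by one;
    fed back, they make the first entry nearly constant.  The bounds do not depend on the base
    point. *)
Lemma minus_column p x : p <= x -> [/\ modc (N p j1 j2 x) <= beta, modc (N p j1 j3 x) <= beta &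
  modc (N p j1 j1 x - 1) <= beta * L].
Proof.
have [s1 s2 s3] := sig.
have small y f i : p <= y -> f = u \/ f = v -> i != j1 ->
    (forall y, rder (N p j1 i) y ('i * z * 2 * N p j1 i y + - ((f y)^cj * N p j1 j1 y))) ->
    modc (N p j1 i y) <= beta.
  move=> py fuv i1 dN; pose th := 2 * 'i * z * (-1 : R)%:C.
  have fc : rcont f by case: fuv => ->.
  have dN' t : rder (N p j1 i) t (- th * N p j1 i t + - ((f t)^cj * N p j1 j1 t)).
    by apply: (rder_eq (dN t)); congr (_ * _ + _); rewrite /th rmorphN rmorph1; ring.
  have rc : rcont (fun t => - ((f t)^cj * N p j1 j1 t)).
    by apply: rcontN; apply: rcontM; [exact: rcontJ|exact: N_rcont].
  have := variation_of_constants p y y dN' rc.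
  rewrite subrr mulr0 cexp0 mul1r [N p j1 i p]propag_base (negbTE i1) mulr0 subr0 => <-.
  have Kc : rcont (fun t : R => cexp (th * (t - y)%:C)).
    apply: (rder_rcont (d := fun t => cexp (th * (t - y)%:C) * th)) => t.
    apply: rder_cexp; apply: (rder_eq (rderZ th (rder_real (is_deriveB' (is_derive_id t 1) (is_derive_cst y t 1))))).
    by rewrite subr0 mulr1.
  have -> : (fun t => cexp (th * (t - y)%:C) * - ((f t)^cj * N p j1 j1 t)) =
     (fun t => -1 * ((f t)^cj * (cexp (th * (t - y)%:C) * N p j1 j1 t))) by apply/funext => t; ring.
  rewrite cintZ ?mulN1r ?modcN; last first.
    by apply: rcontM; [exact: rcontJ|apply: rcontM => //; exact: N_rcont].
  apply: (hosc (fam_conj fuv) (or_intror erefl) py (a' := fun y => u y * N p j1 j2 y + v y * N p j1 j3 y)).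
  - by move=> t /andP[_ ty]; rewrite mulN1r opprB subr_ge0.
  - by move=> t; apply: (rder_eq (N1_der p j1 t)); rewrite subrr mulr0 mul0r add0r.
  - by apply: rcontD; apply: rcontM => //; exact: N_rcont.
  - by move=> t /andP[pt _]; exact: minus_le.
  - move=> t /andP[pt _]; rewrite -[leRHS]mul1r; apply: pair_le; exact: minus_le.
have small2 y : p <= y -> modc (N p j1 j2 y) <= beta.
  move=> py; apply: (small y u) => //; [by left|move=> t; apply: (rder_eq (N2_der p j1 t))].
  by rewrite s1 s2 opprK.
have small3 y : p <= y -> modc (N p j1 j3 y) <= beta.
  move=> py; apply: (small y v) => //; [by right|move=> t; apply: (rder_eq (N3_der p j1 t))].
  by rewrite s1 s3 opprK.
move=> px; split; [exact: small2|exact: small3|].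
have b1 : N p j1 j1 p = 1 by rewrite [N p j1 j1 p]propag_base.
rewrite -b1; apply: (small_incr (r := fun y => u y * N p j1 j2 y + v y * N p j1 j3 y)) => //.
  by move=> t; apply: (rder_eq (N1_der p j1 t)); rewrite subrr mulr0 mul0r add0r.
by move=> t /andP[pt _]; apply: pair_le; [exact: small2|exact: small3].
Qed.

(** Here only the first entry is an oscillatory integral, of the two others. *)
Lemma plus_column p x k : k != j1 -> x <= p -> modc (N p k j1 x) <= 2 * beta /\
  forall i, i != j1 -> modc (N p k i x - (i == k)%:R) <= 2 * beta * L.
Proof.
move=> k1; have [s1 s2 s3] := sig.
have sk : sigma_diag 0 k = 1 :> C by move: k k1; apply: ord3E.
have d2 t : rder (N p k j2) t (- ((u t)^cj * N p k j1 t)).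
  by apply: (rder_eq (N2_der p k t)); rewrite sk s2 subrr mulr0 mul0r add0r.
have d3 t : rder (N p k j3) t (- ((v t)^cj * N p k j1 t)).
  by apply: (rder_eq (N3_der p k t)); rewrite sk s3 subrr mulr0 mul0r add0r.
have half f i y : y <= p -> f = u \/ f = v -> (forall t, rder (N p k i) t (- ((f t)^cj * N p k j1 t))) ->
    modc (cint (fun t => f t * (cexp ((2 * 'i * z * (1 : R)%:C) * (t - y)%:C) * N p k i t)) y p) <= beta.
  move=> yp fuv dN; have fc : rcont f by case: fuv => ->.
  apply: (hosc _ (or_introl erefl) yp (a' := fun t => - ((f t)^cj * N p k j1 t))).
  - by case: fuv => ->; [constructor 1|constructor 2].
  - by move=> t /andP[yt _]; rewrite mul1r subr_ge0.
  - exact: dN.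
  - by apply: rcontN; apply: rcontM; [exact: rcontJ|exact: N_rcont].
  - by move=> t /andP[_ tp]; exact: plus_le.
  - move=> t /andP[_ tp]; rewrite modcN modcM modc_conj -[leRHS]mulr1.
    apply: ler_pM; rewrite ?modc_ge0 ?plus_le // /pot_abs.
    by case: fuv => ->; rewrite ?lerDl ?lerDr modc_ge0.
have small y : y <= p -> modc (N p k j1 y) <= 2 * beta.
  move=> yp; pose th := 2 * 'i * z * (1 : R)%:C.
  have dN' t : rder (N p k j1) t (- th * N p k j1 t + (u t * N p k j2 t + v t * N p k j3 t)).
    by apply: (rder_eq (N1_der p k t)); congr (_ * _ + _); rewrite /th rmorph1 s1 sk; ring.
  have rc : rcont (fun t => u t * N p k j2 t + v t * N p k j3 t).
    by apply: rcontD; apply: rcontM => //; exact: N_rcont.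
  have := variation_of_constants y p y dN' rc.
  rewrite subrr mulr0 cexp0 mul1r [N p k j1 p]propag_base eq_sym (negbTE k1) mulr0 sub0r => E.
  rewrite -modcN -E.
  have Kc : rcont (fun t : R => cexp (th * (t - y)%:C)).
    apply: (rder_rcont (d := fun t => cexp (th * (t - y)%:C) * th)) => t.
    apply: rder_cexp; apply: (rder_eq (rderZ th (rder_real (is_deriveB' (is_derive_id t 1) (is_derive_cst y t 1))))).
    by rewrite subr0 mulr1.
  have -> : (fun t => cexp (th * (t - y)%:C) * (u t * N p k j2 t + v t * N p k j3 t)) =
     (fun t => u t * (cexp (th * (t - y)%:C) * N p k j2 t) + v t * (cexp (th * (t - y)%:C) * N p k j3 t)).
    by apply/funext => t; ring.
  rewrite cintD; [|apply: rcontM => //; apply: rcontM => //; exact: N_rcont..].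
  apply: (le_trans (modcD _ _)); rewrite mulrDl mul1r; apply: lerD.
    by apply: half => //; left.
  by apply: half => //; right.
move=> xp; split; first exact: small.
have fin f i : f = u \/ f = v -> (forall t, rder (N p k i) t (- ((f t)^cj * N p k j1 t))) ->
    modc (N p k i x - (i == k)%:R) <= 2 * beta * L.
  move=> fuv dN; rewrite -(propag_base p z i k) modcBC.
  apply: (small_incr (f := N p k i) (r := fun t => - ((f t)^cj * N p k j1 t))) => //.
    by rewrite mulr_ge0.
  move=> t /andP[_ tp]; rewrite modcN modcM modc_conj mulrC.
  apply: ler_pM; rewrite ?modc_ge0 ?small // /pot_abs.
  by case: fuv => ->; rewrite ?lerDl ?lerDr modc_ge0.
apply: ord3E => // _; first by apply: (fin u) => //; left.
by apply: (fin v) => //; right.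
Qed.

(** The estimates for the truncated columns do not depend on the truncation and survive in the
    limit. *)
Lemma jost_near (D : jost_data (potential u v)) x : 0 <= L ->
  (forall i k, modc (jost_cols D x z i k - (1%:M : M3) i k) <= 2 * (1 + L) * beta) /\
  modc (s11 D z - 1) <= 2 * (1 + L) * beta.
Proof.
move=> L0; have U0 y i : potential u v y i i = 0 by have [d _ _ _] := potentialE u v y.
have Ule := potential_le u v.
have lim1 := jost_cols_limit F D (pot_primP hu hv) Ule (pot_tail hu hv).
have lim2 := s11_limit F D (pot_primP hu hv) Ule (pot_tail hu hv).
have Lb : 0 <= L * beta by rewrite mulr_ge0.
split=> [i k|].
  apply/ler_addgt0Pr => e e0; have [A0 hA] := lim1 x i k z z0 e e0.
  pose A := Num.max A0 `|x|; have A1 : A0 <= A by rewrite /A le_max lexx.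
  have A2 : `|x| <= A by rewrite /A le_max lexx orbT.
  have xA : x <= A := le_trans (ler_norm x) A2.
  have Ax : - A <= x by rewrite lerNl; apply: le_trans A2; rewrite -normrN ler_norm.
  have h := hA A A1; apply: (le_trans (modc_tri (propag Phi x (jost_base k A) z 1%:M i k) _ _)).
  rewrite addrC; apply: lerD => //; clear h hA.
  have [b1 b2 b3] := @jost_baseE R A.
  have [m2 m3 m1] := minus_column Ax.
  have -> : (1%:M : M3) i k = (i == k)%:R by rewrite mxE.
  move: k; apply: ord3E; rewrite ?b1 ?b2 ?b3.
  - move: i; apply: ord3E; rewrite /= ?subr0.
    + by apply: (le_trans m1); move: Lb beta0; lra.
    + by apply: (le_trans m2); move: Lb beta0; lra.
    + by apply: (le_trans m3); move: Lb beta0; lra.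
  - have [p1 p2] := @plus_column A x j2 isT xA; move: i; apply: ord3E.
    + by rewrite subr0; apply: (le_trans p1); move: Lb beta0; lra.
    + by apply: (le_trans (p2 j2 isT)); move: Lb beta0; lra.
    + by apply: (le_trans (p2 j3 isT)); move: Lb beta0; lra.
  - have [p1 p2] := @plus_column A x j3 isT xA; move: i; apply: ord3E.
    + by rewrite subr0; apply: (le_trans p1); move: Lb beta0; lra.
    + by apply: (le_trans (p2 j2 isT)); move: Lb beta0; lra.
    + by apply: (le_trans (p2 j3 isT)); move: Lb beta0; lra.
apply/ler_addgt0Pr => e e0; have [A0 hA] := lim2 z z0 e e0.
pose A := Num.max A0 0; have A1 : A0 <= A by rewrite /A le_max lexx.
have A2 : 0 <= A by rewrite /A le_max lexx orbT.
have AA : - A <= A by move: A2; lra.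
have h := hA A A1; apply: (le_trans (modc_tri (propag Phi A (- A) z 1%:M j1 j1) _ _)).
rewrite addrC; apply: lerD => //; have [_ _ m1] := minus_column AA.
by apply: (le_trans m1); move: Lb beta0; lra.
Qed.

End ColumnAsymptotics.

(** * Reflection, propagation and the Gram matrix on the real axis *)

Section InverseLimits.
Context {R : realType}.
Notation C := R[i].
Notation M3 := 'M[C]_3.

Lemma mlim_local m n (A B : set C) (F G : C -> 'M[C]_(m, n)) z (L : 'M[C]_(m, n)) (r : R) : 0 < r ->
  (forall w, B w -> modc (w - z) < r -> A w /\ G w = F w) -> mlim A F z L -> mlim B G z L.
Proof.
move=> r0 h hA i j e e0; have [d d0 hd] := hA i j e e0.
exists (Num.min r d) => [|w Bw]; first by rewrite lt_min r0.
by rewrite lt_min => /andP[w1 w2]; have [Aw ->] := h w Bw w1; exact: hd.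
Qed.

Lemma mlim_sub m n (A B : set C) (F : C -> 'M[C]_(m, n)) z (L : 'M[C]_(m, n)) : B `<=` A ->
  mlim A F z L -> mlim B F z L.
Proof. by move=> BA h; apply: (mlim_local ltr01 _ h) => w /BA. Qed.

Lemma mlim_invmx n (A : set C) (F : C -> 'M[C]_n) z (L : 'M[C]_n) : L \in unitmx -> mlim A F z L ->
  mlim A (fun w => invmx (F w)) z (invmx L).
Proof.
move=> uL h; have hd := wlim_det h.
have dL : \det L != 0 by rewrite -unitfE -unitmxE.
have m0 : 0 < modc (\det L) by rewrite modc_gt0.
have [d d0 hdd] := hd _ m0.
have inv w : A w -> modc (w - z) < d -> invmx (F w) = (\det (F w))^-1 *: \adj (F w).
  move=> Aw wz; rewrite /invmx ifT // unitmxE unitfE; apply/eqP => E.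
  by have := hdd w Aw wz; rewrite E sub0r modcN ltxx.
apply: (mlim_local (A := A) (F := fun w => (\det (F w))^-1 *: \adj (F w)) d0) => [w Aw wz|i j].
  by split=> //; exact: inv.
have -> : invmx L i j = (\det L)^-1 * \adj L i j by rewrite /invmx uL mxE.
apply: (@wlim_ext _ A (fun w => (\det (F w))^-1 * ((-1) ^+ (j + i) * \det (row' j (col' i (F w)))))) => [w _|].
  by rewrite [RHS]mxE [\adj _ _ _]mxE.
rewrite [\adj L i j]mxE; apply: wlimM; first exact: wlimV.
apply: wlimM; first exact: wlim_cst.
apply: wlim_det => a b.
apply: (@wlim_ext _ A (fun w => F w (lift j a) (lift i b))) => [w _|]; first by rewrite !mxE.
by rewrite !mxE; exact: h.
Qed.

Lemma holo_invmx n (F : C -> 'M[C]_n) z : F z \in unitmx -> (forall i j, holo (fun w => F w i j) z) ->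
  forall i j, holo (fun w => invmx (F w) i j) z.
Proof.
move=> uF h i j; have hd := holo_det h.
have dF : \det (F z) != 0 by rewrite -unitfE -unitmxE.
have m0 : 0 < modc (\det (F z)) by rewrite modc_gt0.
have [d d0 hdd] := holo_cont hd m0.
apply: (@holo_near _ (fun w => (\det (F w))^-1 * ((-1) ^+ (j + i) * \det (row' j (col' i (F w))))) _ z d d0).
  move=> w wz; have uw : F w \in unitmx.
    rewrite unitmxE unitfE; apply/eqP => E.
    by have := hdd w I wz; rewrite E sub0r modcN ltxx.
  by rewrite /invmx uw mxE [\adj _ _ _]mxE.
apply: holoM; first exact: holoV.
apply: holoM; first exact: holo_cst.
apply: holo_det => a b.
apply: (@holo_near _ (fun w => F w (lift j a) (lift i b)) _ z 1 ltr01) => [w _|]; first by rewrite !mxE.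
exact: h.
Qed.

(** With [A = 1 + E] and inverse [1 + Y] one has [Y = - E - E Y]: first [Y] is bounded, then it is
    as small as [E]. *)
Lemma invmx_near1 (A : M3) (e : R) : A \in unitmx -> e <= 1 / 18 ->
  (forall i j, modc (A i j - (1%:M : M3) i j) <= e) ->
  forall i j, modc (invmx A i j - (1%:M : M3) i j) <= 18 * e.
Proof.
move=> uA e18 hA i0 j0; pose E := A - 1%:M; pose Y := invmx A - 1%:M.
have sub (P P' : M3) i j : (P - P') i j = P i j - P' i j by rewrite [LHS]mxE [X in _ + X]mxE.
have hE i j : modc (E i j) <= e by rewrite /E sub.
have e0 : 0 <= e := le_trans (modc_ge0 _) (hE i0 j0).
have YE : Y = - E - E *m Y.
  have aux (V : zmodType) (a b c : V) : b - a = - (c - a) - ((a - b) - (c - a)).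
    by set d := c - a; rewrite opprB addKr opprB.
  have EY : E *m Y = 1%:M - invmx A - (A - 1%:M).
    by rewrite /Y /E mulmxBr mulmx1 mulmxBl mul1mx mulmxV.
  rewrite EY; exact: aux.
pose s := \sum_i \sum_j modc (Y i j).
have s_ge i j : modc (Y i j) <= s.
  rewrite /s (bigD1 i) //= (bigD1 j) //= -addrA lerDl addr_ge0 //; apply: sumr_ge0 => k _; rewrite ?modc_ge0 //.
  by apply: sumr_ge0 => m _; exact: modc_ge0.
have col_le j : \sum_k modc (Y k j) <= s.
  rewrite /s; apply: ler_sum => k _; rewrite (bigD1 j) //= lerDl.
  by apply: sumr_ge0 => m _; exact: modc_ge0.
have step i j : modc (Y i j) <= e + e * s.
  rewrite {1}YE; have -> : (- E - E *m Y) i j = - E i j - \sum_k E i k * Y k j.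
    by rewrite sub [X in X - _]mxE [X in _ - X]mxE.
  apply: (le_trans (modcB _ _)); rewrite modcN; apply: lerD => //.
  apply: (le_trans (modc_sum _ _ _)); apply: (@le_trans _ _ (\sum_k e * modc (Y k j))).
    by apply: ler_sum => k _; rewrite modcM ler_wpM2r ?modc_ge0.
  by rewrite -mulr_sumr ler_wpM2l.
have s9 : s <= 9 * (e + e * s).
  have -> : 9 * (e + e * s) = \sum_(i < 3) \sum_(j < 3) (e + e * s).
    by rewrite !sum3; set x := e + e * s; lra.
  by apply: ler_sum => i _; apply: ler_sum => j _.
have s0 : 0 <= s by apply: le_trans (s_ge i0 j0); exact: modc_ge0.
have es : e * s <= 1 / 18 * s by rewrite ler_wpM2r.
rewrite -sub; apply: (le_trans (s_ge i0 j0)); move: s9 es; lra.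
Qed.

End InverseLimits.

Section Reflection.
Context {R : realType}.
Notation C := R[i].
Notation M3 := 'M[C]_3.

(** Schwarz reflection of a matrix function: the extension to the other half plane. *)
Definition bar (B : C -> M3) (z : C) : M3 := invmx (dagger (B z^cj)).

Lemma unitmx_dagger (A : M3) : (dagger A \in unitmx) = (A \in unitmx).
Proof.
rewrite !unitmxE !unitfE det_dagger -!modc_gt0; by rewrite modc_conj.
Qed.

Lemma conjcKK (z : C) : z^cj^cj = z.
Proof. by apply: eqC; rewrite !ReImE ?opprK. Qed.

Lemma modc_cjB (w z : C) : modc (w^cj - z^cj) = modc (w - z).
Proof. by rewrite -conjcB modc_conj. Qed.

Lemma mlim_bar (A B : set C) (F : C -> M3) z : (forall w, B w -> A w^cj) -> F z^cj \in unitmx ->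
  mlim A F z^cj (F z^cj) -> mlim B (bar F) z (bar F z).
Proof.
move=> BA uF h; apply: mlim_invmx; first by rewrite unitmx_dagger.
move=> i j e e0; have [d d0 hd] := h j i e e0; exists d => // w Bw wz.
by rewrite !daggerE modc_cjB; apply: hd; [exact: BA|rewrite modc_cjB].
Qed.

Lemma holo_bar (F : C -> M3) z : F z^cj \in unitmx -> (forall i j, holo (fun w => F w i j) z^cj) ->
  forall i j, holo (fun w => bar F w i j) z.
Proof.
move=> uF h; apply: holo_invmx; first by rewrite unitmx_dagger.
move=> i j; apply: (@holo_near _ (fun w => (F w^cj j i)^cj) _ z 1 ltr01) => [w _|]; first by rewrite daggerE.
exact: (holoJ (h j i)).
Qed.

Lemma bar_unit (F : C -> M3) z : F z^cj \in unitmx -> bar F z \in unitmx.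
Proof. by move=> h; rewrite /bar unitmx_inv unitmx_dagger. Qed.

Lemma bar_near1 (F : C -> M3) z (e : R) : F z^cj \in unitmx -> e <= 1 / 18 ->
  (forall i j, modc (F z^cj i j - (1%:M : M3) i j) <= e) ->
  forall i j, modc (bar F z i j - (1%:M : M3) i j) <= 18 * e.
Proof.
move=> uF e18 h; apply: invmx_near1 => //; first by rewrite unitmx_dagger.
by move=> i j; rewrite daggerE -(dagger1 (R := R)) daggerE -conjcB modc_conj.
Qed.

Section Propagate.
Variables (U : R -> M3) (Phi : R -> C -> M3).
Hypothesis F : fundamental U Phi.

Lemma propag_unit x p z B : (propag Phi x p z B \in unitmx) = (B \in unitmx).
Proof.
have u1 : exp_sigma (- (z * (x - p)%:C)) \in @unitmx C 3.
  by have [] := mulmx1_unit (exp_sigmaKN (z * (x - p)%:C)).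
have u2 : Phi x z *m dagger (Phi p z^cj) \in unitmx.
  have [a _] := mulmx1_unit (fund_inv' F z x); have [_ b] := mulmx1_unit (fund_inv' F z p).
  by rewrite unitmx_mul a b.
by rewrite /propag unitmx_mul u1 andbT unitmx_mul u2.
Qed.

(** Propagation commutes with reflection, because the inverse of the fundamental matrix is its
    reflected adjoint. *)
Lemma propag_bar x p (B : C -> M3) z : B z^cj \in unitmx ->
  propag Phi x p z (bar B z) = bar (fun w => propag Phi x p w (B w)) z.
Proof.
move=> uB; apply/esym; rewrite /bar.
have uB' : dagger (B z^cj) \in unitmx by rewrite unitmx_dagger.
have key : propag Phi x p z (invmx (dagger (B z^cj))) *m dagger (propag Phi x p z^cj (B z^cj)) = 1%:M.
  rewrite /propag !daggerM daggerK dagger_exp_sigma conjcKK.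
  have -> : - (- (z^cj * (x - p)%:C))^cj = z * (x - p)%:C.
    by apply: eqC; rewrite ?ReImE; ring.
  rewrite -!mulmxA (mulmxA (exp_sigma (- _)) (exp_sigma _)) exp_sigmaKN mul1mx.
  rewrite (mulmxA (invmx _)) mulVmx // mul1mx.
  by rewrite (mulmxA (dagger (Phi p z^cj))) (fund_inv F) mul1mx (fund_inv' F).
have u : dagger (propag Phi x p z^cj (B z^cj)) \in unitmx by rewrite unitmx_dagger propag_unit.
by rewrite -[LHS]mul1mx -key -mulmxA mulmxV // mulmx1.
Qed.

(** It suffices to verify a jump relation at one point: both sides are transported alike. *)
Lemma propag_jump x p l (A B V : M3) : A = B *m exp_ad (l * p%:C) V ->
  propag Phi x p l A = propag Phi x p l B *m exp_ad (l * x%:C) V.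
Proof.
move=> ->; rewrite /propag /exp_ad -!mulmxA -!exp_sigmaD; congr (_ *m (_ *m (_ *m _))).
rewrite (mulmxA (exp_sigma (- (l * (x - p)%:C)))) -exp_sigmaD.
have -> : - (l * (x - p)%:C) + l * x%:C = l * p%:C by apply: eqC; rewrite ?ReImE; ring.
congr (_ *m (_ *m exp_sigma _)).
by apply: eqC; rewrite ?ReImE; ring.
Qed.

End Propagate.

Lemma mx3E (a b c d e f g h k : C) :
  let M : M3 := mx3 [:: [:: a; b; c]; [:: d; e; f]; [:: g; h; k]] in
  ((M j1 j1 = a) * (M j1 j2 = b) * (M j1 j3 = c) * (M j2 j1 = d) * (M j2 j2 = e) * (M j2 j3 = f) *
   (M j3 j1 = g) * (M j3 j2 = h) * (M j3 j3 = k))%type.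
Proof. by rewrite /=; repeat split; rewrite mxE. Qed.

Lemma mx1E i j : (1%:M : M3) i j = (i == j)%:R.
Proof. by rewrite mxE. Qed.

Lemma gram_mul (P A B : M3) : dagger P *m P = 1%:M -> (A *m dagger P) *m (P *m B) = A *m B.
Proof. by move=> h; rewrite -!mulmxA (mulmxA (dagger P)) h mul1mx. Qed.

Section RealJump.
Variables (r1 r2 : C).

(** The three matrices are related by [refl_gram] and [outer_inner]: the jump outside the circle is
    the Gram matrix of a unipotent matrix, the jump inside has the form of an inverse Gram
    matrix, since there the inner region lies on the other side. *)
Definition refl_mx : M3 := mx3 [:: [:: 1; 0; 0]; [:: r1; 1; 0]; [:: r2; 0; 1]].

Definition outer_mx : M3 :=
  mx3 [:: [:: 1 + r1 * r1^cj + r2 * r2^cj; r1^cj; r2^cj]; [:: r1; 1; 0]; [:: r2; 0; 1]].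

Definition inner_mx : M3 :=
  mx3 [:: [:: 1; - r1^cj; - r2^cj]; [:: - r1; 1 + r1 * r1^cj; r1 * r2^cj];
          [:: - r2; r1^cj * r2; 1 + r2 * r2^cj]].

Let c0 : (0 : C)^cj = 0. Proof. by apply: eqC; rewrite ?ReImE ?oppr0. Qed.
Let c1 : (1 : C)^cj = 1. Proof. by apply: eqC; rewrite ?ReImE ?oppr0. Qed.

Lemma refl_gram : dagger refl_mx *m refl_mx = outer_mx.
Proof.
apply/matrixP => i j; rewrite [LHS]mxE sum3 !daggerE /refl_mx /outer_mx.
by move: i j; apply: ord3E; apply: ord3E; rewrite !mx3E ?c0 ?c1; ring.
Qed.

Lemma outer_inner : outer_mx *m inner_mx = 1%:M.
Proof.
apply/matrixP => i j; rewrite [LHS]mxE sum3 /outer_mx /inner_mx mx1E.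
by move: i j; apply: ord3E; apply: ord3E; rewrite !mx3E ?eqxx /=; ring.
Qed.

End RealJump.

Lemma normC_sqr (r : C) : `|r| ^+ 2 = r * r^cj.
Proof.
rewrite normCE; have -> : ((modc r)%:C) ^+ 2 = (modc r ^+ 2)%:C :> C by rewrite rmorphXn.
by apply: eqC; rewrite sqr_modc !ReImE; ring.
Qed.

Section JostJump.
Variables (Q U : R -> M3) (Phi : R -> C -> M3) (D : jost_data Q).
Hypothesis F : fundamental U Phi.
Hypothesis U0 : forall y i, U y i i = 0.
Variable a : R.
Hypothesis QU : forall y, a < y -> Q y = U y.

(** A column of its determinant is divided by $s_{11}$, so the determinant is one. *)
Lemma beals_coifman_unit z : Cplus_closed z -> s11 D z != 0 -> beals_coifman_plus D a z \in unitmx.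
Proof.
move=> zc s0; rewrite unitmxE beals_coifman_det (jost_cols_det D F U0 QU zc) mulVf //.
exact: unitr1.
Qed.

Lemma beals_coifman_mlim x z : Cplus_closed z -> s11 D z != 0 ->
  mlim (@Cplus_closed R) (beals_coifman_plus D x) z (beals_coifman_plus D x z).
Proof.
move=> zc s0 i j; have [_ sc _] := s11E D.
have E w := beals_coifman_entry D x w i.
move: j; apply: ord3E.
- have [-> _ _] := E z.
  apply: (@wlim_ext _ _ (fun w => (s11 D w)^-1 * jost_cols D x w i j1)) => [w _|]; first by have [-> _ _] := E w.
  by apply: wlimM; [apply: wlimV => //; exact: sc|have [_ h _] := jost_colsP D x i j1; exact: h].
- have [_ -> _] := E z.
  apply: (@wlim_ext _ _ (fun w => jost_cols D x w i j2)) => [w _|]; first by have [_ -> _] := E w.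
  by have [_ h _] := jost_colsP D x i j2; exact: h.
- have [_ _ ->] := E z.
  apply: (@wlim_ext _ _ (fun w => jost_cols D x w i j3)) => [w _|]; first by have [_ _ ->] := E w.
  by have [_ h _] := jost_colsP D x i j3; exact: h.
Qed.

Lemma beals_coifman_holo x z : Cplus z -> s11 D z != 0 ->
  forall i j, holo (fun w => beals_coifman_plus D x w i j) z.
Proof.
move=> zc s0 i j; have [_ _ sc] := s11E D.
have E w := beals_coifman_entry D x w i.
move: j; apply: ord3E.
- apply: (@holo_near _ (fun w => (s11 D w)^-1 * jost_cols D x w i j1) _ z 1 ltr01) => [w _|]; first by have [-> _ _] := E w.
  by apply: holoM; [apply: holoV => //; exact: sc|have [_ _ h] := jost_colsP D x i j1; exact: h].
- apply: (@holo_near _ (fun w => jost_cols D x w i j2) _ z 1 ltr01) => [w _|]; first by have [_ -> _] := E w.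
  by have [_ _ h] := jost_colsP D x i j2; exact: h.
- apply: (@holo_near _ (fun w => jost_cols D x w i j3) _ z 1 ltr01) => [w _|]; first by have [_ _ ->] := E w.
  by have [_ _ h] := jost_colsP D x i j3; exact: h.
Qed.

(** On the real axis the Beals-Coifman solution is a unitary matrix times a triangular one, so
    that its Gram matrix, which is the jump across the axis, is explicit. *)
Lemma beals_coifman_gram (l : R) : smx D l j1 j1 != 0 ->
  dagger (beals_coifman_plus D a l%:C) *m beals_coifman_plus D a l%:C =
  exp_ad (l%:C * a%:C) (outer_mx (refl1 D l) (refl2 D l)).
Proof.
move=> s0; pose w : C := a%:C * l%:C.
have wJ : w^cj = w by apply: eqC; rewrite /w ?ReImE; ring.
have E : beals_coifman_plus D a l%:C = mplus D a l *m exp_ad w (refl_mx (refl1 D l) (refl2 D l)).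
  apply/matrixP => i k; have [e1 e2 e3] := beals_coifman_entry D a l%:C i.
  have JE k' : jost_cols D a l%:C i k' = jost_cols_real D a l i k' by have [-> _ _] := jost_colsP D a i k'.
  have [r1 r2 r3] := cols3E (col j1 (mminus D a l)) (col j2 (mplus D a l)) (col j3 (mplus D a l)) i.
  have [sE _ _] := s11E D.
  rewrite [RHS]mxE sum3 !exp_adE.
  move: k; apply: ord3E; rewrite ?e1 ?e2 ?e3 JE /jost_cols_real ?r1 ?r2 ?r3 [col _ _ _ _]mxE /refl_mx.
  - rewrite (jost_scattering D F QU l) sE [X in _ * X = _]mxE sum3 !exp_adE -/w !mx3E /refl1 /refl2.
    field; exact: s0.
  - by rewrite !mx3E subrr !mulr0 cexp0 mul1r mulr1 add0r addr0.
  - by rewrite !mx3E subrr !mulr0 cexp0 mul1r mulr1 !add0r.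
rewrite E daggerM dagger_exp_ad wJ (gram_mul _ _ (jost_unitary D F QU l)).
by rewrite -exp_adM refl_gram /w mulrC.
Qed.

End JostJump.
End Reflection.

(** * The solution of the Riemann-Hilbert problem *)

Section Solution.
Context {R : realType}.
Notation C := R[i].
Notation M3 := 'M[C]_3.
Variables (u v : R -> C).
Hypotheses (hu : H11 u) (hv : H11 v).
Variable D : jost_data (potential u v).
Variable S : R.
Hypothesis S0 : 0 < S.
Hypothesis sD : forall z : C, 0 <= complex.Im z -> S%:C <= `|z| -> s11 D z != 0.
Variables (x0 : R) (D0 : jost_data (cutoff x0 (potential u v))).
Hypothesis sD0 : forall z : C, 0 <= complex.Im z -> s11 D0 z != 0.
Variable x : R.
Variable Phi : R -> C -> M3.
Hypothesis F : fundamental (potential u v) Phi.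

Lemma leCmod (a : R) (z : C) : (a%:C <= `|z|) = (a <= modc z).
Proof. by rewrite normCE lecR. Qed.

Lemma ltCmod (a : R) (z : C) : (a%:C < `|z|) = (a < modc z).
Proof. by rewrite normCE ltcR. Qed.

Let U0 y i : potential u v y i i = 0.
Proof. by have [d _ _ _] := potentialE u v y. Qed.

Let cut y : x0 < y -> cutoff x0 (potential u v) y = potential u v y.
Proof. by rewrite /cutoff => ->. Qed.

(** The four regions, [out]side or inside the circle and [up]per or lower, with their closures
    in the half planes; the solution on each of them is obtained from its value at [x0]. *)
Definition sector (out up : bool) : set C := [set z |
  (if up then 0 < complex.Im z else complex.Im z < 0) /\ (if out then S < modc z else modc z < S)].

Definition closed_sector (out up : bool) : set C := [set z |
  (if up then 0 <= complex.Im z else complex.Im z <= 0) /\ (if out then S <= modc z else modc z <= S)].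

Definition bcp (out : bool) (z : C) : M3 :=
  if out then beals_coifman_plus D x0 z else beals_coifman_plus D0 x0 z.

Definition base_sol (out up : bool) : C -> M3 := if up then bcp out else bar (bcp out).

Definition sector_sol (out up : bool) (z : C) : M3 := propag Phi x x0 z (base_sol out up z).

Definition solution (z : C) : M3 := sector_sol (S < modc z) (0 < complex.Im z) z.

Lemma sector_closed out up : sector out up `<=` closed_sector out up.
Proof. by case: out up => [] [] z [h1 h2]; split; exact: ltW. Qed.

Lemma solution_sector out up z : sector out up z -> solution z = sector_sol out up z.
Proof.
move=> [h1 h2]; rewrite /solution; congr (sector_sol _ _ z).
  by case: out h2 => // /ltW h; apply/negbTE; rewrite -leNgt.
by case: up h1 => // /ltW h; apply/negbTE; rewrite -leNgt.
Qed.

Lemma closed_sector_cj out up z : closed_sector out up z -> closed_sector out (~~ up) z^cj.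
Proof.
by case: out up => [] [] [h1 h2]; split; rewrite ?modc_conj //= ImJ; rewrite ?oppr_le0 ?oppr_ge0.
Qed.

Lemma sector_cj out up z : sector out up z -> sector out (~~ up) z^cj.
Proof.
by case: out up => [] [] [h1 h2]; split; rewrite ?modc_conj //= ImJ; rewrite ?oppr_lt0 ?oppr_gt0.
Qed.

Let s_ok out z : closed_sector out true z -> (if out then s11 D z else s11 D0 z) != 0.
Proof. by case: out => -[h1 h2]; [apply: sD; rewrite ?leCmod|exact: sD0]. Qed.

Lemma bcp_unit out z : closed_sector out true z -> bcp out z \in unitmx.
Proof.
move=> h; have s0 := s_ok h; have [z0 _] := h.
by case: out h s0 => _ s0; [apply: (beals_coifman_unit F U0)|apply: (beals_coifman_unit F U0 cut)].
Qed.

Lemma bcp_mlim out z : closed_sector out true z -> mlim (closed_sector out true) (bcp out) z (bcp out z).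
Proof.
move=> h; have s0 := s_ok h; have [z0 _] := h.
apply: (@mlim_sub _ _ _ (@Cplus_closed R)); first by move=> w [].
by case: out h s0 => _ s0; exact: beals_coifman_mlim.
Qed.

Lemma bcp_holo out z : sector out true z -> forall i j, holo (fun w => bcp out w i j) z.
Proof.
move=> h; have s0 := s_ok (sector_closed h); have [z0 _] := h.
by case: out h s0 => _ s0; exact: beals_coifman_holo.
Qed.

Lemma base_sol_unit out up z : closed_sector out up z -> base_sol out up z \in unitmx.
Proof.
case: up => h; first exact: bcp_unit.
by apply: bar_unit; apply: bcp_unit; exact: (closed_sector_cj h).
Qed.

Lemma sector_sol_unit out up z : closed_sector out up z -> sector_sol out up z \in unitmx.
Proof. by move=> h; rewrite /sector_sol (propag_unit F); exact: base_sol_unit. Qed.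

Lemma sector_sol_mlim out up z : closed_sector out up z ->
  mlim (closed_sector out up) (sector_sol out up) z (sector_sol out up z).
Proof.
move=> h; apply: (wlim_propag F); case: up h => h; first exact: bcp_mlim.
have h' := closed_sector_cj h.
apply: (mlim_bar (A := closed_sector out true)); [exact: (@closed_sector_cj out false)|exact: bcp_unit|exact: bcp_mlim].
Qed.

Lemma sector_sol_holo out up z : sector out up z -> forall i j, holo (fun w => sector_sol out up w i j) z.
Proof.
move=> h; apply: (holo_propag F); case: up h => h; first exact: bcp_holo.
apply: holo_bar; first exact: bcp_unit (sector_closed (sector_cj h)).
exact: bcp_holo (sector_cj h).
Qed.

Lemma sector_open out up z : sector out up z -> exists2 r : R, 0 < r &
  forall w, modc (w - z) < r -> sector out up w.
Proof.
move=> [h1 h2]; exists (Num.min `|complex.Im z| `|modc z - S|).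
  rewrite lt_min !normr_gt0; apply/andP; split.
    by case: up h1 => h; [rewrite gt_eqF|rewrite lt_eqF].
  by rewrite subr_eq0; case: out h2 => h; [rewrite gt_eqF|rewrite lt_eqF].
move=> w; rewrite lt_min => /andP[w1 w2].
have im := le_lt_trans (Im_le_modc (w - z)) w1; rewrite ImB in im.
have m1 := modc_sub_le w z; have m2 := modc_sub_le z w; rewrite [modc (z - w)]modcBC in m2.
split.
  case: up h1 => h.
    rewrite (gtr0_norm h) in im; have := ler_norm (complex.Im z - complex.Im w); rewrite distrC; move: im; lra.
  rewrite (ltr0_norm h) in im; have := ler_norm (complex.Im w - complex.Im z); move: im; lra.
case: out h2 => h.
  rewrite ger0_norm in w2; last by rewrite subr_ge0 ltW.
  by move: w2 m2; lra.
rewrite ler0_norm in w2; last by rewrite subr_le0 ltW.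
by move: w2 m1; lra.
Qed.

Lemma sector_ex z : ~ contour S z -> exists out up, sector out up z.
Proof.
move=> nc; exists (S < modc z), (0 < complex.Im z); split.
  case: ltP => // h; rewrite lt_neqAle h andbT; apply/eqP => E; apply: nc; by left.
case: ltP => // h; rewrite lt_neqAle h andbT; apply/eqP => E; apply: nc; right.
by rewrite normCE E.
Qed.

Lemma contour_cases l : (contour S `\` corners S) l ->
  [\/ complex.Im l = 0 /\ S < modc l, complex.Im l = 0 /\ modc l < S,
      0 < complex.Im l /\ modc l = S | complex.Im l < 0 /\ modc l = S].
Proof.
move=> [cl nc].
have real_case : complex.Im l = 0 -> [\/ complex.Im l = 0 /\ S < modc l, complex.Im l = 0 /\ modc l < S,
      0 < complex.Im l /\ modc l = S | complex.Im l < 0 /\ modc l = S].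
  move=> l0; have E : l = (complex.Re l)%:C by apply: eqC; rewrite ?ReC ?ImC.
  have mE : modc l = `|complex.Re l| by rewrite {1}E modc_real.
  have [h|h|h] := ltgtP S (modc l); [by constructor 1|by constructor 2|].
  exfalso; apply: nc; rewrite E /corners /= h mE.
  have [r0|r0] := leP 0 (complex.Re l); first by left; rewrite ger0_norm.
  by right; rewrite ltr0_norm // rmorphN opprK.
case: cl => [//|/(congr1 (@complex.Re R))]; rewrite normCE !ReC => mS.
have [/real_case //|l0] := eqVneq (complex.Im l) 0.
have [h|h] := ltP 0 (complex.Im l); first by constructor 3.
by constructor 4; rewrite lt_neqAle l0.
Qed.

(** Whether the point lies on the boundary of the outer upper region; if it does not, the plus side
    is the inner lower region. *)
Definition plus_side (l : C) : bool := (0 < complex.Im l) || ((complex.Im l == 0) && (S < modc l)).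
Definition minus_side (l : C) : bool := (complex.Im l < 0) || ((complex.Im l == 0) && (S < modc l)).

Let Om_sector w : [/\ Omega1 S w -> sector true true w, Omega2 S w -> sector true false w,
  Omega3 S w -> sector false true w & Omega4 S w -> sector false false w].
Proof.
split=> -[h1 h2]; split => //=; rewrite ?ltCmod // in h2 *; by move: h2; rewrite normCE ltcR.
Qed.

Lemma plus_local l : (contour S `\` corners S) l -> let p := plus_side l in
  closed_sector p p l /\ exists2 r : R, 0 < r & forall w, modc (w - l) < r ->
    (Omega_plus S w -> sector p p w) /\
    ((contour S `\` corners S) w -> plus_side w = p /\ closed_sector p p w).
Proof.
move=> hl p; rewrite {}/p /plus_side; have Sp := S0.
have near w := modc_sub_le l w; have near' w := modc_sub_le w l.
have imn w : `|complex.Im w - complex.Im l| <= modc (w - l) by rewrite -ImB; exact: Im_le_modc.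
case: (contour_cases hl) => -[h1 h2].
- rewrite h1 ltxx eqxx h2 /=; split; first by split; rewrite /= ?h1 // ltW.
  exists (modc l - S) => [|w wl]; first by rewrite subr_gt0.
  have Sw : S < modc w by have := near w; rewrite [modc (l - w)]modcBC; move: wl; lra.
  have [q1 _ _ q4] := Om_sector w; split=> [[/q1 //|/q4 [_ /= h]]|/contour_cases hw].
    by have := lt_trans h Sw; rewrite ltxx.
  case: hw => -[w1 w2].
  - by rewrite w1 ltxx eqxx Sw; split=> //; split=> /=; rewrite ?w1 // ltW.
  - by have := lt_trans w2 Sw; rewrite ltxx.
  - by move: Sw; rewrite w2 ltxx.
  - by move: Sw; rewrite w2 ltxx.
- have -> : (0 < complex.Im l) || (complex.Im l == 0) && (S < modc l) = false.
    by rewrite h1 ltxx eqxx /=; apply/negbTE; rewrite -leNgt ltW.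
  split; first by split; rewrite /= ?h1 // ltW.
  exists (S - modc l) => [|w wl]; first by rewrite subr_gt0.
  have Sw : modc w < S by have := near' w; move: wl; lra.
  have [q1 _ _ q4] := Om_sector w; split=> [[/q1 [_ /= h]|/q4 //]|/contour_cases hw].
    by have := lt_trans h Sw; rewrite ltxx.
  case: hw => -[w1 w2].
  - by have := lt_trans w2 Sw; rewrite ltxx.
  - split; last by split=> /=; rewrite ?w1 // ltW.
    by rewrite w1 ltxx eqxx /=; apply/negbTE; rewrite -leNgt ltW.
  - by move: Sw; rewrite w2 ltxx.
  - by move: Sw; rewrite w2 ltxx.
- rewrite h1 /=; split; first by split; rewrite /= ?h2 // ltW.
  exists (complex.Im l) => // w wl.
  have iw : 0 < complex.Im w.
    have := imn w; have := ler_norm (complex.Im l - complex.Im w); rewrite distrC; move: wl; lra.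
  have [q1 _ _ q4] := Om_sector w; split=> [[/q1 //|/q4 [/= h _]]|/contour_cases hw].
    by have := lt_trans h iw; rewrite ltxx.
  rewrite iw /=; split => //; case: hw => -[w1 w2].
  - by move: iw; rewrite w1 ltxx.
  - by move: iw; rewrite w1 ltxx.
  - by split=> /=; rewrite ?w2 // ltW.
  - by have := lt_trans w1 iw; rewrite ltxx.
- have -> : (0 < complex.Im l) || (complex.Im l == 0) && (S < modc l) = false.
    by rewrite lt_eqF //=; rewrite ltNge (ltW h1).
  split; first by split; rewrite /= ?h2 // ltW.
  exists (- complex.Im l) => [|w wl]; first by rewrite oppr_gt0.
  have iw : complex.Im w < 0.
    have := imn w; have := ler_norm (complex.Im w - complex.Im l); move: wl; lra.
  have [q1 _ _ q4] := Om_sector w; split=> [[/q1 [/= h _]|/q4 //]|/contour_cases hw].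
    by have := lt_trans h iw; rewrite ltxx.
  have -> : (0 < complex.Im w) || (complex.Im w == 0) && (S < modc w) = false.
    by rewrite lt_eqF //=; rewrite ltNge (ltW iw).
  split => //; case: hw => -[w1 w2].
  - by move: iw; rewrite w1 ltxx.
  - by move: iw; rewrite w1 ltxx.
  - by have := lt_trans w1 iw; rewrite ltxx.
  - by split=> /=; rewrite ?w2 // ltW.
Qed.

Let contour_cj l : (contour S `\` corners S) l -> (contour S `\` corners S) l^cj.
Proof.
move=> [cl nc]; split.
  case: cl => h; [left|right]; first by rewrite ImJ h oppr0.
  by rewrite -h !normCE modc_conj.
have rJ (r : R) : (r%:C)^cj = r%:C by apply: eqC; rewrite ?ReImE ?oppr0.
move=> h; apply: nc; case: h => h; [left|right]; rewrite -(conjcKK l) h ?conjcN rJ //.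
Qed.

(** The minus side is the plus side of the complex conjugate problem. *)
Lemma minus_local l : (contour S `\` corners S) l -> let m := minus_side l in
  closed_sector m (~~ m) l /\ exists2 r : R, 0 < r & forall w, modc (w - l) < r ->
    (Omega_minus S w -> sector m (~~ m) w) /\
    ((contour S `\` corners S) w -> minus_side w = m /\ closed_sector m (~~ m) w).
Proof.
have mE w : minus_side w = plus_side w^cj by rewrite /minus_side /plus_side ImJ oppr_gt0 oppr_eq0 modc_conj.
move=> hl; rewrite /= mE; have [h1 [r r0 hr]] := plus_local (contour_cj hl).
split; first by have := closed_sector_cj h1; rewrite conjcKK.
exists r => // w wl; have [|a b] := hr w^cj; first by rewrite modc_cjB.
split=> [hw|hw]; last first.
  by have [b1 b2] := b (contour_cj hw); rewrite mE b1; split=> //; have := closed_sector_cj b2; rewrite conjcKK.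
suff: Omega_plus S w^cj by move=> /a h; have := sector_cj h; rewrite conjcKK.
have nJ : `|w^cj| = `|w| by rewrite !normCE modc_conj.
by case: hw => -[w1 w2]; [left|right]; split; rewrite /= ?ImJ ?oppr_lt0 ?oppr_gt0 ?nJ.
Qed.

Lemma jump_outerE l : jump_outer D l = outer_mx (refl1 D l) (refl2 D l).
Proof. by rewrite /jump_outer /outer_mx !normC_sqr. Qed.

Lemma jump_innerE l : jump_inner D0 l = inner_mx (refl1 D0 l) (refl2 D0 l).
Proof. by rewrite /jump_inner /inner_mx !normC_sqr. Qed.

Let exp_adK (l : C) (B : M3) : exp_ad (l * x0%:C) (exp_ad (- (x0%:C * l)) B) = B.
Proof. by rewrite -exp_adD [x0%:C * l]mulrC subrr exp_ad0. Qed.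

(** On the axis both jumps come from the Gram matrix; on the arcs the jump is by definition the
    quotient of the two Beals-Coifman solutions. *)
Lemma base_jump l : (contour S `\` corners S) l ->
  base_sol (plus_side l) (plus_side l) l =
  base_sol (minus_side l) (~~ minus_side l) l *m exp_ad (l * x0%:C) (jump S D D0 l).
Proof.
move=> hl; rewrite /jump /plus_side /minus_side; case: (contour_cases hl) => -[h1 h2].
- have E : l = (complex.Re l)%:C by apply: eqC; rewrite ?ReC ?ImC.
  have lJ : l^cj = l by apply: eqC; rewrite ?ReJ ?ImJ // h1 oppr0.
  have mE : modc l = `|complex.Re l| by rewrite {1}E modc_real.
  rewrite h1 eqxx ltxx h2 /= -mE h2 /base_sol /bar /bcp lJ jump_outerE.
  have cl : closed_sector true true l by split; rewrite /= ?h1 // ltW.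
  have [s1 _ _] := s11E D; have s0 : smx D (complex.Re l) j1 j1 != 0.
    by rewrite -s1 -E; exact: (s_ok cl).
  have g := beals_coifman_gram F (Q := potential u v) (a := x0) (fun _ _ => erefl) s0.
  rewrite -E in g; rewrite -g mulKmx // unitmx_dagger; exact: (bcp_unit cl).
- have E : l = (complex.Re l)%:C by apply: eqC; rewrite ?ReC ?ImC.
  have lJ : l^cj = l by apply: eqC; rewrite ?ReJ ?ImJ // h1 oppr0.
  have mE : modc l = `|complex.Re l| by rewrite {1}E modc_real.
  have nS : (S < modc l) = false by apply/negbTE; rewrite -leNgt ltW.
  rewrite h1 eqxx ltxx -mE nS /= /base_sol /bar /bcp lJ jump_innerE.
  have cl : closed_sector false true l by split; rewrite /= ?h1 // ltW.
  have [s1 _ _] := s11E D0; have s0 : smx D0 (complex.Re l) j1 j1 != 0.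
    by rewrite -s1 -E; exact: (s_ok cl).
  have g := beals_coifman_gram F cut s0; rewrite -E in g.
  have ub : dagger (beals_coifman_plus D0 x0 l) \in unitmx by rewrite unitmx_dagger; exact: (bcp_unit cl).
  rewrite -[RHS](mulKmx ub) (mulmxA (dagger _)) g -exp_adM outer_inner exp_ad1 mulmx1 //.
- have cl : closed_sector false true l by split; rewrite /= ?h2 // ltW.
  rewrite h1 gt_eqF //= [complex.Im l < 0]ltNge (ltW h1) /= /jump_arc_plus exp_adK /beals_coifman h1.
  rewrite /base_sol /= /bcp mulmxA mulmxV ?mul1mx //; exact: (bcp_unit cl).
- have cl : closed_sector true false l by split; rewrite /= ?h2 // ltW.
  rewrite h1 lt_eqF //= [0 < complex.Im l]ltNge (ltW h1) /= /jump_arc_minus exp_adK /beals_coifman.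
  rewrite [0 < complex.Im l]ltNge (ltW h1) /=.
  have := base_sol_unit cl; rewrite /base_sol /bar /bcp /= => ub.
  by rewrite mulmxA mulmxV // mul1mx.
Qed.

(** All columns and $s_{11}$ are close to their limits by [jost_near]; the division costs a
    factor two. *)
Lemma beals_coifman_near1 (L : R) z beta y : 0 <= L ->
  (forall s t, s <= t -> pot_prim u v t - pot_prim u v s <= L) ->
  0 <= complex.Im z -> osc u v z beta -> 2 * (1 + L) * beta <= 1 / 2 ->
  forall i k, modc (beals_coifman_plus D y z i k - (1%:M : M3) i k) <= 4 * (2 * (1 + L) * beta).
Proof.
move=> L0 hL z0 ho; set e := 2 * (1 + L) * beta => e2 i k.
have [h1 h2] := jost_near hu hv F hL z0 ho D y L0; rewrite -/e in h1 h2.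
have e0 : 0 <= e := le_trans (modc_ge0 _) h2.
have [b1 b2 b3] := beals_coifman_entry D y z i.
have s_big : 1 / 2 <= modc (s11 D z).
  by have := modc_sub_le 1 (s11 D z); rewrite modc1 [modc (1 - _)]modcBC; move: h2 e2; lra.
have s_gt : 0 < modc (s11 D z) by apply: lt_le_trans s_big; rewrite divr_gt0.
have sn : s11 D z != 0 by rewrite -modc_gt0.
move: k; apply: ord3E; rewrite ?b1 ?b2 ?b3.
- have -> : (s11 D z)^-1 * jost_cols D y z i j1 - (1%:M : M3) i j1 =
    (s11 D z)^-1 * ((jost_cols D y z i j1 - (1%:M : M3) i j1) - (s11 D z - 1) * (1%:M : M3) i j1).
    by field.
  have I1 : modc ((1%:M : M3) i j1) <= 1 by rewrite mx1E; case: (i == j1); rewrite ?modc1 ?modc0 ?ler01.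
  rewrite modcM modcV ler_pdivrMl //.
  apply: (le_trans (modcB _ _)); rewrite [modc (_ * _)]modcM.
  apply: (@le_trans _ _ (e + e * 1)); first by apply: lerD => //; apply: ler_pM; rewrite ?modc_ge0.
  have := ler_wpM2r e0 s_big; lra.
- by apply: (le_trans (h1 i j2)); move: e0; lra.
- by apply: (le_trans (h1 i j3)); move: e0; lra.
Qed.

Lemma solution_near1 (L : R) z beta : 0 <= L ->
  (forall s t, s <= t -> pot_prim u v t - pot_prim u v s <= L) ->
  ~ contour S z -> S < modc z -> (0 < complex.Im z -> osc u v z beta) ->
  (complex.Im z < 0 -> osc u v z^cj beta) -> 2 * (1 + L) * beta <= 1 / 72 ->
  forall i k, modc (solution z i k - (1%:M : M3) i k) <= 72 * (2 * (1 + L) * beta).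
Proof.
move=> L0 hL nc Sz ho1 ho2; set e := 2 * (1 + L) * beta => e72 i k.
have e2 : e <= 1 / 2 by move: e72; lra.
have [iz|iz|iz] := ltgtP 0 (complex.Im z); last by case: nc; left.
- have zs : sector true true z by split.
  rewrite (solution_sector zs) /sector_sol /base_sol /bcp -(beals_coifman_evolution F D x x0 (ltW iz)).
  have h := beals_coifman_near1 x L0 hL (ltW iz) (ho1 iz) e2; rewrite -/e in h.
  apply: (le_trans (h i k)); have := le_trans (modc_ge0 _) (h i k); lra.
have zs : sector true false z by split.
have cs := sector_cj zs; have ccs := sector_closed cs.
have iJ : 0 <= complex.Im z^cj by rewrite ImJ oppr_ge0 ltW.
rewrite (solution_sector zs) /sector_sol /base_sol (propag_bar F) ?(bcp_unit ccs) //.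
have h := beals_coifman_near1 x L0 hL iJ (ho2 iz) e2; rewrite -/e in h.
have -> : 72 * e = 18 * (4 * e) by lra.
apply: bar_near1; rewrite ?(propag_unit F) ?(bcp_unit ccs) //; first by move: e72; lra.
by move=> i' k'; rewrite /bcp -(beals_coifman_evolution F D x x0 iJ); exact: h.
Qed.

Lemma solution_normalized : normalized_at_infinity (contour S) solution.
Proof.
have [L L0 hL] := pot_variation hu hv; have L1 : 0 < 144 * (1 + L) by rewrite mulr_gt0 // ltr_pwDl.
have norm_le (z : C) (e : R) : 0 <= e -> (forall i k, modc (solution z i k - (1%:M : M3) i k) <= e) ->
    `|solution z - 1%:M| <= e%:C.
  have sub i k : (solution z - 1%:M) i k = solution z i k - (1%:M : M3) i k.
    by rewrite [LHS]mxE [X in _ + X]mxE.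
  by move=> e0 h; apply: norm_mx_le => // i k; rewrite sub.
split=> [e e0|d d0].
- pose beta := Num.min e 1 / (144 * (1 + L)).
  have m0 : 0 < Num.min e 1 by rewrite lt_min e0 ltr01.
  have b0 : 0 < beta by rewrite divr_gt0.
  have bE : 72 * (2 * (1 + L) * beta) = Num.min e 1.
    by rewrite /beta; field; rewrite gt_eqF // ltr_pwDl.
  have [Z Z0 hZ] := osc_small hu hv b0.
  exists (S + 1 + Z) => z nc; rewrite leCmod => Az.
  have Sz : S < modc z by move: Az Z0; lra.
  have Zz : Z <= modc z by move: Az S0; lra.
  apply: norm_le; first exact: ltW.
  move=> i k; apply: (@le_trans _ _ (72 * (2 * (1 + L) * beta))); last by rewrite bE ge_min lexx.
  apply: solution_near1 => //.
  - by move=> iz; apply: hZ => //; exact: ltW.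
  - by move=> iz; apply: hZ; rewrite ?modc_conj // ImJ oppr_ge0 ltW.
  - have : Num.min e 1 <= 1 by rewrite ge_min lexx orbT.
    by rewrite -bE; lra.
(* 72 is the constant of [solution_near1]; beyond [A] the estimate falls below its threshold *)
have [K K0 hK] := osc_rate hu hv d0; pose A := S + 1 + 144 * (1 + L) * K.
have LK : 0 <= 144 * (1 + L) * K by rewrite mulr_ge0 // ltW.
exists A, (144 * (1 + L) * K) => z nc; rewrite leCmod => Az dz.
have Sz : S < modc z by move: Az LK; rewrite /A; lra.
have zm : 0 < modc z by apply: lt_trans Sz.
rewrite normCE modcV -rmorphM; apply: norm_le; first by rewrite mulr_ge0 // invr_ge0 ltW.
move=> i k; have -> : 144 * (1 + L) * K / modc z = 72 * (2 * (1 + L) * (K / modc z)) by field; rewrite gt_eqF.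
apply: solution_near1 => //.
- by move=> iz; apply: hK; rewrite gtr0_norm in dz.
- by move=> iz; rewrite -modc_conj; apply: hK; rewrite ImJ; rewrite ltr0_norm in dz.
- have -> : 2 * (1 + L) * (K / modc z) = (144 * (1 + L) * K) / modc z / 72 by field; rewrite gt_eqF.
  rewrite ler_pM2r ?invr_gt0 // ler_pdivrMr // mul1r.
  by move: Az S0; rewrite /A; lra.
Qed.

Lemma solution_holo z : ~ contour S z -> forall i j, holo (fun w => solution w i j) z.
Proof.
move=> /sector_ex [out [up zs]] i j; have [r r0 hr] := sector_open zs.
apply: (@holo_near _ (fun w => sector_sol out up w i j) _ z r r0); last exact: sector_sol_holo.
by move=> w /hr ws; rewrite (solution_sector ws).
Qed.

Lemma solution_unit z : ~ contour S z -> solution z \in unitmx.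
Proof.
move=> /sector_ex [out [up zs]]; rewrite (solution_sector zs).
exact: sector_sol_unit (sector_closed zs).
Qed.

Definition solution_plus (l : C) : M3 := sector_sol (plus_side l) (plus_side l) l.
Definition solution_minus (l : C) : M3 := sector_sol (minus_side l) (~~ minus_side l) l.

Lemma solution_plusP l : (contour S `\` corners S) l ->
  [/\ mlim (Omega_plus S) solution l (solution_plus l), solution_plus l \in unitmx &
      mlim (contour S `\` corners S) solution_plus l (solution_plus l)].
Proof.
move=> hl; have [cl [r r0 hr]] := plus_local hl; split; last 1 first.
- apply: (mlim_local r0 _ (sector_sol_mlim cl)) => w cw wl; have [_ h] := hr w wl.
  by rewrite /solution_plus; have [-> h2] := h cw.
- apply: (mlim_local r0 _ (sector_sol_mlim cl)) => w Ow wl; have [h _] := hr w wl.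
  by split; [exact: sector_closed (h Ow)|exact: solution_sector (h Ow)].
exact: sector_sol_unit.
Qed.

Lemma solution_minusP l : (contour S `\` corners S) l ->
  [/\ mlim (Omega_minus S) solution l (solution_minus l), solution_minus l \in unitmx &
      mlim (contour S `\` corners S) solution_minus l (solution_minus l)].
Proof.
move=> hl; have [cl [r r0 hr]] := minus_local hl; split; last 1 first.
- apply: (mlim_local r0 _ (sector_sol_mlim cl)) => w cw wl; have [_ h] := hr w wl.
  by rewrite /solution_minus; have [-> h2] := h cw.
- apply: (mlim_local r0 _ (sector_sol_mlim cl)) => w Ow wl; have [h _] := hr w wl.
  by split; [exact: sector_closed (h Ow)|exact: solution_sector (h Ow)].
exact: sector_sol_unit.
Qed.

Lemma solution_jump l : (contour S `\` corners S) l ->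
  solution_plus l = solution_minus l *m exp_ad (l * x%:C) (jump S D D0 l).
Proof. by move=> hl; apply: propag_jump; exact: base_jump. Qed.

Lemma solution_corner l : corners S l ->
  forall Om, [\/ Om = Omega1 S, Om = Omega2 S, Om = Omega3 S | Om = Omega4 S] ->
  exists2 L : M3, L \in unitmx & mlim Om solution l L.
Proof.
move=> lc Om hOm.
have [l0 lS] : complex.Im l = 0 /\ modc l = S.
  by case: lc => ->; rewrite ?ImN ImC ?oppr0 ?modcN modc_real gtr0_norm.
have cl out up : closed_sector out up l by case: out up => [] []; split; rewrite /= ?l0 ?lS.
have [out [up sub]] : exists out up, Om `<=` sector out up.
  case: hOm => ->; [exists true, true|exists true, false|exists false, true|exists false, false] => w;
  by have [q1 q2 q3 q4] := Om_sector w.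
exists (sector_sol out up l); first exact: sector_sol_unit.
apply: (mlim_local ltr01 _ (sector_sol_mlim (cl out up))) => w /sub ws _.
by split; [exact: sector_closed|exact: solution_sector].
Qed.

Theorem solution_rhp : rhp_solution S (jump S D D0) x solution.
Proof.
split.
- by move=> z nz; apply/derivable_mx_holo/solution_holo.
- exact: solution_normalized.
- exists solution_plus, solution_minus; split; last exact: solution_jump.
  + by move=> l /solution_plusP [h _ _]; apply/cvg_mlimP.
  + by move=> l /solution_minusP [h _ _]; apply/cvg_mlimP.
  + by apply/within_mlimP => l /solution_plusP [_ _ h].
  + by apply/within_mlimP => l /solution_minusP [_ _ h].
- move=> l lc Om hOm; have [L _ h] := solution_corner lc hOm.
  by exists L; apply/cvg_mlimP.
Qed.

End Solution.

(** * Uniqueness *)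

Section Uniqueness.
Context {R : realType}.
Notation C := R[i].
Notation M3 := 'M[C]_3.
Variable S : R.
Hypothesis S0 : 0 < S.

(** Moving away from the real axis leaves it, and the modulus changes strictly with the distance;
    so of two displacements at most one ends on the circle. *)
Lemma off_contour_dense (p : C) (d : R) : 0 < d ->
  exists2 w : C, ~ contour S w & modc (w - p) < d.
Proof.
move=> d0; pose s : R := if 0 <= complex.Im p then 1 else -1.
pose q (t : R) : C := complex.Re p +i* (complex.Im p + s * t).
have ss : s * s = 1 by rewrite /s; case: ifP => _; rewrite ?mulr1 // mulrNN mulr1.
have sn : `|s| = 1 by rewrite /s; case: ifP => _; rewrite ?normrN normr1.
have sp : 0 <= s * complex.Im p.
  by rewrite /s; case: ifP => h; rewrite ?mul1r // mulN1r oppr_ge0 ltW // ltNge h.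
have qm t : modc (q t) ^+ 2 = modc p ^+ 2 + t * (2 * (s * complex.Im p) + t).
  rewrite !sqr_modc /=.
  transitivity (complex.Re p ^+ 2 + (complex.Im p ^+ 2 + 2 * (s * complex.Im p) * t + (s * s) * t ^+ 2)); first by ring.
  by rewrite ss; ring.
have qd (t : R) : 0 < t -> t < d -> modc (q t - p) < d.
  move=> t0 td; have -> : q t - p = 'i * (s * t)%:C.
    by apply: eqC; rewrite !ReImE /= !(mul0r, mulr0, mul1r, subr0, addr0, add0r); ring.
  by rewrite modcM modc_i mul1r modc_real normrM sn mul1r gtr0_norm.
have qi (t : R) : 0 < t -> complex.Im (q t) != 0.
  move=> t0; apply/eqP => /= E; have : s * (complex.Im p + s * t) = 0 by rewrite E mulr0.
  by rewrite mulrDr mulrA ss mul1r => h; move: sp t0 h; lra.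
have d2 : 0 < d / 2 by rewrite divr_gt0.
have d4 : 0 < d / 4 by rewrite divr_gt0.
have cc (t : R) : 0 < t -> contour S (q t) -> modc (q t) = S.
  move=> t0 [h|h]; first by have := qi t t0; rewrite h eqxx.
  by move: h; rewrite normCE => /(congr1 (@complex.Re R)); rewrite !ReC.
have [/cc h2|n2] := pselect (contour S (q (d / 2))); last by exists (q (d / 2)) => //; apply: qd; lra.
exists (q (d / 4)); last by apply: qd; lra.
move=> /cc h4; have := qm (d / 2); have := qm (d / 4); rewrite h2 // h4 // => e4 e2.
have t1 : d / 4 * (2 * (s * complex.Im p) + d / 4) < d / 2 * (2 * (s * complex.Im p) + d / 2).
  have kd : 0 <= s * complex.Im p * d by rewrite mulr_ge0 // ltW.
  have dd : 0 < d * d by rewrite mulr_gt0.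
  rewrite -subr_gt0; set k := s * complex.Im p in kd *.
  have -> : d / 2 * (2 * k + d / 2) - d / 4 * (2 * k + d / 4) = (k * d) / 2 + 3 / 16 * (d * d) by field.
  set a := k * d in kd *; set b := d * d in dd *; lra.
by move: t1 e2 e4; lra.
Qed.

(** The complement of the contour is dense, so a bound there passes to the contour. *)
Lemma dense_bound (h : C -> C) (p : C) (d B : R) : ccont h p -> 0 < d ->
  (forall w, ~ contour S w -> modc (w - p) < d -> modc (h w) <= B) -> modc (h p) <= B.
Proof.
move=> hc d0 hB; apply/ler_addgt0Pr => e e0; have [r r0 hr] := hc e e0.
have [|w wn wp] := @off_contour_dense p (Num.min d r); first by rewrite lt_min d0.
move: wp; rewrite lt_min => /andP[w1 w2].
have := hr w I w2; have := hB w wn w1; have := modc_sub_le (h p) (h w); rewrite [modc (h p - _)]modcBC.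
lra.
Qed.

(** The Moebius transformation maps the two coordinate axes to the contour, the origin and
    infinity to its two corners. *)
Definition moebius (w : C) : C := S%:C * (1 + w) / (1 - w).

Lemma moebius_real (w : C) : w != 1 -> complex.Im (moebius w) = 0 -> complex.Im w = 0.
Proof.
move=> w1; have n0 : 1 - w != 0 by rewrite subr_eq0 eq_sym.
have E : moebius w * (1 - w) = S%:C * (1 + w) by rewrite /moebius divfK.
move: (moebius w) E => m E m0; have := congr1 (@complex.Im R) E; have := congr1 (@complex.Re R) E.
rewrite !ReImE m0 !(mul0r, subr0, addr0, add0r, sub0r) => e1 e2.
have [//|i0] := eqVneq (complex.Im w) 0.
have h : (S + complex.Re m) * complex.Im w = 0.
  by rewrite mulrDl -e2; ring.
move/eqP: h; rewrite mulf_eq0 (negbTE i0) orbF => /eqP h.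
have hm : complex.Re m = - S by move: h; lra.
by move: e1; rewrite hm; move: S0; lra.
Qed.

Lemma moebius_circle (w : C) : w != 1 -> modc (moebius w) = S -> complex.Re w = 0.
Proof.
move=> w1; have n0 : 1 - w != 0 by rewrite subr_eq0 eq_sym.
rewrite /moebius !modcM modcV modc_real gtr0_norm // => E.
have mw : 0 < modc (1 - w) by rewrite modc_gt0.
have h : modc (1 + w) = modc (1 - w).
  have : S * modc (1 + w) = S * modc (1 - w) by rewrite -[in RHS]E divfK // gt_eqF.
  by apply: mulfI; rewrite gt_eqF.
have := congr1 (fun r => r ^+ 2) h; rewrite /= !sqr_modc !ReImE.
by set a := complex.Re w; set b := complex.Im w => e; lra.
Qed.

Lemma moebius_near0 (w : C) : modc w <= 1 / 2 -> modc (moebius w - S%:C) <= 4 * S * modc w.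
Proof.
move=> w2; have m1 : 1 / 2 <= modc (1 - w).
  by have := modc_sub_le 1 w; rewrite modc1; move: w2; lra.
have mp : 0 < modc (1 - w) by apply: lt_le_trans m1; rewrite divr_gt0.
have n0 : 1 - w != 0 by rewrite -modc_gt0.
have -> : moebius w - S%:C = (2 * S)%:C * w / (1 - w).
  by rewrite /moebius rmorphM rmorph_nat; field.
rewrite !modcM modcV modc_real gtr0_norm ?mulr_gt0 // ler_pdivrMr //.
have h : 0 <= 2 * S * modc w by rewrite !mulr_ge0 ?modc_ge0 // ltW.
by have := ler_wpM2l h m1; move: h; lra.
Qed.

Lemma moebius_far (w : C) : 1 < modc w -> modc (moebius w + S%:C) <= 2 * S / (modc w - 1).
Proof.
move=> w1; have m1 : modc w - 1 <= modc (1 - w).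
  by have := modc_sub_le w 1; rewrite modc1 modcBC.
have mp : 0 < modc w - 1 by rewrite subr_gt0.
have mp' : 0 < modc (1 - w) := lt_le_trans mp m1.
have n0 : 1 - w != 0 by rewrite -modc_gt0.
have -> : moebius w + S%:C = (2 * S)%:C / (1 - w).
  by rewrite /moebius rmorphM rmorph_nat; field.
rewrite modcM modcV modc_real gtr0_norm ?mulr_gt0 // ler_pM2l ?mulr_gt0 //.
by rewrite lef_pV2 ?posrE.
Qed.

Lemma moebius_near1 (w : C) (d : R) : 0 < d -> d <= 1 -> w != 1 -> modc (w - 1) < d ->
  S / d <= modc (moebius w).
Proof.
move=> d0 d1 wn wd; have mp : 0 < modc (1 - w) by rewrite modc_gt0 subr_eq0 eq_sym.
rewrite /moebius !modcM modcV modc_real gtr0_norm // -mulrA ler_pM2l //.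
have m2 : 1 <= modc (1 + w).
  have := modc_sub_le 2 (1 - w); rewrite modc2.
  have -> : 2 - (1 - w) = 1 + w by ring.
  by rewrite modcBC in wd; move: wd d1; lra.
apply: (@le_trans _ _ (modc (1 - w))^-1); last by rewrite ler_peMl // invr_ge0 ltW.
by rewrite lef_pV2 ?posrE // modcBC ltW.
Qed.

Lemma moebius_inv (z : C) : z != S%:C -> z != - S%:C ->
  let w := (z - S%:C) / (z + S%:C) in [/\ w != 0, w != 1 & moebius w = z].
Proof.
move=> z1 z2 w; have zp : z + S%:C != 0 by rewrite addr_eq0.
have S2 : (2 * S)%:C != 0 :> C.
  by rewrite -modc_gt0 modc_real normr_gt0 gt_eqF // mulr_gt0.
have S2' : S%:C + S%:C != 0 :> C by rewrite -rmorphD -mulr2n -mulr_natl.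
have w1E : 1 - w = (S%:C + S%:C) / (z + S%:C) by rewrite /w; field.
have w1 : 1 - w != 0 by rewrite w1E mulf_neq0 ?invr_eq0.
split; first by rewrite /w mulf_neq0 ?invr_eq0 // subr_eq0.
  by rewrite eq_sym -subr_eq0.
by rewrite /moebius w1E /w; field; rewrite zp S2'.
Qed.

(** A function continuous off the corners, analytic off the contour, bounded near the corners and
    vanishing at infinity is zero: transported by the Moebius transformation it is a bounded
    function analytic off the axes, with value zero at the image of infinity. *)
Lemma contour_liouville (h : C -> C) :
  (forall z, ~ contour S z -> holo h z) ->
  (forall z, ~ corners S z -> ccont h z) ->
  (forall c, corners S c -> exists2 r : R, 0 < r & exists B : R,
     forall w, ~ contour S w -> modc (w - c) < r -> modc (h w) <= B) ->
  (forall e : R, 0 < e -> exists A : R, forall w, ~ contour S w -> A <= modc w -> modc (h w) <= e) ->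
  forall z, ~ contour S z -> h z = 0.
Proof.
move=> hh hc hb hi.
have Sn : S != 0 by rewrite gt_eqF.
(* [moebius] sends one to infinity, where [h] tends to zero *)
pose ht w := if (w == 1) || (w == 0) then 0 else h (moebius w).
have noncorner w : w != 1 -> w != 0 -> ~ corners S (moebius w).
  move=> w1 w0; have n0 : 1 - w != 0 by rewrite subr_eq0 eq_sym.
  have SC : S%:C != 0 :> C by rewrite -modc_gt0 modc_real normr_gt0.
  case=> E.
    have : S%:C * (1 + w) = S%:C * (1 - w) by rewrite -[in RHS]E /moebius divfK.
    move/(mulfI SC)/eqP; rewrite -subr_eq0 => /eqP e; move/eqP: w0; apply.
    have : 2 * w = 0 by rewrite -e; ring.
    by move/eqP; rewrite mulf_eq0 pnatr_eq0 => /eqP.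
  have : S%:C * (1 + w) = S%:C * (w - 1).
    by rewrite -opprB mulrN -mulNr -E /moebius divfK.
  move/(mulfI SC)/eqP; rewrite -subr_eq0 => /eqP e.
  have : (2 : C) = 0 by rewrite -e; ring.
  by move/eqP; rewrite pnatr_eq0.
have mholo w : w != 1 -> holo moebius w.
  move=> w1; have n0 : 1 - w != 0 by rewrite subr_eq0 eq_sym.
  apply: holoM; last by apply: holoV => //; apply: holoB; [exact: holo_cst|exact: holo_id].
  by apply: holoM; [exact: holo_cst|apply: holoD; [exact: holo_cst|exact: holo_id]].
have ht_near w : w != 1 -> w != 0 -> exists2 r : R, 0 < r & forall w', modc (w' - w) < r ->
    h (moebius w') = ht w'.
  move=> w1 w0; exists (Num.min (modc w) (modc (w - 1))) => [|w'].
    by rewrite lt_min !modc_gt0 w0 subr_eq0.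
  rewrite lt_min => /andP[a b]; rewrite /ht; case: ifP => // /orP[] /eqP E.
    by move: b; rewrite E modcBC ltxx.
  by move: a; rewrite E sub0r modcN ltxx.
have ext_bound c r B : (forall w, ~ contour S w -> modc (w - c) < r -> modc (h w) <= B) ->
    forall p, ~ corners S p -> modc (p - c) < r -> modc (h p) <= B.
  move=> hB p pn pc; apply: (@dense_bound _ _ (r - modc (p - c)) _ (hc p pn)); first by rewrite subr_gt0.
  move=> w wn wp; apply: hB => //; have := modc_tri p w c; move: wp; lra.
have contS : corners S (S%:C) by left.
have contS' : corners S (- S%:C) by right.
have [ra ra0 [Ba hBa]] := hb _ contS; have [rb rb0 [Bb hBb]] := hb _ contS'.
have main : forall w, w != 0 -> ht w = ht (1 +i* 1).
  apply: (@liouville _ ht (Num.max 0 (Num.max Ba Bb)) (Num.min (1 / 2) (ra / (4 * S))) (1 + 2 * S / rb)).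
  - by rewrite lt_min !divr_gt0 // mulr_gt0.
  - move=> w w1 w2.
    have wn1 : w != 1 by apply/eqP => E; move: w2; rewrite E Im1 eqxx.
    have wn0 : w != 0 by apply/eqP => E; move: w2; rewrite E Im0 eqxx.
    have [r r0 hr] := ht_near w wn1 wn0; apply: (holo_near r0 hr).
    apply: holo_comp; first exact: mholo.
    apply: hh => -[/moebius_real|] E; first by move: w2; rewrite E // eqxx.
    have : modc (moebius w) = S by move: E; rewrite normCE => /(congr1 (@complex.Re R)); rewrite !ReC.
    by move/(moebius_circle wn1) => E'; move: w1; rewrite E' eqxx.
  - move=> w wn0; have [->|wn1] := eqVneq w 1.
      move=> e e0; have e2 : 0 < e / 2 by rewrite divr_gt0.
      have [A hA] := hi _ e2; pose A' := Num.max 1 A.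
      have A'0 : 0 < A' by rewrite lt_max ltr01.
      pose d := Num.min 1 (S / (A' + 1)).
      have d0 : 0 < d by rewrite lt_min ltr01 divr_gt0 // ltr_pwDl // ltW.
      have d1 : d <= 1 by rewrite /d ge_min lexx.
      exists d => // w' _ wd; rewrite /ht eqxx /= subr0.
      case: ifP => [_|/negbT]; first by rewrite modc0.
      rewrite negb_or => /andP[w1 w0].
      have big : A' + 1 <= modc (moebius w').
        apply: le_trans (moebius_near1 d0 d1 w1 wd).
        rewrite ler_pdivlMr // mulrC -ler_pdivlMr; first by rewrite /d ge_min lexx orbT.
        by rewrite ltr_pwDl // ltW.
      apply: (@le_lt_trans _ _ (e / 2)); last by move: e0; lra.
      apply: (dense_bound (hc _ (noncorner w' w1 w0)) ltr01) => p pn pd; apply: hA => //.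
      have := modc_sub_le (moebius w') p; rewrite [modc (moebius w' - p)]modcBC.
      have : A <= A' by rewrite /A' le_max lexx orbT.
      by move: big pd; lra.
    have [r r0 hr] := ht_near w wn1 wn0.
    have c : ccont (fun w => h (moebius w)) w.
      by apply: (@wlim_comp _ setT setT) (holo_cont (mholo w wn1)) (hc _ (noncorner w wn1 wn0)).
    rewrite /ccont -(hr w); last by rewrite subrr modc0.
    by apply: wlim_near r0 _ c => w' _; exact: hr.
  - move=> w; rewrite lt_min => /andP[w2 wr]; rewrite /ht.
    case: ifP => [_|/negbT]; first by rewrite modc0 le_max lexx.
    rewrite negb_or => /andP[w1 w0].
    apply: (@le_trans _ _ Ba); last by rewrite !le_max lexx orbT.
    apply: (ext_bound _ _ _ hBa); first exact: noncorner.
    apply: le_lt_trans (moebius_near0 (ltW w2)) _.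
    by move: wr; rewrite ltr_pdivlMr ?mulr_gt0 // mulrC.
  - move=> w wr; rewrite /ht.
    case: ifP => [_|/negbT]; first by rewrite modc0 le_max lexx.
    rewrite negb_or => /andP[w1 w0].
    apply: (@le_trans _ _ Bb); last by rewrite !le_max lexx !orbT.
    apply: (ext_bound _ _ _ hBb); first exact: noncorner.
    have wg : 1 < modc w by apply: lt_trans wr; rewrite ltrDl !divr_gt0 ?mulr_gt0.
    rewrite opprK; apply: (le_lt_trans (moebius_far wg)).
    rewrite ltr_pdivrMr ?subr_gt0 // -ltr_pdivrMl // mulrC.
    by move: wr; set a := 2 * S / rb; lra.
move=> z zn.
have zc c : corners S c -> z != c.
  move=> cc; apply/eqP => E; apply: zn; rewrite E; left.
  by case: cc => ->; rewrite ?ImN ImC ?oppr0.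
have [w0 w1 mE] := moebius_inv (zc _ contS) (zc _ contS').
set w := _ / _ in w0 w1 mE.
have := main w w0; rewrite -(main 1 (oner_neq0 _)) /ht eqxx /= (negbTE w0) (negbTE w1) /= mE.
by [].
Qed.

Section TwoSolutions.
Variables (V : C -> M3) (x : R) (M0 M1 P0 N0 : C -> M3).
Hypothesis rhp1 : rhp_solution S V x M1.
Hypothesis inf0 : normalized_at_infinity (contour S) M0.
Hypothesis holo0 : forall z, ~ contour S z -> forall i j, holo (fun w => M0 w i j) z.
Hypothesis unit0 : forall z, ~ contour S z -> M0 z \in unitmx.
Hypothesis plus0 : forall l, (contour S `\` corners S) l ->
  [/\ mlim (Omega_plus S) M0 l (P0 l), P0 l \in unitmx & mlim (contour S `\` corners S) P0 l (P0 l)].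
Hypothesis minus0 : forall l, (contour S `\` corners S) l ->
  [/\ mlim (Omega_minus S) M0 l (N0 l), N0 l \in unitmx & mlim (contour S `\` corners S) N0 l (N0 l)].
Hypothesis jump0 : forall l, (contour S `\` corners S) l ->
  P0 l = N0 l *m exp_ad (l * x%:C) (V l).
Hypothesis corner0 : forall l, corners S l ->
  forall Om, [\/ Om = Omega1 S, Om = Omega2 S, Om = Omega3 S | Om = Omega4 S] ->
  exists2 L : M3, L \in unitmx & mlim Om M0 l L.

Let region z : ~ contour S z -> [\/ Omega1 S z, Omega2 S z, Omega3 S z | Omega4 S z].
Proof.
move=> zn; have [out [up zs]] := sector_ex zn.
by case: out zs => -[]; case: up => h1 h2; [constructor 1|constructor 2|constructor 3|constructor 4];
  split=> //=; rewrite normCE ltcR.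
Qed.

(** Both solutions have the same jump, so the quotient [M1 *m invmx M0] has none; [M0] is known to be
    invertible, and [contour_liouville] applies to the quotient minus the identity. *)
Lemma rhp_unique z : ~ contour S z -> M1 z = M0 z.
Proof.
have [P1 [N1 [tp tn cp cn jmp]]] := rhp_boundary rhp1.
pose G w : M3 := if pselect (contour S w) then P1 w *m invmx (P0 w) else M1 w *m invmx (M0 w).
have Goff w : ~ contour S w -> G w = M1 w *m invmx (M0 w) by rewrite /G; case: pselect.
have Gon w : contour S w -> G w = P1 w *m invmx (P0 w) by rewrite /G; case: pselect.
have holo1 w : ~ contour S w -> forall i j, holo (fun w => M1 w i j) w.
  by move=> wn; apply/derivable_mx_holo; exact: (rhp_analytic rhp1).
have off_near w : ~ contour S w -> exists2 r : R, 0 < r & forall w', modc (w' - w) < r -> ~ contour S w'.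
  move=> wn; have [out [up ws]] := sector_ex wn; have [r r0 hr] := sector_open ws.
  exists r => // w' /hr [h1 h2] [h|h].
    by case: up {ws hr} h1; rewrite h ltxx.
  have mS : modc w' = S by move: h; rewrite normCE => /(congr1 (@complex.Re R)); rewrite !ReC.
  by case: out {ws hr} h2; rewrite mS ltxx.
have Gholo w : ~ contour S w -> forall i j, holo (fun w => G w i j) w.
  move=> wn i j; have [r r0 hr] := off_near w wn.
  apply: (@holo_near _ (fun w => (M1 w *m invmx (M0 w)) i j) _ w r r0) => [w' /hr wn'|]; first by rewrite Goff.
  apply: holo_mulmx => i' j'; first exact: holo1.
  by apply: holo_invmx; [exact: unit0|exact: holo0].
have quot l : (contour S `\` corners S) l -> P1 l *m invmx (P0 l) = N1 l *m invmx (N0 l).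
  move=> hl; have [_ uP _] := plus0 hl; have [_ uN _] := minus0 hl.
  have JE : exp_ad (l * x%:C) (V l) = invmx (N0 l) *m P0 l by rewrite (jump0 hl) mulKmx.
  by rewrite (jmp l hl) JE -!mulmxA mulmxV // mulmx1.
have Gcont w : ~ corners S w -> forall i j, ccont (fun w => G w i j) w.
  move=> wc i j; have [cw|wn] := pselect (contour S w); last exact: holo_cont (Gholo w wn i j).
  have hl : (contour S `\` corners S) w by split.
  have [p0 uP c0] := plus0 hl; have [n0 uN _] := minus0 hl.
  have lp := wlim_mulmx (proj1 (cvg_mlimP _ _ _ _) (tp w hl)) (mlim_invmx uP p0) i j.
  have ln := wlim_mulmx (proj1 (cvg_mlimP _ _ _ _) (tn w hl)) (mlim_invmx uN n0) i j.
  have lc := wlim_mulmx (proj1 (within_mlimP _ _) cp w hl) (mlim_invmx uP c0) i j.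
  rewrite -(quot w hl) in ln.
  rewrite /ccont (Gon w cw) => e e0.
  have [d1 d10 h1] := lp e e0; have [d2 d20 h2] := ln e e0; have [d3 d30 h3] := lc e e0.
  have s1 : 0 < modc (w - S%:C) by rewrite modc_gt0 subr_eq0; apply/eqP => E; apply: wc; left.
  have s2 : 0 < modc (w + S%:C) by rewrite modc_gt0 addr_eq0; apply/eqP => E; apply: wc; right.
  exists (Num.min (Num.min (modc (w - S%:C)) (modc (w + S%:C))) (Num.min d1 (Num.min d2 d3))) => [|w' _].
    by rewrite !lt_min s1 s2 d10 d20.
  rewrite !lt_min => /andP[/andP[b1 b2] /and3P[b3 b4 b5]].
  have [cw'|wn'] := pselect (contour S w').
    rewrite (Gon w' cw'); apply: h3 => //; split => // -[E|E].
      by move: b1; rewrite E modcBC ltxx.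
    by move: b2; rewrite E -modcN opprB opprK ltxx.
  rewrite (Goff w' wn'); case: (region wn') => hO.
  - by apply: h1 => //; left.
  - by apply: h2 => //; left.
  - by apply: h2 => //; right.
  - by apply: h1 => //; right.
have Gcorner c : corners S c -> forall i j, exists2 r : R, 0 < r & exists B : R,
    forall w, ~ contour S w -> modc (w - c) < r -> modc (G w i j) <= B.
  move=> cc i j.
  have one Om : [\/ Om = Omega1 S, Om = Omega2 S, Om = Omega3 S | Om = Omega4 S] ->
      exists2 r : R, 0 < r & exists B : R,
      forall w, Om w -> modc (w - c) < r -> modc ((M1 w *m invmx (M0 w)) i j) <= B.
    move=> hOm; have [L uL l0] := corner0 cc hOm.
    have [L1 /cvg_mlimP l1] := rhp_corners rhp1 cc hOm.
    have [d d0 hd] := wlim_bounded (wlim_mulmx l1 (mlim_invmx uL l0) i j).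
    by exists d => //; exists (modc ((L1 *m invmx L) i j) + 1).
  have [|a a0 [A hA]] := one (Omega1 S); first by constructor 1.
  have [|b b0 [B hB]] := one (Omega2 S); first by constructor 2.
  have [|c' c0 [C' hC]] := one (Omega3 S); first by constructor 3.
  have [|d d0 [D hD]] := one (Omega4 S); first by constructor 4.
  exists (Num.min (Num.min a b) (Num.min c' d)); first by rewrite !lt_min a0 b0 c0.
  exists (Num.max (Num.max A B) (Num.max C' D)) => w wn.
  rewrite !lt_min => /andP[/andP[w1 w2] /andP[w3 w4]]; rewrite (Goff w wn) !le_max.
  by case: (region wn) => hO; [rewrite hA|rewrite hB|rewrite hC|rewrite hD]; rewrite ?orbT.
have Ginf (e : R) : 0 < e -> exists A : R, forall w, ~ contour S w -> A <= modc w ->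
    forall i j, modc (G w i j - (1%:M : M3) i j) <= e.
  move=> e0; pose d := Num.min (1 / 18) (e / 100).
  have d0 : 0 < d by rewrite lt_min !divr_gt0.
  have d18 : d <= 1 / 18 by rewrite /d ge_min lexx.
  have de : d <= e / 100 by rewrite /d ge_min lexx orbT.
  have [i1 _] := rhp_infinity rhp1; have [i0 _] := inf0.
  have [A hA] := i1 d d0; have [B hB] := i0 d d0.
  exists (Num.max A B) => w wn; rewrite ge_max => /andP[wA wB] i j; rewrite (Goff w wn).
  have sub (P P' : M3) a b : (P - P') a b = P a b - P' a b by rewrite [LHS]mxE [X in _ + X]mxE.
  have e1 a b : modc ((M1 w - 1%:M) a b) <= d.
    by apply: norm_mx_ge (ltW d0) _; apply: hA => //; rewrite leCmod.
  have e2 a b : modc ((invmx (M0 w) - 1%:M) a b) <= 18 * d.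
    rewrite sub; apply: invmx_near1 => //; first exact: unit0.
    by move=> a' b'; rewrite -sub; apply: norm_mx_ge (ltW d0) _; apply: hB => //; rewrite leCmod.
  set X := M1 w - 1%:M in e1; set Y := invmx (M0 w) - 1%:M in e2.
  have aD (P P' : M3) a b : (P + P') a b = P a b + P' a b by rewrite mxE.
  have -> : M1 w *m invmx (M0 w) = 1%:M + (X + Y + X *m Y).
    have -> : M1 w = 1%:M + X by rewrite /X addrC subrK.
    have -> : invmx (M0 w) = 1%:M + Y by rewrite /Y addrC subrK.
    by rewrite mulmxDl mul1mx mulmxDr mulmx1 -addrA [Y + _]addrA [Y + X]addrC.
  have -> : (1%:M + (X + Y + X *m Y)) i j - (1%:M : M3) i j = X i j + Y i j + (X *m Y) i j.
    by rewrite !aD; ring.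
  have t1 := modcD (X i j + Y i j) ((X *m Y) i j); have t2 := modcD (X i j) (Y i j).
  have t3 := mul3_le (ltW d0) e1 e2 i j.
  have dd : d * d <= 1 / 18 * d by rewrite ler_wpM2r // ltW.
  have := e1 i j; have := e2 i j; move: t1 t2 t3 dd de.
  have -> : 3 * d * (18 * d) = 54 * (d * d) by ring.
  set dsq := d * d; lra.
move=> zn; have G1 : G z = 1%:M.
  apply/matrixP => i j; apply/eqP; rewrite -subr_eq0; apply/eqP.
  apply: (@contour_liouville (fun w => G w i j - (1%:M : M3) i j)) zn.
  - by move=> w wn; apply: holoB; [exact: Gholo|exact: holo_cst].
  - by move=> w wc; apply: wlimB; [exact: Gcont|exact: wlim_cst].
  - move=> c cc; have [r r0 [B hB]] := Gcorner c cc i j; exists r => //.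
    exists (B + modc ((1%:M : M3) i j)) => w wn wr; apply: (le_trans (modcB _ _)).
    by rewrite lerD2r; exact: hB.
  - move=> e e0; have [A hA] := Ginf e e0; exists A => w wn wA; exact: hA.
by rewrite -[M1 z]mulmx1 -(mulVmx (unit0 zn)) mulmxA -(Goff z zn) G1 mul1mx.
Qed.

End TwoSolutions.
End Uniqueness.

(** * Existence and uniqueness *)

Local Close Scope classical_set_scope.
Unset Implicit Arguments.
Set Strict Implicit.
Set Printing Implicit Defensive.

Theorem proposition5p9 (R : realType) (u0 v0 : R -> R[i])
    (hu : H11 u0) (hv : H11 v0)
    (D : jost_data (potential u0 v0))
    (Sinf : R) (Sinf_gt0 : 0 < Sinf)
    (s11_neq0 : forall z : R[i],
       0 <= complex.Im z -> Sinf%:C <= `|z| -> s11 D z != 0)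
    (x0 : R) (D0 : jost_data (cutoff x0 (potential u0 v0)))
    (s11_cutoff_neq0 : forall z : R[i], 0 <= complex.Im z -> s11 D0 z != 0)
    (x : R) :
  (exists M : R[i] -> 'M[R[i]]_3, rhp_solution Sinf (jump Sinf D D0) x M) /\
  (forall M1 M2 : R[i] -> 'M[R[i]]_3,
     rhp_solution Sinf (jump Sinf D D0) x M1 ->
     rhp_solution Sinf (jump Sinf D D0) x M2 ->
     forall z : R[i], ~ contour Sinf z -> M1 z = M2 z).
Proof.
have [Phi F] := fundamental_ex (potential_mrcont (H11_rcont hu) (H11_rcont hv)) (potential_anti u0 v0).
have rhp := solution_rhp hu hv Sinf_gt0 s11_neq0 s11_cutoff_neq0 x F.
split; first by exists (solution D Sinf D0 x Phi).
have uniq (M : R[i] -> 'M[R[i]]_3) : rhp_solution Sinf (jump Sinf D D0) x M ->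
    forall z : R[i], ~ contour Sinf z -> M z = solution D Sinf D0 x Phi z.
  move=> rM z; apply: (rhp_unique Sinf_gt0 rM (rhp_infinity rhp)).
  - exact: (solution_holo s11_neq0 s11_cutoff_neq0 x F).
  - exact: (solution_unit s11_neq0 s11_cutoff_neq0 x F).
  - exact: (solution_plusP Sinf_gt0 s11_neq0 s11_cutoff_neq0 x F).
  - exact: (solution_minusP Sinf_gt0 s11_neq0 s11_cutoff_neq0 x F).
  - exact: (solution_jump s11_neq0 s11_cutoff_neq0 x F).
  - exact: (solution_corner Sinf_gt0 s11_neq0 s11_cutoff_neq0 x F).
by move=> M1 M2 r1 r2 z nz; rewrite (uniq M1 r1 z nz) (uniq M2 r2 z nz).
Qed.
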